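(* Let $I$ be a set and $1 \leq p <\infty$. The space $\mathfrak{R}_{p,cb}^I$ equipped with the usual matrix product is a completely contractive Banach algebra. More precisely, if $A$ and $B$ are matrices in $\mathfrak{R}_{p,cb}^I$ and $i,j\in I$, the limit $\lim_{J}\sum_{k\in J} a_{ik}b_{kj}$ (over finite subsets $J$ of $I$ directed by inclusion) exists. Moreover, the $I\times I$ matrix $AB$ defined by $[AB]_{ij}=\lim_{J}\sum_{k\in J} a_{ik}b_{kj}$ belongs to $\mathfrak{R}_{p,cb}^I$. Finally, the map $$\mathfrak{R}_{p,cb}^I \widehat{\otimes} \mathfrak{R}_{p,cb}^I\to \mathfrak{R}_{p,cb}^I,\qquad A\otimes B\mapsto AB$$ is completely contractive.
   Context: For $1\le p<\infty$, $S_p^I$ is the Schatten class of compact operators $A$ on $\ell_2^I$ with $\|A\|_{S_p^I}=(\mathrm{Tr}\,(A^*A)^{p/2})^{1/p}<\infty$; $S_\infty^I$ is the space of compact operators on $\ell_2^I$ with the operator norm. Elements are regarded as $I\times I$ matrices. $p^*$ is the conjugate exponent. Operator space structures: $S_\infty^I$ has its $C^*$-algebra structure, $S_1^I$ is the dual of $S_\infty^I$ via the pairing $\langle A,B\rangle=\mathrm{Tr}(AB^T)$ ($B^T$ the matrix transpose), and $S_p^I=(S_\infty^I,S_1^I)_{1/p}$ by complex interpolation, with $M_n(E_\theta)=(M_n(E_0),M_n(E_1))_\theta$. $*$ is the Schur (entrywise) product $[a_{ij}]*[b_{ij}]=[a_{ij}b_{ij}]$. $\widehat{\otimes}$ is the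 operator space projective tensor product. $\psi_p^I: S_p^I\widehat{\otimes}S_{p^*}^I\to S_1^I$ is the completely contractive linear map with $\psi_p^I(A\otimes B)=A*B$. $\mathfrak{R}_{p,cb}^I$ is $\mathrm{Im}\,\psi_p^I\subset S_1^I$ with the operator space structure of $(S_p^I\widehat{\otimes}S_{p^*}^I)/\mathrm{Ker}\,\psi_p^I$. A Banach algebra $\mathcal{A}$ with an operator space structure is completely contractive if its product is a jointly completely contractive bilinear map $\mathcal{A}\times\mathcal{A}\to\mathcal{A}$, i.e. induces a complete contraction $\mathcal{A}\widehat{\otimes}\mathcal{A}\to\mathcal{A}$. *)

(* Defs.v *)
From HB Require Import structures.
From mathcomp Require Import all_boot all_order all_algebra finmap.
From mathcomp Require Import complex mxtens.
From mathcomp Require Import all_classical all_reals all_analysis.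
From mathcomp Require Import summability.

Set Implicit Arguments.
Unset Strict Implicit.
Unset Printing Implicit Defensive.
Import Order.TTheory GRing.Theory Num.Theory.
Import numFieldNormedType.Exports.
Import ComplexField.Normc.
Local Open Scope classical_set_scope.
Local Open Scope complex_scope.
Local Open Scope ring_scope.

Section Hilbert.
Context {R : realType}.
Local Notation C := R[i].

(* [partial_sum x @ totally] is the net of sums of x over the finite subsets
   directed by inclusion. R[i] only has a topology through its alias R[i]^o. *)
Definition net_summable (I : choiceType) (x : I -> C) : Prop :=
  cvg ((partial_sum x : {fset I} -> C^o) @ totally).

Definition net_sum (I : choiceType) (x : I -> C) : C :=
  summability.sum (x : I -> C^o).

Definition l2sq (I : choiceType) (x : I -> C) : \bar R :=
  \esum_(i in [set: I]) ((normc (x i)) ^+ 2)%:E.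

Definition l2 (I : choiceType) : set (I -> C) := [set x | (l2sq x < +oo)%E].

Definition inner (I : choiceType) (x y : I -> C) : C :=
  net_sum (fun i => x i * (y i)^*).

Definition matvec (I J : choiceType) (A : I * J -> C) (x : J -> C) : I -> C :=
  fun i => net_sum (fun j => A (i, j) * x j).

(* The norm of A as an operator from l2^J to l2^I; it is +oo when A does not
   define a bounded operator. *)
Definition opnorm (I J : choiceType) (A : I * J -> C) : \bar R :=
  ereal_inf [set c%:E | c in [set c : R | 0 <= c /\
    forall x : J -> C, l2 x ->
      (forall i, net_summable (fun j => A (i, j) * x j)) /\
      (l2sq (matvec A x) <= (c ^+ 2)%:E * l2sq x)%E]].

Definition mxnorm (m n : nat) (a : 'M[C]_(m, n)) : \bar R :=
  opnorm (fun t : 'I_m * 'I_n => a t.1 t.2).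

Definition mxprod (I J K : choiceType) (A : I * J -> C) (B : J * K -> C) :
    I * K -> C :=
  fun t => net_sum (fun j => A (t.1, j) * B (j, t.2)).

Definition transp (I J : Type) (A : I * J -> C) : J * I -> C :=
  fun t => A (t.2, t.1).

Definition adjoint (I J : Type) (A : I * J -> C) : J * I -> C :=
  fun t => (A (t.2, t.1))^*.

Definition trace (I : choiceType) (A : I * I -> C) : C :=
  net_sum (fun i => A (i, i)).

Definition compact_op (I : choiceType) (A : I * I -> C) : Prop :=
  (opnorm A < +oo)%E /\
  forall x : nat -> I -> C, (forall k, (l2sq (x k) <= 1)%E) ->
    exists (s : nat -> nat) (y : I -> C),
      [/\ {homo s : k l / (k < l)%N}, l2 y &
          (fun k => l2sq (fun i => matvec A (x (s k)) i - y i))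
            @ \oo --> (0%E : \bar R)].

Definition orthonormal_basis (I : choiceType) (D : set (I -> C)) : Prop :=
  [/\ D `<=` @l2 I,
      forall e, D e -> inner e e = 1,
      forall e f, D e -> D f -> e <> f -> inner e f = 0 &
      forall x, l2 x -> (forall e, D e -> inner x e = 0) -> x = (fun=> 0)].

(* Tr (A^* A)^(q/2): by the functional calculus, (A^* A)^(q/2) is diagonal with
   entries lam e `^ (q / 2) in any orthonormal basis diagonalizing A^* A with
   eigenvalues lam e. The value does not depend on the basis; such a basis
   exists when A is compact. *)
Definition trace_abs_pow (I : choiceType) (q : R) (A : I * I -> C) : \bar R :=
  ereal_inf [set r | exists (D : set (I -> C)) (lam : (I -> C) -> R),
    [/\ orthonormal_basis D,
        forall e, D e -> 0 <= lam e,
        forall e, D e ->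
          matvec (adjoint A) (matvec A e) = (fun i => (lam e)%:C * e i) &
        r = \esum_(e in D) ((lam e) `^ (q / 2))%:E]].

Definition schatten_norm (I : choiceType) (q : R) (A : I * I -> C) : \bar R :=
  ((trace_abs_pow q A) `^ q^-1)%E.

Definition schatten (I : choiceType) (q : R) : set (I * I -> C) :=
  [set A | compact_op A /\ (schatten_norm q A < +oo)%E].

End Hilbert.

Section OperatorSpaces.
Context {R : realType}.
Local Notation C := R[i].

(* All the operator spaces considered are spaces of functions T -> C (T := I * I
   for I x I matrices). Such a space E is given by the norms of the M_n(E),
   n : nat, extended by +oo outside M_n(E). *)
Definition mnorms (T : Type) := forall n : nat, 'M[T -> C]_n -> \bar R.

Section OneSpace.
Variables (T : Type).

Definition norm1 (N : mnorms T) (f : T -> C) : \bar R := N 1 (const_mx f).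

Definition carrier (N : mnorms T) : set (T -> C) :=
  [set f | (norm1 N f < +oo)%E].

Definition scalef (c : C) (f : T -> C) : T -> C := fun t => c * f t.

Definition scalemxf (n : nat) (c : C) (x : 'M[T -> C]_n) : 'M[T -> C]_n :=
  map_mx (scalef c) x.

Definition evmx (m n : nat) (x : 'M[T -> C]_(m, n)) (t : T) : 'M[C]_(m, n) :=
  map_mx (fun f => f t) x.

(* The M_n-bimodule product a x b. *)
Definition bimod (m n p q : nat)
    (a : 'M[C]_(m, n)) (x : 'M[T -> C]_(n, p)) (b : 'M[C]_(p, q)) :
    'M[T -> C]_(m, q) :=
  \matrix_(i, j) (fun t => (a *m evmx x t *m b) i j).

(* Abstract operator spaces, by Ruan's axioms. *)
Record operator_space (N : mnorms T) : Prop := OperatorSpace {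
  os_ge0 : forall n (x : 'M[T -> C]_n), (0 <= N n x)%E;
  os_carrier : forall n (x : 'M[T -> C]_n),
    (N n x < +oo)%E <-> (forall i j, carrier N (x i j));
  os_eq0 : forall n (x : 'M[T -> C]_n), N n x = 0%E <-> x = 0;
  os_scale : forall n (c : C) (x : 'M[T -> C]_n),
    (N n x < +oo)%E -> N n (scalemxf c x) = ((normc c)%:E * N n x)%E;
  os_triangle : forall n (x y : 'M[T -> C]_n), (N n (x + y)%R <= N n x + N n y)%E;
  os_direct_sum : forall m n (x : 'M[T -> C]_m) (y : 'M[T -> C]_n),
    N (m + n)%N (block_mx x 0 0 y) = maxe (N m x) (N n y);
  os_bimod : forall m n (a : 'M[C]_(m, n)) (x : 'M[T -> C]_n) (b : 'M[C]_(n, m)),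
    (N n x < +oo)%E -> (N m (bimod a x b) <= mxnorm a * N n x * mxnorm b)%E
}.

Definition cauchy_seq (N : mnorms T) (n : nat) (u : nat -> 'M[T -> C]_n) :
    Prop :=
  (forall k, (N n (u k) < +oo)%E) /\
  forall e : R, 0 < e -> exists K : nat, forall k l : nat,
    (K <= k)%N -> (K <= l)%N -> (N n (u k - u l)%R < e%:E)%E.

Definition cvg_seq (N : mnorms T) (n : nat) (u : nat -> 'M[T -> C]_n)
    (x : 'M[T -> C]_n) : Prop :=
  (fun k => N n (u k - x)) @ \oo --> (0%E : \bar R).

Definition complete_space (N : mnorms T) : Prop :=
  forall u : nat -> T -> C, cauchy_seq N (fun k => const_mx (u k) : 'M[T -> C]_1) ->
    exists2 f, carrier N f & cvg_seq N (fun k => const_mx (u k) : 'M[T -> C]_1)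
                                       (const_mx f).

End OneSpace.

(* Complex interpolation M_n(E_theta) = (M_n(E_0), M_n(E_1))_theta. *)
Section Interpolation.
Variables (T : Type) (N0 N1 : mnorms T) (n : nat).

Definition sum_norm (x : 'M[T -> C]_n) : \bar R :=
  ereal_inf [set r | exists x0 x1 : 'M[T -> C]_n,
    x = x0 + x1 /\ r = (N0 x0 + N1 x1)%E].

Definition strip : set C := [set z | 0 <= complex.Re z <= 1].

Definition open_strip : set C := [set z | 0 < complex.Re z < 1].

Definition bounded_continuous_on_strip (f : C -> 'M[T -> C]_n) : Prop :=
  (exists c : R, forall z, strip z -> (sum_norm (f z) <= c%:E)%E) /\
  (forall z, strip z -> forall e : R, 0 < e -> exists2 d : R, 0 < d &
     forall w, strip w -> normc (w - z) < d ->
       (sum_norm (f w - f z)%R <= e%:E)%E).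

Definition analytic_on_open_strip (f : C -> 'M[T -> C]_n) : Prop :=
  forall z, open_strip z -> exists2 D : 'M[T -> C]_n, (sum_norm D < +oo)%E &
    forall e : R, 0 < e -> exists2 d : R, 0 < d &
      forall h : C, normc h < d ->
        (sum_norm (f (z + h) - f z - scalemxf h D)%R <= (e * normc h)%R%:E)%E.

Definition C0_on_line (N : mnorms T) (g : R -> 'M[T -> C]_n) : Prop :=
  [/\ forall t, (N n (g t) < +oo)%E,
      forall t (e : R), 0 < e -> exists2 d : R, 0 < d &
        forall s, `|s - t| < d -> (N n (g s - g t)%R <= e%:E)%E &
      forall e : R, 0 < e -> exists c : R,
        forall t, c < `|t| -> (N n (g t) <= e%:E)%E].

Definition interp_fun (f : C -> 'M[T -> C]_n) : Prop :=
  [/\ bounded_continuous_on_strip f, analytic_on_open_strip f,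
      C0_on_line N0 (fun t => f (0 +i* t)) &
      C0_on_line N1 (fun t => f (1 +i* t))].

Definition interp_fun_norm (f : C -> 'M[T -> C]_n) : \bar R :=
  maxe (ereal_sup [set N0 (f (0 +i* t)) | t in [set: R]])
       (ereal_sup [set N1 (f (1 +i* t)) | t in [set: R]]).

End Interpolation.

Definition interpolation (T : Type) (N0 N1 : mnorms T) (theta : R) : mnorms T :=
  fun n x => ereal_inf [set interp_fun_norm N0 N1 f |
    f in [set f : C -> 'M[T -> C]_n | interp_fun N0 N1 f /\ f theta%:C = x]].

Section Tensor.
Variables (T1 T2 : Type).

(* The algebraic tensor product of a space of functions on T1 and a space of
   functions on T2 is identified with a space of functions on T1 * T2. *)
Definition tensf (f : T1 -> C) (g : T2 -> C) : T1 * T2 -> C :=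
  fun t => f t.1 * g t.2.

(* x (x) y in M_k(E1) (x) M_l(E2) = M_kl(E1 (x) E2). *)
Definition tensm (k l : nat) (x : 'M[T1 -> C]_k) (y : 'M[T2 -> C]_l) :
    'M[T1 * T2 -> C]_(k * l) :=
  \matrix_(i, j) (fun t => tensmx (evmx x t.1) (evmx y t.2) i j).

(* The projective norms on the M_n of the algebraic tensor product; the
   projective tensor product is its completion. An element of M_n of the
   completion is represented by a Cauchy sequence of M_n of the algebraic tensor
   product, and its norm is the limit of the norms. *)
Definition proj_tensor (N1 : mnorms T1) (N2 : mnorms T2) : mnorms (T1 * T2) :=
  fun n u => ereal_inf [set r | exists k l (a : 'M[C]_(n, k * l))
      (x : 'M[T1 -> C]_k) (y : 'M[T2 -> C]_l) (b : 'M[C]_(k * l, n)),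
    [/\ (N1 k x < +oo)%E, (N2 l y < +oo)%E, u = bimod a (tensm x y) b &
        r = (mxnorm a * (N1 k x * N2 l y) * mxnorm b)%E]].

End Tensor.

(* The linear map f extends by continuity to a complete contraction from the
   completion of N to the complete space N'. *)
Definition complete_contraction (T T' : Type) (N : mnorms T) (N' : mnorms T')
    (f : (T -> C) -> (T' -> C)) : Prop :=
  (forall (c : C) x y, carrier N x -> carrier N y ->
     f (scalef c x + y) = scalef c (f x) + f y) /\
  forall n (u : nat -> 'M[T -> C]_n), cauchy_seq N u ->
    exists A : 'M[T' -> C]_n,
      [/\ (N' n A < +oo)%E, cvg_seq N' (fun k => map_mx f (u k)) A &
          forall r : \bar R, (fun k => N n (u k)) @ \oo --> r -> (N' n A <= r)%E].

Definition jointly_completely_contractive (T1 T2 T3 : Type)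
    (N1 : mnorms T1) (N2 : mnorms T2) (N3 : mnorms T3)
    (mul : (T1 -> C) -> (T2 -> C) -> (T3 -> C)) : Prop :=
  exists f : (T1 * T2 -> C) -> (T3 -> C),
    (forall x y, carrier N1 x -> carrier N2 y -> f (tensf x y) = mul x y) /\
    complete_contraction (proj_tensor N1 N2) N3 f.

(* The image of the completion of N under the continuous extension of f, with
   values in N', with the operator space structure of its quotient by the kernel
   of that extension. *)
Definition quotient_image (T T' : Type) (N : mnorms T) (N' : mnorms T')
    (f : (T -> C) -> (T' -> C)) : mnorms T' :=
  fun n A => ereal_inf [set r | exists u : nat -> 'M[T -> C]_n,
    [/\ cauchy_seq N u, cvg_seq N' (fun k => map_mx f (u k)) A &
        (fun k => N n (u k)) @ \oo --> r]].

Record completely_contractive_banach_algebra (T : Type) (N : mnorms T)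
    (mul : (T -> C) -> (T -> C) -> (T -> C)) : Prop := CCBanachAlgebra {
  cba_operator_space : operator_space N;
  cba_complete : complete_space N;
  cba_closed : forall x y, carrier N x -> carrier N y -> carrier N (mul x y);
  cba_linearl : forall c x y z, carrier N x -> carrier N y -> carrier N z ->
    mul (scalef c x + y) z = scalef c (mul x z) + mul y z;
  cba_linearr : forall c x y z, carrier N x -> carrier N y -> carrier N z ->
    mul z (scalef c x + y) = scalef c (mul z x) + mul z y;
  cba_assoc : forall x y z, carrier N x -> carrier N y -> carrier N z ->
    mul x (mul y z) = mul (mul x y) z;
  cba_norm : forall x y, carrier N x -> carrier N y ->
    (norm1 N (mul x y) <= norm1 N x * norm1 N y)%E;
  cba_jcc : jointly_completely_contractive N N N mul
}.

End OperatorSpaces.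

Section Schatten.
Context {R : realType} (I : choiceType).
Local Notation C := R[i].

Definition restrict_mnorms (T : Type) (E : set (T -> C)) (N : mnorms T) :
    mnorms T :=
  fun n x => if `[< forall i j, E (x i j) >] then N n x else +oo%E.

(* M_n(S_oo) is a space of operators on l2^n (x) l2^I. *)
Definition Soo : mnorms (I * I) :=
  restrict_mnorms (@compact_op R I) (fun n x =>
    opnorm (fun t : ('I_n * I) * ('I_n * I) =>
              x t.1.1 t.2.1 (t.1.2, t.2.2))).

Definition trace_pairing (A B : I * I -> C) : C := trace (mxprod A (transp B)).

(* M_n(S_1) = CB(S_oo, M_n): the norm of x is the completely bounded norm of
   B |-> [<x_ij, B>]. *)
Definition S1 : mnorms (I * I) :=
  restrict_mnorms (schatten 1) (fun n x =>
    ereal_sup [set r | exists m (b : 'M[I * I -> C]_m), (Soo b <= 1)%E /\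
      r = mxnorm (\matrix_(i < n * m, j < n * m)
            trace_pairing (x (mxtens_unindex i).1 (mxtens_unindex j).1)
                          (b (mxtens_unindex i).2 (mxtens_unindex j).2))]).

(* Only meant for q in [1, +oo]. *)
Definition Sp (q : \bar R) : mnorms (I * I) :=
  match q with
  | r%:E => if r == 1 then S1
            else restrict_mnorms (schatten r) (interpolation Soo S1 r^-1)
  | _ => Soo
  end.

(* The linear map with A (x) B |-> A * B (Schur product): it maps
   [tensf A B], that is (s, t) |-> A s * B t, to t |-> A t * B t. *)
Definition psi (u : (I * I) * (I * I) -> C) : I * I -> C := fun t => u (t, t).

Definition Rpcb (p : R) : mnorms (I * I) :=
  quotient_image (proj_tensor (Sp p%:E) (Sp (hoelder_conjugate p%:E))) S1 psi.

End Schatten.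

Arguments Rpcb {R} I p n x.

(* Main.v *)
(* An element of the open unit ball of M_n(R_{p,cb}), cut to a finite block, is
   the Schur compression of an atom a (x (x) y) b, with x, y in the unit balls
   over S_p and S_p* (th = 1/p) and a, b contractions. A product of two atoms
   involves sum_k X_k (x) Y_k, with X_k(i,j) = x1(i,k) (x) x2(k,j) and Y_k
   likewise from y1, y2. Multiplying interpolation families of x1 and x2 gives
   analytic families F_k on the strip with F_k(th) = X_k that for each k are
   contractions at Re z = 0, and that are jointly bounded in l_1(k; S_1) at
   Re z = 1. Factoring F_k through positive densities, by the three lines
   theorem, writes the sum over k as an atom whose a and b are at most 1 + e in
   prescribed Hilbert-Schmidt weights; a minimax argument, by separation of
   convex sets, then bounds a and b by 1 + e in operator norm. This is
   submultiplicativity on finite blocks. It passes to R_{p,cb} because its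
   elements are the limits of their truncations and have as norm the supremum
   over finite blocks. *)

Require Import Defs.
From mathcomp Require Import all_boot all_order all_algebra finmap.
From mathcomp Require Import complex mxtens spectral.
From mathcomp Require Import all_classical all_reals all_analysis.
From mathcomp Require Import summability.
From mathcomp Require Import ring lra.
Set Implicit Arguments.
Unset Strict Implicit.
Unset Printing Implicit Defensive.
Import Order.TTheory GRing.Theory Num.Theory.
Import numFieldNormedType.Exports.
Import ComplexField.Normc.
Local Open Scope classical_set_scope.
Local Open Scope complex_scope.
Local Open Scope ring_scope.

Tactic Notation "eqs" ident(i) := apply: eq_bigr => i _.
Tactic Notation "eqs" ident(i) ident(j) := apply: eq_bigr => i _; apply: eq_bigr => j _.
Tactic Notation "sums" ident(i) := rewrite ?(mulr_sumr, mulr_suml); apply: eq_bigr => i _.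
Tactic Notation "sums" ident(i) ident(j) := sums i; sums j.
Tactic Notation "ext" ident(i) := apply/funext => i.
Tactic Notation "ext" ident(i) ident(j) := ext i; ext j.
Tactic Notation "letr" uconstr(c) := refine (@le_trans _ _ c _ _ _ _).

(** The sum over k cannot be bounded term by term: at Re z = 0 the columns are only bounded
    uniformly in k. The joint bound at Re z = 1 becomes usable after multiplication on both sides by
    matrices of Hilbert-Schmidt norm at most 1, which is why weights g and h enter. The row index is
    a pair in A x D, and the two marginals of g supply the densities for the x-side and for the
    y-side; their powers th/2 and (1 - th)/2 are recombined by a second use of three lines. Since
    this answer depends on the weights, an operator norm bound needs one atom that suits all of
    them. Direct sums of atoms make the set of kernels dominating the Gram kernels a a^* and b^* b
    convex, and this is what the minimax separates.

    The analytic arguments run on finite index sets, entry by entry, so that scalar functions on the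
    strip suffice. For infinite I a bound on all finite blocks does not by itself produce an element
    of the completed tensor product; convergence of truncations is therefore carried along as a
    second invariant, next to the block bound. *)

Lemma sum_pair (V : nmodType) (S T : finType) (F : S * T -> V) :
 \sum_p F p = \sum_s \sum_t F (s, t).
Proof. by rewrite pair_big/=; apply: eq_bigr => -[]. Qed.

Lemma sum_deltal (K : pzSemiRingType) (T : finType) (s : T) (f : T -> K) :
 \sum_t (s == t)%:R * f t = f s.
Proof.
rewrite (bigD1 s)//= eqxx mul1r big1 ?addr0// => t.
by rewrite eq_sym => /negbTE ->; rewrite mul0r.
Qed.

Lemma sum_deltar (K : pzSemiRingType) (T : finType) (s : T) (f : T -> K) :
 \sum_t (t == s)%:R * f t = f s.
Proof. by under eq_bigr do rewrite eq_sym; rewrite sum_deltal. Qed.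

Section Main.
Context {R : realType}.
Local Notation C := R[i].
Local Notation re := complex.Re.
Local Notation im := complex.Im.
Local Notation psum := partial_sum.
Local Notation unidx := mxtens_unindex.
#[local] Existing Instance totally_filter.

(** * The modulus of complex numbers *)

Section ComplexNorm.
Implicit Types (x y z : C).

Lemma normc_ge0 z : 0 <= normc z.
Proof. by case: z => a b; rewrite /normc. Qed.

Lemma normcD x y : normc (x + y) <= normc x + normc y.
Proof. exact: le_normcD. Qed.

Lemma normcNE x : normc (- x) = normc x. Proof. exact: normcN. Qed.

Lemma normcB x y : normc (x - y) <= normc x + normc y.
Proof. by rewrite -(normcNE y) normcD. Qed.

Lemma normc_subl x y : normc x <= normc (x - y) + normc y.
Proof. by apply: le_trans (normcD _ _); rewrite subrK. Qed.

Lemma normc_distC x y : normc (x - y) = normc (y - x).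
Proof. by rewrite -normcNE opprB. Qed.

Lemma normc_eq0 x : (normc x == 0) = (x == 0).
Proof. by apply/eqP/eqP => [/eq0_normc //|->]; rewrite normc0. Qed.

Lemma normc_conj x : normc (x^*)%R = normc x.
Proof. by case: x => a b; rewrite /= sqrrN. Qed.

Lemma normcX x n : normc (x ^+ n) = normc x ^+ n.
Proof. by elim: n => [|n ih]; rewrite ?normc1// !exprS normcM ih. Qed.

Lemma normc_real (a : R) : normc a%:C = `|a|.
Proof. by rewrite /= expr0n addr0 sqrtr_sqr. Qed.

Lemma normc_sum (T : Type) (r : seq T) (P : pred T) (F : T -> C) :
 normc (\sum_(i <- r | P i) F i) <= \sum_(i <- r | P i) normc (F i).
Proof.
elim/big_ind2: _ => //; first by rewrite normc0.
by move=> x1 y1 x2 y2 h1 h2; rewrite (le_trans (normcD _ _))// lerD.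
Qed.

Lemma normc_sq z : normc z ^+ 2 = re z ^+ 2 + im z ^+ 2.
Proof. by case: z => a b; rewrite sqr_sqrtr// addr_ge0 ?sqr_ge0. Qed.

Lemma normc_mulconj z : (normc z ^+ 2)%:C = z * (z^*)%R.
Proof. by rewrite -normCK rmorphXn. Qed.

Lemma normc_ReIm z : normc z <= `|re z| + `|im z|.
Proof.
rewrite -(@ler_pXn2r _ 2) ?nnegrE ?normc_ge0 ?addr_ge0//.
rewrite normc_sq sqrrD !real_normK ?num_real//.
by rewrite addrAC lerDl.
Qed.

Lemma Re_le_normc z : `|re z| <= normc z.
Proof.
rewrite -(@ler_pXn2r _ 2) ?nnegrE ?normc_ge0// normc_sq real_normK ?num_real//.
by rewrite lerDl sqr_ge0.
Qed.

Lemma Im_le_normc z : `|im z| <= normc z.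
Proof.
rewrite -(@ler_pXn2r _ 2) ?nnegrE ?normc_ge0// normc_sq real_normK ?num_real//.
by rewrite lerDr sqr_ge0.
Qed.

Lemma lerc_real (a b : R) : (a%:C <= b%:C :> C) = (a <= b).
Proof. exact: lecR. Qed.

Lemma ReD x y : re (x + y) = re x + re y.
Proof. by lra. Qed.

Lemma ImD x y : im (x + y) = im x + im y.
Proof. by lra. Qed.

Lemma Re_sum (T : Type) (r : seq T) (P : pred T) (F : T -> C) :
 re (\sum_(i <- r | P i) F i) = \sum_(i <- r | P i) re (F i).
Proof. by elim/big_rec2: _ => // i y1 y2 _ <-; rewrite ReD. Qed.

Lemma real_complex_sum (T : Type) (r : seq T) (P : pred T) (F : T -> R) :
 (\sum_(i <- r | P i) F i)%:C = \sum_(i <- r | P i) (F i)%:C :> C.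
Proof. exact: rmorph_sum. Qed.

Lemma normc_phase z : exists2 u : C, normc u = 1 & u * z = (normc z)%:C.
Proof.
have [->|z0] := eqVneq z 0.
 by exists 1; rewrite ?normc1// mul1r normc0.
have nz0 : normc z != 0 by rewrite normc_eq0.
exists ((z^*)%R * ((normc z)^-1)%:C).
 rewrite normcM normc_conj normc_real ger0_norm ?invr_ge0 ?normc_ge0//.
 by rewrite divff.
rewrite mulrAC (mulrC _ z) -normc_mulconj -rmorphM/= -mulrA divff// mulr1.
by [].
Qed.

End ComplexNorm.

(** * Finite l_2 norms and the Cauchy-Schwarz inequality *)

Section CauchySchwarz.
Context {T : finType}.

Lemma CS_real (x y : T -> R) :
 (\sum_t x t * y t) ^+ 2 <= (\sum_t x t ^+ 2) * (\sum_t y t ^+ 2).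
Proof.
have h : 0 <= \sum_s \sum_t (x s * y t - x t * y s) ^+ 2.
 by apply: sumr_ge0 => s _; apply: sumr_ge0 => t _; rewrite sqr_ge0.
have e : \sum_s \sum_t (x s * y t - x t * y s) ^+ 2 =
  ((\sum_t x t ^+ 2) * (\sum_t y t ^+ 2) - (\sum_t x t * y t) ^+ 2) *+ 2.
 transitivity (\sum_s \sum_t (x s ^+ 2 * y t ^+ 2 + (y s ^+ 2 * x t ^+ 2)
   - (x s * y s * (x t * y t)) *+ 2)).
  by apply: eq_bigr => s _; apply: eq_bigr => t _; ring.
 under eq_bigr do rewrite sumrB big_split/= -!mulr_sumr sumrMnl -mulr_sumr.
 rewrite sumrB big_split/= -!mulr_suml sumrMnl -mulr_suml.
 by ring.
by lra.
Qed.

Definition n2 (v : T -> C) : R := \sum_t normc (v t) ^+ 2.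

Lemma n2_ge0 v : 0 <= n2 v.
Proof. by apply: sumr_ge0 => t _; rewrite sqr_ge0. Qed.

Lemma n2_scale a v : n2 (fun t => a * v t) = normc a ^+ 2 * n2 v.
Proof. by rewrite mulr_sumr; apply: eq_bigr => t _; rewrite normcM exprMn. Qed.

Lemma n2_conj v : n2 (fun t => ((v t)^*)%R) = n2 v.
Proof. by apply: eq_bigr => t _; rewrite normc_conj. Qed.

Lemma n2_eq0 v : n2 v = 0 -> forall t, v t = 0.
Proof.
move=> /eqP; rewrite psumr_eq0; last by move=> t _; rewrite sqr_ge0.
move=> /allP h t; have := h t (mem_index_enum t).
by rewrite sqrf_eq0 normc_eq0 => /eqP.
Qed.

Lemma n2_mulconj v : (n2 v)%:C = \sum_t v t * ((v t)^*)%R.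
Proof. by rewrite real_complex_sum; apply: eq_bigr => t _; rewrite normc_mulconj. Qed.

Lemma normc_le_n2 v t : normc (v t) ^+ 2 <= n2 v.
Proof.
by rewrite /n2 (bigD1 t)//= lerDl sumr_ge0// => s _; rewrite sqr_ge0.
Qed.

Lemma CS (v w : T -> C) : normc (\sum_t v t * w t) ^+ 2 <= n2 v * n2 w.
Proof.
apply: le_trans _ (CS_real (fun t => normc (v t)) (fun t => normc (w t))).
rewrite ler_pXn2r ?nnegrE ?normc_ge0//; last first.
 by apply: sumr_ge0 => t _; rewrite mulr_ge0 ?normc_ge0.
apply: le_trans (normc_sum _ _ _) _.
by apply: ler_sum => t _; rewrite normcM.
Qed.

Lemma n2_eq (v w : T -> C) : v =1 w -> n2 v = n2 w.
Proof. by move=> h; apply: eq_bigr => t _; rewrite h. Qed.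

End CauchySchwarz.

#[local] Hint Resolve normc_ge0 n2_ge0 sqr_ge0 sqrtr_ge0 : core.
#[local] Hint Extern 0 (is_true (0 <= _)%R) => solve [apply: ltW; assumption] : core.

Ltac positivity := try done; lazymatch goal with
 | |- is_true (_ && _) => apply/andP; split; positivity
 | |- is_true (0 < _ * _)%R => apply: mulr_gt0; positivity
 | |- is_true (0 < _^-1)%R => rewrite invr_gt0; positivity
 | |- is_true (0 < _ ^+ _)%R => apply: exprn_gt0; positivity
 | |- is_true (0 < Num.min _ _)%R => rewrite lt_min; positivity
 | |- is_true (0 < Num.sqrt _)%R => rewrite sqrtr_gt0; positivity
 | |- is_true (0 < expR _)%R => exact: expR_gt0
 | |- is_true (0 < _ - _)%R => rewrite subr_gt0; done
 | |- is_true (0 < _ + _)%R => first [solve [apply: ltr_wpDl; positivity] | apply: ltr_wpDr; positivity]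
 | |- is_true (0 <= _ * _)%R => apply: mulr_ge0; positivity
 | |- is_true (0 <= _^-1)%R => rewrite invr_ge0; positivity
 | |- is_true (0 <= _ ^+ _)%R => apply: exprn_ge0; positivity
 | |- is_true (0 <= _ *+ _)%R => apply: mulrn_wge0; positivity
 | |- is_true (0 <= _ - _)%R => rewrite subr_ge0; first [done | exact: ltW]
 | |- is_true (0 <= _ + _)%R => apply: addr_ge0; positivity
 | |- is_true (0 <= expR _)%R => exact: expR_ge0
 | |- is_true (0 <= \sum_(_ <- _ | _) _)%R => apply: sumr_ge0 => ? _; positivity
 | |- is_true (0 <= _)%R => apply: ltW; positivity
 | |- is_true (_ != 0)%R => apply: lt0r_neq0; positivity
 end.
Tactic Notation "pos" := solve [positivity].

Lemma n2_bij (T T' : finType) (h : T' -> T) (v : T -> R[i]) :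
 bijective h -> n2 (v \o h) = n2 v.
Proof.
by move=> bh; rewrite [RHS](reindex h)//=; apply: onW_bij.
Qed.

Lemma n2_inj (T T' : finType) (h : T' -> T) (v : T -> R[i]) :
 injective h -> n2 (v \o h) <= n2 v.
Proof.
move=> ih; rewrite /n2.
have := @big_imset _ _ _ _ _ h predT (fun t => normc (v t) ^+ 2) (in2W ih).
move=> /= <-.
by rewrite [leRHS](bigID (mem (h @: predT)))/= lerDl sumr_ge0// => t _; rewrite sqr_ge0.
Qed.

(** * Operators between finite-dimensional l_2 spaces, given by kernels *)

Section Kernels.
Implicit Types A B S T U X : finType.

(* [opsq K c]: the operator with kernel K has squared norm at most c. *)
Definition opsq S T (K : S -> T -> C) (c : R) : Prop :=
 forall v : T -> C, n2 (fun s => \sum_t K s t * v t) <= c * n2 v.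

Definition kcomp S T U (K : S -> T -> C) (L : T -> U -> C) :
 S -> U -> C := fun s u => \sum_t K s t * L t u.

Lemma opsq_le S T (K : S -> T -> C) c d :
 c <= d -> opsq K c -> opsq K d.
Proof.
by move=> cd h v; apply: le_trans (h v) _; rewrite ler_wpM2r//.
Qed.

Lemma opsq_ext S T (K L : S -> T -> C) c :
 (forall s t, K s t = L s t) -> opsq K c -> opsq L c.
Proof.
move=> e h v; rewrite (@n2_eq _ _ (fun s => \sum_t K s t * v t))//.
by move=> s; apply: eq_bigr => t _; rewrite e.
Qed.

(** Cauchy-Schwarz one way; for the converse the test vector w is the conjugate of K v, and one
    factor |K v|^2 cancels. *)
Lemma opsq_bil S T (K : S -> T -> C) c : 0 <= c ->
 opsq K c <-> forall w v,
  normc (\sum_s \sum_t w s * K s t * v t) ^+ 2 <= c * (n2 w * n2 v).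
Proof.
split=> [h w v|h v].
 under eq_bigr => s _ do (under eq_bigr do rewrite -mulrA; rewrite -mulr_sumr).
 apply: le_trans (CS _ _) _; rewrite mulrCA ler_wpM2l ?n2_ge0//.
have := h (fun s => ((\sum_t K s t * v t)^*)%R) v.
under eq_bigr => s _ do (under eq_bigr do rewrite -mulrA; rewrite -mulr_sumr mulrC).
rewrite -n2_mulconj normc_real ger0_norm ?n2_ge0// n2_conj.
set N := n2 (fun s => _); rewrite mulrCA.
have [->|N0] := eqVneq N 0; first by rewrite mulr_ge0.
by rewrite ler_pM2l// lt0r N0 n2_ge0.
Qed.

Lemma opsq_tr S T (K : S -> T -> C) c : 0 <= c ->
 opsq K c -> opsq (fun t s => K s t) c.
Proof.
move=> c0 /(opsq_bil _ c0) h; apply/(opsq_bil _ c0) => w v.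
rewrite exchange_big/= (mulrC (n2 w)).
apply: le_trans (h _ _); rewrite le_eqVlt; apply/orP; left; apply/eqP.
by congr (normc _ ^+ 2); apply: eq_bigr => s _; apply: eq_bigr => t _; ring.
Qed.

Lemma opsq_conj S T (K : S -> T -> C) c :
 opsq K c -> opsq (fun s t => ((K s t)^*)%R) c.
Proof.
move=> h v; rewrite -[n2 v]n2_conj.
rewrite -n2_conj; rewrite (@n2_eq _ _ (fun s => \sum_t K s t * ((v t)^*)%R))//.
by move=> s; rewrite rmorph_sum; apply: eq_bigr => t _; rewrite rmorphM/= conjCK.
Qed.

Lemma opsq_adj S T (K : S -> T -> C) c : 0 <= c ->
 opsq K c -> opsq (fun t s => ((K s t)^*)%R) c.
Proof. by move=> c0 /opsq_conj /(opsq_tr c0). Qed.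

Lemma opsq_comp S T U (K : S -> T -> C) (L : T -> U -> C) c d :
 0 <= c -> opsq K c -> opsq L d -> opsq (kcomp K L) (c * d).
Proof.
move=> c0 hK hL v.
rewrite (@n2_eq _ _ (fun s => \sum_t K s t * (\sum_u L t u * v u))).
 by apply: le_trans (hK _) _; rewrite -mulrA ler_wpM2l.
move=> s.
under eq_bigr do rewrite mulr_suml.
rewrite exchange_big/=; apply: eq_bigr => t _.
by rewrite mulr_sumr; apply: eq_bigr => u _; rewrite mulrA.
Qed.

Lemma opsq_scale S T (K : S -> T -> C) a c :
 opsq K c -> opsq (fun s t => a * K s t) (normc a ^+ 2 * c).
Proof.
move=> h v.
rewrite (@n2_eq _ _ (fun s => a * (\sum_t K s t * v t))).
 by rewrite n2_scale -[leRHS]mulrA ler_wpM2l ?sqr_ge0.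
by move=> s; rewrite mulr_sumr; apply: eq_bigr => t _; rewrite mulrA.
Qed.

Lemma opsq_inj S T S' T' (g : S' -> S) (h : T' -> T)
  (K : S -> T -> C) c : 0 <= c -> injective g -> injective h ->
 opsq K c -> opsq (fun s t => K (g s) (h t)) c.
Proof.
move=> c0 ig ih hK.
have h1 : opsq (fun s t => K (g s) t) c.
 move=> v; apply: le_trans (hK v).
 exact: (n2_inj (fun s => \sum_t K s t * v t) ig).
have h2 := opsq_tr c0 h1.
apply: (opsq_tr c0 (K := fun t s => K (g s) (h t))) => v.
apply: le_trans (h2 v).
exact: (n2_inj (fun t => \sum_s K (g s) t * v s) ih).
Qed.

Lemma n2_pair S T (v : S * T -> C) :
 n2 v = \sum_s n2 (fun t => v (s, t)).
Proof. by rewrite pair_big/=; apply: eq_bigr => -[]. Qed.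

Lemma n2_swap S T (v : S * T -> C) :
 n2 v = \sum_t n2 (fun s => v (s, t)).
Proof. by rewrite n2_pair exchange_big. Qed.

Lemma opsq_blockdiag X S T (K : X -> S -> T -> C) c :
 (forall x, opsq (K x) c) ->
 opsq (fun (s : X * S) (t : X * T) => (s.1 == t.1)%:R * K s.1 s.2 t.2) c.
Proof.
move=> h v; rewrite !n2_pair mulr_sumr; apply: ler_sum => x _.
apply: le_trans (h x _); rewrite (@n2_eq _ _ (fun s => \sum_t K x s t * v (x, t)))//.
move=> s; rewrite sum_pair/=.
under eq_bigr do under eq_bigr do rewrite -mulrA.
by under eq_bigr do rewrite -mulr_sumr; rewrite sum_deltal.
Qed.

Lemma opsq_ampl X S T (K : S -> T -> C) c :
 opsq K c -> opsq (fun (s : X * S) (t : X * T) => (s.1 == t.1)%:R * K s.2 t.2) c.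
Proof. by move=> h; apply: (@opsq_blockdiag X S T (fun=> K)). Qed.

(** K (x) L is the product of the ampliations K (x) 1 and 1 (x) L; the swap [sw] brings the first
    into the form of [opsq_ampl]. *)
Lemma opsq_kron S T S' T' (K : S -> T -> C) (L : S' -> T' -> C) c d :
 0 <= c -> 0 <= d -> opsq K c -> opsq L d ->
 opsq (fun (s : S * S') (t : T * T') => K s.1 t.1 * L s.2 t.2) (c * d).
Proof.
move=> c0 d0 hK hL.
have h2 := @opsq_ampl T _ _ _ _ hL.
have h1 := @opsq_ampl S' _ _ _ _ hK.
have sw A B : injective (fun x : A * B => (x.2, x.1)).
 by move=> [a b] [a' b'] [-> ->].
have h3 := opsq_inj c0 (@sw _ _) (@sw _ _) h1.
apply: opsq_ext (opsq_comp c0 h3 h2) => -[s s'] [t t']; rewrite /kcomp/=.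
rewrite sum_pair/=.
under eq_bigr do under eq_bigr do rewrite -mulrA.
under eq_bigr do rewrite sum_deltal mulrCA.
by rewrite sum_deltar.
Qed.

Lemma n2_triangle T (v w : T -> C) :
 Num.sqrt (n2 (fun t => v t + w t)) <= Num.sqrt (n2 v) + Num.sqrt (n2 w).
Proof.
rewrite -(@ler_pXn2r _ 2) ?nnegrE ?sqrtr_ge0//.
rewrite sqrrD !sqr_sqrtr ?n2_ge0//.
have le : \sum_t normc (v t) * normc (w t) <= Num.sqrt (n2 v) * Num.sqrt (n2 w).
 rewrite -sqrtrM ?n2_ge0//; apply: le_trans (ler_norm _) _.
 rewrite -sqrtr_sqr ler_wsqrtr//; exact: CS_real.
letr (n2 v + (\sum_t normc (v t) * normc (w t)) *+ 2 + n2 w).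
 rewrite -sumrMnl -!big_split/=; apply: ler_sum => t _.
 by rewrite -sqrrD ler_pXn2r ?nnegrE ?addr_ge0 ?normc_ge0// normcD.
by lra.
Qed.

Lemma opsq_add S T (K L : S -> T -> C) (c d : R) :
 0 <= c -> 0 <= d -> opsq K (c ^+ 2) -> opsq L (d ^+ 2) ->
 opsq (fun s t => K s t + L s t) ((c + d) ^+ 2).
Proof.
move=> c0 d0 hK hL v.
rewrite -[leLHS]sqr_sqrtr ?n2_ge0// -[n2 v in leRHS]sqr_sqrtr ?n2_ge0//.
rewrite -exprMn ler_pXn2r ?nnegrE ?mulr_ge0 ?addr_ge0 ?sqrtr_ge0//.
rewrite (@n2_eq _ _ (fun s => (\sum_t K s t * v t) + \sum_t L s t * v t)); last first.
 by move=> s; rewrite -big_split/=; apply: eq_bigr => t _; rewrite mulrDl.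
apply: le_trans (n2_triangle _ _) _; rewrite mulrDl lerD//.
 by rewrite -[c](ger0_norm c0) -sqrtr_sqr -sqrtrM ?sqr_ge0// ler_wsqrtr.
by rewrite -[d](ger0_norm d0) -sqrtr_sqr -sqrtrM ?sqr_ge0// ler_wsqrtr.
Qed.

Lemma opsq0 S T c : 0 <= c -> opsq (fun (_ : S) (_ : T) => 0 : C) c.
Proof.
move=> c0 v; rewrite /n2 big1 ?mulr_ge0 ?n2_ge0// => s _.
by rewrite big1 ?normc0 ?expr0n// => t _; rewrite mul0r.
Qed.

Lemma opsq_HS S T (K : S -> T -> C) :
 opsq K (\sum_s n2 (K s)).
Proof. by move=> v; rewrite mulr_suml; apply: ler_sum => s _; exact: CS. Qed.

Lemma opsq_entry S T (K : S -> T -> C) c s t :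
 opsq K c -> normc (K s t) ^+ 2 <= c.
Proof.
move=> h; have := h (fun u => (u == t)%:R).
have -> : n2 (fun u => (u == t)%:R : C) = 1.
 rewrite /n2 (bigD1 t)//= eqxx normc1 expr1n big1 ?addr0// => u /negbTE ->.
 by rewrite normc0 expr0n.
rewrite mulr1; apply: le_trans.
apply: le_trans (normc_le_n2 _ s); rewrite (bigD1 t)//= eqxx mulr1 big1 ?addr0//.
by move=> u /negbTE ->; rewrite mulr0.
Qed.

Lemma opsq_id T : opsq (fun s t : T => (s == t)%:R : C) 1.
Proof.
by move=> v; rewrite mul1r (@n2_eq _ _ v)// => s; rewrite sum_deltal.
Qed.

Lemma opsq_diag T (d : T -> C) c :
 (forall t, normc (d t) ^+ 2 <= c) -> opsq (fun s t : T => (s == t)%:R * d s) c.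
Proof.
move=> h v; rewrite mulr_sumr; apply: ler_sum => s _.
rewrite (bigD1 s)//= eqxx mul1r big1 ?addr0.
 by rewrite normcM exprMn ler_wpM2r ?sqr_ge0.
by move=> t; rewrite eq_sym => /negbTE ->; rewrite !mul0r.
Qed.

(** A partial isometry: the columns selected by [P] are orthonormal and the others vanish. The left
    factor of a singular value decomposition has this form. *)
Lemma opsq_isometry S T (K : S -> T -> C) (P : T -> bool) :
 (forall t u, \sum_s ((K s t)^*)%R * K s u = (P t && (t == u))%:R) -> opsq K 1.
Proof.
move=> h v; rewrite mul1r -lerc_real n2_mulconj.
have -> : \sum_s (\sum_t K s t * v t) * (((\sum_t K s t * v t))^*)%R
  = (\sum_(t | P t) normc (v t) ^+ 2)%:C.
 transitivity (\sum_t \sum_u v u * ((v t)^*)%R * \sum_s ((K s t)^*)%R * K s u).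
  under eq_bigr do rewrite rmorph_sum/= mulr_sumr.
  rewrite exchange_big/=; apply: eq_bigr => t _.
  under eq_bigr do rewrite mulr_suml.
  rewrite exchange_big/=; apply: eq_bigr => u _.
  by rewrite mulr_sumr; apply: eq_bigr => s _; ring.
 rewrite real_complex_sum [RHS]big_mkcond/=; apply: eq_bigr => t _.
 rewrite (bigD1 t)//= h eqxx big1 ?addr0.
  by case: (P t); rewrite ?mulr1 ?mulr0// normc_mulconj.
 by move=> u ut; rewrite h eq_sym (negbTE ut) andbF mulr0.
by rewrite lerc_real [leRHS](bigID P)/= lerDl sumr_ge0// => t _; rewrite sqr_ge0.
Qed.

Lemma ler_eq (x y : R) : x = y -> x <= y. Proof. by lra. Qed.

Lemma opsq_delta S T (i : S) (j : T) : opsq (fun s t => (s == i)%:R * (t == j)%:R : C) 1.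
Proof.
move=> v; have -> : (fun s => \sum_t (s == i)%:R * (t == j)%:R * v t) = fun s => (s == i)%:R * v j.
 by ext s; rewrite -(sum_deltar j v); sums t; rewrite mulrA.
rewrite mul1r [leLHS]/n2 (bigD1 i)//= big1 ?addr0 => [|s /negbTE ->]; last by rewrite mul0r normc0 expr0n.
by rewrite eqxx mul1r normc_le_n2.
Qed.

(** Atoms carry one common bound for the squared norms of both outer factors; scaling a by sqrt (B /
    A) and b by its inverse leaves the products unchanged and provides it. *)
Lemma opsq_balance S T U X (a : S -> T -> C) (b : U -> X -> C) (A B : R) :
 0 < A -> 0 < B -> opsq a (A ^+ 2) -> opsq b (B ^+ 2) ->
 exists t u : C, [/\ t * u = 1, opsq (fun i j => t * a i j) (A * B) & opsq (fun i j => u * b i j) (A * B)].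
Proof.
move=> A0 B0 ha hb; have q0 : 0 < B / A by pos.
pose t := Num.sqrt (B / A); have tt : t ^+ 2 = B / A by rewrite sqr_sqrtr// ltW.
exists t%:C, t^-1%:C; split; first by rewrite -rmorphM/= mulfV// gt_eqF// sqrtr_gt0.
 have := opsq_scale t%:C ha; rewrite normc_real real_normK ?num_real// tt.
 by apply: opsq_le; apply: ler_eq; field; rewrite gt_eqF.
have := opsq_scale t^-1%:C hb; rewrite normc_real real_normK ?num_real// exprVn tt.
by apply: opsq_le; apply: ler_eq; field; rewrite !gt_eqF.
Qed.

End Kernels.


(** * Integrals of continuous functions on a segment *)

Section SegmentIntegral.
Implicit Types (f g : R -> R) (a b c x y : R).
Local Notation mu := (@lebesgue_measure R).

Definition econt a b f := forall x, a <= x <= b -> forall e : R, 0 < e ->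
 exists2 d : R, 0 < d & forall y, a <= y <= b -> `|y - x| < d -> `|f y - f x| <= e.

Definition intg f a b : R := \int[mu]_(x in `[a, b]) f x.

Lemma econtW a b c d f : a <= c -> d <= b -> econt a b f -> econt c d f.
Proof.
move=> ac db h x /andP[cx xd] e e0.
have [|d0 d00 hd] := h x _ e e0; first by rewrite (le_trans ac cx) (le_trans xd db).
exists d0 => // y /andP[cy yd]; apply: hd.
by lra.
Qed.

Lemma econt_within a b f : econt a b f -> {within `[a, b], continuous f}.
Proof.
move=> h; apply/subspace_continuousP => x /=; rewrite in_itv/= => xab.
apply/cvgrPdist_le => e e0; have [d d0 hd] := h x xab e e0.
have := nbhsx_ballx x d d0.
apply: filterS => y /= xy; rewrite in_itv/= => yab.
by rewrite distrC; apply: hd => //; rewrite distrC.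
Qed.

Lemma econt_intble a b f : econt a b f -> mu.-integrable `[a, b] (EFin \o f).
Proof.
move=> h; apply: continuous_compact_integrable; first exact: segment_compact.
exact: econt_within.
Qed.

Lemma econtD a b f g : econt a b f -> econt a b g -> econt a b (fun x => f x + g x).
Proof.
move=> hf hg x xab e e0.
have e20 : 0 < e / 2 by lra.
have [d d0 hd] := hf x xab _ e20; have [d' d'0 hd'] := hg x xab _ e20.
exists (Num.min d d'); first by rewrite lt_min d0.
move=> y yab; rewrite lt_min => /andP[y1 y2].
rewrite opprD addrACA (le_trans (ler_normD _ _))// [leRHS]splitr lerD//.
 exact: hd.
exact: hd'.
Qed.

Lemma econt_cst a b c : econt a b (fun=> c).
Proof. by move=> x _ e e0; exists 1 => // y _ _; rewrite subrr normr0. Qed.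

Lemma intg_split a b c f : a <= c -> c <= b -> econt a b f ->
 intg f a b = intg f a c + intg f c b.
Proof.
move=> ac cb h; rewrite /intg.
have hi := econt_intble h.
have := Rintegral_itvB (x := c) hi; rewrite !bnd_simp => /(_ ac cb) e.
rewrite -(Rintegral_itv_obnd_cbnd (r := c)); last first.
 apply: integrableS hi => //; apply: subset_itv; rewrite bnd_simp//.
by lra.
Qed.

Lemma intgD a b f g : econt a b f -> econt a b g ->
 intg (fun x => f x + g x) a b = intg f a b + intg g a b.
Proof. by move=> hf hg; rewrite /intg RintegralD//; exact: econt_intble. Qed.

Lemma le_intg a b f g : econt a b f -> econt a b g ->
 (forall x, a <= x <= b -> f x <= g x) -> intg f a b <= intg g a b.
Proof.
move=> hf hg h; apply: le_Rintegral => //; try exact: econt_intble.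
Qed.

Lemma intg_cst a b c : a <= b -> intg (fun=> c) a b = c * (b - a).
Proof.
move=> ab; rewrite /intg Rintegral_cst; last exact: measurable_itv.
rewrite [X in fine X](lebesgue_measure_itv `[a, b])/= lte_fin.
by move: ab; rewrite le_eqVlt => /orP[/eqP->|->//]; rewrite ltxx/= subrr.
Qed.

Lemma intg_eq a b f g : (forall x, a <= x <= b -> f x = g x) ->
 intg f a b = intg g a b.
Proof.
move=> h; apply: eq_Rintegral => x; rewrite inE/=; exact: h.
Qed.

Lemma intg_est a b f K M : a <= b -> econt a b f ->
 (forall x, a <= x <= b -> `|f x - K| <= M) ->
 `|intg f a b - K * (b - a)| <= M * (b - a).
Proof.
move=> ab hf h; rewrite ler_distl -mulrBl -mulrDl -!(intg_cst _ ab).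
apply/andP; split; apply: le_intg => //; try exact: econt_cst.
 by move=> x /h; rewrite ler_distl => /andP[].
by move=> x /h; rewrite ler_distl => /andP[].
Qed.

Lemma intg_lower a b c d f m : a <= c -> c <= d -> d <= b -> econt a b f ->
 (forall x, a <= x <= b -> 0 <= f x) -> (forall x, c <= x <= d -> m <= f x) ->
 m * (d - c) <= intg f a b.
Proof.
move=> ac cd db hf f0 hm.
have h0 u v : a <= u -> v <= b -> 0 <= intg f u v.
 move=> au vb; apply: Rintegral_ge0 => x /=; rewrite in_itv/= => /andP[ux xv].
 by rewrite f0// (le_trans au ux) (le_trans xv vb).
rewrite (intg_split ac (le_trans cd db))// (intg_split cd db); last exact: econtW hf.
rewrite -[leLHS]add0r lerD ?h0 ?(le_trans cd db)//.
rewrite -[leLHS]addr0 lerD ?h0 ?(le_trans ac cd)//.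
rewrite -(intg_cst _ cd); apply: le_intg => //; first exact: econt_cst.
exact: econtW hf.
Qed.

End SegmentIntegral.

(** * Goursat's theorem on rectangles *)

Section Goursat.
Implicit Types (h : C -> C) (z : C) (a b c d : R).

Definition cdiff h z := exists D : C, forall e : R, 0 < e -> exists2 d : R, 0 < d &
 forall k : C, normc k < d -> normc (h (z + k) - h z - k * D) <= e * normc k.

Lemma cdiff_cont h z : cdiff h z -> forall e : R, 0 < e -> exists2 d : R, 0 < d &
 forall k : C, normc k < d -> normc (h (z + k) - h z) <= e.
Proof.
move=> [D hD] e e0; have [d d0 hd] := hD 1 ltr01.
have D0 : 0 < 1 + normc D by pos.
exists (Num.min d (e / (1 + normc D))); first by pos.
move=> k; rewrite lt_min => /andP[/hd k1 k2].
rewrite -[X in normc X](subrK (k * D)) (le_trans (normcD _ _))//.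
letr (normc k * (1 + normc D)).
 by rewrite normcM mulrDr mulr1 lerD2r -[leRHS]mul1r.
by rewrite -ler_pdivlMr// ltW.
Qed.

(* The real part of (1/i) times the integral of h along the boundary of the
  rectangle with corners a + i c and b + i d. *)
Definition contour h a b c d : R :=
 intg (fun y => re (h (b +i* y) - h (a +i* y))) c d
 - intg (fun x => im (h (x +i* d) - h (x +i* c))) a b.

Definition cdiff_rect h a b c d :=
 forall x y, a <= x <= b -> c <= y <= d -> cdiff h (x +i* y).

Lemma cdiff_econtv h a b c d x : cdiff_rect h a b c d -> a <= x <= b ->
 econt c d (fun y => re (h (x +i* y))).
Proof.
move=> H xab y ycd e e0; have [d0 d00 hd] := cdiff_cont (H _ _ xab ycd) e0.
exists d0 => // y' _ yy'; have := hd (0 +i* (y' - y)).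
rewrite /normc/= expr0n/= add0r sqrtr_sqr => /(_ yy').
set u := h _; set v := h _ => uv.
have -> : h (x +i* y') = u by rewrite /u; simpc; rewrite addrC subrK.
apply: le_trans uv; apply: le_trans (Re_le_normc _).
by rewrite ReD; case: (v).
Qed.

Lemma cdiff_econth h a b c d y : cdiff_rect h a b c d -> c <= y <= d ->
 econt a b (fun x => im (h (x +i* y))).
Proof.
move=> H ycd x xab e e0; have [d0 d00 hd] := cdiff_cont (H _ _ xab ycd) e0.
exists d0 => // x' _ xx'; have := hd ((x' - x) +i* 0).
rewrite /normc/= expr0n/= addr0 sqrtr_sqr => /(_ xx').
set u := h _; set v := h _ => uv.
have -> : h (x' +i* y) = u by rewrite /u; simpc; rewrite addrC subrK.
by apply: le_trans uv; apply: le_trans (Im_le_normc _); case: (u); case: (v).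
Qed.

Lemma econtN a b (f : R -> R) : econt a b f -> econt a b (fun x => - f x).
Proof.
move=> hf x xab e e0; have [d d0 hd] := hf x xab e e0.
by exists d => // y yab yx; rewrite -opprD normrN hd.
Qed.

Lemma econt_ext a b (f g : R -> R) : f =1 g -> econt a b f -> econt a b g.
Proof. by move=> /funext ->. Qed.

Lemma ReB z w : re (z - w) = re z - re w.
Proof. by lra. Qed.

Lemma ImB z w : im (z - w) = im z - im w.
Proof. by lra. Qed.

Lemma econt_contourv h a b c d x x' : cdiff_rect h a b c d -> a <= x <= b -> a <= x' <= b ->
 econt c d (fun y => re (h (x +i* y) - h (x' +i* y))).
Proof.
move=> H hx hx'; apply: econt_ext (econtD (cdiff_econtv H hx) (econtN (cdiff_econtv H hx'))).
by move=> y; rewrite ReB.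
Qed.

Lemma econt_contourh h a b c d y y' : cdiff_rect h a b c d -> c <= y <= d -> c <= y' <= d ->
 econt a b (fun x => im (h (x +i* y) - h (x +i* y'))).
Proof.
move=> H hx hx'; apply: econt_ext (econtD (cdiff_econth H hx) (econtN (cdiff_econth H hx'))).
by move=> y0; rewrite ImB.
Qed.

Lemma contour_splitx h a b c d m : a <= m -> m <= b -> c <= d -> cdiff_rect h a b c d ->
 contour h a b c d = contour h a m c d + contour h m b c d.
Proof.
move=> am mb cd H; rewrite /contour.
have ab := le_trans am mb.
rewrite (intg_split am mb); last by apply: (econt_contourh H); rewrite ?lexx ?cd.
rewrite addrACA -opprD; congr (_ - _).
rewrite -intgD; last 2 first.
- by apply: (econt_contourv H); rewrite ?lexx ?am ?mb ?ab.
- by apply: (econt_contourv H); rewrite ?lexx ?am ?mb ?ab.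
by apply: intg_eq => y _; rewrite -ReD; congr re; ring.
Qed.

Lemma contour_splity h a b c d m : c <= m -> m <= d -> a <= b -> cdiff_rect h a b c d ->
 contour h a b c d = contour h a b c m + contour h a b m d.
Proof.
move=> cm md ab H; rewrite /contour.
have cd := le_trans cm md.
rewrite (intg_split cm md); last by apply: (econt_contourv H); rewrite ?lexx ?ab.
rewrite addrACA -opprD; congr (_ - _).
rewrite -intgD; last 2 first.
- by apply: (econt_contourh H); rewrite ?lexx ?cm ?md ?cd.
- by apply: (econt_contourh H); rewrite ?lexx ?cm ?md ?cd.
by apply: intg_eq => y _; rewrite -ImD; congr im; ring.
Qed.

Lemma cdiff_rectW h a b c d a' b' c' d' : a <= a' -> b' <= b -> c <= c' -> d' <= d ->
 cdiff_rect h a b c d -> cdiff_rect h a' b' c' d'.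
Proof.
move=> aa bb cc dd H x y /andP[ax xb] /andP[cy yd]; apply: H.
 by lra.
by lra.
Qed.

(* Near a point of differentiability the contour integral is o(diameter^2),
  since it vanishes for affine functions. *)
Lemma contour_small h a b c d p D e : a <= b -> c <= d -> 0 <= e ->
 cdiff_rect h a b c d ->
 (forall x y, a <= x <= b -> c <= y <= d ->
   normc (h (x +i* y) - h p - ((x +i* y) - p) * D) <= e) ->
 `|contour h a b c d| <= (e + e) * ((b - a) + (d - c)).
Proof.
move=> ab cd e0 H hD; rewrite /contour.
set K := re D.
have dif x y x' y' : a <= x <= b -> c <= y <= d -> a <= x' <= b -> c <= y' <= d ->
  normc (h (x +i* y) - h (x' +i* y') - ((x - x') +i* (y - y')) * D) <= e + e.
 move=> h1 h2 h3 h4.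
 have := lerD (hD _ _ h1 h2) (hD _ _ h3 h4); apply: le_trans.
 apply: le_trans (normcB _ _); apply: ler_eq.
 congr normc; rewrite -[(x - x') +i* (y - y')]/((x +i* y) - (x' +i* y')); ring.
have h1 := @intg_est c d (fun y => re (h (b +i* y) - h (a +i* y)))
  (K * (b - a)) (e + e) cd.
have h2 := @intg_est a b (fun x => im (h (x +i* d) - h (x +i* c)))
  (K * (d - c)) (e + e) ab.
rewrite -[X in `|X|](subrK (K * (b - a) * (d - c))).
rewrite [X in `|X|](_ : _ = (intg (fun y => re (h (b +i* y) - h (a +i* y))) c d
  - K * (b - a) * (d - c)) - (intg (fun x => im (h (x +i* d) - h (x +i* c))) a b
  - K * (d - c) * (b - a))); last by ring.
rewrite [leRHS]mulrDr [leRHS]addrC; apply: (le_trans (ler_normB _ _)); apply: lerD.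
- apply: h1; first by apply: (econt_contourv H); rewrite ?lexx ?ab.
 move=> y ycd; have := dif b y a y; rewrite !lexx ab => /(_ isT ycd isT ycd).
 apply: le_trans; apply: le_trans (Re_le_normc _).
 rewrite (ReB (_ - _) (_ * D)) [re (_ * D)](_ : _ = K * (b - a))//.
 by rewrite subrr /K; case: (D) => u v; simpc; rewrite mulrC.
- apply: h2; first by apply: (econt_contourh H); rewrite ?lexx ?cd.
 move=> x xab; have := dif x d x c; rewrite !lexx cd => /(_ xab isT xab isT).
 apply: le_trans; apply: le_trans (Im_le_normc _).
 rewrite (ImB (_ - _) (_ * D)) [im (_ * D)](_ : _ = K * (d - c))//.
 by rewrite subrr /K; case: (D) => u v; simpc; rewrite /= mulrC.
Qed.

(** The contour integral is additive under both bisections, so the four quarters cannot all carry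
    less than a quarter of its absolute value. *)
Lemma contour_quarter h a b c d : a <= b -> c <= d -> cdiff_rect h a b c d ->
 exists2 q : R * R, a <= q.1 /\ c <= q.2 &
  [/\ q.1 + (b - a) / 2 <= b, q.2 + (d - c) / 2 <= d &
  `|contour h a b c d| / 4 <=
  `|contour h q.1 (q.1 + (b - a) / 2) q.2 (q.2 + (d - c) / 2)|].
Proof.
move=> ab cd H; set m := a + (b - a) / 2; set k := c + (d - c) / 2.
have am : a <= m by rewrite lerDl divr_ge0// subr_ge0.
have ck : c <= k by rewrite lerDl divr_ge0// subr_ge0.
have mb' : m + (b - a) / 2 = b by rewrite /m; field.
have kd' : k + (d - c) / 2 = d by rewrite /k; field.
have mb : m <= b by lra.
have kd : k <= d by lra.
have e : contour h a b c d = contour h a m c k + contour h a m k d +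
  (contour h m b c k + contour h m b k d).
 rewrite (contour_splitx am mb cd H) (contour_splity ck kd am) ?(contour_splity ck kd mb)//.
  by apply: cdiff_rectW H.
 by apply: cdiff_rectW H.
have [h1|h1] := lerP (`|contour h a b c d| / 4) `|contour h a m c k|.
 by exists (a, c).
have [h2|h2] := lerP (`|contour h a b c d| / 4) `|contour h a m k d|.
 by exists (a, k) => //=; rewrite kd'.
have [h3|h3] := lerP (`|contour h a b c d| / 4) `|contour h m b c k|.
 by exists (m, c) => //=; rewrite mb'.
have [h4|h4] := lerP (`|contour h a b c d| / 4) `|contour h m b k d|.
 by exists (m, k) => //=; rewrite mb' kd'.
have : `|contour h a b c d| <= `|contour h a m c k| + `|contour h a m k d| +
  (`|contour h m b c k| + `|contour h m b k d|).
 rewrite {1}e (le_trans (ler_normD _ _))// lerD// ler_normD//.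
lra.
Qed.

(** Bisection: nested rectangles keep a contour integral of at least E / 4^n, whereas
    differentiability at their common point makes it o(1 / 4^n). *)
Theorem goursat h a b c d : a <= b -> c <= d -> cdiff_rect h a b c d ->
 contour h a b c d = 0.
Proof.
move=> ab cd H.
pose w n : R := (b - a) / 2 ^+ n; pose l n : R := (d - c) / 2 ^+ n.
have w0 n : 0 <= w n by rewrite divr_ge0 ?subr_ge0 ?exprn_ge0.
have l0 n : 0 <= l n by rewrite divr_ge0 ?subr_ge0 ?exprn_ge0.
have wS n : w n.+1 = w n / 2 by rewrite /w exprSr invfM mulrA.
have lS n : l n.+1 = l n / 2 by rewrite /l exprSr invfM mulrA.
pose W n (q : R * R) := `|contour h q.1 (q.1 + w n) q.2 (q.2 + l n)|.
(* The invariant sits inside the existential, as a hypothesis, so that choice yields a selection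
   function defined on all pairs. *)
have step : forall nq : nat * (R * R), exists q' : R * R,
  [/\ a <= nq.2.1, nq.2.1 + w nq.1 <= b, c <= nq.2.2 & nq.2.2 + l nq.1 <= d] ->
  [/\ nq.2.1 <= q'.1, nq.2.2 <= q'.2, q'.1 + w nq.1.+1 <= nq.2.1 + w nq.1,
   q'.2 + l nq.1.+1 <= nq.2.2 + l nq.1 & W nq.1 nq.2 / 4 <= W nq.1.+1 q'].
 move=> [n [x y]]/=.
 have [[ax xb cy yd]|no] := pselect [/\ a <= x, x + w n <= b, c <= y & y + l n <= d];
  last by exists (x, y).
 have [|||q [q1 q2] [q3 q4 q5]] := @contour_quarter h x (x + w n) y (y + l n).
 1,2: by rewrite lerDl.
  by apply: cdiff_rectW H.
 have ex (u v : R) : u + v - u = v by ring.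
 by rewrite !ex in q3 q4 q5; exists q => _; rewrite /W wS lS.
have [f hf] := choice step.
pose q := fix q n := if n is n'.+1 then f (n', q n') else (a, c).
have w00 : w 0%N = b - a by rewrite /w expr0 divr1.
have l00 : l 0%N = d - c by rewrite /l expr0 divr1.
have inv n : [/\ a <= (q n).1, (q n).1 + w n <= b, c <= (q n).2 & (q n).2 + l n <= d].
 elim: n => [|n ih]; first by rewrite /= w00 l00 !(addrC _ (_ - _)) !subrK !lexx.
 have [h1 h2 h3 h4 _] := hf (n, q n) ih; case: ih => i1 i2 i3 i4; split => /=.
 - exact: le_trans i1 h1.
 - exact: le_trans h3 i2.
 - exact: le_trans i3 h2.
 - exact: le_trans h4 i4.
have mono n k : [/\ (q n).1 <= (q (n + k)%N).1, (q n).2 <= (q (n + k)%N).2,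
  (q (n + k)%N).1 + w (n + k)%N <= (q n).1 + w n &
  (q (n + k)%N).2 + l (n + k)%N <= (q n).2 + l n].
 elim: k => [|k [i1 i2 i3 i4]]; first by rewrite addn0.
 rewrite addnS; have [h1 h2 h3 h4 _] := hf (_, _) (inv (n + k)%N); split => /=.
 - exact: le_trans i1 h1.
 - exact: le_trans i2 h2.
 - exact: le_trans h3 i3.
 - exact: le_trans h4 i4.
have big n : W 0%N (a, c) / 4 ^+ n <= W n (q n).
 elim: n => [|n ih]; first by rewrite expr0 divr1.
 have [_ _ _ _ h5] := hf (_, _) (inv n); apply: le_trans h5.
 by rewrite exprSr invfM mulrA ler_wpM2r.
have cross1 m n : (q m).1 <= (q n).1 + w n.
 have [mn|/ltnW mn] := leqP m n.
  have [h1 _ _ _] := mono m (n - m)%N; rewrite subnKC// in h1.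
  by rewrite (le_trans h1)// lerDl.
 have [_ _ h1 _] := mono n (m - n)%N; rewrite subnKC// in h1.
 by apply: le_trans h1; rewrite lerDl.
have cross2 m n : (q m).2 <= (q n).2 + l n.
 have [mn|/ltnW mn] := leqP m n.
  have [_ h1 _ _] := mono m (n - m)%N; rewrite subnKC// in h1.
  by rewrite (le_trans h1)// lerDl.
 have [_ _ _ h1] := mono n (m - n)%N; rewrite subnKC// in h1.
 by apply: le_trans h1; rewrite lerDl.
(* The suprema of the coordinates of the lower left corners give a point of every rectangle of the
   chain, by [cross1] and [cross2]. *)
pose px := sup [set (q n).1 | n in [set: nat]].
pose py := sup [set (q n).2 | n in [set: nat]].
have px1 n : (q n).1 <= px <= (q n).1 + w n.
 apply/andP; split.
  apply: ub_le_sup; last by exists n.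
  by exists ((q 0%N).1 + w 0%N) => _ [m _ <-].
 by apply: ge_sup; [exists (q 0%N).1, 0%N|move=> _ [m _ <-]].
have py1 n : (q n).2 <= py <= (q n).2 + l n.
 apply/andP; split.
  apply: ub_le_sup; last by exists n.
  by exists ((q 0%N).2 + l 0%N) => _ [m _ <-].
 by apply: ge_sup; [exists (q 0%N).2, 0%N|move=> _ [m _ <-]].
have [D hD] : cdiff h (px +i* py).
 have := px1 0%N; have := py1 0%N; rewrite w00 l00/= !(addrC _ (_ - _)) !subrK.
 by move=> y1 x1; exact: H.
apply/eqP; rewrite -normr_eq0; apply/eqP/le_anti; rewrite normr_ge0 andbT.
set E := `|_|; rewrite leNgt; apply/negP => E0.
have EW : E = W 0%N (a, c) by rewrite /W w00 l00/= !(addrC _ (_ - _)) !subrK.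
(* The added 1 keeps S positive for degenerate rectangles. With e = E / (4 S^2) the bound of
   [contour_small] is at most E / 2 / 4^n, below the E / 4^n kept by the bisection. *)
pose S := (b - a) + (d - c) + 1.
have S1 : 1 <= S by rewrite lerDr addr_ge0 ?subr_ge0.
have S0 : 0 < S by exact: lt_le_trans S1.
pose e := E / (4 * S ^+ 2).
have e0 : 0 < e by rewrite divr_gt0// mulr_gt0// exprn_gt0.
have [dl dl0 hdl] := hD e e0.
have [n hn] : exists n : nat, S / 2 ^+ n < dl.
 exists (Num.bound (S / dl)).
 have := archi_boundP (ltW (divr_gt0 S0 dl0)); set N := Num.bound _ => hN.
 rewrite ltr_pdivrMr ?exprn_gt0// mulrC -ltr_pdivrMr//.
 apply: lt_trans hN _; rewrite -natrX ltr_nat ltn_expl//.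
have Ssum : w n + l n <= S / 2 ^+ n.
 rewrite /w /l -mulrDl ler_wpM2r ?invr_ge0 ?exprn_ge0// /S; lra.
have /andP[x1 x2] := px1 n; have /andP[y1 y2] := py1 n.
have [i1 i2 i3 i4] := inv n.
have := @contour_small h (q n).1 ((q n).1 + w n) (q n).2 ((q n).2 + l n) (px +i* py) D
 (e * (S / 2 ^+ n)).
have er0 : 0 <= e * (S / 2 ^+ n).
 by rewrite mulr_ge0 ?(ltW e0)// divr_ge0 ?(ltW S0)// exprn_ge0.
rewrite !lerDl w0 l0 er0 => /(_ isT isT isT (cdiff_rectW i1 i2 i3 i4 H)) => hh.
have : W n (q n) <= (e * (S / 2 ^+ n) + e * (S / 2 ^+ n)) * (w n + l n).
 rewrite /W; apply: le_trans (hh _) _; last first.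
  have ex (u v : R) : u + v - u = v by ring.
  by rewrite !ex.
 move=> x y /andP[xa xb] /andP[yc yd].
 have nk : normc ((x - px) +i* (y - py)) <= S / 2 ^+ n.
  apply: le_trans (normc_ReIm _) _ => /=; apply: le_trans Ssum.
  by rewrite lerD// ler_distl; apply/andP; split; lra.
 have := hdl ((x - px) +i* (y - py)) (le_lt_trans nk hn).
 rewrite (_ : (px +i* py) + ((x - px) +i* (y - py)) = x +i* y); last first.
  by simpc; congr (_ +i* _); ring.
 move=> h1; apply: (le_trans (le_trans _ h1)); last by rewrite ler_wpM2l// ltW.
 by rewrite -[x +i* y - _]/((x - px) +i* (y - py)).
have := big n; rewrite -EW => h1 /(le_trans h1).
move=> /le_trans /(_ (ler_wpM2l _ Ssum)) h2.
have : E / 4 ^+ n <= (e * (S / 2 ^+ n) + e * (S / 2 ^+ n)) * (S / 2 ^+ n).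
 by apply: h2; rewrite addr_ge0.
have -> : (e * (S / 2 ^+ n) + e * (S / 2 ^+ n)) * (S / 2 ^+ n) = E / 2 / 4 ^+ n.
 rewrite (_ : 4 = 2 * 2) ?exprMn; last by ring.
 by rewrite /e; field; rewrite ?expf_neq0 ?gt_eqF ?exprn_gt0.
rewrite ler_pM2r ?invr_gt0 ?exprn_gt0//; lra.
Qed.

End Goursat.

(** * Rules for complex derivatives *)

Section ComplexDifferentiability.
Implicit Types (f g : C -> C) (z : C).

Lemma cdiff_ext f g z : f =1 g -> cdiff f z -> cdiff g z.
Proof. by move=> /funext ->. Qed.

Lemma cdiff_cst (c : C) z : cdiff (fun=> c) z.
Proof.
exists 0 => e e0; exists 1 => // k _.
by rewrite subrr mulr0 subrr normc0 mulr_ge0.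
Qed.

Lemma cdiff_id z : cdiff (fun w => w) z.
Proof.
exists 1 => e e0; exists 1 => // k _.
rewrite [X in normc X](_ : _ = 0); last by ring.
by rewrite normc0 mulr_ge0.
Qed.

Lemma cdiffD f g z : cdiff f z -> cdiff g z -> cdiff (fun w => f w + g w) z.
Proof.
move=> [D hD] [E hE]; exists (D + E) => e e0.
have e2 : 0 < e / 2 by lra.
have [d d0 hd] := hD _ e2; have [d' d'0 hd'] := hE _ e2.
exists (Num.min d d'); first by rewrite lt_min d0.
move=> k; rewrite lt_min => /andP[/hd h1 /hd' h2].
rewrite [X in normc X](_ : _ = (f (z + k) - f z - k * D) + (g (z + k) - g z - k * E)); last by ring.
by rewrite (le_trans (normcD _ _))// [e]splitr mulrDl lerD.
Qed.

Lemma cdiffM f g z : cdiff f z -> cdiff g z -> cdiff (fun w => f w * g w) z.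
Proof.
move=> [D hD] [E hE]; exists (D * g z + f z * E) => e e0.
pose S := normc (f z) + normc D + normc (g z) + normc E + 1 + normc (D * E) + 1.
have S1 : 1 <= S by rewrite lerDr !addr_ge0.
have S0 : 0 < S by lra.
pose e1 := Num.min 1 (e / (2 * S)).
have e10 : 0 < e1 by rewrite lt_min ltr01 divr_gt0// mulr_gt0.
have [d d0 hd] := hD _ e10; have [d' d'0 hd'] := hE _ e10.
exists (Num.min e1 (Num.min d d')); first by rewrite lt_min e10 lt_min d0.
move=> k; rewrite lt_min => /andP[/ltW k1]; rewrite lt_min => /andP[/hd h1 /hd' h2].
set r1 := _ - _ - k * D in h1; set r2 := _ - _ - k * E in h2.
have e11 : e1 <= 1 by rewrite ge_min lexx.
have kk1 : normc k <= 1 by lra.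
(* The increment minus its linear part: a quadratic term and the two remainders. Each piece carries
   a factor e1 |k|. *)
rewrite [X in normc X](_ : _ = k * k * (D * E) + (f z + k * D) * r2 +
  r1 * (g z + k * E + r2)); last by rewrite /r1 /r2; ring.
letr (normc k * e1 * normc (D * E) + (normc (f z) + normc D) * (e1 * normc k)
  + (e1 * normc k) * (normc (g z) + normc E + 1)).
 apply: le_trans (normcD _ _) _; rewrite lerD//.
  apply: le_trans (normcD _ _) _; rewrite lerD//.
   by rewrite !normcM ler_wpM2r ?mulr_ge0 ?normc_ge0// ler_wpM2l.
  rewrite normcM ler_pM ?normc_ge0// (le_trans (normcD _ _))// lerD2l normcM.
  by rewrite ler_piMl.
 rewrite normcM ler_pM ?normc_ge0// (le_trans (normcD _ _))// lerD//.
  by rewrite (le_trans (normcD _ _))// lerD2l normcM ler_piMl.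
 by apply: le_trans h2 _; rewrite mulr_ile1.
rewrite [leLHS](_ : _ = e1 * normc k * (S - 1)); last by rewrite /S; ring.
rewrite mulrAC ler_wpM2r//.
letr (e / (2 * S) * (S - 1)).
 by rewrite ler_wpM2r ?subr_ge0// ge_min lexx orbT.
letr (e / (2 * S) * S).
 by rewrite ler_wpM2l ?divr_ge0 ?mulr_ge0 ?(ltW e0)// gerBl.
by rewrite invfM mulrA mulfVK ?gt_eqF// ler_piMr ?(ltW e0)// invf_le1// ler1n.
Qed.

Lemma cdiffX f z n : cdiff f z -> cdiff (fun w => f w ^+ n) z.
Proof.
move=> hf; elim: n => [|n ih]; first exact: cdiff_cst.
by apply: cdiff_ext (cdiffM hf ih) => w; rewrite exprS.
Qed.

Lemma cdiff_onem f z : cdiff f (1 - z) -> cdiff (fun w => f (1 - w)) z.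
Proof.
move=> [D hD]; exists (- D) => e e0; have [d d0 hd] := hD e e0; exists d => // k kd.
have := hd (- k); rewrite normcNE => /(_ kd).
by rewrite opprD addrA mulrN mulNr.
Qed.

(** The reflection in the line Re z = s. The conjugate of f at the reflected point is again
    holomorphic, and on the line its product with f is |f|^2. *)
Definition reflect (s : R) z : C := (s + s)%:C - (z^*)%R.

Lemma cdiff_reflect f s z : cdiff f (reflect s z) ->
 cdiff (fun w => ((f (reflect s w))^*)%R) z.
Proof.
move=> [D hD]; exists (- (D^*)%R) => e e0; have [d d0 hd] := hD e e0; exists d => // k kd.
have := hd (- (k^*)%R); rewrite normcNE normc_conj => /(_ kd).
apply: le_trans; rewrite -[leRHS]normc_conj le_eqVlt; apply/orP; left; apply/eqP.
rewrite !rmorphB/= rmorphM/= rmorphN/= conjCK mulrN.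
by rewrite /reflect !rmorphD/= opprD addrA mulNr.
Qed.

End ComplexDifferentiability.

(** * The three lines theorem *)

Section ThreeLines.
Implicit Types (f g : C -> C) (z : C).
Local Notation strip := (@strip R).
Local Notation open_strip := (@open_strip R).

Definition scont f := forall z, strip z -> forall e : R, 0 < e -> exists2 d : R, 0 < d &
 forall w, strip w -> normc (w - z) < d -> normc (f w - f z) <= e.

Lemma bernoulli_unbounded (r K : R) : 1 < r -> exists n : nat, K < r ^+ n.
Proof.
move=> r1; have b n : 1 + n%:R * (r - 1) <= r ^+ n.
 elim: n => [|n ih]; first by rewrite mul0r expr0.
 rewrite exprS; letr (r * (1 + n%:R * (r - 1))).
  have : 0 <= n%:R * (r - 1) * (r - 1) by pos.
  lra.
 by rewrite ler_wpM2l// (le_trans _ (ltW r1)).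
have r0 : 0 < r - 1 by lra.
exists (Num.bound (`|K| / (r - 1))); apply: lt_le_trans (b _).
have : `|K| / (r - 1) < (Num.bound (`|K| / (r - 1)))%:R.
 by apply: archi_boundP; rewrite divr_ge0//.
rewrite ltr_pdivrMr// => h; apply: le_lt_trans (ler_norm _) _; lra.
Qed.

Lemma strip_EVT g (L kappa : R) : 0 <= L -> scont g ->
 exists2 p : R * R, 0 <= p.1 <= 1 /\ - L <= p.2 <= L &
 forall x y, 0 <= x <= 1 -> - L <= y <= L ->
  normc (g (x +i* y)) - kappa * x <= normc (g (p.1 +i* p.2)) - kappa * p.1.
Proof.
move=> L0 hg.
pose G (p : R * R) := normc (g (p.1 +i* p.2)) - kappa * p.1.
pose A := `[0, 1]%classic `*` `[- L, L]%classic : set (R * R).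
have A0 : A !=set0.
 exists (0, 0); split; rewrite /= in_itv/= ?lexx ?ler01//.
 by lra.
have Ac : compact A by apply: compact_setX; exact: segment_compact.
have Gc : {within A, continuous G}.
 rewrite /A; apply/subspace_continuousP => -[x y] /=[]; rewrite !in_itv/= => x01 yL.
 apply/cvgrPdist_le => e e0.
 have e2 : 0 < e / 2 by lra.
 have [d d0 hd] := hg (x +i* y) x01 (e / 2) e2.
 pose d' := Num.min (d / 2) (e / 2 / (`|kappa| + 1)).
 have d'0 : 0 < d' by rewrite lt_min !divr_gt0.
 have := nbhsx_ballx (x, y) d' d'0.
 apply: filterS => -[x' y'] /= [/= bx by_] [x'01 y'L].
 have xx : `|x' - x| < d' by rewrite distrC.
 have yy : `|y' - y| < d' by rewrite distrC.
 have h1 : normc (g (x' +i* y') - g (x +i* y)) <= e / 2.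
  apply: hd => //; apply: le_lt_trans (normc_ReIm _) _ => /=.
  rewrite [d]splitr ltrD//.
   by apply: lt_le_trans xx _; rewrite ge_min lexx.
  by apply: lt_le_trans yy _; rewrite ge_min lexx.
 have h2 : `|kappa * x' - kappa * x| <= e / 2.
  rewrite -mulrBr normrM; letr (`|kappa| * (e / 2 / (`|kappa| + 1))).
   by rewrite ler_wpM2l// (le_trans (ltW xx))// ge_min lexx orbT.
  by rewrite mulrCA ler_piMr ?(ltW e2)// ler_pdivrMr// mul1r lerDl.
 have h3 : `|normc (g (x +i* y)) - normc (g (x' +i* y'))| <= e / 2.
  apply: le_trans _ h1; rewrite ler_norml; apply/andP; split.
   rewrite lerNl opprB lerBlDr; apply: le_trans (normcD _ _).
   by rewrite subrK.
  rewrite lerBlDr normc_distC; apply: le_trans (normcD _ _).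
  by rewrite subrK.
 rewrite [e]splitr.
 have -> : G (x, y) - G (x', y') = (normc (g (x +i* y)) - normc (g (x' +i* y'))) +
  (kappa * x' - kappa * x) by rewrite /G/=; ring.
 by rewrite (le_trans (ler_normD _ _))// lerD.
have [p /[!inE]-[p1 p2] hp] := compact_EVT_max A0 Ac Gc.
exists p; first by move: p1 p2.
move=> x y hx hy; have := hp (x, y); apply; rewrite inE/=.
by [].
Qed.

(* If |g| - kappa x were maximal at an interior point s + it, comparing |g|^2n on
  the line Re = s with the product of its values on Re = s - eta and Re = s + eta
  (Goursat for g(z)^n times the conjugate of g(reflected z)^n) would contradict
  (M - kappa eta)(M + kappa eta) < M^2 for n large. *)
Lemma max_principle g (L : R) : 0 <= L -> scont g ->
 (forall z, open_strip z -> cdiff g z) ->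
 (forall y, normc (g (0 +i* y)) <= 1) -> (forall y, normc (g (1 +i* y)) <= 1) ->
 (forall x y, 0 <= x <= 1 -> L <= `|y| -> normc (g (x +i* y)) <= 1) ->
 forall x y, 0 <= x <= 1 -> normc (g (x +i* y)) <= 1.
Proof.
move=> L0 gc gd g0 g1 gL x0 y0 x001; rewrite leNgt; apply/negP => gt1.
set M0 := normc _ in gt1.
(* M0 = 1 + 3 k, and the tilt costs at most k, so the modulus M at the maximum is at least 1 + 2 k
   and M - k is still at least 1 + k. *)
pose k := (M0 - 1) / 3; have k0 : 0 < k by rewrite divr_gt0// subr_gt0.
have [[s t]/= [/andP[s0 s1] /andP[tL1 tL2]] hp] := strip_EVT k L0 gc.
set M := normc (g (s +i* t)) in hp.
have y0L : - L <= y0 <= L.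
 rewrite -ler_norml leNgt; apply/negP => /ltW h.
 by have := gL _ _ x001 h; rewrite leNgt gt1.
have MM0 : M0 - k <= M.
 have := hp _ _ x001 y0L; rewrite -/M0; case/andP: x001 => a b.
 have : k * x0 <= k by rewrite ler_piMr// ltW.
 have : 0 <= k * s by rewrite mulr_ge0// ltW.
 lra.
have Mk : 1 + k <= M - k by move: MM0; rewrite /k; lra.
have s0' : 0 < s.
 rewrite lt0r s0 andbT; apply/eqP => s00.
 by have := g0 t; rewrite -{1}s00 -/M; lra.
have s1' : s < 1.
 rewrite lt_neqAle s1 andbT; apply/eqP => s11.
 by have := g1 t; rewrite -{1}s11 -/M; lra.
have hpp x y : 0 <= x <= 1 -> normc (g (x +i* y)) <= M + k * (x - s).
 move=> x01; have [yL|Ly] := lerP `|y| L.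
  by have := hp _ y x01; rewrite -ler_norml => /(_ yL); lra.
 have := gL _ _ x01 (ltW Ly); case/andP: x01 => a b.
 have : 0 <= k * (1 + x - s) by rewrite mulr_ge0 ?(ltW k0)//; lra.
 lra.
pose eta := Num.min s (1 - s) / 2.
have eta0 : 0 < eta by rewrite divr_gt0// lt_min s0' subr_gt0.
have etas : eta < s.
 have : Num.min s (1 - s) <= s by rewrite ge_min lexx.
 rewrite /eta; move: eta0; rewrite /eta; lra.
have eta1 : s + eta < 1.
 have : Num.min s (1 - s) <= 1 - s by rewrite ge_min lexx orbT.
 rewrite /eta; move: eta0; rewrite /eta; lra.
have keta : k * eta <= k by rewrite ler_piMr ?(ltW k0)//; lra.
have keta0 : 0 < k * eta by rewrite mulr_gt0.
pose q := M - k * eta; pose Q := M + k * eta.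
have q1 : 1 <= q by rewrite /q; lra.
have Q1 : 1 <= Q by rewrite /Q; lra.
have qQ1 : 1 <= q * Q by rewrite mulr_ege1.
have qQ0 : 0 < q * Q by rewrite (lt_le_trans ltr01).
(* With this [sg], (M - sg)^2 = M^2 - (k eta)^2 / 2 + sg^2, which exceeds q Q = M^2 - (k eta)^2. *)
pose sg := (k * eta) ^+ 2 / (4 * M).
have M0' : 0 < M by lra.
have sg0 : 0 < sg by rewrite divr_gt0 ?exprn_gt0// mulr_gt0.
pose m := M - sg.
have mqQ : q * Q < m ^+ 2.
 have -> : q * Q = M ^+ 2 - (k * eta) ^+ 2 by rewrite /q /Q; ring.
 have -> : m ^+ 2 = M ^+ 2 - (k * eta) ^+ 2 / 2 + sg ^+ 2.
  by rewrite /m /sg; field; rewrite gt_eqF.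
 have : 0 < (k * eta) ^+ 2 by rewrite exprn_gt0.
 have : 0 < sg ^+ 2 by rewrite exprn_gt0.
 lra.
have m0 : 0 <= m.
 rewrite /m /sg subr_ge0 ler_pdivrMr ?mulr_gt0//.
 have : (k * eta) * (k * eta) <= M * M by rewrite ler_pM ?(ltW keta0)//; lra.
 have : 0 < M * M by rewrite mulr_gt0.
 rewrite expr2; lra.
have [d d0 hd] := gc (s +i* t) (introT andP (conj s0 s1)) sg sg0.
pose dl := Num.min (d / 2) 1.
have dl0 : 0 < dl by rewrite lt_min ltr01 divr_gt0.
have dl1 : dl <= 1 by rewrite ge_min lexx orbT.
have gm y : t - dl <= y <= t + dl -> m <= normc (g (s +i* y)).
 move=> ty; have := hd (s +i* y) (introT andP (conj s0 s1)).
 have -> : s +i* y - s +i* t = 0 +i* (y - t) by rewrite -[LHS]/((s - s) +i* (y - t)) subrr.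
 rewrite [X in X < _ -> _]/normc/= expr0n/= add0r sqrtr_sqr => hh.
 have {}hh := hh _.
 have : normc (g (s +i* y) - g (s +i* t)) <= sg.
  apply: hh; apply: (@le_lt_trans _ _ (d / 2)); last by lra.
  letr dl; last by rewrite ge_min lexx.
  by rewrite ler_distl; lra.
 rewrite /m lerBlDr normc_distC => h; apply: le_trans (normc_subl _ (g (s +i* y))) _.
 by rewrite [leLHS]addrC lerD2l.
pose T := L + 1.
have TL y : `|y| = T -> L <= `|y| by move=> ->; rewrite lerDl.
have T0 : 0 <= T by rewrite addr_ge0.
(* The contour integral of [h] over [s - eta, s] x [-T, T] vanishes. The right side contributes at
   least 2 dl m^(2n), the left side at most 2 T (q Q)^n and the horizontal sides at most 2 eta; the
   inequality is halved. *)
have key n : dl * m ^+ (2 * n) <= eta + T * (q * Q) ^+ n.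
 pose h z := g z ^+ n * ((g (reflect s z) ^+ n)^*)%R.
 have rfl x y : reflect s (x +i* y) = (s + s - x) +i* y.
  by rewrite /reflect/=; simpc.
 have hdiff : cdiff_rect h (s - eta) s (- T) T.
  move=> x y /andP[sx xs] _; apply: cdiffM.
   by apply/cdiffX/gd; rewrite /open_strip/=; lra.
  apply: (@cdiff_reflect (fun z => g z ^+ n)); apply/cdiffX/gd.
  by rewrite rfl /open_strip/=; lra.
 have := goursat _ _ hdiff.
 have se : s - eta <= s by lra.
 have TT : - T <= T by lra.
 move=> /(_ se TT); rewrite /contour => /eqP; rewrite subr_eq0 => /eqP E.
 have hb y : re (h (s +i* y)) = normc (g (s +i* y)) ^+ (2 * n).
  rewrite /h rfl addrK rmorphXn/= -exprMn -normc_mulconj -rmorphXn/=.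
  by rewrite exprM.
 have ha y : normc (h ((s - eta) +i* y)) <= (q * Q) ^+ n.
  rewrite /h rfl normcM normc_conj !normcX exprMn ler_pM ?exprn_ge0 ?normc_ge0//.
   rewrite lerXn2r ?nnegrE ?normc_ge0//; first by lra.
   by apply: le_trans (hpp _ _ _) _; [lra|rewrite /q; lra].
  rewrite lerXn2r ?nnegrE ?normc_ge0//; first by lra.
  by apply: le_trans (hpp _ _ _) _; [lra|rewrite /Q; lra].
 have hT x y : `|y| = T -> s - eta <= x <= s -> normc (h (x +i* y)) <= 1.
  move=> /TL yT xs; rewrite /h rfl normcM normc_conj !normcX.
  by rewrite mulr_ile1 ?exprn_ge0 ?normc_ge0// exprn_ile1 ?normc_ge0// gL//; lra.
 have cv : econt (- T) T (fun y => re (h (s +i* y) - h ((s - eta) +i* y))).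
  by apply: (econt_contourv hdiff); lra.
 have I1 : m ^+ (2 * n) * ((t + dl) - (t - dl)) <= intg (fun y =>
    re (h (s +i* y) - h ((s - eta) +i* y)) + (q * Q) ^+ n) (- T) T.
  apply: intg_lower; rewrite /T; try lra.
  - by apply: econtD => //; exact: econt_cst.
  - move=> y _; rewrite ReB hb.
   have := le_trans (le_trans (ler_norm _) (Re_le_normc _)) (ha y) => h1.
   by rewrite -addrA addr_ge0 ?exprn_ge0 ?normc_ge0// addrC subr_ge0.
  - move=> y ty; rewrite ReB hb.
   have := le_trans (le_trans (ler_norm _) (Re_le_normc _)) (ha y) => h1.
   rewrite -addrA -[leLHS]addr0 lerD//; last by rewrite addrC subr_ge0.
   by rewrite lerXn2r ?nnegrE ?normc_ge0// gm.
 rewrite intgD// in I1; last exact: econt_cst.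
 rewrite E intg_cst// in I1.
 have I2 : `|intg (fun x => im (h (x +i* T) - h (x +i* - T))) (s - eta) s
   - 0 * (s - (s - eta))| <= 2 * (s - (s - eta)).
  apply: intg_est => //; first by apply: (econt_contourh hdiff); lra.
  move=> x xs; rewrite subr0 (le_trans (Im_le_normc _))// (le_trans (normcB _ _))//.
  by rewrite (_ : 2 = 1 + 1)// lerD// hT// ?normrN ger0_norm.
 have I3 := le_trans (ler_norm _) I2.
 have -> : dl * m ^+ (2 * n) = m ^+ (2 * n) * ((t + dl) - (t - dl)) / 2 by field.
 by rewrite ler_pdivrMr//; apply: le_trans I1 _; lra.
have rho : 1 < m ^+ 2 / (q * Q) by rewrite ltr_pdivlMr// mul1r.
have [n hn] := bernoulli_unbounded ((eta + T) / dl) rho.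
have := key n; rewrite leNgt => /negP; apply.
rewrite ltr_pdivrMr// mulrC in hn.
rewrite expr_div_n mulrA ltr_pdivlMr ?exprn_gt0// in hn.
rewrite -exprM in hn; apply: le_lt_trans hn.
by rewrite [leRHS]mulrDl lerD2r ler_peMr ?(ltW eta0)// exprn_ege1.
Qed.

Definition cexp z : C := (expR (re z))%:C * (cos (im z) +i* sin (im z)).

Lemma cexp0 : cexp 0 = 1.
Proof. by rewrite /cexp/= expR0 cos0 sin0 mul1r. Qed.

Lemma cexpD z w : cexp (z + w) = cexp z * cexp w.
Proof.
rewrite /cexp ReD ImD expRD cosD sinD rmorphM/= mulrACA; congr (_ * _).
by case: z => a b; case: w => c d; simpc; rewrite [X in _ +i* X]addrC.
Qed.

Lemma normc_cexp z : normc (cexp z) = expR (re z).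
Proof.
rewrite /cexp normcM normc_real ger0_norm ?expR_ge0//.
by rewrite /normc cos2Dsin2 sqrtr1 mulr1.
Qed.

Lemma cexp_real (x : R) : cexp x%:C = (expR x)%:C.
Proof. by rewrite /cexp/= cos0 sin0 mulr1. Qed.

Lemma cexp_conj z : ((cexp z)^*)%R = cexp (z^*)%R.
Proof.
rewrite /cexp rmorphM/=; case: z => a b.
have -> : ((expR a)%:C^*)%R = (expR a)%:C :> C by exact: conjc_real.
by congr (_ * _); rewrite [im _]/= cosN sinN.
Qed.

Lemma deriv_eps (phi : R -> R) (d : R) : is_derive (0 : R) 1 phi d -> forall e : R, 0 < e ->
 exists2 dl : R, 0 < dl & forall a, `|a| < dl -> `|phi a - phi 0 - d * a| <= e * `|a|.
Proof.
move=> [dphi dE] e e0.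
have : h^-1 *: ((phi \o shift 0) (h *: 1) - phi 0) @[h --> 0^'] --> d.
 by rewrite -dE; exact: dphi.
move=> /cvgrPdist_le /(_ e e0); rewrite near_withinE => /nbhs_ballP[dl /= dl0 hdl].
exists dl => // a ad; have [->|a0] := eqVneq a 0.
 by rewrite subrr mulr0 subr0 normr0 mulr0.
have := hdl a; rewrite /ball/= sub0r normrN => /(_ ad a0).
rewrite /= addr0 /GRing.scale/= mulr1 => h.
have -> : phi a - phi 0 - d * a = - ((d - a^-1 * (phi a - phi 0)) * a) by field.
by rewrite normrN normrM ler_wpM2r.
Qed.

Lemma cexp_small (e : R) : 0 < e -> exists2 d : R, 0 < d &
 forall k, normc k < d -> normc (cexp k - 1 - k) <= e * normc k.
Proof.
(* The remainders of the real expansions add up to 5 e1 |k| and the cross term to 2 |k|^2; e1 <= e /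
   10 and |k| < e / 4 bring the total to e |k|. *)
move=> e0; pose e1 := Num.min 1 (e / 10).
have e10 : 0 < e1 by rewrite lt_min ltr01 divr_gt0.
have e11 : e1 <= 1 by rewrite ge_min lexx.
have e1e : e1 <= e / 10 by rewrite ge_min lexx orbT.
have [d1 d10 h1] := @deriv_eps expR (expR 0) (is_derive_expR 0) e1 e10.
have [d2 d20 h2] := @deriv_eps cos (- sin 0) (is_derive_cos 0) e1 e10.
have [d3 d30 h3] := @deriv_eps sin (cos 0) (is_derive_sin 0) e1 e10.
exists (Num.min (Num.min d1 (Num.min d2 d3)) (Num.min (1 / 2) (e / 4))).
 by rewrite !lt_min d10 d20 d30 !divr_gt0.
move=> k; rewrite !lt_min => /andP[/andP[k1 /andP[k2 k3]] /andP[k4 k5]].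
have := Re_le_normc k; have := Im_le_normc k.
set N := normc k in k1 k2 k3 k4 k5 *; have N0 : 0 <= N by exact: normc_ge0.
set a := re k; set b := im k => bN aN.
have {}h1 := h1 a (le_lt_trans aN k1); have {}h2 := h2 b (le_lt_trans bN k2).
have {}h3 := h3 b (le_lt_trans bN k3).
rewrite expR0 mul1r in h1; rewrite sin0 oppr0 mul0r subr0 cos0 in h2.
rewrite sin0 subr0 cos0 mul1r in h3.
have a0 := normr_ge0 a; have b0 := normr_ge0 b.
have ea : `|expR a - 1| <= 2 * `|a|.
 rewrite -[X in `|X|](subrK a) (le_trans (ler_normD _ _))//.
 letr (1 * `|a| + `|a|); last by lra.
 by rewrite lerD2r (le_trans h1)// ler_wpM2r.
have ea2 : expR a <= 2.
 have : expR a - 1 <= 2 * `|a| by exact: le_trans (ler_norm _) ea.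
 lra.
have ep := expR_ge0 a.
apply: le_trans (normc_ReIm _) _.
have -> : re (cexp k - 1 - k) = (expR a - 1 - a) + expR a * (cos b - 1).
 rewrite /cexp -/a -/b !ReB/= !mul0r subr0; ring.
have -> : im (cexp k - 1 - k) = expR a * (sin b - b) + (expR a - 1) * b.
 rewrite /cexp -/a -/b !ImB/= !mul0r addr0; ring.
letr (e1 * N + 2 * (e1 * N) + (2 * (e1 * N) + (2 * N) * N)).
 have E1 : e1 * `|a| <= e1 * N by rewrite ler_wpM2l// ltW.
 have E2 : e1 * `|b| <= e1 * N by rewrite ler_wpM2l// ltW.
 rewrite lerD// (le_trans (ler_normD _ _))// lerD ?(le_trans h1)//.
 - by rewrite normrM (ger0_norm ep) ler_pM// (le_trans h2).
 - by rewrite normrM (ger0_norm ep) ler_pM// (le_trans h3).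
 - by rewrite normrM ler_pM// (le_trans ea)// ler_wpM2l.
have -> : e1 * N + 2 * (e1 * N) + (2 * (e1 * N) + 2 * N * N) = (5 * e1 + 2 * N) * N by ring.
by rewrite ler_wpM2r//; lra.
Qed.

Lemma cdiff_cexp z : cdiff cexp z.
Proof.
exists (cexp z) => e e0.
have n0 : 0 < normc (cexp z) by rewrite normc_cexp expR_gt0.
have [d d0 hd] := cexp_small (divr_gt0 e0 n0).
exists d => // k kd.
rewrite cexpD [X in normc X](_ : _ = cexp z * (cexp k - 1 - k)); last by ring.
rewrite normcM (le_trans (ler_wpM2l _ (hd k kd))) ?normc_ge0//.
by rewrite mulrA mulrCA divff ?gt_eqF// mulr1.
Qed.

Lemma cdiff_comp f g z : cdiff g z -> cdiff f (g z) -> cdiff (f \o g) z.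
Proof.
move=> [D hD] [E hE]; exists (D * E) => e e0.
pose e1 := Num.min 1 (e / (2 * (1 + normc D + normc E))).
have S0 : 0 < 1 + normc D + normc E by pos.
have e10 : 0 < e1 by rewrite lt_min ltr01 divr_gt0// mulr_gt0.
have e11 : e1 <= 1 by rewrite ge_min lexx.
have [d d0 hd] := hD _ e10; have [d' d'0 hd'] := hE _ e10.
have [d2 d20 hd2] := cdiff_cont (ex_intro _ D hD) (divr_gt0 d'0 (ltr0Sn R 1)).
exists (Num.min d d2); first by rewrite lt_min d0.
move=> k; rewrite lt_min => /andP[/hd k1 /hd2 k2].
set q := g (z + k) - g z in k1 k2.
have qd : normc q < d' by lra.
have := hd' q qd; rewrite (addrC (g z)) subrK => h3.
rewrite /= [X in normc X](_ : _ = (f (g (z + k)) - f (g z) - q * E) + (q - k * D) * E); last by ring.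
have qk : normc q <= (1 + normc D) * normc k.
 rewrite -[X in normc X](subrK (k * D)) (le_trans (normcD _ _))// mulrDl lerD//.
  by rewrite (le_trans k1)// ler_wpM2r.
 by rewrite normcM mulrC.
apply: le_trans (normcD _ _) _; rewrite normcM.
letr (e1 * (1 + normc D + normc E) * normc k).
 rewrite mulrDr mulrDl lerD//.
  by rewrite (le_trans h3)// -mulrA ler_wpM2l//.
 by rewrite mulrAC ler_wpM2r.
rewrite ler_wpM2r ?normc_ge0//.
letr (e / (2 * (1 + normc D + normc E)) * (1 + normc D + normc E)).
 by rewrite ler_wpM2r ?(ltW S0)// ge_min lexx orbT.
rewrite invfM mulrA mulfVK; lra.
Qed.

(** The scalar class to which three lines applies. Matrix families are required to be [good] entry
    by entry. *)
Definition good f := [/\ scont f, (exists B, forall z, strip z -> normc (f z) <= B) &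
 forall z, open_strip z -> cdiff f z].

Lemma good_entire f B : (forall z, cdiff f z) -> (forall z, strip z -> normc (f z) <= B) ->
 good f.
Proof.
move=> hd hB; split; [|by exists B|by move=> z _].
move=> z _ e e0; have [d d0 h] := cdiff_cont (hd z) e0; exists d => // w _ wd.
by have := h (w - z) wd; rewrite (addrC z) subrK.
Qed.

Lemma good_cst (c : C) : good (fun=> c).
Proof. by apply: (@good_entire _ (normc c)) => // z; exact: cdiff_cst. Qed.

Lemma goodD f g : good f -> good g -> good (fun z => f z + g z).
Proof.
move=> [fc [B hB] fd] [gc [B' hB'] gd]; split.
- move=> z sz e e0; have e2 : 0 < e / 2 by pos.
 have [d d0 h] := fc z sz _ e2; have [d' d'0 h'] := gc z sz _ e2.
 exists (Num.min d d'); first by rewrite lt_min d0.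
 move=> w sw; rewrite lt_min => /andP[/(h _ sw) h1 /(h' _ sw) h2].
 by rewrite opprD addrACA (le_trans (normcD _ _))// [e]splitr lerD.
- exists (B + B') => z sz; by rewrite (le_trans (normcD _ _))// lerD ?hB ?hB'.
- by move=> z sz; apply: cdiffD; [exact: fd|exact: gd].
Qed.

Lemma goodM f g : good f -> good g -> good (fun z => f z * g z).
Proof.
move=> [fc [B hB] fd] [gc [B' hB'] gd]; split.
- move=> z sz e e0; pose S := `|B| + `|B'| + 1.
 have S0 : 0 < S by rewrite ltr_wpDl.
 have e2 : 0 < e / S by pos.
 have [d d0 h] := fc z sz _ e2; have [d' d'0 h'] := gc z sz _ e2.
 exists (Num.min d d'); first by rewrite lt_min d0.
 move=> w sw; rewrite lt_min => /andP[/(h _ sw) h1 /(h' _ sw) h2].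
 rewrite [X in normc X](_ : _ = f w * (g w - g z) + (f w - f z) * g z); last by ring.
 rewrite (le_trans (normcD _ _))// !normcM.
 letr (`|B| * (e / S) + e / S * `|B'|).
  rewrite lerD// ler_pM ?normc_ge0//; last by rewrite (le_trans (hB' _ sz)) ?ler_norm.
  by rewrite (le_trans (hB _ sw)) ?ler_norm.
 by rewrite mulrC -mulrDr -mulrA ler_piMr ?(ltW e0)// mulrC ler_pdivrMr// mul1r lerDl.
- by exists (B * B') => z sz; rewrite normcM ler_pM ?hB ?hB'.
- by move=> z sz; apply: cdiffM; [exact: fd|exact: gd].
Qed.

Lemma good_sum (T : Type) (r : seq T) (P : pred T) (F : T -> C -> C) :
 (forall t, P t -> good (F t)) -> good (fun z => \sum_(t <- r | P t) F t z).
Proof.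
move=> h; elim: r => [|t r ih].
 by rewrite (_ : (fun z => _) = fun=> 0); [exact: good_cst|ext z; rewrite big_nil].
rewrite (_ : (fun z => _) = fun z => (if P t then F t z else 0) + \sum_(t <- r | P t) F t z).
 apply: goodD => //; case: (boolP (P t)) => [/h//|_]; exact: good_cst.
by ext z; rewrite big_cons; case: ifP; rewrite ?add0r.
Qed.

Lemma good_onem f : good f -> good (fun z => f (1 - z)).
Proof.
move=> [fc [B hB] fd].
have so z : strip z -> strip (1 - z).
 by rewrite /strip/= ReB/= => /andP[a b]; rewrite subr_ge0 b gerBl.
split.
- move=> z sz e e0; have [d d0 h] := fc _ (so _ sz) _ e0; exists d => // w sw wd.
 apply: h; first exact: so.
 by rewrite [X in normc X](_ : _ = - (w - z)) ?normcNE//; ring.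
- by exists B => z /so/hB.
- move=> z sz; apply/cdiff_onem/fd; move: sz; rewrite /open_strip/= ReB/= => /andP[a b].
 by lra.
Qed.

Lemma good_cexp (c : R) (d : C) : good (fun z => cexp (c%:C * z + d)).
Proof.
apply: (@good_entire _ (expR (`|c| + re d))).
 move=> z; apply: (@cdiff_comp cexp); last exact: cdiff_cexp.
 by apply: cdiffD; [apply: cdiffM; [exact: cdiff_cst|exact: cdiff_id]|exact: cdiff_cst].
move=> z /andP[z0 z1]; rewrite normc_cexp ler_expR ReD lerD2r.
case: z z0 z1 => x y /= x0 x1; rewrite mul0r subr0.
by rewrite (le_trans (ler_norm _))// normrM (ger0_norm x0) ler_piMr.
Qed.

(** The Gaussian exp (e (z^2 - 1)) has modulus at most 1 on the strip and decays along it, which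
    supplies the bound far out that [max_principle] asks for; then e tends to 0. *)
Lemma three_lines f (x : R) : good f ->
 (forall y, normc (f (0 +i* y)) <= 1) -> (forall y, normc (f (1 +i* y)) <= 1) ->
 0 <= x <= 1 -> normc (f x%:C) <= 1.
Proof.
move=> [fc [B hB] fd] f0 f1 x01.
have gauss (e : R) : 0 < e -> normc (f x%:C) * expR (e * (x ^+ 2 - 1)) <= 1.
 move=> e0; pose G z := cexp (e%:C * (z * z - 1)).
 have GE u v : normc (G (u +i* v)) = expR (e * (u ^+ 2 - v ^+ 2 - 1)).
  by rewrite normc_cexp; congr expR; rewrite /=; ring.
 have Gle u v : 0 <= u <= 1 -> normc (G (u +i* v)) <= 1.
  move=> /andP[u0 u1]; rewrite GE -[leRHS]expR0 ler_expR pmulr_rle0//.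
  have : u ^+ 2 <= 1 by rewrite exprn_ile1.
  have := sqr_ge0 v; lra.
 have Gg : good G.
  apply: (@good_entire _ 1).
   move=> z; apply: (@cdiff_comp cexp); last exact: cdiff_cexp.
   apply: cdiffM; first exact: cdiff_cst.
   by apply: cdiffD; [apply: cdiffM; exact: cdiff_id|exact: cdiff_cst].
  by move=> [u v]; exact: Gle.
 (* For |v| >= L >= 1 one has exp (e v^2) >= 1 + e v^2 >= 1 + e L, which exceeds |B|. *)
 pose L := `|B| / e + 1.
 have L1 : 1 <= L by rewrite lerDr divr_ge0// ltW.
 have -> : normc (f x%:C) * expR (e * (x ^+ 2 - 1)) = normc (f x%:C * G x%:C).
  by rewrite normcM GE expr0n subr0.
 have [gc _ gd] := goodM (And3 fc (ex_intro _ B hB) fd) Gg.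
 apply: (@max_principle (fun z => f z * G z) L) => //.
 - exact: le_trans L1.
 - by move=> y; rewrite normcM mulr_ile1 ?normc_ge0// Gle// lexx ler01.
 - by move=> y; rewrite normcM mulr_ile1 ?normc_ge0// Gle// lexx ler01.
 - move=> u v u01 Lv; rewrite normcM GE.
  letr (`|B| * expR (- (e * v ^+ 2))).
   rewrite ler_pM ?normc_ge0 ?expR_ge0//.
    by rewrite (le_trans (hB _ _)) ?ler_norm.
   rewrite ler_expR -[leRHS]mulrN ler_pM2l//.
   have : u ^+ 2 <= 1 by case/andP: u01 => *; rewrite exprn_ile1.
   lra.
  rewrite expRN ler_pdivrMr ?expR_gt0// mul1r.
  letr (1 + e * v ^+ 2); last exact: expR_ge1Dx.
  have vL : L <= v ^+ 2.
   rewrite -real_normK ?num_real// expr2 (le_trans Lv)// ler_peMl//.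
   exact: le_trans L1 Lv.
  have : e * L <= e * v ^+ 2 by rewrite ler_pM2l.
  by rewrite /L mulrDr mulrCA divff ?gt_eqF//; lra.
rewrite leNgt; apply/negP => f1x.
set N := normc _ in gauss f1x.
have N0 : 0 < N by lra.
(* For this e the Gaussian factor at x is at least 1 - e, and N (1 - e) = (N + 1) / 2 is still above
   1. *)
have := gauss ((N - 1) / N / 2) _; rewrite !divr_gt0 ?subr_gt0// => /(_ isT).
apply/negP; rewrite -ltNge.
set e := _ / 2; have e0 : 0 < e by rewrite !divr_gt0 ?subr_gt0.
apply: (@lt_le_trans _ _ (N * (1 - e))).
 have -> : N * (1 - e) = (N + 1) / 2 by rewrite /e; field; rewrite gt_eqF.
 lra.
rewrite ler_pM2l//; apply: le_trans (expR_ge1Dx _); rewrite lerD2l mulrBr mulr1 lerBrDr addrC subrr.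
by rewrite mulr_ge0 ?(ltW e0)// sqr_ge0.
Qed.

End ThreeLines.

Section Finite.
Implicit Types A B D G K P Q S T : finType.

(** * Spectral theorem, complex powers and singular values of kernels *)

Section KernelAlgebra.

Definition kid T : T -> T -> C := fun s t => (s == t)%:R.

Definition kadj S T (K : S -> T -> C) : T -> S -> C :=
 fun t s => ((K s t)^*)%R.

Lemma kcompA S T (U V : finType) (K : S -> T -> C) (L : T -> U -> C) (M : U -> V -> C) :
 kcomp K (kcomp L M) = kcomp (kcomp K L) M.
Proof.
ext s v; rewrite /kcomp.
under eq_bigr do rewrite mulr_sumr.
rewrite exchange_big/=; eqs u.
by sums t; rewrite mulrA.
Qed.

Lemma kcomp1l S T (K : S -> T -> C) : kcomp (@kid S) K = K.
Proof. by ext s t; rewrite /kcomp sum_deltal. Qed.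

Lemma kcomp1r S T (K : S -> T -> C) : kcomp K (@kid T) = K.
Proof.
ext s t; rewrite /kcomp.
by under eq_bigr do rewrite mulrC; rewrite sum_deltar.
Qed.

Lemma opsq_comp1 S T (U : finType) (K : S -> T -> C) (L : T -> U -> C) :
 opsq K 1 -> opsq L 1 -> opsq (kcomp K L) 1.
Proof. by move=> hK hL; have := opsq_comp ler01 hK hL; rewrite mulr1. Qed.

Lemma kadjK S T (K : S -> T -> C) : kadj (kadj K) = K.
Proof. by ext s t; rewrite /kadj conjCK. Qed.

Lemma kadj_comp S T (U : finType) (K : S -> T -> C) (L : T -> U -> C) :
 kadj (kcomp K L) = kcomp (kadj L) (kadj K).
Proof.
ext u s; rewrite /kadj /kcomp rmorph_sum.
by eqs t; rewrite rmorphM mulrC.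
Qed.

Lemma natr_conj (b : bool) : ((b%:R : C)^*)%R = b%:R.
Proof. by case: b; rewrite ?conjC1 ?conjC0. Qed.

Lemma kadj_id T : kadj (@kid T) = @kid T.
Proof. by ext s t; rewrite /kadj natr_conj eq_sym. Qed.

Lemma opsq_coisometry S T (K : S -> T -> C) :
 kcomp (kadj K) K = @kid T -> opsq K 1.
Proof.
move=> h; apply: (@opsq_isometry _ _ _ xpredT) => t u.
by have := congr1 (fun f => f t u) h.
Qed.

Definition ktrace T (K : T -> T -> C) : C := \sum_t K t t.

Lemma ktraceC S T (K : S -> T -> C) (L : T -> S -> C) :
 ktrace (kcomp K L) = ktrace (kcomp L K).
Proof.
rewrite /ktrace exchange_big; eqs t.
by eqs s; rewrite mulrC.
Qed.

Definition hs2 S T (K : S -> T -> C) : R := \sum_s \sum_t normc (K s t) ^+ 2.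

Lemma hs2_trace S T (K : S -> T -> C) :
 (hs2 K)%:C = ktrace (kcomp K (kadj K)).
Proof.
rewrite real_complex_sum; eqs s.
by rewrite real_complex_sum; eqs t; rewrite normc_mulconj.
Qed.

Lemma hs2_n2 S T (K : S -> T -> C) : hs2 K = n2 (fun p : S * T => K p.1 p.2).
Proof. by rewrite /n2 sum_pair. Qed.

Lemma hs2_ge0 S T (K : S -> T -> C) : 0 <= hs2 K.
Proof. by rewrite hs2_n2. Qed.

Definition qform T (K : T -> T -> C) (w : T -> C) : C :=
 \sum_s \sum_t w s * K s t * ((w t)^*)%R.

Definition posdef T (K : T -> T -> C) : Prop :=
 kadj K = K /\ exists2 d : R, 0 < d & forall w, (d * n2 w)%:C <= qform K w.

Definition psd T (K : T -> T -> C) : Prop :=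
 kadj K = K /\ forall w, 0 <= qform K w.

Record unitary_diag T (K : T -> T -> C) (U : T -> T -> C) (d : T -> R) : Prop :=
 UnitaryDiag {
  ud_isom : kcomp (kadj U) U = @kid T;
  ud_coisom : kcomp U (kadj U) = @kid T;
  ud_eq : forall s t, K s t = \sum_r ((U r s)^*)%R * (d r)%:C * U r t }.

(** The spectral theorem for hermitian matrices, carried to an arbitrary finite type by
    [enum_rank]. *)
Lemma spectral_kernel T (K : T -> T -> C) : kadj K = K ->
 exists U d, unitary_diag K U d.
Proof.
move=> Kh; pose n := #|T|.
pose M : 'M[C]_n := \matrix_(i, j) K (enum_val i) (enum_val j).
have Mh : M \is hermsymmx.
 apply/is_hermitianmxP; apply/matrixP => i j; rewrite !mxE mul1r.
 by rewrite -[in LHS]Kh.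
have /orthomx_spectralP Mspec : M \is normalmx by exact: hermitian_normalmx.
have dreal := hermitian_spectral_diag_real Mh.
have Pu := spectral_unitarymx M.
set P := spectralmx M in Mspec Pu; set D := spectral_diag M in Mspec dreal.
have dE i : D 0 i = (re (D 0 i))%:C.
 by rewrite RRe_real//; move/mxOverP: dreal.
exists (fun s t => P (enum_rank s) (enum_rank t)),
 (fun t => re (D 0 (enum_rank t))).
have PP : P *m map_mx Num.conj P^T = 1%:M by apply/unitarymxP.
have PP' : map_mx Num.conj P^T *m P = 1%:M by rewrite -(invmx_unitary Pu) mulVmx// unitarymx_unit.
have reind (F : 'I_n -> C) : \sum_(t : T) F (enum_rank t) = \sum_i F i.
 rewrite [RHS](reindex (@enum_rank T))//=.
 by exists enum_val => x _; rewrite ?enum_rankK ?enum_valK.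
split.
- ext s t; rewrite /kcomp.
 rewrite (reind (fun r => (P r (enum_rank s))^* * P r (enum_rank t)))%R.
 have := congr1 (fun M : 'M[R[i]]_n => M (enum_rank s) (enum_rank t)) PP'; rewrite !mxE /kid.
 rewrite (inj_eq enum_rank_inj) => <-; eqs r; by rewrite !mxE.
- ext s t; rewrite /kcomp.
 rewrite (reind (fun r => P (enum_rank s) r * (P (enum_rank t) r)^*))%R.
 have := congr1 (fun M : 'M[R[i]]_n => M (enum_rank s) (enum_rank t)) PP; rewrite !mxE /kid.
 rewrite (inj_eq enum_rank_inj) => <-; eqs r; by rewrite !mxE.
- move=> s t.
 rewrite (reind (fun r => ((P r (enum_rank s))^*)%R * (re (D 0 r))%:C * P r (enum_rank t))).
 have := congr1 (fun M : 'M[R[i]]_n => M (enum_rank s) (enum_rank t)) Mspec.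
 rewrite [LHS]mxE !enum_rankK => ->.
 rewrite invmx_unitary// mxE; eqs r; rewrite -dE.
 rewrite mxE (bigD1 r)//= !mxE eqxx big1 ?addr0//.
 by move=> r' r'r; rewrite !mxE (negbTE r'r) mulr0.
Qed.

Lemma ud_eigen T (K U : T -> T -> C) d : unitary_diag K U d ->
 forall r, qform K (U r) = (d r)%:C.
Proof.
move=> [Uis Uco KE] r; rewrite /qform.
under eq_bigr => s _ do under eq_bigr => t _ do rewrite KE.
transitivity (\sum_q (\sum_s U r s * ((U q s)^*)%R) * (d q)%:C *
  (\sum_t U q t * ((U r t)^*)%R)).
 under [RHS]eq_bigr => q _ do rewrite mulr_suml mulr_suml.
 rewrite [RHS]exchange_big/=; eqs s.
 under [RHS]eq_bigr => q _ do rewrite mulr_sumr.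
 rewrite [RHS]exchange_big/=; eqs t.
 sums q; ring.
have E q q' : \sum_s U q s * ((U q' s)^*)%R = (q == q')%:R.
 by have := congr1 (fun f => f q q') Uco.
under eq_bigr => q _ do rewrite !E -mulrA.
by rewrite sum_deltal eqxx mulr1.
Qed.

Lemma n2_unitary_row T (U : T -> T -> C) r :
 kcomp U (kadj U) = @kid T -> n2 (U r) = 1.
Proof.
move=> h; apply: (@complexI R); rewrite n2_mulconj.
by have := congr1 (fun f => f r r) h; rewrite /kid eqxx.
Qed.

Lemma ud_pos T (K U : T -> T -> C) d : posdef K -> unitary_diag K U d ->
 forall r, 0 < d r.
Proof.
move=> [_ [c c0 hc]] ud r; have := hc (U r).
rewrite (ud_eigen ud) lerc_real n2_unitary_row ?mulr1; last by case: ud.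
exact: lt_le_trans.
Qed.

Lemma ud_ge0 T (K U : T -> T -> C) d : psd K -> unitary_diag K U d ->
 forall r, 0 <= d r.
Proof. by move=> [_ hc] ud r; have := hc (U r); rewrite (ud_eigen ud) ler0c. Qed.

(** The rules of z |-> K^z, all that is used of complex powers. [pw_good] admits affine arguments
    because half powers and shifted powers enter the interpolation families. *)
Record powers T (K : T -> T -> C) (W : C -> T -> T -> C) : Prop := Powers {
 pw0 : W 0 = @kid T;
 pw1 : W 1 = K;
 pwD : forall z w, W (z + w) = kcomp (W z) (W w);
 pwJ : forall z, kadj (W z) = W ((z^*)%R);
 pw_good : forall (c : R) (d : C) s t, good (fun z => W (c%:C * z + d) s t) }.

(** K = U^* diag(d) U with d > 0, and K^z = U^* diag(exp (z ln d)) U. *)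
Lemma posdef_powers T (K : T -> T -> C) : posdef K -> exists W, powers K W.
Proof.
move=> Kp; have [U [d ud]] := spectral_kernel Kp.1.
have d0 := ud_pos Kp ud; case: ud => Uis Uco KE.
have Uis' s t : \sum_r ((U r s)^*)%R * U r t = (s == t)%:R.
 by have := congr1 (fun f => f s t) Uis.
have Uco' s t : \sum_r U s r * ((U t r)^*)%R = (s == t)%:R.
 by have := congr1 (fun f => f s t) Uco.
exists (fun z s t => \sum_r ((U r s)^*)%R * cexp ((ln (d r))%:C * z) * U r t); split.
- ext s t; rewrite /kid -Uis'.
 by eqs r; rewrite mulr0 cexp0 mulr1.
- ext s t; rewrite KE.
 by eqs r; rewrite mulr1 cexp_real lnK ?posrE.
- move=> z w; ext s t.
 under [RHS]eq_bigr => u _ do rewrite mulr_suml.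
 rewrite [RHS]exchange_big/=; eqs r.
 rewrite -[LHS]mulr1; transitivity (\sum_q (r == q)%:R * (((U r s)^*)%R *
   (cexp ((ln (d r))%:C * z) * cexp ((ln (d q))%:C * w)) * U q t)).
  by rewrite sum_deltal mulrDr cexpD mulr1.
 under [RHS]eq_bigr => u _ do rewrite mulr_sumr.
 rewrite [RHS]exchange_big/=; eqs q.
 rewrite -Uco'; sums u; ring.
- move=> z; ext s t; rewrite /kadj rmorph_sum.
 apply: eq_bigr => r _ /=; rewrite 2!rmorphM/= conjCK cexp_conj rmorphM/=.
 have -> : (((ln (d r))%:C)^*)%R = (ln (d r))%:C :> C by exact: conjc_real.
 by rewrite mulrC mulrA [RHS]mulrAC.
- move=> c e s t; apply: good_sum => r _; apply: goodM; last exact: good_cst.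
 apply: goodM; first exact: good_cst.
 rewrite (_ : (fun z => _) = fun z => cexp ((ln (d r) * c)%:C * z + (ln (d r))%:C * e)).
  exact: good_cexp.
 by ext z; rewrite mulrDr mulrA rmorphM.
Qed.

(** The adjoint of K^(iy) is K^(-iy), its inverse. *)
Lemma pw_unitary T (K : T -> T -> C) W y : powers K W -> opsq (W (0 +i* y)) 1.
Proof.
move=> PW; apply: opsq_coisometry; rewrite (pwJ PW) -(pwD PW) -(pw0 PW); congr W.
by rewrite -[LHS]/((0 + 0) +i* (- y + y)) addr0 addNr.
Qed.

Lemma hs2_pw T (K : T -> T -> C) W z : powers K W ->
 (hs2 (W z))%:C = ktrace (W (z + (z^*)%R)).
Proof. by move=> PW; rewrite hs2_trace (pwJ PW) (pwD PW). Qed.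

Lemma powers_tr T (K : T -> T -> C) W : powers K W ->
 powers (fun s t => K t s) (fun z s t => W z t s).
Proof.
move=> PW; split.
- by rewrite (pw0 PW); ext s t; rewrite /kid eq_sym.
- by rewrite (pw1 PW).
- move=> z w; ext s t.
 rewrite addrC (pwD PW); eqs r; exact: mulrC.
- move=> z; ext s t.
 by have := congr1 (fun f => f t s) (pwJ PW z).
- by move=> c d s t; exact: pw_good PW _ _ _ _.
Qed.

(** W diagonalizes X^* X, and sg consists of the square roots of the eigenvalues. V is only a
    partial isometry: its columns at zero singular values vanish. *)
Lemma svd T (X : T -> T -> C) : exists (V W : T -> T -> C) (sg : T -> R),
 [/\ forall t, 0 <= sg t, kcomp (kadj W) W = @kid T, kcomp W (kadj W) = @kid T,
  forall t u, \sum_s ((V s t)^*)%R * V s u = ((0 < sg t) && (t == u))%:R &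
  forall s t, X s t = \sum_r V s r * (sg r)%:C * W r t].
Proof.
pose K := kcomp (kadj X) X.
have qK w : qform K w = (n2 (fun u => \sum_t X u t * ((w t)^*)%R))%:C.
 rewrite /qform n2_mulconj.
 under eq_bigr => s _ do under eq_bigr => t _ do rewrite mulr_sumr mulr_suml.
 under eq_bigr => s _ do rewrite exchange_big/=.
 rewrite exchange_big/=; apply: eq_bigr => u _.
 rewrite rmorph_sum/= mulr_suml exchange_big/=; apply: eq_bigr => t _.
 rewrite mulr_sumr; apply: eq_bigr => s _.
 by rewrite rmorphM/= conjCK; ring.
have Kp : psd K.
 split; first by rewrite kadj_comp kadjK.
 by move=> w; rewrite qK ler0c.
have [U [d ud]] := spectral_kernel Kp.1.
have d0 := ud_ge0 Kp ud; case: ud => Uis Uco KE.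
have Uis' s t : \sum_r ((U r s)^*)%R * U r t = (s == t)%:R.
 by have := congr1 (fun f => f s t) Uis.
have Uco' s t : \sum_r U s r * ((U t r)^*)%R = (s == t)%:R.
 by have := congr1 (fun f => f s t) Uco.
pose Y s r := \sum_t X s t * ((U r t)^*)%R.
have YY r q : \sum_s ((Y s r)^*)%R * Y s q = (r == q)%:R * (d r)%:C.
 transitivity (\sum_t \sum_t' U r t * K t t' * ((U q t')^*)%R).
  under [RHS]eq_bigr => t _ do under eq_bigr => t' _ do rewrite mulr_sumr mulr_suml.
  under [RHS]eq_bigr => s _ do rewrite exchange_big/=.
  rewrite [RHS]exchange_big/=; apply: eq_bigr => u _.
  rewrite rmorph_sum/= mulr_suml; apply: eq_bigr => t _.
  rewrite mulr_sumr; apply: eq_bigr => s _.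
  by rewrite rmorphM/= conjCK; ring.
 under eq_bigr => s _ do under eq_bigr => t _ do rewrite KE.
 transitivity (\sum_p (\sum_s U r s * ((U p s)^*)%R) * (d p)%:C *
   (\sum_t U p t * ((U q t)^*)%R)).
  under [RHS]eq_bigr => p _ do rewrite mulr_suml mulr_suml.
  rewrite [RHS]exchange_big/=; apply: eq_bigr => s _.
  under [RHS]eq_bigr => p _ do rewrite mulr_sumr.
  rewrite [RHS]exchange_big/=; apply: eq_bigr => t _.
  rewrite mulr_sumr mulr_suml; apply: eq_bigr => p _; ring.
 under eq_bigr => p _ do rewrite !Uco' -mulrA.
 by rewrite sum_deltal mulrC.
(* The inverse of 0 is 0, so the columns at zero eigenvalues are indeed zero. *)
exists (fun s r => ((Num.sqrt (d r))^-1)%:C * Y s r), U, (fun r => Num.sqrt (d r)); split => //.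
- move=> r q.
 transitivity ((((Num.sqrt (d r))^-1)%:C * ((Num.sqrt (d q))^-1)%:C) *
   (\sum_s ((Y s r)^*)%R * Y s q)).
  rewrite mulr_sumr; apply: eq_bigr => s _; rewrite rmorphM/=.
  have -> : ((((Num.sqrt (d r))^-1)%:C)^*)%R = ((Num.sqrt (d r))^-1)%:C :> C by exact: conjc_real.
  ring.
 rewrite YY sqrtr_gt0; have [<-|_] := eqVneq r q; last by rewrite mul0r mulr0 andbF.
 rewrite mul1r -!rmorphM/= -invfM -expr2 sqr_sqrtr//.
 have := d0 r; rewrite le_eqVlt => /orP[/eqP<-|dr].
  by rewrite ltxx mulr0.
 by rewrite dr mulVf ?gt_eqF.
- move=> s t.
 transitivity (\sum_r Y s r * U r t).
  under eq_bigr do rewrite mulr_suml.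
  rewrite exchange_big/=.
  under eq_bigr => u _ do (under eq_bigr => r _ do rewrite -mulrA; rewrite -mulr_sumr Uis' mulrC).
  by rewrite sum_deltar.
 apply: eq_bigr => r _; congr (_ * _).
 (* At a zero eigenvalue the column of Y has norm zero, so X loses nothing there. *)
 have := d0 r; rewrite le_eqVlt => /orP[/eqP dr|dr].
  rewrite -dr sqrtr0 mulr0; have := YY r r; rewrite -dr mulr0.
  under eq_bigr do rewrite mulrC.
  rewrite -n2_mulconj => -[/n2_eq0 h]; exact: h.
 rewrite mulrAC -rmorphM/= mulVf ?mul1r//.
 by pos.
Qed.

End KernelAlgebra.

(** * Matrices over the trace class in finite dimension *)

Section TraceClassBall.

Definition kext A A' S (L : A -> A' -> C) : A * S -> A' * S -> C :=
 fun p q => (p.2 == q.2)%:R * L p.1 q.1.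

(** (L (x) 1) X (L' (x) 1): scalar coefficients on both sides of an operator-valued matrix. *)
Definition sand A B S (L : A -> B -> C) (X : B * S -> B * S -> C) (L' : B -> A -> C) :
 A * S -> A * S -> C := kcomp (@kext _ _ S L) (kcomp X (@kext _ _ S L')).

Definition kpair S T (X Y : S -> T -> C) : C := \sum_s \sum_t X s t * Y s t.

(* The pairing of the matrix x = [x_aa'] of operators on l2^S with b = [b_pp'],
  through the bilinear trace pairing of the entries. *)
Definition spair A B S (x : A * S -> A * S -> C) (b : B * S -> B * S -> C) :
 A * B -> A * B -> C :=
 fun p q => \sum_s \sum_t x (p.1, s) (q.1, t) * b (p.2, s) (q.2, t).

(* The unit ball of M_A(S_1^S) = CB(S_oo^S, M_A). *)
Definition S1b A S (x : A * S -> A * S -> C) : Prop :=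
 forall B (b : B * S -> B * S -> C), opsq b 1 -> opsq (spair x b) 1.

Lemma kext_comp A B D S (L : A -> B -> C) (M : B -> D -> C) :
 @kext _ _ S (kcomp L M) = kcomp (kext L) (kext M).
Proof.
apply/funext => -[a s]; apply/funext => -[d t]; rewrite /kext /kcomp/= sum_pair/=.
sums b.
under eq_bigr do rewrite -mulrA.
by rewrite sum_deltal mulrCA.
Qed.

Lemma kext_id A S : @kext _ _ S (@kid A) = @kid _.
Proof.
apply/funext => -[a s]; apply/funext => -[d t]; rewrite /kext.
by rewrite -natrM mulnb andbC.
Qed.

Lemma kext_opsq A B S (L : A -> B -> C) c : 0 <= c ->
 opsq L c -> opsq (@kext _ _ S L) c.
Proof.
move=> c0 /(@opsq_ampl S) h.
have sw (X Y : finType) : injective (fun x : X * Y => (x.2, x.1)).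
 by move=> [a b] [a' b'] [-> ->].
exact: (opsq_inj c0 (@sw _ _) (@sw _ _) h).
Qed.

Lemma sandE A B S (L : A -> B -> C) (X : B * S -> B * S -> C) (L' : B -> A -> C) p q :
 sand L X L' p q = \sum_b \sum_b' L p.1 b * X (b, p.2) (b', q.2) * L' b' q.1.
Proof.
rewrite /sand /kcomp /kext/= sum_pair/=; eqs b.
under eq_bigr => s _ do rewrite -mulrA.
rewrite sum_deltal mulr_sumr sum_pair/=; eqs b'.
rewrite (eq_bigr (fun s => (s == q.2)%:R * (L p.1 b * X (b, p.2) (b', s) * L' b' q.1))).
 by rewrite sum_deltar.
by move=> s _; ring.
Qed.

Lemma sand_opsq A B S (L : A -> B -> C) (X : B * S -> B * S -> C) (L' : B -> A -> C) :
 opsq L 1 -> opsq X 1 -> opsq L' 1 -> opsq (sand L X L') 1.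
Proof.
move=> hL hX hL'; apply: opsq_comp1 => //; first exact: kext_opsq.
by apply: opsq_comp1 => //; exact: kext_opsq.
Qed.

Lemma sand_comp A B D S (L : A -> B -> C) (M : B -> D -> C)
  (X : D * S -> D * S -> C) (M' : D -> B -> C) (L' : B -> A -> C) :
 sand L (sand M X M') L' = sand (kcomp L M) X (kcomp M' L').
Proof. by rewrite /sand !kext_comp !kcompA. Qed.

Lemma sand_id A S (X : A * S -> A * S -> C) :
 sand (@kid A) X (@kid A) = X.
Proof. by rewrite /sand kext_id kcomp1l kcomp1r. Qed.

End TraceClassBall.

(** * Singular values of an interpolation family between two densities *)

Section BlockFactorization.

Lemma kpair_opsq1 S T (Y : S -> T -> C) (v : S -> C) (w : T -> C) :
 opsq Y 1 -> n2 v <= 1 -> n2 w <= 1 ->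
 normc (\sum_s \sum_t v s * Y s t * w t) <= 1.
Proof.
move=> hY hv hw; rewrite -(@ler_pXn2r _ 2) ?nnegrE ?normc_ge0// expr1n.
have /(opsq_bil _ ler01) h := hY.
apply: le_trans (h v w) _; rewrite mul1r mulr_ile1 ?n2_ge0//.
Qed.

(* s^(z / th), with value 0 at s = 0. *)
Definition spow (th : R) (s : R) (z : C) : C :=
 if 0 < s then cexp ((ln s / th)%:C * z) else 0.

Lemma spow_good th s (c : R) (d : C) : good (fun z => spow th s (c%:C * z + d)).
Proof.
rewrite /spow; case: (0 < s); last exact: good_cst.
rewrite (_ : (fun z => _) = fun z => cexp ((ln s / th * c)%:C * z + (ln s / th)%:C * d)).
 exact: good_cexp.
by ext z; rewrite mulrDr mulrA -rmorphM.
Qed.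

Lemma normc_spow th s x y : normc (spow th s (x +i* y)) =
 if 0 < s then expR (ln s / th * x) else 0.
Proof.
rewrite /spow; case: ifP => s0; last exact: normc0.
by rewrite normc_cexp; rewrite /= mul0r subr0.
Qed.

Lemma spow_real th s x : spow th s x%:C = (if 0 < s then expR (ln s / th * x) else 0)%:C.
Proof. by rewrite /spow; case: ifP => // _; rewrite -rmorphM cexp_real. Qed.

Lemma spow_th th s : 0 < th -> 0 <= s -> spow th s th%:C = s%:C.
Proof.
move=> t0 s0; rewrite spow_real divfK ?gt_eqF//.
move: s0; rewrite le_eqVlt => /orP[/eqP<-|s0]; first by rewrite ltxx.
by rewrite s0 lnK.
Qed.

Lemma spowD th s z w : spow th s (z + w) = spow th s z * spow th s w.
Proof. by rewrite /spow; case: ifP => _; rewrite ?mulr0// mulrDr cexpD. Qed.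

Variables (K A S : finType) (th : R).
Hypothesis (th0 : 0 < th) (th1 : th <= 1).
Variables (D D' : A -> A -> C) (Wa Wa' : C -> A -> A -> C).
Hypotheses (PW : powers D Wa) (PW' : powers D' Wa').
Hypotheses (trD : re (ktrace D) <= 1) (trD' : re (ktrace D') <= 1).
Variable F : K -> C -> A * S -> A * S -> C.
Hypothesis Fgood : forall k p q, good (fun z => F k z p q).
Hypothesis F0 : forall k y, opsq (F k (0 +i* y)) 1.
Hypothesis F1 : forall y (L L' : A -> A -> C) (B : K -> A * S -> A * S -> C),
 hs2 L <= 1 -> hs2 L' <= 1 -> (forall k, opsq (B k) 1) ->
 normc (\sum_k kpair (sand L (F k (1 +i* y)) L') (B k)) <= 1.

(** Half powers of the densities on both sides. On Re z = 0 they are unitary and Y is a contraction;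
    on Re z = 1 their Hilbert-Schmidt norm is at most 1 because the traces are, as [F1] requires. *)
Let Y k (z : C) := sand (Wa ((2^-1)%:C * z + 0)) (F k z) (Wa' ((2^-1)%:C * z + 0)).

Variables (V W : K -> A * S -> A * S -> C) (sg : K -> A * S -> R).
Hypotheses (sg0 : forall k p, 0 <= sg k p) (Wis : forall k, kcomp (kadj (W k)) (W k) = @kid _)
 (Wco : forall k, kcomp (W k) (kadj (W k)) = @kid _)
 (Vis : forall k t u, \sum_s ((V k s t)^*)%R * V k s u = ((0 < sg k t) && (t == u))%:R)
 (XE : forall k s t, Y k th%:C s t = \sum_r V k s r * (sg k r)%:C * W k r t).

Let Wco' k s t : \sum_r W k s r * ((W k t r)^*)%R = (s == t)%:R.
Proof. by have := congr1 (fun f => f s t) (Wco k). Qed.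

Let Sg : R := \sum_k \sum_r (if 0 < sg k r then expR (ln (sg k r) / th) else 0).

(** The dual family of the singular value decompositions of Y(th). Summed over k, its trace norms
    are at most [Sg] on Re z = 0; on Re z = 1 it consists of contractions; at th it pairs with Y to
    [Sg]. *)
Let Bz k (z : C) p q := \sum_r ((V k p r)^*)%R * spow th (sg k r) ((-1)%:C * z + 1) * ((W k r q)^*)%R.

Let h (z : C) := \sum_k kpair (Y k z) (Bz k z).

Let h_good : good h.
Proof.
apply: good_sum => k _; apply: good_sum => p _; apply: good_sum => q _.
apply: goodM.
 rewrite (_ : (fun z => _) = fun z => \sum_b \sum_b' Wa ((2^-1)%:C * z + 0) p.1 b *
   F k z (b, p.2) (b', q.2) * Wa' ((2^-1)%:C * z + 0) b' q.1); last first.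
  by ext z; rewrite /Y sandE.
 apply: good_sum => b _; apply: good_sum => b' _; apply: goodM; last exact: (pw_good PW').
 apply: goodM => //; exact: (pw_good PW).
apply: good_sum => r _; apply: goodM; last exact: good_cst.
apply: goodM; [exact: good_cst|exact: spow_good].
Qed.

Let nV k r : n2 (fun p => ((V k p r)^*)%R) <= 1.
Proof.
rewrite n2_conj -lerc_real n2_mulconj.
under eq_bigr do rewrite mulrC.
by rewrite Vis eqxx; case: (0 < _).
Qed.

Let nW k r : n2 (fun q => ((W k r q)^*)%R) <= 1.
Proof. by rewrite n2_conj n2_unitary_row. Qed.

Let kpairB k Y0 z : kpair Y0 (Bz k z) = \sum_r spow th (sg k r) ((-1)%:C * z + 1) *
 (\sum_p \sum_q ((V k p r)^*)%R * Y0 p q * ((W k r q)^*)%R).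
Proof.
rewrite /kpair.
under eq_bigr => p _ do under eq_bigr => q _ do rewrite mulr_sumr.
under eq_bigr => p _ do rewrite exchange_big/=.
rewrite exchange_big/=; eqs r; rewrite mulr_sumr.
eqs p; sums q; ring.
Qed.

Let Sg_ge0 : 0 <= Sg.
Proof.
by apply: sumr_ge0 => k _; apply: sumr_ge0 => r _; case: ifP => // _.
Qed.

Let h0 y : normc (h (0 +i* y)) <= Sg.
Proof.
apply: le_trans (normc_sum _ _ _) _; apply: ler_sum => k _.
rewrite kpairB; apply: le_trans (normc_sum _ _ _) _; apply: ler_sum => r _.
rewrite normcM.
have -> : (-1)%:C * (0 +i* y) + 1 = 1 +i* (- y) :> C by simpc; congr (_ +i* _); ring.
rewrite normc_spow mulr1 ler_piMr//; first by case: ifP => // _; exact: expR_ge0.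
apply: kpair_opsq1 => //; rewrite /Y; apply: sand_opsq => //.
 rewrite (_ : _ + 0 = 0 +i* (2^-1 * y)); first exact: pw_unitary PW.
 by simpc; congr (_ +i* _); ring.
rewrite (_ : _ + 0 = 0 +i* (2^-1 * y)); first exact: pw_unitary PW'.
by simpc; congr (_ +i* _); ring.
Qed.

Let hs2_half (E : A -> A -> C) X y : powers E X -> re (ktrace E) <= 1 ->
 hs2 (X ((2^-1)%:C * (1 +i* y) + 0)) <= 1.
Proof.
move=> PX trE; have := hs2_pw ((2^-1)%:C * (1 +i* y) + 0) PX.
rewrite (_ : _ + _^* = 1)%R; first by rewrite (pw1 PX) => /(congr1 (@re R)) /= ->.
rewrite addr0 -[((_ * _)^*)%R]/(conjc _); simpc.
by rewrite -[RHS]/(1 +i* 0); congr (_ +i* _); field.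
Qed.

Let h1 y : normc (h (1 +i* y)) <= 1.
Proof.
rewrite /h /Y; apply: F1; [exact: hs2_half PW trD|exact: hs2_half PW' trD'|move=> k].
have -> : Bz k (1 +i* y) = kcomp (fun p r => ((V k p r)^*)%R)
  (kcomp (fun r r' => (r == r')%:R * spow th (sg k r) (0 +i* (- y))) (fun r q => ((W k r q)^*)%R)).
 ext p q; eqs r.
 rewrite /kcomp; under [in RHS]eq_bigr do rewrite -mulrA.
 rewrite sum_deltal -mulrA; congr (_ * (spow _ _ _ * _)).
 by simpc; congr (_ +i* _); ring.
apply: opsq_comp1 => //.
 by apply: opsq_conj; apply: (@opsq_isometry _ _ _ (fun r => 0 < sg k r)) => t u; exact: Vis.
apply: opsq_comp1 => //.
 apply: opsq_diag => r; rewrite normc_spow; case: ifP => _; last by rewrite expr0n.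
 by rewrite mulr0 expR0 expr1n.
exact/opsq_conj/opsq_coisometry.
Qed.

Let hth : h th%:C = Sg%:C.
Proof.
rewrite /h /Sg real_complex_sum; eqs k; rewrite real_complex_sum kpairB.
eqs r.
have -> : \sum_p \sum_q ((V k p r)^*)%R * Y k th%:C p q * ((W k r q)^*)%R = (sg k r)%:C.
 under eq_bigr => p _ do under eq_bigr => q _ do rewrite XE mulr_sumr mulr_suml.
 transitivity (\sum_u (\sum_p ((V k p r)^*)%R * V k p u) * (sg k u)%:C *
   (\sum_q W k u q * ((W k r q)^*)%R)).
  under [RHS]eq_bigr => u _ do rewrite mulr_suml mulr_suml.
  rewrite [RHS]exchange_big/=; eqs p.
  under [RHS]eq_bigr => u _ do rewrite mulr_sumr.
  rewrite [RHS]exchange_big/=; eqs q.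
  eqs u; ring.
 under eq_bigr => u _ do rewrite Vis Wco' mulrC.
 rewrite sum_deltar eqxx andbT.
 by have := sg0 k r; rewrite le_eqVlt => /orP[/eqP<-|->]; rewrite ?mulr0 ?mul1r.
rewrite -[in LHS](spow_th th0 (sg0 k r)) -spowD.
have -> : (-1)%:C * th%:C + 1 + th%:C = 1%:C :> C by simpc; congr (_ +i* _); ring.
by rewrite spow_real mulr1.
Qed.

(** h is bounded by [Sg] on Re z = 0 and by 1 on Re z = 1, and h(th) = [Sg]. Three lines gives Sg <=
    Sg^(1 - th), hence Sg <= 1. *)
Lemma singular_sum_le1 :
 \sum_k \sum_r (if 0 < sg k r then expR (ln (sg k r) / th) else 0) <= 1.
Proof.
rewrite -/Sg; have [->|Sgn] := eqVneq Sg 0; first exact: ler01.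
have Sp : 0 < Sg by rewrite lt0r Sgn Sg_ge0.
(* This is h(z) Sg^(z - 1), bounded by 1 on both lines. *)
pose G z := h z * cexp ((ln Sg)%:C * z + (- ln Sg)%:C).
have Gg : good G by apply: goodM => //; exact: good_cexp.
have GE z : normc (G z) = normc (h z) * expR (ln Sg * re z - ln Sg).
 rewrite normcM normc_cexp; congr (_ * expR _).
 by case: z => u v; rewrite /=; ring.
have := @three_lines _ th Gg; rewrite !GE hth normc_real ger0_norm//=.
rewrite (ltW th0) th1 => H; have {}H : Sg * expR (ln Sg * th - ln Sg) <= 1.
 apply: H => // y; rewrite GE/=.
  rewrite mulr0 add0r expRN lnK ?posrE// ler_pdivrMr// mul1r; exact: h0.
 by rewrite mulr1 subrr expR0 mulr1; exact: h1.
have : expR (ln Sg * th) <= 1.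
 by apply: le_trans H; rewrite expRD expRN lnK ?posrE// mulrCA divff ?mulr1.
rewrite -[leRHS]expR0 ler_expR pmulr_lle0// => lS.
by rewrite -[Sg]lnK ?posrE// -[leRHS]expR0 ler_expR.
Qed.

End BlockFactorization.

(** * Unit balls of matrices over finite Schatten classes *)

Section SchattenBall.

(* The unit ball of M_A(S_p^S), th = 1/p, for the norm of complex interpolation
  between M_A(S_oo^S) and M_A(S_1^S). *)
Definition Spball (th : R) A S (x : A * S -> A * S -> C) : Prop :=
 exists f : C -> A * S -> A * S -> C,
 [/\ forall p q, good (fun z => f z p q), f th%:C = x,
   forall y, opsq (f (0 +i* y)) 1 & forall y, S1b (f (1 +i* y))].

(** With L and Rk read as contractions between A and S x T, the pairing of x with b is their product
    around the ampliation 1_T (x) b. *)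
Lemma S1b_factor A S T (x : A * S -> A * S -> C)
  (L : A * S -> T -> C) (Rk : T -> A * S -> C) :
 (forall p q, x p q = \sum_r L p r * Rk r q) ->
 (forall w : A -> C, n2 (fun u : S * T => \sum_a w a * L (a, u.1) u.2) <= n2 w) ->
 (forall w : A -> C, n2 (fun u : S * T => \sum_a Rk u.2 (a, u.1) * w a) <= n2 w) ->
 S1b x.
Proof.
move=> xE hL hR B b hb; apply/(opsq_bil _ ler01) => v w.
pose vL (u : T * (B * S)) := \sum_a v (a, u.2.1) * L (a, u.2.2) u.1.
pose wR (u : T * (B * S)) := \sum_a Rk u.1 (a, u.2.2) * w (a, u.2.1).
have /(opsq_bil _ ler01) /(_ vL wR) := @opsq_ampl T _ _ _ _ hb.
have -> : \sum_s \sum_t vL s * ((s.1 == t.1)%:R * b s.2 t.2) * wR t =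
  \sum_s \sum_t v s * spair x b s t * w t.
 transitivity (\sum_r \sum_u \sum_u' vL (r, u) * b u u' * wR (r, u')).
  rewrite sum_pair; apply: eq_bigr => r _; apply: eq_bigr => u _.
  rewrite sum_pair/= exchange_big; apply: eq_bigr => u' _.
  rewrite -(sum_deltal r (fun r' => vL (r, u) * b u u' * wR (r', u'))).
  by apply: eq_bigr => r' _; ring.
 rewrite /vL /wR/=.
 transitivity (\sum_r \sum_(u : B * S) \sum_(u' : B * S) \sum_a \sum_a'
  v (a, u.1) * L (a, u.2) r * b u u' * (Rk r (a', u'.2) * w (a', u'.1))).
  apply: eq_bigr => r _; apply: eq_bigr => u _; apply: eq_bigr => u' _.
  rewrite mulr_suml mulr_suml; apply: eq_bigr => a _.
  by rewrite mulr_sumr.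
 transitivity (\sum_(s : A * B) \sum_(t : A * B) \sum_i \sum_j \sum_r
  v s * (L (s.1, i) r * Rk r (t.1, j) * b (s.2, i) (t.2, j)) * w t); last first.
  apply: eq_bigr => s _; apply: eq_bigr => t _.
  rewrite /spair mulr_sumr mulr_suml; apply: eq_bigr => i _.
  rewrite mulr_sumr mulr_suml; apply: eq_bigr => j _.
  by rewrite xE mulr_suml mulr_sumr mulr_suml.
 rewrite !pair_bigA/=.
 rewrite (reindex (fun t : (((A * B) * (A * B)) * S * S * T)%type =>
  ((((t.2, (t.1.1.1.1.2, t.1.1.2)), (t.1.1.1.2.2, t.1.2)), t.1.1.1.1.1), t.1.1.1.2.1)))/=.
  by apply: eq_bigr => -[[[[[a p] [a' p']] i] j] r] _ /=; ring.
 exists (fun t : (T * (B * S) * (B * S) * A * A)%type =>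
  (((((t.1.2, t.1.1.1.2.1), (t.2, t.1.1.2.1)), t.1.1.1.2.2), t.1.1.2.2), t.1.1.1.1)).
  by move=> [[[[[a p] [a' p']] i] j] r] _.
 by move=> [[[[r [p i]] [p' j]] a] a'] _.
move=> h; apply: le_trans h _; rewrite ler_wpM2l// ler_pM ?n2_ge0//.
 rewrite /vL n2_swap; apply: le_trans (_ : \sum_p n2 (fun a => v (a, p)) <= _); last by rewrite -n2_swap.
 rewrite sum_pair; apply: ler_sum => p _.
 apply: le_trans (hL (fun a => v (a, p))); rewrite n2_pair.
 by apply: ler_sum => s _; rewrite /n2.
rewrite /wR n2_swap; apply: le_trans (_ : \sum_p n2 (fun a => w (a, p)) <= _); last by rewrite -n2_swap.
rewrite sum_pair; apply: ler_sum => p _.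
apply: le_trans (hR (fun a => w (a, p))); rewrite n2_pair.
by apply: ler_sum => s _; rewrite /n2.
Qed.

(** * Marginal densities of a singular value decomposition *)

Section Factor.
Variables (A S : finType) (th dl : R).
Hypothesis (th0 : 0 < th) (dl0 : 0 < dl).
Variables (X V W : A * S -> A * S -> C) (sg : A * S -> R).
Hypotheses (sg0 : forall p, 0 <= sg p)
 (Wis : kcomp (kadj W) W = @kid _) (Wco : kcomp W (kadj W) = @kid _)
 (Vis : forall t u, \sum_s ((V s t)^*)%R * V s u = ((0 < sg t) && (t == u))%:R)
 (XE : forall s t, X s t = \sum_r V s r * (sg r)%:C * W r t).

Let c r : R := if 0 < sg r then expR (ln (sg r) / th) else 0.

Let c0 r : 0 <= c r. Proof. by rewrite /c; case: ifP => // _; exact: expR_ge0. Qed.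

(** The partial trace over S of Y diag(c) Y^*, with c = sg^(1/th); the multiple dl of the identity
    makes it invertible. *)
Definition marginal (Y : A * S -> A * S -> C) : A -> A -> C := fun a a' =>
 \sum_s \sum_r (c r)%:C * (Y (a, s) r * ((Y (a', s) r)^*)%R) + dl%:C * (a == a')%:R.

Lemma marginal_qform Y w : qform (marginal Y) w =
 (\sum_s \sum_r c r * normc (\sum_a w a * Y (a, s) r) ^+ 2 + dl * n2 w)%:C.
Proof.
rewrite /qform /marginal rmorphD rmorphM/= n2_mulconj mulr_sumr.
under eq_bigr => a _ do under eq_bigr => a' _ do rewrite mulrDr mulrDl.
under eq_bigr => a _ do rewrite big_split/=.
rewrite big_split/=; congr (_ + _); last first.
 eqs a.
 rewrite -(sum_deltal a (fun a' => dl%:C * (w a * ((w a')^*)%R))).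
 by eqs a'; ring.
rewrite real_complex_sum.
under [RHS]eq_bigr => s _ do rewrite real_complex_sum.
under [RHS]eq_bigr => s _ do under eq_bigr => r _ do
 rewrite rmorphM/= normc_mulconj rmorph_sum/= mulr_suml mulr_sumr.
under [RHS]eq_bigr => s _ do rewrite exchange_big.
rewrite [RHS]exchange_big; eqs a.
under [RHS]eq_bigr => s _ do under eq_bigr => r _ do rewrite mulr_sumr mulr_sumr.
under [RHS]eq_bigr => s _ do rewrite exchange_big.
rewrite [RHS]exchange_big; eqs a'.
sums s.
sums r.
by rewrite rmorphM/=; ring.
Qed.

Lemma marginal_posdef Y : posdef (marginal Y).
Proof.
split.
 ext a a'; rewrite /kadj /marginal rmorphD/= rmorphM/= natr_conj.
 have cc (r : R) : ((r%:C)^*)%R = r%:C :> C by exact: conjc_real.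
 rewrite cc eq_sym; congr (_ + _); rewrite rmorph_sum; eqs s.
 rewrite rmorph_sum; apply: eq_bigr => r _ /=.
 by rewrite !rmorphM/= cc conjCK (mulrC (Y _ _)).
exists dl => // w; rewrite marginal_qform lerc_real lerDr.
by apply: sumr_ge0 => s _; apply: sumr_ge0 => r _; rewrite mulr_ge0 ?sqr_ge0.
Qed.

Lemma marginal_trace Y : (forall r, 0 < sg r -> n2 (fun p => Y p r) = 1) ->
 re (ktrace (marginal Y)) = \sum_r c r + dl * #|A|%:R.
Proof.
move=> hY; rewrite /ktrace /marginal big_split/= ReD; congr (_ + _); last first.
 under eq_bigr do rewrite eqxx mulr1.
 by rewrite Re_sum/= sumr_const mulr_natr.
rewrite [X in re X](_ : _ = (\sum_r c r)%:C)//.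
rewrite real_complex_sum.
under eq_bigr => a _ do rewrite exchange_big.
rewrite exchange_big; apply: eq_bigr => r _ /=.
under eq_bigr => a _ do rewrite -mulr_sumr.
rewrite -mulr_sumr -(sum_pair (fun p => Y p r * ((Y p r)^*)%R)) -n2_mulconj -rmorphM/=.
congr (_%:C); rewrite /c; case: ifP => [/hY ->|]; by rewrite ?mulr1 ?mul0r.
Qed.

(** Re z = -1/2, so that the powers on the two sides of the density M cancel it: M^z M M^(conj z) =
    1. Leaving out the dl part of M turns the equality into an inequality. *)
Lemma marginal_bound (Y : A * S -> A * S -> C) (P : C -> A -> A -> C) z (e : A * S -> C) w :
 powers (marginal Y) P -> z + 1 + (z^*)%R = 0 -> (forall r, normc (e r) ^+ 2 = c r) ->
 n2 (fun u : S * (A * S) => \sum_a w a *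
   ((\sum_b P z a b * Y (b, u.1) u.2) * e u.2)) <= n2 w.
Proof.
move=> PP zz he; pose w' b := \sum_a w a * P z a b.
rewrite (@n2_eq _ _ (fun u : S * (A * S) => (\sum_b w' b * Y (b, u.1) u.2) * e u.2)); last first.
 move=> u; rewrite mulr_suml; under [RHS]eq_bigr => b _ do rewrite !mulr_suml.
 rewrite [RHS]exchange_big; apply: eq_bigr => a _; rewrite !mulr_suml mulr_sumr.
 by apply: eq_bigr => b _; ring.
have q : qform (marginal Y) w' = (n2 w)%:C.
 rewrite /qform /w' -(pw1 PP) n2_mulconj.
 transitivity (\sum_a \sum_a' w a * (kcomp (P z) (kcomp (P 1) (P ((z^*)%R)))) a a' * ((w a')^*)%R).
  rewrite -(pwJ PP) /kcomp /kadj.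
  under [RHS]eq_bigr => a _ do under eq_bigr => a' _ do rewrite mulr_sumr mulr_suml.
  under [RHS]eq_bigr => a _ do rewrite exchange_big.
  rewrite [RHS]exchange_big; apply: eq_bigr => b _ /=.
  under [RHS]eq_bigr => a _ do under eq_bigr => a' _ do rewrite !mulr_sumr mulr_suml.
  under [RHS]eq_bigr => a _ do rewrite exchange_big.
  rewrite [RHS]exchange_big; apply: eq_bigr => b' _ /=.
  rewrite rmorph_sum mulr_suml mulr_suml; apply: eq_bigr => a _.
  rewrite mulr_sumr; apply: eq_bigr => a' _.
  by rewrite rmorphM/=; ring.
 rewrite -!(pwD PP) addrA zz (pw0 PP); apply: eq_bigr => a _.
 rewrite -(sum_deltal a (fun a' => w a * ((w a')^*)%R)).
 by apply: eq_bigr => a' _; rewrite /kid; ring.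
have : (\sum_s \sum_r c r * normc (\sum_a w' a * Y (a, s) r) ^+ 2)%:C <= qform (marginal Y) w'.
 by rewrite marginal_qform lerc_real lerDl mulr_ge0 ?n2_ge0// ltW.
rewrite q lerc_real; apply: le_trans; rewrite n2_pair; apply: ler_sum => s _.
by apply: ler_sum => r _ /=; rewrite normcM exprMn he mulrC.
Qed.

(** The family is z |-> P(-z/2) V sg^(z/th) W P'(-z/2). On Re z = 0 all factors are contractions. On
    Re z = 1 the power of sg splits into two halves of squared modulus c, one for each density, and
    [S1b_factor] applies. *)
Lemma factor_ball (P P' : C -> A -> A -> C) :
 powers (marginal V) P -> powers (marginal (fun p r => ((W r p)^*)%R)) P' ->
 Spball th (sand (P ((- 2^-1)%:C * th%:C + 0)) X (fun a b => P' ((- 2^-1)%:C * th%:C + 0) a b)).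
Proof.
move=> PP PP'.
pose Y (z : C) p q := \sum_r V p r * spow th (sg r) (1%:C * z + 0) * W r q.
exists (fun z => sand (P ((- 2^-1)%:C * z + 0)) (Y z) (P' ((- 2^-1)%:C * z + 0))).
split.
- move=> p q; rewrite (_ : (fun z => _) = fun z => \sum_b \sum_b' P ((- 2^-1)%:C * z + 0) p.1 b *
   Y z (b, p.2) (b', q.2) * P' ((- 2^-1)%:C * z + 0) b' q.1); last first.
  by ext z; rewrite sandE.
 apply: good_sum => b _; apply: good_sum => b' _; apply: goodM; last exact: (pw_good PP').
 apply: goodM; first exact: (pw_good PP).
 apply: good_sum => r _; apply: goodM; last exact: good_cst.
 by apply: goodM; [exact: good_cst|exact: spow_good].
- congr sand; ext p q; rewrite XE; eqs r.
 by rewrite mul1r addr0 spow_th.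
- move=> y; apply: sand_opsq.
 + rewrite (_ : _ + 0 = 0 +i* (- 2^-1 * y)); first exact: pw_unitary PP.
  by simpc; congr (_ +i* _); ring.
 + have -> : Y (0 +i* y) = kcomp V (kcomp (fun r r' => (r == r')%:R * spow th (sg r) (0 +i* y)) W).
   ext p q; eqs r.
   rewrite /kcomp; under [in RHS]eq_bigr do rewrite -mulrA.
   by rewrite sum_deltal -mulrA mul1r addr0.
  apply: opsq_comp1; first by apply: (@opsq_isometry _ _ _ (fun r => 0 < sg r)).
  apply: opsq_comp1; last exact: opsq_coisometry.
  apply: opsq_diag => r; rewrite normc_spow; case: ifP => _; last by rewrite expr0n.
  by rewrite mulr0 expR0 expr1n.
 + rewrite (_ : _ + 0 = 0 +i* (- 2^-1 * y)); first exact: pw_unitary PP'.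
  by simpc; congr (_ +i* _); ring.
- move=> y; set z := (- 2^-1)%:C * _ + 0.
 have zE : z = (- 2^-1) +i* (- 2^-1 * y) by rewrite /z; simpc; congr (_ +i* _); ring.
 have zz : z + 1 + (z^*)%R = 0.
  rewrite zE -[((_ +i* _)^*)%R]/((- 2^-1) -i* (- 2^-1 * y)).
  rewrite -[LHS]/((- 2^-1 + 1 + - 2^-1) +i* (- 2^-1 * y + 0 + - (- 2^-1 * y))).
  by rewrite -[RHS]/(0 +i* 0); congr (_ +i* _); field.
 have half u r : normc (spow th (sg r) (2^-1 +i* u)) ^+ 2 = c r.
  rewrite normc_spow /c; case: ifP => _; last by rewrite expr0n.
  by rewrite -expRM_natl; congr expR; field; rewrite gt_eqF.
 apply: (@S1b_factor A S (A * S)%type _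
  (fun p r => (\sum_b P z p.1 b * V (b, p.2) r) * spow th (sg r) (2^-1 +i* 0))
  (fun r q => spow th (sg r) (2^-1 +i* y) * (\sum_b W r (b, q.2) * P' z b q.1))).
 + move=> p q; rewrite sandE.
  under [RHS]eq_bigr => r _ do rewrite !mulr_suml.
  rewrite [RHS]exchange_big; apply: eq_bigr => b _ /=.
  under [RHS]eq_bigr => r _ do rewrite !mulr_sumr.
  rewrite [RHS]exchange_big; apply: eq_bigr => b' _ /=.
  rewrite /Y; sums r.
  have -> : 1%:C * (1 +i* y) + 0 = 2^-1 +i* 0 + 2^-1 +i* y :> C.
   by simpc; congr (_ +i* _); field.
  by rewrite spowD; ring.
 + move=> w; exact: (@marginal_bound V P z (fun r => spow th (sg r) (2^-1 +i* 0)) w PP zz (half 0)).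
 + move=> w; rewrite -[leRHS]n2_conj -[leLHS]n2_conj.
  have hc r : normc ((spow th (sg r) (2^-1 +i* y))^*)%R ^+ 2 = c r.
   by rewrite normc_conj half.
  have zz' : (z^*)%R + 1 + (((z^*)^*)%R) = 0 by rewrite conjCK -zz; ring.
  have := @marginal_bound (fun p r => ((W r p)^*)%R) P' ((z^*)%R)
   (fun r => ((spow th (sg r) (2^-1 +i* y))^*)%R) (fun a => ((w a)^*)%R) PP' zz' hc.
  apply: le_trans; apply: ler_eq.
  apply: n2_eq => u; rewrite rmorph_sum; apply: eq_bigr => a _ /=.
  rewrite !rmorphM/= rmorph_sum/= mulrC (mulrC _ (\sum_b _)); congr (_ * (_ * _)).
  eqs b; rewrite rmorphM/= mulrC; congr (_ * _).
  by have := congr1 (fun f => f a b) (pwJ PP' z); rewrite /kadj => ->.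
Qed.

End Factor.

(** * The terms of a matrix product over S *)

Section TensorFamily.
Variables (A1 A2 S : finType) (f1 : A1 * S -> A1 * S -> C) (f2 : A2 * S -> A2 * S -> C).

(** Column k of f1 against row k of f2, with tensored coefficients; the product over S is the sum
    over k. *)
Definition tcol (k : S) : (A1 * A2) * S -> (A1 * A2) * S -> C :=
 fun p q => f1 (p.1.1, p.2) (q.1.1, k) * f2 (p.1.2, k) (q.1.2, q.2).

Lemma tcol_opsq k : opsq f1 1 -> opsq f2 1 -> opsq (tcol k) 1.
Proof.
move=> h1 h2; have := opsq_kron ler01 ler01 h1 h2; rewrite mulr1 => h.
apply: (@opsq_inj _ _ _ _ (fun p : (A1 * A2) * S => ((p.1.1, p.2), (p.1.2, k)))
 (fun q : (A1 * A2) * S => ((q.1.1, k), (q.1.2, q.2))) _ _ ler01 _ _ h).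
 by move=> [[a b] i] [[a' b'] i'] [-> -> ->].
by move=> [[a b] i] [[a' b'] i'] [-> -> ->].
Qed.

(** The [B k] assemble into one contraction [b2], block diagonal in k up to relabelling. Pairing it
    with f2 and the result with f1 gives contractions again, by the definition of [S1b]; L and L'
    become vectors of norm at most 1 against which the last one is tested. *)
Lemma tcol_S1b (L L' : A1 * A2 -> A1 * A2 -> C) (B : S -> (A1 * A2) * S -> (A1 * A2) * S -> C) :
 S1b f1 -> S1b f2 -> hs2 L <= 1 -> hs2 L' <= 1 -> (forall k, opsq (B k) 1) ->
 normc (\sum_k kpair (sand L (tcol k) L') (B k)) <= 1.
Proof.
move=> h1 h2 hL hL' hB; pose A : finType := (A1 * A2)%type.
pose b2 (u v : (A * S) * S) := (u.2 == v.1.2)%:R * B u.2 u.1 (v.1.1, v.2).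
have hb2 : opsq b2 1.
 have := @opsq_blockdiag S _ _ B 1 hB => h.
 apply: opsq_ext (@opsq_inj _ _ _ _ (fun u : (A * S) * S => (u.2, u.1))
  (fun v : (A * S) * S => (v.1.2, (v.1.1, v.2))) _ _ ler01 _ _ h) => //=.
  by move=> [a i] [a' i'] [-> ->].
 by move=> [[a b] i] [[a' b'] i'] [-> -> ->].
have hE := h2 _ _ hb2; set E := spair f2 b2 in hE.
pose b1 (u v : (A2 * A) * S) := E (u.1.1, (u.1.2, u.2)) (v.1.1, (v.1.2, v.2)).
have hb1 : opsq b1 1.
 have inj : injective (fun u : (A2 * A) * S => (u.1.1, (u.1.2, u.2))).
  by move=> [[a b] i] [[a' b'] i'] [-> -> ->].
 exact: (@opsq_inj _ _ _ _ (fun u : (A2 * A) * S => (u.1.1, (u.1.2, u.2)))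
  (fun u : (A2 * A) * S => (u.1.1, (u.1.2, u.2))) _ _ ler01 inj inj hE).
have hM := h1 _ _ hb1; set M := spair f1 b1 in hM.
pose v (u : A1 * (A2 * A)) := L u.2.2 (u.1, u.2.1).
pose v' (u : A1 * (A2 * A)) := L' (u.1, u.2.1) u.2.2.
have nv : n2 v <= 1.
 apply: le_trans hL; rewrite hs2_n2 le_eqVlt; apply/orP; left; apply/eqP.
 rewrite -(@n2_bij _ _ (fun u : A1 * (A2 * A) => (u.2.2, (u.1, u.2.1)))); first exact: n2_eq.
 by exists (fun u : A * A => (u.2.1, (u.2.2, u.1))) => [[? [? ?]]|[? [? ?]]].
have nv' : n2 v' <= 1.
 apply: le_trans hL'; rewrite hs2_n2 le_eqVlt; apply/orP; left; apply/eqP.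
 rewrite -(@n2_bij _ _ (fun u : A1 * (A2 * A) => ((u.1, u.2.1), u.2.2))); first exact: n2_eq.
 by exists (fun u : A * A => (u.1.1, (u.1.2, u.2))) => [[? [? ?]]|[[? ?] ?]].
have := kpair_opsq1 hM nv nv'.
suff -> : \sum_s \sum_t v s * M s t * v' t = \sum_k kpair (sand L (tcol k) L') (B k) by [].
transitivity (\sum_(s : A1 * (A2 * A)) \sum_(t : A1 * (A2 * A)) \sum_i \sum_l \sum_j
 L s.2.2 (s.1, s.2.1) * (f1 (s.1, i) (t.1, l) * (f2 (s.2.1, l) (t.2.1, j) *
  B l (s.2.2, i) (t.2.2, j))) * L' (t.1, t.2.1) t.2.2).
 eqs s t; rewrite /v /v' /M /spair mulr_sumr mulr_suml.
 eqs i; sums l.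
 rewrite /b1 /E /spair/= /b2/= exchange_big mulr_sumr mulr_sumr mulr_suml; apply: eq_bigr => j _ /=.
 congr (_ * (_ * _) * _).
 rewrite -[RHS](sum_deltar l (fun k => f2 (s.2.1, k) (t.2.1, j) * B k (s.2.2, i) (t.2.2, j))).
 by eqs k; ring.
transitivity (\sum_k \sum_(p : A * S) \sum_(q : A * S) \sum_(b : A) \sum_(b' : A)
 (L p.1 b * tcol k (b, p.2) (b', q.2) * L' b' q.1) * B k p q); last first.
 eqs k p; eqs q.
 rewrite sandE; sums b.
 by rewrite mulr_suml.
rewrite !pair_bigA/=.
rewrite (reindex (fun t : (S * (A * S) * (A * S) * A * A)%type =>
 let k := t.1.1.1.1 in let p := t.1.1.1.2 in let q := t.1.1.2 in let b := t.1.2 in let b' := t.2 in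
 (((((b.1, (b.2, p.1)), (b'.1, (b'.2, q.1))), p.2), k), q.2)))/=.
 by apply: eq_bigr => -[[[[k [a0 i]] [a0' j]] [a1 a2]] [a1' a2']] _ /=; rewrite /tcol/=; ring.
exists (fun t : ((A1 * (A2 * A)) * (A1 * (A2 * A)) * S * S * S)%type =>
 let s := t.1.1.1.1 in let s' := t.1.1.1.2 in let i := t.1.1.2 in let k := t.1.2 in let j := t.2 in
 ((((k, (s.2.2, i)), (s'.2.2, j)), (s.1, s.2.1)), (s'.1, s'.2.1))).
 by move=> [[[[k [a0 i]] [a0' j]] [a1 a2]] [a1' a2']] _.
by move=> [[[[[a1 [a2 a0]] [a1' [a2' a0']]] i] k] j] _.
Qed.

End TensorFamily.

(** * Hilbert-Schmidt bounds from the two marginals of a weight *)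

Section MarginalInterpolation.
Variables (G : finType).

(** The contractions [U k] only decrease the norm. Since z + conj z = -1, the powers of [Bk k]
    combine to [Bk k] itself, and the powers of the marginal of g cancel that marginal under the
    trace. *)
Lemma marg_line A D K (g : G -> A * D -> C) (W : C -> D -> D -> C)
  (PB : K -> C -> D -> D -> C) (Bk : K -> D -> D -> C) (U : K -> A -> A -> C) (z : C) :
 powers (fun c c' => \sum_u \sum_a ((g u (a, c))^*)%R * g u (a, c')) W ->
 (forall k, powers (Bk k) (PB k)) -> (forall k, opsq (U k) 1) ->
 z + 1 + (z^*)%R = 0 ->
 n2 (fun t : G * K * (A * D) => \sum_a \sum_c g t.1.1 (a, c) * U t.1.2 a t.2.1 *
   kcomp (W z) (PB t.1.2 (- z)) c t.2.2) <= re (\sum_k ktrace (Bk k)).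
Proof.
move=> PW PPB hU zz.
pose Y k := kcomp (W z) (PB k (- z)).
pose w (t : G * K * D) a := \sum_c g t.1.1 (a, c) * Y t.1.2 c t.2.
letr (\sum_(t : G * K * D) n2 (w t)).
 rewrite n2_pair.
 rewrite [leRHS]sum_pair; apply: ler_sum => -[u k] _.
 rewrite n2_swap; apply: ler_sum => d _ /=.
 have /(opsq_tr ler01) /(_ (w (u, k, d))) := hU k; rewrite mul1r; apply: le_trans.
 rewrite le_eqVlt; apply/orP; left; apply/eqP; apply: n2_eq => a' /=.
 apply: eq_bigr => a _; rewrite /w mulr_sumr; apply: eq_bigr => c _ /=.
 by rewrite /Y; ring.
rewrite -lerc_real le_eqVlt; apply/orP; left; apply/eqP.
have zJ : ((- z)^*)%R = 1 + z.
 by rewrite rmorphN; apply/eqP; rewrite eqr_oppLR -subr_eq0; apply/eqP; rewrite -zz; ring.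
have key k : \sum_u \sum_d (n2 (w (u, k, d)))%:C = ktrace (Bk k).
 transitivity (ktrace (kcomp (W 1) (kcomp (Y k) (kadj (Y k))))); last first.
  rewrite /Y kadj_comp (pwJ PW) (pwJ (PPB k)) zJ -kcompA.
  rewrite (kcompA (PB k (- z))) -(pwD (PPB k)) addrCA addNr addr0 (pw1 (PPB k)).
  rewrite (kcompA (W 1)) -(pwD PW) ktraceC -kcompA -(pwD PW).
  have -> : (z^*)%R + (1 + z) = 0 by rewrite -zz; ring.
  by rewrite (pw0 PW) kcomp1r.
 transitivity (\sum_u \sum_d \sum_a \sum_c \sum_c' (g u (a, c) * Y k c d) *
   ((g u (a, c') * Y k c' d)^*)%R).
  apply: eq_bigr => u _; apply: eq_bigr => d _; rewrite n2_mulconj.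
  apply: eq_bigr => a _; rewrite /w rmorph_sum/= mulr_suml.
  by apply: eq_bigr => c _; rewrite mulr_sumr.
 transitivity (\sum_c' \sum_c \sum_u \sum_a \sum_d ((g u (a, c'))^*)%R * g u (a, c) *
   (Y k c d * ((Y k c' d)^*)%R)); last first.
  rewrite (pw1 PW) /ktrace /kcomp; apply: eq_bigr => c' _; apply: eq_bigr => c _.
  rewrite mulr_suml; apply: eq_bigr => u _; rewrite mulr_suml; apply: eq_bigr => a _.
  by rewrite mulr_sumr.
 rewrite !pair_bigA/=.
 rewrite (reindex (fun t : (D * D * G * A * D)%type =>
  ((((t.1.1.2, t.2), t.1.2), t.1.1.1.2), t.1.1.1.1)))/=.
  by apply: eq_bigr => -[[[[c' c] u] a] d] _ /=; rewrite rmorphM/=; ring.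
 exists (fun t : (G * D * A * D * D)%type => ((((t.2, t.1.2), t.1.1.1.1), t.1.1.2), t.1.1.1.2)).
  by move=> [[[[? ?] ?] ?] ?].
 by move=> [[[[? ?] ?] ?] ?].
have e : (\sum_(t : G * K * D) n2 (w t))%:C = \sum_k ktrace (Bk k).
 rewrite real_complex_sum sum_pair/= sum_pair/= exchange_big; apply: eq_bigr => k _ /=.
 exact: key.
by rewrite -e.
Qed.

(** Three lines for a vector-valued function, paired with its own value at th. On Re z = 0 the
    factors over A are unitary and those over D fall under [marg_line]; on Re z = 1 the roles are
    exchanged. *)
Lemma marg_bound A D K (g : G -> A * D -> C) (W1 : C -> A -> A -> C)
  (W2 : C -> D -> D -> C) (PA : K -> C -> A -> A -> C) (PB : K -> C -> D -> D -> C)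
  (Ak : K -> A -> A -> C) (Bk : K -> D -> D -> C) (th c : R) :
 powers (fun a a' => \sum_u \sum_d ((g u (a, d))^*)%R * g u (a', d)) W1 ->
 powers (fun d d' => \sum_u \sum_a ((g u (a, d))^*)%R * g u (a, d')) W2 ->
 (forall k, powers (Ak k) (PA k)) -> (forall k, powers (Bk k) (PB k)) ->
 re (\sum_k ktrace (Ak k)) <= c -> re (\sum_k ktrace (Bk k)) <= c ->
 0 <= th <= 1 -> 0 < c ->
 n2 (fun t : G * K * (A * D) => \sum_a \sum_d g t.1.1 (a, d) *
   kcomp (W1 ((- 2^-1)%:C * th%:C + 0)) (PA t.1.2 ((2^-1)%:C * th%:C + 0)) a t.2.1 *
   kcomp (W2 ((2^-1)%:C * th%:C + (- 2^-1)%:C))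
    (PB t.1.2 ((- 2^-1)%:C * th%:C + (2^-1)%:C)) d t.2.2) <= c.
Proof.
move=> PW1 PW2 PPA PPB trA trB th01 c0.
pose v (z : C) (t : G * K * (A * D)) := \sum_a \sum_d g t.1.1 (a, d) *
   kcomp (W1 ((- 2^-1)%:C * z + 0)) (PA t.1.2 ((2^-1)%:C * z + 0)) a t.2.1 *
   kcomp (W2 ((2^-1)%:C * z + (- 2^-1)%:C)) (PB t.1.2 ((- 2^-1)%:C * z + (2^-1)%:C)) d t.2.2.
rewrite -/(v th%:C); set N := n2 (v th%:C).
rewrite leNgt; apply/negP => cN.
have N0 : 0 < N by exact: lt_trans cN.
(* With this normalization |h| <= 1 on both lines by Cauchy-Schwarz, and h(th) = N / s; so N <= sqrt
   (c N), against c < N. *)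
pose s := Num.sqrt (c * N).
have s0 : 0 < s by rewrite sqrtr_gt0 mulr_gt0.
pose h z := (s^-1)%:C * \sum_t v z t * ((v th%:C t)^*)%R.
have kgood T (E1 E2 : T -> T -> C) X1 X2 c1 c2 d1 d2 i j :
  powers E1 X1 -> powers E2 X2 -> good (fun z => kcomp (X1 (c1%:C * z + d1)) (X2 (c2%:C * z + d2)) i j).
 move=> P1 P2; apply: good_sum => r _; apply: goodM; [exact: (pw_good P1)|exact: (pw_good P2)].
have hg : good h.
 apply: goodM; first exact: good_cst.
 apply: good_sum => t _; apply: goodM; last exact: good_cst.
 apply: good_sum => a _; apply: good_sum => d _; apply: goodM;
  last exact: (kgood _ _ _ _ _ _ _ _ _ _ _ PW2 (PPB t.1.2)).
 by apply: goodM; [exact: good_cst|exact: (kgood _ _ _ _ _ _ _ _ _ _ _ PW1 (PPA t.1.2))].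
have unit T (E1 E2 : T -> T -> C) X1 X2 y1 y2 : powers E1 X1 -> powers E2 X2 ->
  opsq (kcomp (X1 (0 +i* y1)) (X2 (0 +i* y2))) 1.
 by move=> P1 P2; apply: opsq_comp1; [exact: pw_unitary P1|exact: pw_unitary P2].
have hb z : n2 (v z) <= c -> normc (h z) <= 1.
 move=> hz; rewrite normcM normc_real ger0_norm ?invr_ge0 ?(ltW s0)//.
 rewrite ler_pdivrMl// mulr1 -(@ler_pXn2r _ 2) ?nnegrE ?normc_ge0 ?(ltW s0)//.
 rewrite sqr_sqrtr ?mulr_ge0 ?(ltW c0) ?(ltW N0)//.
 by rewrite (le_trans (CS _ _))// n2_conj ler_wpM2r ?n2_ge0.
have := @three_lines h th hg.
have hth : h th%:C = (s^-1 * N)%:C by rewrite /h -n2_mulconj -rmorphM.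
rewrite hth normc_real ger0_norm ?mulr_ge0 ?invr_ge0 ?(ltW s0) ?(ltW N0)//.
rewrite ler_pdivrMl// mulr1 => H.
suff : N <= s.
 rewrite -(@ler_pXn2r _ 2) ?nnegrE ?(ltW s0) ?(ltW N0)// sqr_sqrtr ?mulr_ge0 ?(ltW c0) ?(ltW N0)//.
 by rewrite expr2 ler_pM2r// leNgt cN.
apply: H => // y; apply: hb.
- have := @marg_line A D K g W2 PB Bk
  (fun k => kcomp (W1 (0 +i* (- 2^-1 * y))) (PA k (0 +i* (2^-1 * y)))) ((- 2^-1) +i* (2^-1 * y)) PW2 PPB.
 have E : (- 2^-1) +i* (2^-1 * y) + 1 + ((((- 2^-1) +i* (2^-1 * y)))^*)%R = 0 :> C.
  rewrite -[LHS]/((- 2^-1 + 1 + - 2^-1) +i* (2^-1 * y + 0 + - (2^-1 * y))).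
  by rewrite -[RHS]/(0 +i* 0); congr (_ +i* _); field.
 move=> /(_ (fun k => unit _ _ _ _ _ _ _ PW1 (PPA k)) E) /le_trans /(_ trB).
 apply: le_trans; apply: ler_eq; apply: n2_eq => t.
 eqs a d.
 congr (_ * kcomp (W1 _) (PA _ _) _ _ * kcomp (W2 _) (PB _ _) _ _);
  simpc; congr (_ +i* _); ring.
- have := @marg_line D A K (fun u p => g u (p.2, p.1)) W1 PA Ak
  (fun k => kcomp (W2 (0 +i* (2^-1 * y))) (PB k (0 +i* (- 2^-1 * y)))) ((- 2^-1) +i* (- 2^-1 * y)) PW1 PPA.
 have E : (- 2^-1) +i* (- 2^-1 * y) + 1 + ((((- 2^-1) +i* (- 2^-1 * y)))^*)%R = 0 :> C.
  rewrite -[LHS]/((- 2^-1 + 1 + - 2^-1) +i* (- 2^-1 * y + 0 + - (- 2^-1 * y))).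
  by rewrite -[RHS]/(0 +i* 0); congr (_ +i* _); field.
 move=> /(_ (fun k => unit _ _ _ _ _ _ _ PW2 (PPB k)) E) /le_trans /(_ trA).
 apply: le_trans; apply: ler_eq.
 rewrite -[RHS](@n2_bij _ _ (fun t : G * K * (A * D) => (t.1, (t.2.2, t.2.1)))); last first.
  by exists (fun t : G * K * (D * A) => (t.1, (t.2.2, t.2.1))) => -[? []].
 apply: n2_eq => t /=; rewrite exchange_big; eqs d a.
 rewrite mulrAC; congr (_ * kcomp (W2 _) (PB _ _) _ _ * kcomp (W1 _) (PA _ _) _ _);
  simpc; congr (_ +i* _); by field.
Qed.

End MarginalInterpolation.

End SchattenBall.

(** * Factoring a family through densities of total trace 1 + dl *)

Section BlockDecomposition.

(** x factors through the identity on A x S: division by n > #|S| makes the left factor a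
    contraction, and t n h <= 1 does it for the right one. *)
Lemma S1b_HS A S (x : A * S -> A * S -> C) : exists2 c : R, 0 < c &
 forall t : R, 0 <= t -> t <= c -> S1b (fun p q => t%:C * x p q).
Proof.
pose n : R := #|S|%:R + 1; have n0 : 0 < n by rewrite ltr_wpDl.
pose h : R := hs2 x + 1; have h0 : 0 < h by rewrite ltr_wpDl ?hs2_ge0.
exists ((n * h)^-1); first by rewrite invr_gt0 mulr_gt0.
move=> t t0 tc.
apply: (@S1b_factor A S (A * S)%type _ (fun p r => (n^-1)%:C * (p == r)%:R)
 (fun r q => (t * n)%:C * x r q)).
- move=> p q; rewrite -(sum_deltal p (fun r => t%:C * x r q)).
 have nn : (n^-1)%:C * n%:C = 1 :> C by rewrite -rmorphM/= mulVf ?gt_eqF.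
 by eqs r; rewrite rmorphM/= -[LHS]mul1r -nn; ring.
- move=> w; rewrite n2_pair.
 have E s : n2 (fun r : A * S => \sum_a w a * ((n^-1)%:C * ((a, s) == r)%:R)) = n^-1 ^+ 2 * n2 w.
  rewrite (@n2_eq _ _ (fun r => (n^-1)%:C * ((s == r.2)%:R * w r.1))).
   rewrite n2_scale normc_real real_normK ?num_real//; congr (_ * _).
   rewrite n2_swap/=.
   under eq_bigr do rewrite n2_scale.
   rewrite -[RHS](sum_deltal s (fun=> n2 w)); eqs s'; congr (_ * _).
   by case: (s == s'); rewrite ?normc1 ?expr1n// normc0 expr0n.
  move=> [a' s'] /=; rewrite -(sum_deltar a' (fun a => (n^-1)%:C * ((s == s')%:R * w a))).
  by eqs a; rewrite xpair_eqE -mulnb natrM; ring.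
 under eq_bigr do rewrite E.
 rewrite sumr_const -mulr_natr mulrAC ler_piMl ?n2_ge0// exprVn mulrC.
 rewrite ler_pdivrMr ?exprn_gt0// mul1r.
 have : 0 <= #|S|%:R :> R by [].
 by rewrite /n expr2; nra.
- move=> w; rewrite n2_swap.
 letr ((t * n) ^+ 2 * hs2 x * n2 w).
  rewrite -mulrA [hs2 x * _]mulr_suml mulr_sumr; apply: ler_sum => r _.
  rewrite sum_pair exchange_big/= mulr_suml mulr_sumr [leLHS]/n2; apply: ler_sum => s _.
  rewrite mulrA.
  apply: le_trans (CS _ _) _; rewrite n2_scale normc_real real_normK ?num_real//.
 rewrite ler_piMl ?n2_ge0//.
 have th : t * n * h <= 1 by move: tc; rewrite -div1r ler_pdivlMr ?mulr_gt0// mulrA.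
 have tn0 : 0 <= t * n by rewrite mulr_ge0// ltW.
 have h1 : 1 <= h by rewrite lerDr hs2_ge0.
 have hh : hs2 x <= h by rewrite lerDl.
 have tn1 : t * n <= 1 by nra.
 rewrite expr2 -mulrA mulr_ile1 ?mulr_ge0 ?hs2_ge0 ?(ltW n0)//.
 by apply: le_trans th; rewrite ler_wpM2l.
Qed.

(** F_k(th) is Y_k between the powers -th/2 of D and D', and Y_k is an element of the ball between
    the powers th/2 of its own marginal densities. These densities are the [Ak] and [Ak'];
    [singular_sum_le1] bounds their total trace. *)
Lemma block_factor K A S (th dl : R) (D D' : A -> A -> C) (W W' : C -> A -> A -> C)
  (F : K -> C -> A * S -> A * S -> C) : 0 <= th <= 1 -> 0 < dl ->
 powers D W -> powers D' W' ->
 re (ktrace D) <= 1 -> re (ktrace D') <= 1 ->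
 (forall k p q, good (fun z => F k z p q)) ->
 (forall k y, opsq (F k (0 +i* y)) 1) ->
 (forall y (L L' : A -> A -> C) (B : K -> A * S -> A * S -> C),
  hs2 L <= 1 -> hs2 L' <= 1 -> (forall k, opsq (B k) 1) ->
  normc (\sum_k kpair (sand L (F k (1 +i* y)) L') (B k)) <= 1) ->
 exists (Ak Ak' : K -> A -> A -> C) (PA PA' : K -> C -> A -> A -> C)
  (x : K -> A * S -> A * S -> C),
 [/\ forall k, powers (Ak k) (PA k), forall k, powers (Ak' k) (PA' k),
   re (\sum_k ktrace (Ak k)) <= 1 + dl,
   re (\sum_k ktrace (Ak' k)) <= 1 + dl &
   forall k, Spball th (x k) /\
    F k th%:C = sand (kcomp (W ((- 2^-1)%:C * th%:C + 0)) (PA k ((2^-1)%:C * th%:C + 0)))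
     (x k) (kcomp (PA' k ((2^-1)%:C * th%:C + 0)) (W' ((- 2^-1)%:C * th%:C + 0)))].
Proof.
move=> /andP[th0 th1] dl0 PW PW' trD trD' Fg F0 F1.
(* One regularization e for each k and each diagonal entry: the total is at most dl, and the + 1
   covers empty index types. *)
pose e := dl / (#|K| * #|A| + 1)%:R.
have N0 : 0 < (#|K| * #|A| + 1)%:R :> R by rewrite ltr0n addn1.
have e0 : 0 < e by rewrite divr_gt0.
have eN : e * #|A|%:R * #|K|%:R <= dl.
 by rewrite -mulrA -natrM mulnC /e mulrAC ler_pdivrMr// ler_pM2l// ler_nat leq_addr.
have cancel T (E : T -> T -> C) X : powers E X ->
  kcomp (X ((- 2^-1)%:C * th%:C + 0)) (X ((2^-1)%:C * th%:C + 0)) = @kid T /\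
  kcomp (X ((2^-1)%:C * th%:C + 0)) (X ((- 2^-1)%:C * th%:C + 0)) = @kid T.
 by move=> PX; rewrite -!(pwD PX) -(pw0 PX); split; congr X; rewrite !rmorphN/=; ring.
(* At th = 0 the exponent 1/th has no meaning, but all powers are trivial: F_k(0) itself lies in the
   ball, and small multiples of the identity serve as densities. *)
move: th0; rewrite le_eqVlt => /orP[/eqP th00|th0].
 have ep : posdef (fun a a' : A => e%:C * (a == a')%:R : C).
  split.
   ext a a'; rewrite /kadj rmorphM/= natr_conj eq_sym; congr (_ * _).
   exact: conjc_real.
  exists e => // w; rewrite rmorphM/= n2_mulconj mulr_sumr /qform le_eqVlt; apply/orP; left; apply/eqP.
  eqs a.
  rewrite -(sum_deltal a (fun a' => e%:C * (w a * ((w a')^*)%R))).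
  by eqs a'; ring.
 have [P PP] := posdef_powers ep.
 exists (fun=> fun a a' : A => e%:C * (a == a')%:R), (fun=> fun a a' : A => e%:C * (a == a')%:R),
  (fun=> P), (fun=> P), (fun k => F k th%:C).
 have tr : re (\sum_(k : K) ktrace (fun a a' : A => e%:C * (a == a')%:R : C)) <= 1 + dl.
  rewrite Re_sum/=; under eq_bigr do rewrite /ktrace Re_sum/=.
  rewrite (eq_bigr (fun=> e * #|A|%:R)); last first.
   move=> k _; rewrite (eq_bigr (fun=> e)); first by rewrite sumr_const mulr_natr.
   by move=> a _; rewrite eqxx/= mulr1 mulr0 subr0.
  by rewrite sumr_const -[leLHS]mulr_natr (le_trans eN)// lerDr.
 split => // k; split; last first.
  have t0 c : c%:C * th%:C + 0 = 0 :> C by rewrite -th00 mulr0 addr0.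
  by rewrite !t0 (pw0 PW) (pw0 PW') (pw0 PP) !kcomp1l sand_id.
 have [c c0 hc] := S1b_HS (F k th%:C).
 (* exp (- l z) is 1 at z = 0 and has modulus min (1, c) on Re z = 1, which brings the constant
    family into the S_1 ball there. *)
 pose l := - ln (Num.min 1 c).
 have m0 : 0 < Num.min 1 c by rewrite lt_min ltr01.
 exists (fun z p q => cexp ((- l)%:C * z + 0) * F k th%:C p q); split.
 - by move=> p q; apply: goodM; [exact: good_cexp|exact: good_cst].
 - ext p q.
  by rewrite -[in cexp _]th00 mulr0 addr0 cexp0 mul1r.
 - move=> y; have h : opsq (F k th%:C) 1 by rewrite -th00; exact: F0.
  have := opsq_scale (cexp ((- l)%:C * (0 +i* y) + 0)) h.
  have -> : normc (cexp ((- l)%:C * (0 +i* y) + 0)) = 1.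
   by rewrite normc_cexp -[RHS]expR0; congr expR; rewrite /=; ring.
  by rewrite expr1n mulr1.
 - move=> y; have : S1b (fun p q => (Num.min 1 c)%:C * F k th%:C p q).
   by apply: hc; rewrite ?(ltW m0)// ge_min lexx orbT.
  have E : cexp ((- l)%:C * (1 +i* y) + 0) = (Num.min 1 c)%:C * cexp (0 +i* (- l * y)).
   have -> : (Num.min 1 c)%:C = cexp (ln (Num.min 1 c))%:C by rewrite cexp_real lnK ?posrE.
   rewrite -cexpD; congr cexp.
   by rewrite /l; simpc; congr (_ +i* _); ring.
  move=> h B b hb; have := opsq_scale (cexp (0 +i* (- l * y))) (h B b hb).
  rewrite (normc_cexp (0 +i* _)) expR0 expr1n mulr1; apply: opsq_ext => p q.
  rewrite /spair; sums s t.
  by rewrite E; ring.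
pose Y k (z : C) := sand (W ((2^-1)%:C * z + 0)) (F k z) (W' ((2^-1)%:C * z + 0)).
have /choice[V /choice[U /choice[sg hsvd]]] : forall k, exists V U (sg : A * S -> R), _ :=
 fun k => svd (Y k th%:C).
have sg0 k := let: And5 h _ _ _ _ := hsvd k in h.
have Uis k := let: And5 _ h _ _ _ := hsvd k in h.
have Uco k := let: And5 _ _ h _ _ := hsvd k in h.
have Vis k := let: And5 _ _ _ h _ := hsvd k in h.
have XE k := let: And5 _ _ _ _ h := hsvd k in h.
have sum1 := singular_sum_le1 th0 th1 PW PW' trD trD' Fg F0 F1 sg0 Uis Uco Vis XE.
have /choice[PA PPA] k := posdef_powers (marginal_posdef th e0 (sg k) (V k)).
have /choice[PA' PPA'] k := posdef_powers
 (marginal_posdef th e0 (sg k) (fun p r => ((U k r p)^*)%R)).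
exists (fun k => marginal th e (sg k) (V k)),
 (fun k => marginal th e (sg k) (fun p r => ((U k r p)^*)%R)), PA, PA',
 (fun k => sand (PA k ((- 2^-1)%:C * th%:C + 0)) (Y k th%:C) (PA' k ((- 2^-1)%:C * th%:C + 0))).
have nV k r : 0 < sg k r -> n2 (fun p => V k p r) = 1.
 move=> s0; apply: (@complexI R); rewrite n2_mulconj.
 by under eq_bigr do rewrite mulrC; rewrite Vis s0 eqxx.
have nU k r : 0 < sg k r -> n2 (fun p => ((U k r p)^*)%R) = 1.
 by move=> _; rewrite n2_conj n2_unitary_row.
have tot : \sum_k (\sum_r (if 0 < sg k r then expR (ln (sg k r) / th) else 0) + e * #|A|%:R) <= 1 + dl.
 by rewrite big_split/= lerD// sumr_const -[leLHS]mulr_natr.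
split => //.
- by rewrite Re_sum; under eq_bigr => k _ do rewrite (marginal_trace _ _ (nV k)).
- by rewrite Re_sum; under eq_bigr => k _ do rewrite (marginal_trace _ _ (nU k)).
- move=> k; split.
  exact: (@factor_ball A S th e th0 e0 (Y k th%:C) (V k) (U k) (sg k)).
 rewrite sand_comp -!kcompA (cancel _ _ _ (PPA k)).2 (kcompA (PA' k _)) (cancel _ _ _ (PPA' k)).1.
 rewrite kcomp1r kcomp1l /Y sand_comp (cancel _ _ _ PW).1 (cancel _ _ _ PW').2 sand_id//.
Qed.

End BlockDecomposition.

(** * An atom adapted to given weights *)

Section Oracle.

Lemma Spball_blockdiag K A S (th : R) (x : K -> A * S -> A * S -> C) :
 (forall k, Spball th (x k)) ->
 Spball th (fun u v : (K * A) * S =>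
  (u.1.1 == v.1.1)%:R * x u.1.1 (u.1.2, u.2) (v.1.2, v.2)).
Proof.
move=> /choice[f hf].
exists (fun z u v => (u.1.1 == v.1.1)%:R * f u.1.1 z (u.1.2, u.2) (v.1.2, v.2)); split.
- by move=> p q; apply: goodM; [exact: good_cst|case: (hf p.1.1)].
- by ext u v; case: (hf u.1.1) => _ -> _ _.
- move=> y; have := @opsq_blockdiag K _ _ (fun k => f k (0 +i* y)) 1.
 move=> /(_ (fun k => let: And4 _ _ h _ := hf k in h y)) h.
 have inj : injective (fun u : (K * A) * S => (u.1.1, (u.1.2, u.2))).
  by move=> [[a b] i] [[a' b'] i'] [-> -> ->].
 exact: (opsq_inj ler01 inj inj h).
- move=> y B b hb; have := @opsq_blockdiag K _ _ (fun k => spair (f k (1 +i* y)) b) 1.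
 move=> /(_ (fun k => let: And4 _ _ _ h := hf k in h y B b hb)) h.
 have inj : injective (fun u : (K * A) * B => (u.1.1, (u.1.2, u.2))).
  by move=> [[a b'] i] [[a' b''] i'] [-> -> ->].
 apply: opsq_ext (opsq_inj ler01 inj inj h) => u v /=.
 rewrite /spair; sums s.
 by sums t; rewrite mulrA.
Qed.

(** The last clause is the joint l_1(k; S_1) bound in dual form, with one contraction [B k] for each
    k and Hilbert-Schmidt coefficients on the outer index. *)
Definition blockfam K A S (F : K -> C -> A * S -> A * S -> C) : Prop :=
 [/\ forall k p q, good (fun z => F k z p q),
   forall k y, opsq (F k (0 +i* y)) 1 &
   forall y (L L' : A -> A -> C) (B : K -> A * S -> A * S -> C),
    hs2 L <= 1 -> hs2 L' <= 1 -> (forall k, opsq (B k) 1) ->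
    normc (\sum_k kpair (sand L (F k (1 +i* y)) L') (B k)) <= 1].

(** The partial trace of g^* g over D; [mg2] is the one over A. *)
Definition mg1 G A D (g : G -> A * D -> C) : A -> A -> C :=
 fun a a' => \sum_u \sum_d ((g u (a, d))^*)%R * g u (a', d).

Definition mg2 G A D (g : G -> A * D -> C) : D -> D -> C :=
 fun d d' => \sum_u \sum_a ((g u (a, d))^*)%R * g u (a, d').

Lemma mg1_trace G A D (g : G -> A * D -> C) :
 re (ktrace (mg1 g)) = hs2 g.
Proof.
have -> : ktrace (mg1 g) = (hs2 g)%:C; last by [].
rewrite /ktrace /mg1 exchange_big real_complex_sum; apply: eq_bigr => u _ /=.
rewrite real_complex_sum sum_pair; eqs a d.
by rewrite normc_mulconj mulrC.
Qed.

Lemma mg2_trace G A D (g : G -> A * D -> C) :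
 re (ktrace (mg2 g)) = hs2 g.
Proof.
have -> : ktrace (mg2 g) = (hs2 g)%:C; last by [].
rewrite /ktrace /mg2 exchange_big real_complex_sum; apply: eq_bigr => u _ /=.
rewrite real_complex_sum sum_pair exchange_big; eqs a d.
by rewrite normc_mulconj mulrC.
Qed.

(** g^* g >= dl, and the quadratic form of the marginal is a sum over d of the forms of g^* g at
    conj(w) (x) delta_d; the term of [d0] already gives the lower bound. *)
Lemma mg1_posdef G A D (g : G -> A * D -> C) (d0 : D) (dl : R) : 0 < dl ->
 (forall w, dl * n2 w <= n2 (fun u => \sum_p g u p * w p)) -> posdef (mg1 g).
Proof.
move=> dl0 hg; split.
 ext a a'; rewrite /kadj /mg1 rmorph_sum.
 eqs u; rewrite rmorph_sum; apply: eq_bigr => d _ /=.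
 by rewrite rmorphM/= conjCK mulrC.
exists dl => // w.
have E : qform (mg1 g) w =
  (\sum_d n2 (fun u => \sum_(p : A * D) g u p * ((d == p.2)%:R * ((w p.1)^*)%R)))%:C.
 rewrite real_complex_sum.
 under [RHS]eq_bigr => d _.
  rewrite (@n2_eq _ _ (fun u => \sum_a g u (a, d) * ((w a)^*)%R)); last first.
   move=> u; rewrite sum_pair; apply: eq_bigr => a _ /=.
   rewrite -(sum_deltal d (fun d' => g u (a, d') * ((w a)^*)%R)).
   by eqs d'; ring.
  rewrite n2_mulconj; over.
 rewrite /qform.
 transitivity (\sum_a \sum_a' \sum_u \sum_d w a * (((g u (a, d))^*)%R * g u (a', d)) * ((w a')^*)%R).
  eqs a a'; rewrite /mg1 mulr_sumr mulr_suml.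
  by eqs u; rewrite mulr_sumr mulr_suml.
 transitivity (\sum_d \sum_u \sum_a' \sum_a w a * (((g u (a, d))^*)%R * g u (a', d)) * ((w a')^*)%R).
  rewrite exchange_big; under eq_bigr => a' _ do rewrite exchange_big.
  rewrite exchange_big; under eq_bigr => u _ do under eq_bigr => a' _ do rewrite exchange_big.
  under eq_bigr => u _ do rewrite exchange_big.
  by rewrite exchange_big.
 eqs d u.
 sums a'; rewrite rmorph_sum/= mulr_sumr.
 by eqs a; rewrite rmorphM/= conjCK; ring.
rewrite E lerc_real (bigD1 d0)//= -[leLHS]addr0 lerD//; last first.
 by apply: sumr_ge0 => d _; exact: n2_ge0.
apply: le_trans (hg _); rewrite ler_pM2l// n2_swap (bigD1 d0)//= -[leLHS]addr0 lerD//.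
 by rewrite -n2_conj le_eqVlt; apply/orP; left; apply/eqP; apply: n2_eq => a; rewrite eqxx mul1r.
by apply: sumr_ge0 => d _; exact: n2_ge0.
Qed.

Lemma mg2_posdef G A D (g : G -> A * D -> C) (a0 : A) (dl : R) : 0 < dl ->
 (forall w, dl * n2 w <= n2 (fun u => \sum_p g u p * w p)) -> posdef (mg2 g).
Proof.
move=> dl0 hg; apply: (@mg1_posdef G D A (fun u p => g u (p.2, p.1)) a0 dl dl0) => w.
have bij : bijective (fun p : A * D => (p.2, p.1)).
 by exists (fun p : D * A => (p.2, p.1)) => -[].
rewrite -(n2_bij w bij); apply: le_trans (hg _) _.
apply: ler_eq; apply: n2_eq => u.
rewrite [RHS](reindex (fun p : A * D => (p.2, p.1)))/=; last exact: onW_bij.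
by apply: eq_bigr => -[].
Qed.

Lemma n2_diagblock G K A D (w : G -> K -> A -> D -> C) :
 n2 (fun p : G * ((K * A) * (K * D)) =>
  (p.2.1.1 == p.2.2.1)%:R * w p.1 p.2.1.1 p.2.1.2 p.2.2.2) =
 n2 (fun t : G * K * (A * D) => w t.1.1 t.1.2 t.2.1 t.2.2).
Proof.
rewrite /n2 sum_pair/= [RHS]sum_pair/= sum_pair; eqs u.
rewrite sum_pair/= sum_pair/=; eqs k; rewrite sum_pair/=; eqs a.
rewrite sum_pair/= -(sum_deltal k (fun k' => \sum_d normc (w u k a d) ^+ 2)).
eqs k'; sums d.
by rewrite normcM exprMn; case: (k == k'); rewrite ?normc1 ?expr1n// normc0 expr0n.
Qed.

(** Two uses of [block_factor], with the first marginals of g and h as densities for F and the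
    second ones for H. The inner indices are K x A and K x D, and a and b vanish unless both carry
    the same k. In g a the powers of both marginals meet, which is the situation of [marg_bound];
    likewise for b h. *)
Lemma oracle K S A D G (th dl : R) (F : K -> C -> A * S -> A * S -> C)
  (H : K -> C -> D * S -> D * S -> C) (g : G -> A * D -> C) (h : A * D -> G -> C) :
 0 <= th <= 1 -> 0 < dl -> blockfam F -> blockfam H ->
 posdef (mg1 g) -> posdef (mg2 g) ->
 posdef (mg1 (fun u p => h p u)) -> posdef (mg2 (fun u p => h p u)) ->
 hs2 g <= 1 -> hs2 h <= 1 ->
 exists (X Y : finType) (x : X * S -> X * S -> C) (y : Y * S -> Y * S -> C)
  (a : A * D -> X * Y -> C) (b : X * Y -> A * D -> C),
 [/\ Spball th x, Spball (1 - th) y,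
   forall p p' i j i' j', \sum_k F k th%:C (p.1, i) (p'.1, j) * H k (1 - th)%:C (p.2, i') (p'.2, j')
    = \sum_q \sum_q' a p q * x (q.1, i) (q'.1, j) * y (q.2, i') (q'.2, j') * b q' p',
   hs2 (kcomp g a) <= 1 + dl & hs2 (kcomp b h) <= 1 + dl].
Proof.
move=> th01 dl0 [Fg F0 F1] [Hg H0 H1] g1 g2 h1 h2 ng nh.
have th01' : 0 <= 1 - th <= 1 by move/andP: th01 => [? ?]; rewrite subr_ge0 gerBl; apply/andP.
have [W1 PW1] := posdef_powers g1; have [W2 PW2] := posdef_powers g2.
have [V1 PV1] := posdef_powers h1; have [V2 PV2] := posdef_powers h2.
have nh' : hs2 (fun u p => h p u) <= 1 by rewrite /hs2 exchange_big.
have [||Ak [Ak' [PA [PA' [x [PPA PPA' trA trA' hx]]]]]] :=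
 block_factor th01 dl0 PW1 (powers_tr PV1) _ _ Fg F0 F1.
- by rewrite mg1_trace.
- by rewrite (_ : ktrace _ = ktrace (mg1 (fun u p => h p u))) ?mg1_trace.
have [||Bk [Bk' [PB [PB' [y [PPB PPB' trB trB' hy]]]]]] :=
 block_factor th01' dl0 PW2 (powers_tr PV2) _ _ Hg H0 H1.
- by rewrite mg2_trace.
- by rewrite (_ : ktrace _ = ktrace (mg2 (fun u p => h p u))) ?mg2_trace.
pose a1 k := kcomp (W1 ((- 2^-1)%:C * th%:C + 0)) (PA k ((2^-1)%:C * th%:C + 0)).
pose a2 k := kcomp (W2 ((- 2^-1)%:C * (1 - th)%:C + 0)) (PB k ((2^-1)%:C * (1 - th)%:C + 0)).
pose b1 k := kcomp (PA' k ((2^-1)%:C * th%:C + 0)) (fun s t => V1 ((- 2^-1)%:C * th%:C + 0) t s).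
pose b2 k := kcomp (PB' k ((2^-1)%:C * (1 - th)%:C + 0))
 (fun s t => V2 ((- 2^-1)%:C * (1 - th)%:C + 0) t s).
exists (K * A)%type, (K * D)%type,
 (fun u v => (u.1.1 == v.1.1)%:R * x u.1.1 (u.1.2, u.2) (v.1.2, v.2)),
 (fun u v => (u.1.1 == v.1.1)%:R * y u.1.1 (u.1.2, u.2) (v.1.2, v.2)),
 (fun p q => (q.1.1 == q.2.1)%:R * (a1 q.1.1 p.1 q.1.2 * a2 q.1.1 p.2 q.2.2)),
 (fun q p => (q.1.1 == q.2.1)%:R * (b1 q.1.1 q.1.2 p.1 * b2 q.1.1 q.2.2 p.2)).
(* The exponents of the second factor, -(1 - th)/2 and (1 - th)/2, in the affine form that
   [marg_bound] interpolates. *)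
have args : (2^-1)%:C * th%:C + (- 2^-1)%:C = (- 2^-1)%:C * (1 - th)%:C + 0 :> C.
 by simpc; congr (_ +i* _); ring.
have args' : (- 2^-1)%:C * th%:C + (2^-1)%:C = (2^-1)%:C * (1 - th)%:C + 0 :> C.
 by simpc; congr (_ +i* _); ring.
have c0 : 0 < 1 + dl by rewrite addr_gt0.
split.
- by apply: Spball_blockdiag => k; case: (hx k).
- by apply: Spball_blockdiag => k; case: (hy k).
- move=> p p' i j i' j'.
 transitivity (\sum_k \sum_a \sum_a' \sum_d \sum_d'
   (a1 k p.1 a * x k (a, i) (a', j) * b1 k a' p'.1) *
   (a2 k p.2 d * y k (d, i') (d', j') * b2 k d' p'.2)).
  apply: eq_bigr => k _; rewrite (hx k).2 (hy k).2 !sandE/= mulr_suml.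
  apply: eq_bigr => a _; rewrite mulr_suml; apply: eq_bigr => a' _.
  rewrite mulr_sumr; apply: eq_bigr => d _; rewrite mulr_sumr; exact: eq_bigr.
 transitivity (\sum_k \sum_a \sum_k' \sum_d \sum_l \sum_a' \sum_l' \sum_d'
  (k == k')%:R * ((k == l)%:R * ((k' == l')%:R *
   ((a1 k p.1 a * x k (a, i) (a', j) * b1 k a' p'.1) *
   (a2 k p.2 d * y k' (d, i') (d', j') * b2 k d' p'.2))))); last first.
  rewrite sum_pair/= sum_pair; apply: eq_bigr => k _; apply: eq_bigr => a _.
  rewrite sum_pair/=; apply: eq_bigr => k' _; apply: eq_bigr => d _.
  rewrite sum_pair/= sum_pair; apply: eq_bigr => l _; apply: eq_bigr => a' _.
  rewrite sum_pair/=; apply: eq_bigr => l' _; apply: eq_bigr => d' _.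
  have [->|_] := eqVneq k k'; last by rewrite !mul0r.
  have [<-|_] := eqVneq k' l; last by rewrite !(mul0r, mulr0).
  by case: (k' == l') => /=; ring.
 apply: eq_bigr => k _; apply: eq_bigr => a _.
 transitivity (\sum_k' (k == k')%:R * \sum_d \sum_l (k == l)%:R * \sum_a' \sum_l' (k' == l')%:R *
  \sum_d' ((a1 k p.1 a * x k (a, i) (a', j) * b1 k a' p'.1) *
   (a2 k p.2 d * y k' (d, i') (d', j') * b2 k d' p'.2))).
  rewrite sum_deltal exchange_big; apply: eq_bigr => d _ /=.
  by rewrite sum_deltal; apply: eq_bigr => a' _; rewrite sum_deltal.
 apply: eq_bigr => k' _; rewrite mulr_sumr; apply: eq_bigr => d _.
 rewrite mulr_sumr; apply: eq_bigr => l _; rewrite !mulr_sumr; apply: eq_bigr => a' _.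
 rewrite !mulr_sumr; apply: eq_bigr => l' _; rewrite !mulr_sumr; apply: eq_bigr => d' _.
 by [].
- rewrite hs2_n2.
 have := @marg_bound G A D K g W1 W2 PA PB Ak Bk th (1 + dl) PW1 PW2 PPA PPB trA trB th01 c0.
 rewrite args args'; apply: le_trans.
 have := n2_diagblock (fun u k a d => \sum_a' \sum_d' g u (a', d') *
   kcomp (W1 ((- 2^-1)%:C * th%:C + 0)) (PA k ((2^-1)%:C * th%:C + 0)) a' a *
   kcomp (W2 ((- 2^-1)%:C * (1 - th)%:C + 0)) (PB k ((2^-1)%:C * (1 - th)%:C + 0)) d' d).
 move=> <-; rewrite le_eqVlt; apply/orP; left; apply/eqP.
 apply: n2_eq => -[u [[k a] [k' d]]] /=; rewrite /kcomp sum_pair mulr_sumr.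
 apply: eq_bigr => a' _; rewrite mulr_sumr; apply: eq_bigr => d' _ /=.
 by rewrite -/(kcomp _ _ a' a) -/(kcomp _ _ d' d) /a1 /a2; ring.
- rewrite hs2_n2.
 have := @marg_bound G A D K (fun u p => h p u) V1 V2 (fun k z s t => PA' k z t s)
  (fun k z s t => PB' k z t s) (fun k s t => Ak' k t s) (fun k s t => Bk' k t s) th (1 + dl)
  PV1 PV2 (fun k => powers_tr (PPA' k)) (fun k => powers_tr (PPB' k)) trA' trB' th01 c0.
 rewrite args args'; apply: le_trans.
 have := n2_diagblock (fun u k a d => \sum_a' \sum_d' h (a', d') u *
   kcomp (V1 ((- 2^-1)%:C * th%:C + 0)) (fun s t => PA' k ((2^-1)%:C * th%:C + 0) t s) a' a *
   kcomp (V2 ((- 2^-1)%:C * (1 - th)%:C + 0))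
    (fun s t => PB' k ((2^-1)%:C * (1 - th)%:C + 0) t s) d' d).
 move=> <-.
 have bij : bijective (fun p : G * ((K * A) * (K * D)) => (p.2, p.1)).
  by exists (fun p : ((K * A) * (K * D)) * G => (p.2, p.1)) => -[].
 rewrite -(n2_bij _ bij) le_eqVlt; apply/orP; left; apply/eqP.
 apply: n2_eq => -[u [[k a] [k' d]]] /=; rewrite {1}/kcomp sum_pair mulr_sumr.
 apply: eq_bigr => a' _; rewrite mulr_sumr; apply: eq_bigr => d' _ /=.
 have e1 : b1 k a a' = kcomp (V1 ((- 2^-1)%:C * th%:C + 0))
   (fun s t => PA' k ((2^-1)%:C * th%:C + 0) t s) a' a.
  by rewrite /b1 /kcomp; apply: eq_bigr => r _; exact: mulrC.
 have e2 : b2 k d d' = kcomp (V2 ((- 2^-1)%:C * (1 - th)%:C + 0))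
   (fun s t => PB' k ((2^-1)%:C * (1 - th)%:C + 0) t s) d' d.
  by rewrite /b2 /kcomp; apply: eq_bigr => r _; exact: mulrC.
 by rewrite -e1 -e2; ring.
Qed.

End Oracle.

(** * Separation of a point from a convex set *)

Section Separation.

(** The limit is the supremum of the eventual lower bounds. *)
Lemma real_cauchy (u : nat -> R) :
 (forall e : R, 0 < e -> exists N : nat, forall m n, (N <= m)%N -> (N <= n)%N -> `|u m - u n| <= e) ->
 exists l : R, forall e : R, 0 < e -> exists N : nat, forall n, (N <= n)%N -> `|u n - l| <= e.
Proof.
move=> cu; pose E := [set x : R | exists N : nat, forall n, (N <= n)%N -> x <= u n].
exists (sup E) => e e0; have e20 : 0 < e / 2 by rewrite divr_gt0.
have [N hN] := cu _ e20.
have inE : E (u N - e / 2).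
 by exists N => n Nn; have := hN N n (leqnn N) Nn; rewrite ler_distlC => /andP[]; lra.
have ubE : ubound E (u N + e / 2).
 move=> x [M hM]; have := hM (maxn M N) (leq_maxl _ _).
 have := hN (maxn M N) N (leq_maxr _ _) (leqnn N); rewrite ler_distl => /andP[]; lra.
have h1 : u N - e / 2 <= sup E by apply: ub_le_sup => //; exists (u N + e / 2).
have h2 : sup E <= u N + e / 2 by apply: ge_sup => //; exists (u N - e / 2).
exists N => n Nn; have := hN n N Nn (leqnn N); rewrite !ler_distl => /andP[a b].
by apply/andP; split; lra.
Qed.

Lemma inv_small (e : R) : 0 < e -> exists N : nat, forall n, (N <= n)%N -> n.+1%:R^-1 <= e.
Proof.
move=> e0; have e'0 : 0 <= e^-1 by rewrite invr_ge0 ltW.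
exists (Num.bound e^-1) => n hn.
rewrite -[e]invrK lef_pV2 ?posrE ?invr_gt0//.
apply: (le_trans (ltW (archi_boundP e'0))); rewrite ler_nat.
exact: leq_trans hn _.
Qed.

(** A minimizing sequence for the distance from v to K is Cauchy by the parallelogram identity. Its
    coordinatewise limit [kap], possibly outside K, gives the functional w = kap - v. *)
Lemma separation T (K : set (T -> R)) (v : T -> R) (rho : R) : 0 < rho ->
 (exists k, K k) ->
 (forall k l t, K k -> K l -> 0 <= t <= 1 -> K (fun i => t * k i + (1 - t) * l i)) ->
 (forall k, K k -> rho <= \sum_i (k i - v i) ^+ 2) ->
 exists w : T -> R, forall k, K k -> \sum_i w i * v i + rho <= \sum_i w i * k i.
Proof.
move=> rho0 [k0 Kk0] conv far.
pose q (k : T -> R) := \sum_i (k i - v i) ^+ 2.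
pose Q := [set q k | k in K].
have hQ : has_inf Q.
 by split; [exists (q k0), k0|exists rho => _ [k Kk <-]; exact: far].
pose d := inf Q.
have dle k : K k -> d <= q k by move=> Kk; apply: ge_inf; [exact: hQ.2|exists k].
have /choice[k_ hk] : forall n : nat, exists k, K k /\ q k <= d + n.+1%:R^-1.
 move=> n; have n0 : 0 < (n.+1%:R^-1 : R) by rewrite invr_gt0.
 by have [_ [k Kk <-] hk] := inf_adherent n0 hQ; exists k; split => //; exact: ltW.
have par m n : \sum_i (k_ m i - k_ n i) ^+ 2 <= 2 * (m.+1%:R^-1 + n.+1%:R^-1).
 have e : \sum_i (k_ m i - k_ n i) ^+ 2 = 2 * q (k_ m) + 2 * q (k_ n)
   - 4 * q (fun i => 2^-1 * k_ m i + (1 - 2^-1) * k_ n i).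
  by rewrite /q !mulr_sumr -big_split/= -sumrB; eqs i; field.
 have := dle _ (conv _ _ 2^-1 (hk m).1 (hk n).1 _).
 have h2 : 0 <= (2^-1 : R) <= 1 by lra.
 move=> /(_ h2); have := (hk m).2; have := (hk n).2; rewrite e; move: (m.+1%:R^-1) (n.+1%:R^-1) (q _) (q _) (q _) => a b x y z; lra.
have /choice[kap hkap] : forall i, exists l : R, forall e : R, 0 < e ->
  exists N : nat, forall n, (N <= n)%N -> `|k_ n i - l| <= e.
 move=> i; apply: real_cauchy => e e0.
 have e2 : 0 < e ^+ 2 / 4 by rewrite divr_gt0// exprn_gt0.
 have [N hN] := inv_small e2; exists N => m n Nm Nn.
 rewrite -(@ler_pXn2r _ 2) ?nnegrE ?(ltW e0)// real_normK ?num_real//.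
 have := hN m Nm; have := hN n Nn; have := par m n => h1 h2 h3.
 have : (k_ m i - k_ n i) ^+ 2 <= \sum_i (k_ m i - k_ n i) ^+ 2.
  by rewrite (bigD1 i)//= lerDl sumr_ge0// => j _; exact: sqr_ge0.
 move: h1 h2 h3; move: (m.+1%:R^-1) (n.+1%:R^-1) (_ ^+ 2) (\sum_i _) (_ ^+ 2) => a b x y z; lra.
exists (fun i => kap i - v i) => k Kk.
suff : rho <= \sum_i (kap i - v i) * (k i - v i).
 under eq_bigr do rewrite mulrBr; rewrite sumrB; lra.
rewrite leNgt; apply/negP => lt; set L := \sum_i _ in lt.
pose e := rho - L; have e0 : 0 < e by rewrite subr_gt0.
pose M := 2 * q k + 2 * (d + 1).
have q0 l : 0 <= q l by apply: sumr_ge0 => i _; exact: sqr_ge0.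
have d0 : rho <= d by apply: lb_le_inf; [exact: hQ.1|move=> _ [l Kl <-]; exact: far].
have M0 : 0 < M by rewrite /M; have := q0 k; lra.
(* Moving from [k_ n] towards k by t lowers the squared distance by at least 3 t e / 2 to first
   order; this t keeps the second-order term t^2 M below t e / 4. *)
pose t := Num.min 1 (e / (4 * M)).
have t0 : 0 < t by rewrite lt_min ltr01 divr_gt0// mulr_gt0.
have t1 : t <= 1 by rewrite ge_min lexx.
have tM : t * M <= e / 4.
 have : t <= e / (4 * M) by rewrite ge_min lexx orbT.
 by rewrite ler_pdivlMr ?mulr_gt0//; lra.
pose S := \sum_i `|k i - v i| + 1.
have S0 : 0 < S by rewrite ltr_wpDl// sumr_ge0.
have close : exists N : nat, forall n, (N <= n)%N -> forall i, `|k_ n i - kap i| <= e / (4 * S).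
 have eS : 0 < e / (4 * S) by rewrite divr_gt0// mulr_gt0.
 have /choice[N hN] i := hkap i _ eS.
 exists (\max_i N i)%N => n hn i; apply: hN; apply: leq_trans hn; exact: leq_bigmax.
have [N1 hN1] := close.
(* The minimization error of [k_ n] has to be small compared with t e, not only with e. *)
have [N2 hN2] := inv_small (mulr_gt0 t0 (divr_gt0 e0 (ltr0Sn R 3))).
pose n := maxn N1 N2.
have hn1 i : `|k_ n i - kap i| <= e / (4 * S) by apply: hN1; rewrite leq_maxl.
have hn2 : n.+1%:R^-1 <= t * (e / 4) by apply: hN2; rewrite leq_maxr.
have [Kn qn'] := hk n.
have n1' : n.+1%:R^-1 <= 1 :> R by rewrite invf_le1// ler1n.
have [nn [qn hn2' n1]] : exists nn : R, [/\ q (k_ n) <= d + nn, nn <= t * (e / 4) & nn <= 1].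
 by exists (n.+1%:R^-1); split.
have A1 : \sum_i (k_ n i - v i) * (k i - v i) <= L + e / 4.
 have -> : \sum_i (k_ n i - v i) * (k i - v i) =
   L + \sum_i (k_ n i - kap i) * (k i - v i).
  by rewrite /L -big_split/=; eqs i; ring.
 rewrite lerD2l; apply: le_trans (ler_norm _) _; apply: le_trans (ler_norm_sum _ _ _) _.
 letr (\sum_i e / (4 * S) * `|k i - v i|).
  by apply: ler_sum => i _; rewrite normrM ler_wpM2r.
 rewrite -mulr_sumr; letr (e / (4 * S) * S).
  by rewrite ler_wpM2l ?lerDl// divr_ge0 ?(ltW e0)// mulr_ge0// ltW.
 by apply: ler_eq; field; rewrite gt_eqF.
have A2 : d <= q (k_ n) + 2 * t * \sum_i (k_ n i - v i) * (k i - k_ n i) + t ^+ 2 * M.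
 have := dle _ (conv _ _ t Kk Kn _); rewrite (ltW t0) t1 => /(_ isT) h; apply: le_trans h _.
 have -> : q (fun i => t * k i + (1 - t) * k_ n i) =
   q (k_ n) + 2 * t * (\sum_i (k_ n i - v i) * (k i - k_ n i)) + t ^+ 2 * \sum_i (k i - k_ n i) ^+ 2.
  by rewrite /q !mulr_sumr -!big_split/=; eqs i; ring.
 rewrite lerD2l ler_wpM2l ?sqr_ge0//.
 letr (2 * q k + 2 * q (k_ n)); last by rewrite /M lerD2l ler_pM2l// (le_trans qn)// lerD2l.
 rewrite /q !mulr_sumr -big_split/=; apply: ler_sum => i _.
 have := sqr_ge0 (k i + k_ n i - 2 * v i); nra.
have A3 : \sum_i (k_ n i - v i) * (k i - v i) =
  q (k_ n) + \sum_i (k_ n i - v i) * (k i - k_ n i).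
 by rewrite /q -big_split/=; eqs i; ring.
set I := \sum_i (k_ n i - v i) * (k i - k_ n i) in A2 A3.
have A4 : - (2 * I) <= e / 4 + t * M.
 rewrite -(ler_pM2l t0); have h4 : t ^+ 2 * M = t * (t * M) by ring.
 by move: A2 qn hn2'; rewrite h4; move: (t * M) (q _) => a b; lra.
have := far _ Kn; rewrite -/(q (k_ n)) => far1.
by move: A1; rewrite A3 /e in tM A4 *; rewrite /e; lra.
Qed.

End Separation.

(** * From weighted bounds to operator norm bounds *)

Section Minimax.

Definition dsum (S1 T1 S2 T2 : Type) (K1 : S1 -> T1 -> C) (K2 : S2 -> T2 -> C)
  (s : S1 + S2) (t : T1 + T2) : C :=
 match s, t with
 | inl s, inl t => K1 s t
 | inr s, inr t => K2 s t
 | _, _ => 0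
 end.

Lemma n2_sum S T (v : S + T -> C) :
 n2 v = n2 (fun s => v (inl s)) + n2 (fun t => v (inr t)).
Proof. by rewrite /n2 big_sumType. Qed.

Lemma n2_null T (v : T -> C) : (forall t, v t = 0) -> n2 v = 0.
Proof. by move=> h; rewrite /n2 big1// => t _; rewrite h normc0 expr0n. Qed.

Lemma opsq_dsum S1 T1 S2 T2 (K1 : S1 -> T1 -> C) (K2 : S2 -> T2 -> C) c :
 opsq K1 c -> opsq K2 c -> opsq (dsum K1 K2) c.
Proof.
move=> h1 h2 v; rewrite !n2_sum mulrDr; apply: lerD.
 apply: le_trans (h1 (fun t => v (inl t))).
 apply: ler_eq; apply: n2_eq => s.
 by rewrite big_sumType/= [X in _ + X]big1 ?addr0// => t _; rewrite mul0r.
apply: le_trans (h2 (fun t => v (inr t))).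
apply: ler_eq; apply: n2_eq => s.
by rewrite big_sumType/= big1 ?add0r// => t _; rewrite mul0r.
Qed.

Definition sumdistr (S1 S2 T : Type) (p : (S1 + S2) * T) : S1 * T + S2 * T :=
 match p with (inl s, t) => inl (s, t) | (inr s, t) => inr (s, t) end.

Lemma sumdistr_inj (S1 S2 T : Type) : injective (@sumdistr S1 S2 T).
Proof. by move=> [[s|s] t] [[s'|s'] t'] //= [-> ->]. Qed.

Definition mxsum (A1 A2 S : Type) (x1 : A1 * S -> A1 * S -> C) (x2 : A2 * S -> A2 * S -> C) :
 (A1 + A2) * S -> (A1 + A2) * S -> C := fun p q => dsum x1 x2 (sumdistr p) (sumdistr q).

Lemma opsq_mxsum A1 A2 S (x1 : A1 * S -> A1 * S -> C) (x2 : A2 * S -> A2 * S -> C) :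
 opsq x1 1 -> opsq x2 1 -> opsq (mxsum x1 x2) 1.
Proof.
move=> h1 h2.
exact: (opsq_inj ler01 (@sumdistr_inj _ _ _) (@sumdistr_inj _ _ _) (opsq_dsum h1 h2)).
Qed.

Lemma S1b_mxsum A1 A2 S (x1 : A1 * S -> A1 * S -> C) (x2 : A2 * S -> A2 * S -> C) :
 S1b x1 -> S1b x2 -> S1b (mxsum x1 x2).
Proof.
move=> h1 h2 B b hb.
have := opsq_inj ler01 (@sumdistr_inj _ _ _) (@sumdistr_inj _ _ _) (opsq_dsum (h1 B b hb) (h2 B b hb)).
apply: opsq_ext => -[[s|s] t] [[s'|s'] t'] //=; rewrite /spair big1// => u _; rewrite big1// => v _;
 by rewrite mul0r.
Qed.

Lemma Spball_mxsum A1 A2 S (th : R) (x1 : A1 * S -> A1 * S -> C)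
  (x2 : A2 * S -> A2 * S -> C) :
 Spball th x1 -> Spball th x2 -> Spball th (mxsum x1 x2).
Proof.
move=> [f1 [g1 <- f10 f11]] [f2 [g2 <- f20 f21]].
exists (fun z => mxsum (f1 z) (f2 z)); split => //.
- move=> [[s|s] t] [[s'|s'] t'];
  [exact: g1|exact: good_cst|exact: good_cst|exact: g2].
- by move=> y; exact: opsq_mxsum.
- by move=> y; exact: S1b_mxsum.
Qed.

Definition gram P Q (a : P -> Q -> C) : P -> P -> C :=
 fun p p' => \sum_q a p q * ((a p' q)^*)%R.

Lemma gram_qform P Q (a : P -> Q -> C) w :
 qform (gram a) w = (n2 (fun q => \sum_p w p * a p q))%:C.
Proof.
rewrite n2_mulconj.
transitivity (\sum_p \sum_p' \sum_q w p * (a p q * ((a p' q)^*)%R) * ((w p')^*)%R).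
 by eqs p p'; rewrite mulr_sumr mulr_suml.
under eq_bigr do rewrite exchange_big.
rewrite exchange_big; eqs q; sums p.
rewrite rmorph_sum; sums p'; ring.
Qed.

Lemma gram_kid P : gram (@kid P) = @kid P.
Proof.
ext p p'; rewrite /gram.
under eq_bigr do rewrite natr_conj.
by rewrite sum_deltal eq_sym.
Qed.

Lemma kpair_gram P Q (Om : P -> P -> C) (a : P -> Q -> C) :
 kpair Om (gram a) = \sum_q qform Om (fun p => a p q).
Proof.
rewrite /kpair.
under eq_bigr => p _ do under eq_bigr => p' _ do rewrite mulr_sumr.
under eq_bigr do rewrite exchange_big.
rewrite exchange_big; eqs q p; eqs p'; ring.
Qed.

Definition herm P (Om : P -> P -> C) : P -> P -> C :=
 fun p p' => (2^-1)%:C * (Om p p' + ((Om p' p)^*)%R).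

Lemma herm_adj P (Om : P -> P -> C) : kadj (herm Om) = herm Om.
Proof.
ext p p'; rewrite /kadj rmorphM rmorphD/= conjCK addrC.
by congr (_ * _); exact: conjc_real.
Qed.

Lemma herm_qform P (Om : P -> P -> C) w :
 qform (herm Om) w = (re (qform Om w))%:C.
Proof.
have -> : qform (herm Om) w = (2^-1)%:C * (qform Om w + ((qform Om w)^*)%R).
 rewrite rmorph_sum.
 under [in X in _ + X]eq_bigr do rewrite rmorph_sum.
 rewrite [in X in _ + X]exchange_big/= -big_split/=; sums p.
 rewrite -big_split/=; sums p'.
 by rewrite /herm !rmorphM/= conjCK; ring.
have cE (z : C) : (z^*)%R = re z +i* - im z by case: z.
case: (qform Om w) => u v /=.
by congr (_ +i* _); field.
Qed.

Lemma ud_qform P (M U : P -> P -> C) (d : P -> R) w : unitary_diag M U d ->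
 qform M w = (\sum_r d r * normc (\sum_p w p * ((U r p)^*)%R) ^+ 2)%:C.
Proof.
move=> ud; rewrite real_complex_sum.
transitivity (\sum_p \sum_p' \sum_r w p * (((U r p)^*)%R * (d r)%:C * U r p') * ((w p')^*)%R).
 by eqs p p'; rewrite (ud_eq ud) mulr_sumr mulr_suml.
under eq_bigr do rewrite exchange_big.
rewrite exchange_big; eqs r.
rewrite rmorphM/= normc_mulconj; sums p.
rewrite rmorph_sum !mulr_sumr; eqs p'; rewrite rmorphM/= conjCK; ring.
Qed.

Lemma ud_pair P Q (Om U : P -> P -> C) (d : P -> R) (a : P -> Q -> C) :
 unitary_diag (herm Om) U d ->
 re (kpair Om (gram a)) =
 \sum_r d r * n2 (fun q => \sum_p a p q * ((U r p)^*)%R).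
Proof.
move=> ud; rewrite kpair_gram Re_sum.
transitivity (\sum_q \sum_r d r * normc (\sum_p a p q * ((U r p)^*)%R) ^+ 2).
 eqs q; apply: (@complexI R).
 by rewrite -herm_qform (ud_qform _ ud).
by rewrite exchange_big; eqs r; rewrite mulr_sumr.
Qed.

Lemma ud_trace P (Om U : P -> P -> C) (d : P -> R) :
 unitary_diag (herm Om) U d -> re (kpair Om (@kid P)) = \sum_r d r.
Proof.
move=> ud; rewrite -gram_kid (ud_pair _ ud); eqs r.
rewrite -[RHS]mulr1 -(n2_unitary_row r (ud_coisom ud)) -(n2_conj (U r)).
by congr (_ * _); apply: n2_eq => q; rewrite sum_deltar.
Qed.

Lemma qform_HS P (N : P -> P -> C) w (e : R) : 0 <= e -> hs2 N <= e ^+ 2 ->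
 re (qform N w) <= e * n2 w.
Proof.
move=> e0 hN; apply: le_trans (ler_norm _) _; apply: le_trans (Re_le_normc _) _.
have hs : opsq N (e ^+ 2) by apply: opsq_le hN _; exact: opsq_HS.
have := (opsq_bil N (sqr_ge0 e)).1 hs w (fun t => ((w t)^*)%R).
rewrite n2_conj -exprMn => h.
by rewrite -(@ler_pXn2r _ 2) ?nnegrE ?mulr_ge0.
Qed.

(** A pair of complex kernels coded as one real vector, to which [separation] applies: the first
    boolean chooses the kernel, the last one the real or the imaginary part. *)
Definition oker (P : Type) (k : bool * (P * P * bool) -> R) (s : bool) (p p' : P) : C :=
 k (s, (p, p', true)) +i* k (s, (p, p', false)).

Definition unoker (P : Type) (M : bool -> P -> P -> C) (t : bool * (P * P * bool)) : R :=
 if t.2.2 then re (M t.1 t.2.1.1 t.2.1.2) else im (M t.1 t.2.1.1 t.2.1.2).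

Lemma unokerK (P : Type) (M : bool -> P -> P -> C) s : oker (unoker M) s = M s.
Proof. by ext p p'; rewrite /oker /unoker/=; case: (M s p p'). Qed.

Lemma oker_pair P (w k : bool * (P * P * bool) -> R) :
 \sum_t w t * k t =
 \sum_s re (kpair (fun p p' => ((oker w s p p')^*)%R) (oker k s)).
Proof.
rewrite sum_pair/=; eqs s; rewrite sum_pair/= sum_pair/= Re_sum.
eqs p; rewrite Re_sum; eqs p'.
have cE (z : C) : (z^*)%R = re z +i* - im z by case: z.
by rewrite big_bool; simpc => /=.
Qed.

Lemma oker_hs2 P (k : bool * (P * P * bool) -> R) s :
 hs2 (oker k s) <= \sum_t k t ^+ 2.
Proof.
rewrite sum_pair (bigD1 s)//= -[leLHS]addr0 lerD//; last first.
 by apply: sumr_ge0 => ? _; apply: sumr_ge0 => ? _; exact: sqr_ge0.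
rewrite sum_pair/= sum_pair/= le_eqVlt; apply/orP; left; apply/eqP.
by eqs p p'; rewrite normc_sq big_bool.
Qed.

Lemma qformD P (M N : P -> P -> C) w :
 qform (fun p p' => M p p' + N p p') w = qform M w + qform N w.
Proof.
rewrite -big_split; eqs p; rewrite -big_split; apply: eq_bigr => p' _ /=; ring.
Qed.

Lemma qformZ P (M : P -> P -> C) (c : R) w :
 re (qform (fun p p' => c%:C * M p p') w) = c * re (qform M w).
Proof.
have -> : qform (fun p p' => c%:C * M p p') w = c%:C * qform M w.
 sums p; rewrite mulr_sumr.
 by apply: eq_bigr => p' _ /=; ring.
by case: (qform M w) => u v; simpc.
Qed.

Lemma qform_kid P (w : P -> C) : qform (@kid P) w = (n2 w)%:C.
Proof.
rewrite -gram_kid gram_qform; congr (_%:C); apply: n2_eq => q.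
by under eq_bigr do rewrite mulrC; rewrite sum_deltar.
Qed.

Lemma kpairD S T (M N L : S -> T -> C) :
 kpair L (fun p p' => M p p' + N p p') = kpair L M + kpair L N.
Proof.
rewrite -big_split; eqs p; rewrite -big_split; apply: eq_bigr => p' _ /=; ring.
Qed.

Lemma kpairZ S T (M L : S -> T -> C) (c : R) :
 re (kpair L (fun p p' => c%:C * M p p')) = c * re (kpair L M).
Proof.
have -> : kpair L (fun p p' => c%:C * M p p') = c%:C * kpair L M.
 sums p; rewrite mulr_sumr.
 by apply: eq_bigr => p' _ /=; ring.
by case: (kpair L M) => u v; simpc.
Qed.

Variables (K S A D : finType) (th : R) (F : K -> C -> A * S -> A * S -> C)
 (H : K -> C -> D * S -> D * S -> C).
Hypothesis th01 : 0 <= th <= 1.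
Hypotheses (bF : blockfam F) (bH : blockfam H).

(** The sum over k as a single atom. Bounds on a and b are kept apart, since they are what the
    minimax improves. *)
Record decomp (X Y : finType) (x : X * S -> X * S -> C) (y : Y * S -> Y * S -> C)
  (a : A * D -> X * Y -> C) (b : X * Y -> A * D -> C) : Prop := Decomp {
 dec_l : Spball th x;
 dec_r : Spball (1 - th) y;
 dec_eq : forall p p' i j i' j',
  \sum_k F k th%:C (p.1, i) (p'.1, j) * H k (1 - th)%:C (p.2, i') (p'.2, j')
  = \sum_q \sum_q' a p q * x (q.1, i) (q'.1, j) * y (q.2, i') (q'.2, j') * b q' p' }.

(** A square root of the weight with eigenvalues d and eigenvectors the rows of U. *)
Definition wdiag (d : A * D -> R) (U : A * D -> A * D -> C) : A * D -> A * D -> C :=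
 fun r p => (Num.sqrt (d r))%:C * ((U r p)^*)%R.

Lemma wdiag_n2 d U (w : A * D -> C) : (forall r, 0 <= d r) ->
 n2 (fun r => \sum_p wdiag d U r p * w p) =
 \sum_r d r * normc (\sum_p w p * ((U r p)^*)%R) ^+ 2.
Proof.
move=> d0; eqs r.
under eq_bigr do rewrite -mulrA [X in _ * X]mulrC.
by rewrite -mulr_sumr normcM exprMn normc_real real_normK ?num_real// sqr_sqrtr.
Qed.

Lemma unitary_n2 T (U : T -> T -> C) (w : T -> C) :
 kcomp (kadj U) U = @kid T ->
 \sum_r normc (\sum_p w p * ((U r p)^*)%R) ^+ 2 = n2 w.
Proof.
move=> UU; apply: (@complexI R); rewrite real_complex_sum n2_mulconj.
under eq_bigr do rewrite normc_mulconj rmorph_sum/= mulr_suml.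
transitivity (\sum_p \sum_p' w p * ((w p')^*)%R * \sum_r ((U r p)^*)%R * U r p').
 rewrite exchange_big; eqs p.
 under eq_bigr do rewrite mulr_sumr.
 rewrite exchange_big; eqs p'; sums r.
 by rewrite rmorphM/= conjCK; ring.
eqs p.
have E p' : \sum_r ((U r p)^*)%R * U r p' = (p == p')%:R.
 by have := congr1 (fun k => k p p') UU.
under eq_bigr do rewrite E mulrC.
by rewrite sum_deltal.
Qed.

Lemma wdiag_posdef1 d U (dl : R) (q : A * D) : 0 < dl -> (forall r, dl <= d r) ->
 kcomp (kadj U) U = @kid _ ->
 posdef (mg1 (wdiag d U)) /\ posdef (mg2 (wdiag d U)).
Proof.
move=> dl0 dld UU.
have h w : dl * n2 w <= n2 (fun u => \sum_p wdiag d U u p * w p).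
 rewrite wdiag_n2; last by move=> r; apply: le_trans (dld r).
 rewrite -(unitary_n2 w UU) mulr_sumr; apply: ler_sum => r _.
 by rewrite ler_wpM2r// sqr_ge0.
by split; [exact: (mg1_posdef q.2 dl0 h)|exact: (mg2_posdef q.1 dl0 h)].
Qed.

Lemma wdiag_hs2 d U : (forall r, 0 <= d r) -> kcomp U (kadj U) = @kid _ ->
 hs2 (wdiag d U) = \sum_r d r.
Proof.
move=> d0 UU; eqs r.
have := n2_unitary_row r UU; rewrite /n2 => e; rewrite -[RHS]mulr1 -e mulr_sumr.
eqs p.
by rewrite normcM exprMn normc_real real_normK ?num_real// sqr_sqrtr// normc_conj.
Qed.

Lemma hs2_kadj (V : finType) T (L : V -> T -> C) : hs2 (kadj L) = hs2 L.
Proof.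
by rewrite /hs2 exchange_big; eqs s t; rewrite normc_conj.
Qed.

(** [oracle] for weights in spectral form; the lower bound m makes their marginals positive
    definite. *)
Lemma oracle_diag (q : A * D) (dl m : R) (U U' : A * D -> A * D -> C) (d d' : A * D -> R) :
 0 < dl -> 0 < m -> (forall r, m <= d r) -> (forall r, m <= d' r) ->
 kcomp (kadj U) U = @kid _ -> kcomp U (kadj U) = @kid _ ->
 kcomp (kadj U') U' = @kid _ -> kcomp U' (kadj U') = @kid _ ->
 \sum_r d r <= 1 -> \sum_r d' r <= 1 ->
 exists (X Y : finType) x y a b, [/\ @decomp X Y x y a b,
  \sum_r d r * n2 (fun q => \sum_p a p q * ((U r p)^*)%R) <= 1 + dl &
  \sum_r d' r * n2 (fun q => \sum_p kadj b p q * ((U' r p)^*)%R) <= 1 + dl].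
Proof.
move=> dl0 m0 md md' UU UU2 VV VV2 sd sd'.
have d0 r : 0 <= d r by apply: le_trans (md r).
have d'0 r : 0 <= d' r by apply: le_trans (md' r).
have [g1 g2] := wdiag_posdef1 q m0 md UU; have VVc : kcomp (kadj (fun r p => ((U' r p)^*)%R)) (fun r p => ((U' r p)^*)%R) = @kid _.
 ext s t.
 have := congr1 (fun k => ((k s t)^*)%R) VV; rewrite /kid natr_conj => <-.
 by rewrite rmorph_sum; eqs r; rewrite rmorphM.
have [h1 h2] := wdiag_posdef1 q m0 md' VVc.
have kh : (fun u p => kadj (wdiag d' U') p u) = wdiag d' (fun r p => ((U' r p)^*)%R).
 ext u p; rewrite /kadj rmorphM/=.
 by congr (_ * _); exact: conjc_real.
have [||||X [Y [x [y [a [b [hx hy e1 e2 e3]]]]]]] :=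
 @oracle K S A D (A * D)%type th dl F H (wdiag d U) (kadj (wdiag d' U')) th01 dl0 bF bH g1 g2.
- by rewrite kh.
- by rewrite kh.
- by rewrite wdiag_hs2.
- by rewrite hs2_kadj wdiag_hs2.
have sE (e : A * D -> R) V (c : A * D -> X * Y -> C) : (forall r, 0 <= e r) ->
  \sum_r e r * n2 (fun q0 => \sum_p c p q0 * ((V r p)^*)%R) = hs2 (kcomp (wdiag e V) c).
 move=> e0; rewrite /hs2 exchange_big; under [LHS]eq_bigr do rewrite mulr_sumr.
 rewrite [LHS]exchange_big; eqs q'.
 exact/esym/(wdiag_n2 V (fun p => c p q')).
exists X, Y, x, y, a, b; split => //; first by rewrite sE.
by rewrite sE// -hs2_kadj kadj_comp kadjK.
Qed.

Definition side (X Y : finType) (a : A * D -> X * Y -> C) (b : X * Y -> A * D -> C) (s : bool) :=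
 if s then a else kadj b.

(** Domination of the Gram kernels of an atom, rather than equality with them: the set becomes
    upward closed, so that a separating functional is positive. *)
Definition dominating (k : bool * ((A * D) * (A * D) * bool) -> R) : Prop :=
 exists (X Y : finType) x y a b, @decomp X Y x y a b /\
  forall s w, n2 (fun q => \sum_p w p * side a b s p q) <= re (qform (oker k s) w).

(** The direct sum of two atoms, with outer factors scaled by sqrt t and sqrt (1 - t), represents
    the same sum over k, and its Gram kernels are the convex combination. *)
Lemma dominating_convex k l t : dominating k -> dominating l -> 0 <= t <= 1 ->
 dominating (fun i => t * k i + (1 - t) * l i).
Proof.
move=> [X1 [Y1 [x1 [y1 [a1 [b1 [[hx1 hy1 e1] h1]]]]]]] [X2 [Y2 [x2 [y2 [a2 [b2 [[hx2 hy2 e2] h2]]]]]]].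
move=> /andP[t0 t1]; have t'0 : 0 <= 1 - t by pos.
pose r1 := (Num.sqrt t)%:C : C; pose r2 := (Num.sqrt (1 - t))%:C : C.
have rr1 : r1 * r1 = t%:C by rewrite -rmorphM/= -expr2 sqr_sqrtr.
have rr2 : r2 * r2 = (1 - t)%:C by rewrite -rmorphM/= -expr2 sqr_sqrtr.
pose a p (q : (X1 + X2) * (Y1 + Y2)) := match q with
 | (inl u, inl v) => r1 * a1 p (u, v) | (inr u, inr v) => r2 * a2 p (u, v) | _ => 0 end.
pose b (q : (X1 + X2) * (Y1 + Y2)) p := match q with
 | (inl u, inl v) => r1 * b1 (u, v) p | (inr u, inr v) => r2 * b2 (u, v) p | _ => 0 end.
exists (X1 + X2)%type, (Y1 + Y2)%type, (mxsum x1 x2), (mxsum y1 y2), a, b; split.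
 split; [exact: Spball_mxsum|exact: Spball_mxsum|move=> p p' i j i' j'].
 rewrite -[LHS]mul1r (_ : 1 = t%:C + (1 - t)%:C); last by rewrite -rmorphD/= addrC subrK.
 rewrite mulrDl {1}e1 e2.
 have sm (f : (X1 + X2) * (Y1 + Y2) -> C) : \sum_q f q =
   (\sum_q f (inl q.1, inl q.2) + \sum_q f (inl q.1, inr q.2)) +
   (\sum_q f (inr q.1, inl q.2) + \sum_q f (inr q.1, inr q.2)).
  rewrite sum_pair big_sumType/=; congr (_ + _).
   by rewrite [in RHS]sum_pair [X in _ = _ + X]sum_pair -big_split; eqs u; rewrite big_sumType.
  by rewrite [in RHS]sum_pair [X in _ = _ + X]sum_pair -big_split; eqs u; rewrite big_sumType.
 rewrite sm; congr (_ + _).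
  rewrite [X in _ = _ + X]big1 ?addr0; last first.
   by move=> q _; rewrite big1// => q' _; rewrite !mul0r.
  rewrite mulr_sumr; apply: eq_bigr => -[u v] _; rewrite sm.
  rewrite [X in _ = (_ + X) + _]big1; last by move=> q _; rewrite mulr0.
  rewrite [X in _ = _ + (X + _)]big1 ?add0r; last by move=> q _; rewrite mulr0.
  rewrite [X in _ = _ + X]big1 ?addr0; last by move=> q _; rewrite mulr0 !mul0r.
  rewrite mulr_sumr; apply: eq_bigr => -[u' v'] _; rewrite /mxsum/= -rr1; ring.
 rewrite [X in _ = X + _]big1 ?add0r; last first.
  by move=> q _; rewrite big1// => q' _; rewrite !mul0r.
 rewrite mulr_sumr; apply: eq_bigr => -[u v] _; rewrite sm.
 rewrite [X in _ = (_ + X) + _]big1 ?addr0; last by move=> q _; rewrite mulr0.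
 rewrite [X in _ = _ + (X + _)]big1; last by move=> q _; rewrite mulr0.
 rewrite [X in _ = X + _]big1 ?add0r; last by move=> q _; rewrite mulr0 !mul0r.
 rewrite mulr_sumr; apply: eq_bigr => -[u' v'] _; rewrite /mxsum/= -rr2; ring.
move=> s w.
have -> : oker (fun i => t * k i + (1 - t) * l i) s =
  (fun p p' => t%:C * oker k s p p' + (1 - t)%:C * oker l s p p').
 by ext p p'; simpc.
rewrite qformD ReD !qformZ.
apply: le_trans (lerD (ler_wpM2l t0 (h1 s w)) (ler_wpM2l t'0 (h2 s w))).
have sc (c : R) (X : finType) (f : X -> C) : 0 <= c ->
  n2 (fun q => (Num.sqrt c)%:C * f q) = c * n2 f.
 by move=> c0; rewrite n2_scale normc_real real_normK ?num_real// sqr_sqrtr.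
rewrite -!sc// n2_pair big_sumType/=; apply: lerD.
 rewrite n2_pair; apply: ler_sum => u _; rewrite n2_sum [X in _ + X <= _]n2_null ?addr0.
  apply: ler_eq; apply: n2_eq => v.
  sums p; case: s => /=; first by ring.
  rewrite /kadj/= rmorphM/= (_ : (r1^*)%R = r1); last exact: conjc_real.
  by ring.
 move=> v; rewrite big1// => p _.
 by rewrite /side; case: s => /=; rewrite ?mulr0// /kadj/= rmorph0 mulr0.
rewrite n2_pair; apply: ler_sum => u _; rewrite n2_sum [X in X + _ <= _]n2_null ?add0r.
 apply: ler_eq; apply: n2_eq => v.
 sums p; case: s => /=; first by ring.
 rewrite /kadj/= rmorphM/= (_ : (r2^*)%R = r2); last exact: conjc_real.
 by ring.
move=> v; rewrite big1// => p _.
by rewrite /side; case: s => /=; rewrite ?mulr0// /kadj/= rmorph0 mulr0.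
Qed.

(** Adding a positive kernel preserves domination; c = 0 gives the Gram kernels themselves. *)
Lemma dominating_gram (X Y Z : finType) x y a b (c : bool -> R) (z : A * D -> Z -> C) :
 @decomp X Y x y a b -> (forall s, 0 <= c s) ->
 dominating (unoker (fun s p p' => gram (side a b s) p p' + (c s)%:C * gram z p p')).
Proof.
exists X, Y, x, y, a, b; split => // s w.
rewrite unokerK qformD ReD qformZ !gram_qform/= lerDl mulr_ge0 ?n2_ge0//.
Qed.

Lemma decomp_exists (q : A * D) : exists (X Y : finType) x y a b, @decomp X Y x y a b.
Proof.
pose n : R := #|{: A * D}|%:R.
have n0 : 0 < n by rewrite ltr0n; apply/card_gt0P; exists q.
have idd : kcomp (kadj (@kid (A * D)%type)) (@kid _) = @kid _ by rewrite kadj_id kcomp1l.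
have idd' : kcomp (@kid (A * D)%type) (kadj (@kid _)) = @kid _ by rewrite kadj_id kcomp1l.
have sn : \sum_(r : A * D) n^-1 <= 1.
 by rewrite sumr_const -mulr_natl mulfV ?gt_eqF.
have n'0 : 0 < n^-1 by pos.
have [X [Y [x [y [a [b [hd _ _]]]]]]] := @oracle_diag q 1 n^-1 _ _ (fun=> n^-1) (fun=> n^-1)
 ltr01 n'0 (fun=> lexx _) (fun=> lexx _) idd idd' idd idd' sn sn.
by exists X, Y, x, y, a, b.
Qed.

(** If the dominating pairs stayed away from (1 + e/2) times the pair of identities, the separating
    functional would be a pair of weights up to regularization and scaling, and the answer of
    [oracle_diag] to these weights would have too small a value. *)
Theorem minimax_decomposition (e : R) : 0 < e ->
 exists (X Y : finType) x y a b, [/\ @decomp X Y x y a b, opsq a (1 + e) & opsq b (1 + e)].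
Proof.
move=> e0; have e20 : 0 < e / 2 by pos.
(* Without row indices the empty atom over [void] does; otherwise q provides the base points that
   positive marginals need. *)
have [q _|noq] := pickP {: A * D}; last first.
 exists void, void, (fun _ _ => 0), (fun _ _ => 0), (fun _ _ => 0), (fun _ _ => 0).
 split; [split|exact: opsq0 (addr_ge0 ler01 (ltW e0))|exact: opsq0 (addr_ge0 ler01 (ltW e0))].
 - by exists (fun _ _ _ => 0); split => // [[]|y w|y B b hb w] //; rewrite /n2 big1 ?mul1r ?n2_ge0// => -[[]].
 - by exists (fun _ _ _ => 0); split => // [[]|y w|y B b hb w] //; rewrite /n2 big1 ?mul1r ?n2_ge0// => -[[]].
 - by move=> p; have := noq p.
have [X0 [Y0 [x0 [y0 [a0 [b0 hd0]]]]]] := decomp_exists q.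
pose v := unoker (fun (_ : bool) (p p' : A * D) => (1 + e / 2)%:C * @kid _ p p').
have [[k [[X [Y [x [y [a [b [hd hk]]]]]]] near]]|far] :=
 pselect (exists k, dominating k /\ \sum_i (k i - v i) ^+ 2 < (e / 2) ^+ 2).
 exists X, Y, x, y, a, b.
 have bd s w : n2 (fun q => \sum_p w p * side a b s p q) <= (1 + e) * n2 w.
  apply: le_trans (hk s w) _.
  have -> : oker k s = (fun p p' => oker (fun i => k i - v i) s p p' + (1 + e / 2)%:C * @kid _ p p').
   ext p p'.
   have := congr1 (fun f => f p p') (unokerK (fun (_ : bool) (p p' : A * D) => (1 + e / 2)%:C * @kid _ p p') s).
   by rewrite /= => <-; congr (_ +i* _); ring.
  rewrite qformD ReD qformZ qform_kid/=.
  have hs : hs2 (oker (fun i => k i - v i) s) <= (e / 2) ^+ 2.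
   by apply: le_trans (ltW near); exact: oker_hs2.
  by have := qform_HS w (ltW e20) hs; nra.
 have e1 : 0 <= 1 + e by pos.
 split => //.
  apply: (@opsq_tr _ _ (fun q p => a p q)) => //.
  move=> w; apply: le_trans (bd true w); apply: ler_eq.
  by apply: n2_eq => q'; eqs p; rewrite mulrC.
 have h : opsq (fun q p => ((b q p)^*)%R) (1 + e).
  move=> w; apply: le_trans (bd false w); apply: ler_eq.
  by apply: n2_eq => q'; eqs p; rewrite mulrC.
 by apply: opsq_ext (opsq_conj h) => q' p; rewrite conjCK.
pose rho := (e / 2) ^+ 2; have rho0 : 0 < rho by rewrite exprn_gt0.
have ne0 : exists k, dominating k.
 by eexists; exact: (dominating_gram (fun=> fun _ : unit => 0) hd0 (fun=> lexx 0)).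
have farK k : dominating k -> rho <= \sum_i (k i - v i) ^+ 2.
 by move=> hk; rewrite leNgt; apply/negP => lt; apply: far; exists k.
have [w hw] := separation rho0 ne0 dominating_convex farK.
pose Om s p p' : C := ((oker w s p p')^*)%R.
have pE M : \sum_t w t * unoker M t = \sum_s re (kpair (Om s) (M s)).
 by rewrite oker_pair; eqs s; rewrite unokerK.
have /choice[U /choice[d ud]] s := spectral_kernel (herm_adj (Om s)).
(* Large multiples of the Gram kernel of an eigenvector may be added inside the set, so a negative
   eigenvalue would drive the functional to minus infinity. *)
have d0 s0 r0 : 0 <= d s0 r0.
 rewrite leNgt; apply/negP => dneg.
 pose Bd := \sum_s re (kpair (Om s) (gram (side a0 b0 s))).
 pose L := \sum_t w t * v t + rho.
 have h c : 0 <= c -> L <= Bd + c * d s0 r0.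
  move=> c0; have c0' s : 0 <= (if s == s0 then c else 0) by case: ifP.
  have := hw _ (dominating_gram (fun p (_ : unit) => U s0 r0 p) hd0 c0').
  rewrite pE => h; apply: le_trans h _.
  under eq_bigr do rewrite kpairD ReD kpairZ.
  rewrite big_split/= lerD2l le_eqVlt; apply/orP; left; apply/eqP.
  rewrite (bigD1 s0)//= eqxx big1 ?addr0; last by move=> s /negbTE ->; rewrite mul0r.
  congr (_ * _); rewrite kpair_gram (big_pred1 tt); last by case.
  by apply: (@complexI R); rewrite -herm_qform (ud_eigen (ud s0)).
 have c0 : 0 <= (`|Bd - L| + 1) / - d s0 r0.
  by rewrite divr_ge0 ?addr_ge0// oppr_ge0 ltW.
 have := h _ c0.
 have -> : (`|Bd - L| + 1) / - d s0 r0 * d s0 r0 = - (`|Bd - L| + 1).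
  by field; rewrite lt_eqF.
 by have := ler_norm (Bd - L); lra.
pose n : R := #|{: A * D}|%:R.
(* dl makes the weights invertible. The two sides together lose 2 (1 + e/2) n dl, which stays below
   the gap rho. *)
pose dl := rho / (4 * (1 + e) * (n + 1)).
have dl0 : 0 < dl by rewrite divr_gt0// ?mulr_gt0// ltr_wpDl.
pose tau s := \sum_r (d s r + dl).
have tauE s : tau s = \sum_r d s r + n * dl.
 by rewrite /tau big_split/= sumr_const -mulr_natl.
have tau0 s : 0 < tau s.
 have n1 : 1 <= n by rewrite ler1n; apply/card_gt0P; exists q.
 by rewrite tauE ltr_wpDl ?sumr_ge0// mulr_gt0// (lt_le_trans ltr01 n1).
pose m := Num.min (dl / tau true) (dl / tau false).
have m0 : 0 < m by rewrite lt_min; apply/andP; split; apply: divr_gt0.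
have md s r : m <= (d s r + dl) / tau s.
 have : m <= dl / tau s by rewrite ge_min; case: s; rewrite lexx ?orbT.
 move=> h; apply: le_trans h _; rewrite ler_pM2r ?invr_gt0//.
 by rewrite lerDr.
have sd s : \sum_r (d s r + dl) / tau s <= 1.
 by rewrite -mulr_suml -/(tau s) mulfV// gt_eqF.
have [X [Y [x [y [a [b [hd ha hb]]]]]]] := @oracle_diag q (e / 2) m (U true) (U false)
 _ _ e20 m0 (md true) (md false) (ud_isom (ud true)) (ud_coisom (ud true))
 (ud_isom (ud false)) (ud_coisom (ud false)) (sd true) (sd false).
have bd s : re (kpair (Om s) (gram (side a b s))) <= (1 + e / 2) * tau s.
 have h : \sum_r (d s r + dl) / tau s * n2 (fun q => \sum_p side a b s p q * ((U s r p)^*)%R) <= 1 + e / 2.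
  by case: s.
 rewrite (ud_pair _ (ud s)) -ler_pdivrMr//; apply: le_trans h.
 rewrite mulr_suml; apply: ler_sum => r _; rewrite mulrAC ler_wpM2r ?n2_ge0//.
 by rewrite ler_pM2r ?invr_gt0// lerDl.
have := hw _ (dominating_gram (fun=> fun _ : unit => 0) hd (fun=> lexx 0)).
have -> : \sum_t w t * v t = (1 + e / 2) * \sum_s \sum_r d s r.
 rewrite pE; sums s.
 by rewrite (kpairZ (@kid _) (Om s)) (ud_trace (ud s)).
rewrite !pE; under [leRHS]eq_bigr do rewrite kpairD ReD kpairZ.
rewrite !big_bool/=; have := bd true; have := bd false; rewrite !tauE.
have : n * dl * (4 * (1 + e)) < rho.
 rewrite /dl (_ : _ * _ = rho * (n / (n + 1))).
  by rewrite gtr_pMr// ltr_pdivrMr ?ltr_wpDl// mul1r ltrDl.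
 by field; rewrite !gt_eqF// ltr_wpDl.
by nra.
Qed.

End Minimax.

Section Core.

Lemma Spball_blockfam A1 A2 S (th : R) (x1 : A1 * S -> A1 * S -> C)
  (x2 : A2 * S -> A2 * S -> C) :
 Spball th x1 -> Spball th x2 ->
 exists2 F, @blockfam S (A1 * A2)%type S F & forall k, F k th%:C = tcol x1 x2 k.
Proof.
move=> [f1 [g1 <- h10 h11]] [f2 [g2 <- h20 h21]].
exists (fun k z => tcol (f1 z) (f2 z) k) => //; split.
- by move=> k p q; exact: goodM.
- by move=> k y; exact: tcol_opsq.
- by move=> y L L' B hL hL' hB; exact: tcol_S1b.
Qed.

Lemma schur_product_decomposition A1 A2 D1 D2 S (th e : R)
  (x1 : A1 * S -> A1 * S -> C) (x2 : A2 * S -> A2 * S -> C)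
  (y1 : D1 * S -> D1 * S -> C) (y2 : D2 * S -> D2 * S -> C) :
 0 <= th <= 1 -> 0 < e ->
 Spball th x1 -> Spball th x2 -> Spball (1 - th) y1 -> Spball (1 - th) y2 ->
 exists (X Y : finType) (x : X * S -> X * S -> C) (y : Y * S -> Y * S -> C)
  (a : (A1 * A2) * (D1 * D2) -> X * Y -> C) (b : X * Y -> (A1 * A2) * (D1 * D2) -> C),
 [/\ Spball th x, Spball (1 - th) y,
  forall p p' i j,
   \sum_k tcol x1 x2 k (p.1, i) (p'.1, j) * tcol y1 y2 k (p.2, i) (p'.2, j) =
   \sum_q \sum_q' a p q * x (q.1, i) (q'.1, j) * y (q.2, i) (q'.2, j) * b q' p',
  opsq a (1 + e) & opsq b (1 + e)].
Proof.
move=> th01 e0 hx1 hx2 hy1 hy2.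
have [F bF FE] := Spball_blockfam hx1 hx2; have [H bH HE] := Spball_blockfam hy1 hy2.
have [X [Y [x [y [a [b [[hx hy E] ha hb]]]]]]] := minimax_decomposition th01 bF bH e0.
exists X, Y, x, y, a, b; split => // p p' i j.
by rewrite -E; eqs k; rewrite FE HE.
Qed.

End Core.

End Finite.

(** * Nets of finite sums, and operator norms tested on finite blocks *)

Section Nets.
Implicit Types (I : choiceType).

Lemma psum_mask (V : pzRingType) I (x : I -> V) (J0 J : {fset I}) : (J0 `<=` J)%fset ->
 psum x J0 = \sum_(i : J) ((val i \in J0)%:R * x (val i)).
Proof.
move=> sub; rewrite /psum -(big_seq_fsetE _ _ predT) -(big_seq_fsetE _ _ predT (fun i => (i \in J0)%:R * x i))/=.
rewrite -(big_fset_incl _ sub)/=; last by move=> i _ /negbTE ->; rewrite mul0r.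
by apply: eq_big_seq => i ->; rewrite mul1r.
Qed.

Definition ncvg I (x : I -> C) (l : C) := forall e : R, 0 < e ->
 exists J0 : {fset I}, forall J : {fset I}, (J0 `<=` J)%fset -> normc (psum x J - l) <= e.

Lemma ncvgP I (x : I -> C) (l : C) :
 ncvg x l <-> ((psum x : {fset I} -> C^o) @ totally --> (l : C^o)).
Proof.
split=> [h|/cvgrPdist_le h].
 apply/cvgrPdist_le => e e0; have eE : e = (re e)%:C.
  by case: e e0 => a b; rewrite ltcE/= => /andP[/eqP -> _].
 have r0 : 0 < re e by move: e0; rewrite eE ltcR.
 have [J0 hJ] := h _ r0; exists J0 => // J /= sub.
 rewrite eE lecR normc_distC; exact: hJ.
move=> e e0; have e0' : 0 < e%:C by rewrite ltcR.
have [J0 _ hJ] := h _ e0'; exists J0 => J sub.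
by have := hJ J sub; rewrite lecR normc_distC.
Qed.

Lemma ncvg_sum I (x : I -> C) l : ncvg x l -> net_summable x /\ net_sum x = l.
Proof.
move=> /ncvgP h; split; first by apply/cvg_ex; exists l.
apply: cvg_lim h; exact: norm_hausdorff.
Qed.

Lemma ncvgD I (x y : I -> C) l m : ncvg x l -> ncvg y m -> ncvg (fun i => x i + y i) (l + m).
Proof.
move=> hx hy e e0; have e20 : 0 < e / 2 by pos.
have [J0 h0] := hx _ e20; have [J1 h1] := hy _ e20.
exists (J0 `|` J1)%fset => J; rewrite fsubUset => /andP[s0 s1].
rewrite /psum big_split/= opprD addrACA.
apply: le_trans (normcD _ _) _; rewrite [leRHS](splitr e); apply: lerD; [exact: h0|exact: h1].
Qed.

Lemma ncvgZ I (x : I -> C) l c : ncvg x l -> ncvg (fun i => c * x i) (c * l).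
Proof.
move=> hx e e0; have c0 : 0 < normc c + 1 by pos.
have ec0 : 0 < e / (normc c + 1) by pos.
have [J0 h0] := hx _ ec0; exists J0 => J s0.
rewrite /psum -mulr_sumr -mulrBr normcM.
letr (normc c * (e / (normc c + 1))); first by rewrite ler_wpM2l ?normc_ge0// h0.
by rewrite mulrCA ger_pMr// ler_pdivrMr// mul1r lerDl.
Qed.

Lemma ncvg0 I : ncvg (fun _ : I => 0) 0.
Proof.
by move=> e e0; exists fset0 => J _; rewrite /psum big1// subrr normc0.
Qed.

Lemma ncvg_fsum I (T : Type) (r : seq T) (P : pred T) (x : T -> I -> C) (l : T -> C) :
 (forall t, P t -> ncvg (x t) (l t)) ->
 ncvg (fun i => \sum_(t <- r | P t) x t i) (\sum_(t <- r | P t) l t).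
Proof.
move=> h; elim: r => [|t r ih].
 rewrite big_nil (_ : (fun i => _) = (fun=> 0)); first exact: ncvg0.
 by ext i; rewrite big_nil.
rewrite big_cons (_ : (fun i => _) = (fun i => if P t then x t i + \sum_(t <- r | P t) x t i
  else \sum_(t <- r | P t) x t i)); last by ext i; rewrite big_cons.
by case: ifP => // Pt; apply: ncvgD => //; exact: h.
Qed.

Lemma ncvg_fin I (x : I -> C) (J0 : {fset I}) : (forall i, i \notin J0 -> x i = 0) ->
 ncvg x (psum x J0).
Proof.
move=> h e e0; exists J0 => J sub; rewrite (psum_mask _ sub).
rewrite (_ : _ - _ = 0) ?normc0 ?ltW//; apply/eqP; rewrite subr_eq0; apply/eqP.
eqs i; case: (boolP (val i \in J0)) => [_|/h->]; first by rewrite mul1r.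
by rewrite mulr0.
Qed.

Lemma psum_le I (y : I -> R) (J0 J : {fset I}) : (forall i, 0 <= y i) -> (J0 `<=` J)%fset ->
 psum y J0 <= psum y J.
Proof.
move=> y0 sub; rewrite (psum_mask _ sub); apply: ler_sum => i _.
by case: (val i \in J0); rewrite ?mul1r// mul0r.
Qed.

Lemma psum_sup I (y : I -> R) (M : R) : (forall i, 0 <= y i) -> (forall J, psum y J <= M) ->
 exists s : R, [/\ forall J, psum y J <= s, s <= M & forall e : R, 0 < e ->
  exists J0 : {fset I}, forall J : {fset I}, (J0 `<=` J)%fset -> s - e <= psum y J].
Proof.
move=> y0 yM; pose S := [set psum y J | J in [set: {fset I}]].
have hS : has_sup S.
 by split; [exists (psum y fset0), fset0|exists M => _ [J _ <-]].
exists (sup S); split.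
- by move=> J; apply: ub_le_sup; [exact: hS.2|exists J].
- by apply: ge_sup; [exact: hS.1|move=> _ [J _ <-]].
- move=> e e0; have [_ [J0 _ <-] h] := sup_adherent e0 hS; exists J0 => J sub.
 by apply: le_trans (ltW h) _; exact: psum_le.
Qed.

Lemma ncvg_pos I (y : I -> R) (M : R) : (forall i, 0 <= y i) -> (forall J, psum y J <= M) ->
 exists s : R, ncvg (fun i => (y i)%:C) s%:C.
Proof.
move=> y0 yM; have [s [h1 _ h2]] := psum_sup y0 yM; exists s => e e0.
have [J0 hJ] := h2 e e0; exists J0 => J sub.
have -> : psum (fun i => (y i)%:C) J - s%:C = (psum y J - s)%:C.
 by rewrite rmorphB/= /psum -real_complex_sum.
rewrite normc_real ler_norml.
have := hJ J sub; have := h1 J; rewrite /psum => a b.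
by lra.
Qed.

(** Real and imaginary parts are differences of the nonnegative families |x| + Re x, |x| + Im x and
    |x|, whose finite sums are bounded. *)
Lemma ncvg_abs I (x : I -> C) (M : R) : (forall J, psum (fun i => normc (x i)) J <= M) ->
 exists l, ncvg x l.
Proof.
move=> hM.
have bd (y : I -> R) : (forall i, 0 <= y i) -> (forall i, y i <= 2 * normc (x i)) ->
  exists s : R, ncvg (fun i => (y i)%:C) s%:C.
 move=> y0 y2; apply: (@ncvg_pos _ _ (2 * M)) => // J.
 letr (2 * psum (fun i => normc (x i)) J).
  by rewrite mulr_sumr; apply: ler_sum => i _.
 by rewrite ler_pM2l.
have [a ha] := bd (fun i => normc (x i) + re (x i))
 (fun i => ltac:(have := Re_le_normc (x i); rewrite ler_norml; lra))
 (fun i => ltac:(have := Re_le_normc (x i); rewrite ler_norml; lra)).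
have [b hb] := bd (fun i => normc (x i) + im (x i))
 (fun i => ltac:(have := Im_le_normc (x i); rewrite ler_norml; lra))
 (fun i => ltac:(have := Im_le_normc (x i); rewrite ler_norml; lra)).
have [c hc] := bd (fun i => normc (x i))
 (fun i => normc_ge0 _) (fun i => ltac:(have := normc_ge0 (x i); lra)).
exists ((a%:C + (-1) * c%:C) + (0 +i* 1) * (b%:C + (-1) * c%:C)).
have := ncvgD (ncvgD ha (ncvgZ (-1) hc)) (ncvgZ (0 +i* 1) (ncvgD hb (ncvgZ (-1) hc))).
rewrite (_ : (fun i => _ + _) = x)//; ext i.
by case: (x i) => u v /=; congr (_ +i* _); ring.
Qed.

Definition l2le I (x : I -> C) (c : R) := forall J, psum (fun i => normc (x i) ^+ 2) J <= c.

Lemma l2sqP I (x : I -> C) (c : R) : (l2sq x <= c%:E)%E <-> l2le x c.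
Proof.
split=> h.
 move=> J; rewrite -lee_fin; apply: le_trans h; apply: esum_ge.
 exists [set` J]; first by split => //.
 by rewrite fsbig_finite// set_fsetK /psum -(big_seq_fsetE _ _ predT (fun i => normc (x i) ^+ 2))/= sumEFin.
apply: ge_ereal_sup => _ [X [finX _] <-].
rewrite fsbig_finite//= sumEFin.
by have := h (fset_set X); rewrite /psum -(big_seq_fsetE _ _ predT (fun i => normc (x i) ^+ 2)).
Qed.

Lemma l2sq_ge0 I (x : I -> C) : (0 <= l2sq x)%E.
Proof. by apply: esum_ge0 => i _; rewrite lee_fin sqr_ge0. Qed.

Lemma l2P I (x : I -> C) : l2 x <-> exists c, l2le x c.
Proof.
split=> [|[c /l2sqP h]]; last by rewrite /l2/=; apply: le_lt_trans h _; exact: ltry.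
rewrite /l2/=; have := l2sq_ge0 x; case E : (l2sq x) => [c| |]// _ _.
by exists c; apply/l2sqP; rewrite E.
Qed.

(** The approximant may depend on e, so the limits over finite sets below need no sequence. *)
Lemma n2_lim (T : finType) (m : T -> C) (K : R) : 0 <= K ->
 (forall e : R, 0 < e -> exists v, (forall t, normc (v t - m t) <= e) /\ n2 v <= K) -> n2 m <= K.
Proof.
move=> K0 h.
suff : Num.sqrt (n2 m) <= Num.sqrt K by rewrite ler_sqrt.
apply/ler_addgt0Pr => e e0; pose n : R := #|T|%:R.
have e10 : 0 < e / (n + 1) by pos.
have [v [hv nv]] := h _ e10.
have -> : n2 m = n2 (fun t => v t + (m t - v t)) by apply: n2_eq => t; rewrite addrC subrK.
apply: le_trans (n2_triangle _ _) _; apply: lerD; first by rewrite ler_sqrt.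
rewrite -[leRHS](ger0_norm (ltW e0)) -sqrtr_sqr ler_sqrt ?sqr_ge0//.
letr (\sum_(t : T) (e / (n + 1)) ^+ 2).
 apply: ler_sum => t _; rewrite normc_distC ler_pXn2r ?nnegrE ?(ltW e10)//.
rewrite sumr_const -mulr_natl expr_div_n mulrA ler_pdivrMr ?exprn_gt0 ?ltr_wpDl//.
nra.
Qed.

Lemma opsq_lim (S T : finType) (K : S -> T -> C) (c : R) : 0 <= c ->
 (forall e : R, 0 < e -> exists L, (forall s t, normc (L s t - K s t) <= e) /\ opsq L c) -> opsq K c.
Proof.
move=> c0 h v; apply: n2_lim; first by pos.
move=> e e0; pose V := \sum_t normc (v t) + 1.
have V0 : 0 < V by rewrite ltr_wpDl// sumr_ge0// => t _.
have e10 : 0 < e / V by pos.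
have [L [hL nL]] := h _ e10; exists (fun s => \sum_t L s t * v t); split; last exact: nL.
move=> s; rewrite -sumrB; apply: le_trans (normc_sum _ _ _) _.
letr (\sum_t e / V * normc (v t)).
 by apply: ler_sum => t _; rewrite -mulrBl normcM ler_wpM2r.
rewrite -mulr_sumr mulrAC ler_pdivrMr// ler_pM2l// lerDl//.
Qed.

Lemma opsq_lim_le (S T : finType) (K : S -> T -> C) (c : R) : 0 <= c ->
 (forall e : R, 0 < e -> opsq K (c + e)) -> opsq K c.
Proof.
move=> c0 h v; apply/ler_addgt0Pr => e e0.
have n0 : 0 < n2 v + 1 by pos.
have e10 : 0 < e / (n2 v + 1) by pos.
apply: le_trans (h _ e10 v) _; rewrite mulrDl lerD2l mulrAC ler_pdivrMr// ler_pM2l// lerDl//.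
Qed.

Lemma fset_cover (J : choiceType) (T : finType) (Q0 : T -> {fset J}) :
 exists Q : {fset J}, forall t, (Q0 t `<=` Q)%fset.
Proof.
by exists (\big[fsetU/fset0]_(t : T) Q0 t)%fset => t; rewrite (bigD1 t)//=; exact: fsubsetUl.
Qed.

(* Squared operator norm at most c, tested on finite blocks. *)
Definition bdd (I J : choiceType) (A : I * J -> C) (c : R) : Prop :=
 forall (P : {fset I}) (Q : {fset J}), opsq (fun (s : P) (t : Q) => A (val s, val t)) c.

Lemma bdd_inj (I J : choiceType) (A : I * J -> C) c (S T : finType) (g : S -> I) (h : T -> J) :
 0 <= c -> injective g -> injective h -> bdd A c -> opsq (fun s t => A (g s, h t)) c.
Proof.
move=> c0 ig ih bA.
pose P : {fset I} := [fset g s | s in S]%fset; pose Q : {fset J} := [fset h t | t in T]%fset.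
have gP s : g s \in P by apply/imfsetP; exists s.
have hQ t : h t \in Q by apply/imfsetP; exists t.
have ig' : injective (fun s => [` gP s]%fset) by move=> s s' /(congr1 val)/= /ig.
have ih' : injective (fun t => [` hQ t]%fset) by move=> s s' /(congr1 val)/= /ih.
exact: (opsq_inj c0 ig' ih' (bA P Q)).
Qed.

Definition zext (J : choiceType) (Q : {fset J}) (v : Q -> C) (j : J) : C :=
 if insub j is Some t then v t else 0.

Lemma zextE (J : choiceType) (Q : {fset J}) (v : Q -> C) (t : Q) : zext v (val t) = v t.
Proof. by rewrite /zext valK. Qed.

Lemma zext_out (J : choiceType) (Q : {fset J}) (v : Q -> C) j : j \notin Q -> zext v j = 0.
Proof. by move=> h; rewrite /zext insubN. Qed.

Lemma zext_l2 (J : choiceType) (Q : {fset J}) (v : Q -> C) : l2le (zext v) (n2 v).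
Proof.
move=> J'; pose y := fun j => normc (zext v j) ^+ 2.
have y0 j : 0 <= y j by exact: sqr_ge0.
letr (psum y (J' `|` Q)%fset); first by apply: psum_le => //; exact: fsubsetUl.
rewrite (_ : n2 v = psum y Q); last by eqs t; rewrite /y zextE.
rewrite (psum_mask y (fsubsetUr J' Q)); apply: ler_sum => j _.
have [_|ni] := boolP (val j \in Q); first by rewrite mul1r.
by rewrite /y zext_out// normc0 expr0n/= mulr0.
Qed.

Lemma matvec_zext (I J : choiceType) (A : I * J -> C) (Q : {fset J}) (v : Q -> C) i :
 matvec A (zext v) i = \sum_(t : Q) A (i, val t) * v t.
Proof.
have h : ncvg (fun j => A (i, j) * zext v j) (psum (fun j => A (i, j) * zext v j) Q).
 by apply: ncvg_fin => j jQ; rewrite zext_out// mulr0.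
rewrite /matvec (ncvg_sum h).2; eqs t; by rewrite zextE.
Qed.

Lemma bdd_row (I J : choiceType) (A : I * J -> C) c i : 0 <= c -> bdd A c -> l2le (fun j => A (i, j)) c.
Proof.
move=> c0 bA Q.
have := opsq_tr c0 (bdd_inj c0 (fun (s t : unit) (_ : i = i) => match s, t with tt, tt => erefl end) val_inj bA : opsq (fun (s : unit) (t : Q) => A (i, val t)) c).
move=> /(_ (fun=> 1)); rewrite {2}/n2 (big_pred1 tt) ?normc1 ?expr1n ?mulr1; last by case.
apply: le_trans; apply: ler_eq.
by eqs t; rewrite (big_pred1 tt) ?mulr1//.
Qed.

Lemma bdd_matvec (I J : choiceType) (A : I * J -> C) (x : J -> C) c K : 0 <= c -> bdd A c -> l2le x K ->
 (forall i, ncvg (fun j => A (i, j) * x j) (matvec A x i)) /\ l2le (matvec A x) (c * K).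
Proof.
move=> c0 bA hx.
have K0 : 0 <= K by have := hx fset0; apply: le_trans; apply: sumr_ge0 => j _; pos.
have cv i : ncvg (fun j => A (i, j) * x j) (matvec A x i).
 suff [l hl] : exists l, ncvg (fun j => A (i, j) * x j) l by rewrite /matvec (ncvg_sum hl).2.
 apply: (@ncvg_abs _ _ (Num.sqrt (c * K))) => Q.
 have cs := CS_real (fun t : Q => normc (A (i, val t))) (fun t => normc (x (val t))).
 have rw : \sum_(t : Q) normc (A (i, val t)) ^+ 2 <= c := bdd_row i c0 bA Q.
 rewrite -[leLHS]ger0_norm; last by apply: sumr_ge0 => t _.
 rewrite -sqrtr_sqr ler_sqrt ?mulr_ge0//.
 rewrite /psum; under eq_bigr do rewrite normcM.
 apply: le_trans cs _; apply: ler_pM => //; [|apply: sumr_ge0 => t _; pos|exact: hx].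
 by pos.
split => // P.
apply: n2_lim; first by pos.
move=> e e0.
have /choice[Q0 hQ] (s : P) := cv (val s) e e0.
have [Q QQ] := fset_cover Q0.
exists (fun s => \sum_(t : Q) A (val s, val t) * x (val t)); split.
 by move=> s; exact: hQ.
apply: le_trans (bA P Q (fun t => x (val t))) _; rewrite ler_wpM2l//; exact: hx.
Qed.

(** A block is tested on vectors extended by zero, with c + d in place of c because the infimum
    gives only nearly optimal constants. Conversely, bounded blocks make rows square summable, and
    the bound passes to the limit by [bdd_matvec]. *)
Lemma opnormP (I J : choiceType) (A : I * J -> C) (c : R) : 0 <= c ->
 (opnorm A <= c%:E)%E <-> bdd A (c ^+ 2).
Proof.
split=> h; last first.
 apply: ereal_inf_lbound; exists c => //; split => // x /l2P[K0 /l2sqP hK0].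
 have [] : (l2sq x \is a fin_num)%E.
  by rewrite ge0_fin_numE ?l2sq_ge0//; apply: le_lt_trans hK0 _; exact: ltry.
 move=> /fineK E; have hK : l2le x (fine (l2sq x)) by apply/l2sqP; rewrite E.
 have [h1 h2] := bdd_matvec (sqr_ge0 c) h hK; split.
  by move=> i; exact: (ncvg_sum (h1 i)).1.
 by rewrite -E; apply/l2sqP.
move=> P Q; apply: opsq_lim_le; first pos.
move=> e e0.
have [d d0 hd] : exists2 d : R, 0 < d & (c + d) ^+ 2 <= c ^+ 2 + e.
 exists (Num.min 1 (e / (2 * c + 1))); first by pos.
 set d := Num.min _ _; have d1 : d <= 1 by rewrite ge_min lexx.
 have d0 : 0 <= d by rewrite le_min ler01 divr_ge0 ?(ltW e0)// addr_ge0// mulr_ge0.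
 have : d * (2 * c + 1) <= e by rewrite -ler_pdivlMr ?ltr_wpDl ?mulr_ge0// ge_min lexx orbT.
 by nra.
apply: opsq_le hd _.
have : (opnorm A < (c + d)%:E)%E by apply: le_lt_trans h _; rewrite lte_fin ltrDl.
move=> /ereal_inf_lt[_ [c' [c'0 hc'] <-]]; rewrite lte_fin => c'd v.
have zl : l2 (zext v) by apply/l2P; exists (n2 v); exact: zext_l2.
have [_ hm] := hc' (zext v) zl.
have hm2 : (l2sq (matvec A (zext v)) <= ((c' ^+ 2) * n2 v)%:E)%E.
 apply: (le_trans hm).
 have h0 : (0 <= (c' ^+ 2)%:E :> \bar R)%E by rewrite lee_fin sqr_ge0.
 exact: (lee_wpmul2l h0 ((l2sqP _ _).2 (zext_l2 v))).
have := (l2sqP _ _).1 hm2 P; rewrite /psum => h2.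
letr (c' ^+ 2 * n2 v); last first.
 by rewrite ler_wpM2r ?n2_ge0// ler_pXn2r ?nnegrE ?addr_ge0 ?(ltW d0)// ltW.
apply: le_trans h2; apply: ler_eq.
by eqs s; rewrite matvec_zext.
Qed.

Lemma opnorm_ge0 (I J : choiceType) (A : I * J -> C) : (0 <= opnorm A)%E.
Proof. by apply: le_ereal_inf_tmp => _ [c [c0 _] <-]. Qed.

Lemma opnorm_fin (I J : choiceType) (A : I * J -> C) :
 (opnorm A < +oo)%E -> exists2 c : R, 0 <= c & opnorm A = c%:E.
Proof.
have := opnorm_ge0 A; case: (opnorm A) => [c| |]//.
by exists c.
Qed.

Lemma mxnormP (m n : nat) (a : 'M[C]_(m, n)) (c : R) : 0 <= c ->
 (mxnorm a <= c%:E)%E <-> opsq (fun i j => a i j) (c ^+ 2).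
Proof.
move=> c0; rewrite opnormP//; split=> h.
 exact: (bdd_inj (sqr_ge0 c) (fun s t e => e) (fun s t e => e) h).
by move=> P Q; exact: (opsq_inj (sqr_ge0 c) val_inj val_inj h).
Qed.

Lemma mxnorm_fin (m n : nat) (a : 'M[C]_(m, n)) : exists2 c : R, 0 <= c & mxnorm a = c%:E.
Proof.
apply: opnorm_fin; have h0 : 0 <= \sum_i n2 (a i) by pos.
apply: (@le_lt_trans _ _ (Num.sqrt (\sum_i n2 (a i)))%:E); last exact: ltry.
by apply/mxnormP; rewrite ?sqrtr_ge0// sqr_sqrtr//; exact: opsq_HS.
Qed.

End Nets.

(** * The Hilbert space of square summable families *)

Section Hilbert.
Variable I : choiceType.
Implicit Types (x y z : I -> C) (c : R).

(** [fine] sends +oo to 0, so this is the squared norm only for x in [l2]. *)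
Definition nrm2 x : R := fine (l2sq x).

Lemma l2_nrm2 x : l2 x -> (l2sq x = (nrm2 x)%:E)%E.
Proof.
rewrite /l2/= => h; rewrite fineK// ge0_fin_numE ?l2sq_ge0//.
Qed.

Lemma nrm2_ge0 x : 0 <= nrm2 x.
Proof. by rewrite fine_ge0// l2sq_ge0. Qed.

Lemma l2le_nrm2 x : l2 x -> l2le x (nrm2 x).
Proof. by move=> /l2_nrm2 h; apply/l2sqP; rewrite h. Qed.

Lemma l2le_l2 x c : l2le x c -> l2 x.
Proof. by move=> h; apply/l2P; exists c. Qed.

Lemma nrm2_le x c : l2le x c -> nrm2 x <= c.
Proof.
move=> h; have := l2_nrm2 (l2le_l2 h); move/l2sqP: h => h e.
by move: h; rewrite e.
Qed.

Lemma l2le_add x y c d : 0 <= c -> 0 <= d -> l2le x (c ^+ 2) -> l2le y (d ^+ 2) ->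
 l2le (fun i => x i + y i) ((c + d) ^+ 2).
Proof.
move=> c0 d0 hx hy J.
have := n2_triangle (fun i : J => x (val i)) (fun i : J => y (val i)).
set N := n2 (fun _ => _ + _) => h.
have hN : Num.sqrt N <= c + d.
 apply: le_trans h _; apply: lerD.
  by rewrite -[leRHS](ger0_norm c0) -sqrtr_sqr ler_sqrt ?sqr_ge0//; exact: hx.
 by rewrite -[leRHS](ger0_norm d0) -sqrtr_sqr ler_sqrt ?sqr_ge0//; exact: hy.
rewrite -[leLHS]/N -(sqr_sqrtr (n2_ge0 _ : 0 <= N)).
by rewrite ler_pXn2r ?nnegrE ?sqrtr_ge0// addr_ge0.
Qed.

Lemma l2D x y : l2 x -> l2 y -> l2 (fun i => x i + y i).
Proof.
move=> hx hy; apply: (@l2le_l2 _ ((Num.sqrt (nrm2 x) + Num.sqrt (nrm2 y)) ^+ 2)).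
by apply: l2le_add; rewrite ?sqrtr_ge0// sqr_sqrtr ?nrm2_ge0//; exact: l2le_nrm2.
Qed.

Lemma nrm2D x y : l2 x -> l2 y ->
 Num.sqrt (nrm2 (fun i => x i + y i)) <= Num.sqrt (nrm2 x) + Num.sqrt (nrm2 y).
Proof.
move=> hx hy; rewrite -[leRHS]ger0_norm ?sqrtr_ge0// -sqrtr_sqr ler_sqrt ?sqr_ge0//.
by apply: nrm2_le; apply: l2le_add; rewrite ?sqrtr_ge0// sqr_sqrtr ?nrm2_ge0//; exact: l2le_nrm2.
Qed.

Lemma l2leZ a x c : l2le x c -> l2le (fun i => a * x i) (normc a ^+ 2 * c).
Proof.
move=> h J; letr (normc a ^+ 2 * n2 (fun i : J => x (val i))).
 by rewrite -n2_scale.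
by rewrite ler_wpM2l ?sqr_ge0//; exact: h.
Qed.

Lemma l2Z a x : l2 x -> l2 (fun i => a * x i).
Proof. by move=> /l2le_nrm2 /(l2leZ a); exact: l2le_l2. Qed.

Lemma l2B x y : l2 x -> l2 y -> l2 (fun i => x i - y i).
Proof.
move=> hx hy; have := l2D hx (l2Z (-1) hy).
by rewrite (_ : (fun i => _) = (fun i => x i - y i))//; ext i; rewrite mulN1r.
Qed.

Lemma l2_0 : l2 (fun _ : I => 0 : C).
Proof.
apply: (@l2le_l2 _ 0) => J; rewrite /psum big1// => i _; by rewrite normc0 expr0n.
Qed.

Lemma nrm2_eq0 x : l2 x -> nrm2 x = 0 -> x = (fun=> 0).
Proof.
move=> /l2le_nrm2 h e; ext i; have := h [fset i]%fset.
rewrite e /psum -(big_seq_fsetE _ _ predT (fun i => normc (x i) ^+ 2))/= big_seq_fset1 => h'.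
have : normc (x i) ^+ 2 == 0 by rewrite eq_le h' sqr_ge0.
by rewrite sqrf_eq0 normc_eq0 => /eqP.
Qed.

Lemma entry_nrm2 x i : l2 x -> normc (x i) ^+ 2 <= nrm2 x.
Proof.
move=> /l2le_nrm2 /(_ [fset i]%fset).
by rewrite /psum -(big_seq_fsetE _ _ predT (fun i => normc (x i) ^+ 2))/= big_seq_fset1.
Qed.

Lemma inner_cv x y : l2 x -> l2 y -> ncvg (fun i => x i * ((y i)^*)%R) (inner x y).
Proof.
move=> hx hy; suff [l hl] : exists l, ncvg (fun i => x i * ((y i)^*)%R) l.
 by rewrite /inner (ncvg_sum hl).2.
apply: (@ncvg_abs _ _ (nrm2 x + nrm2 y)) => J.
letr (psum (fun i => normc (x i) ^+ 2) J + psum (fun i => normc (y i) ^+ 2) J).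
 rewrite -big_split/=; apply: ler_sum => i _; rewrite normcM normc_conj.
 nra.
by apply: lerD; apply: l2le_nrm2.
Qed.

Lemma ncvg_unique (u : I -> C) l m : ncvg u l -> ncvg u m -> l = m.
Proof. by move=> /ncvg_sum[_ <-] /ncvg_sum[_ <-]. Qed.

Lemma innerD x x' y : l2 x -> l2 x' -> l2 y ->
 inner (fun i => x i + x' i) y = inner x y + inner x' y.
Proof.
move=> hx hx' hy; apply: ncvg_unique (inner_cv (l2D hx hx') hy) _.
have := ncvgD (inner_cv hx hy) (inner_cv hx' hy).
by rewrite (_ : (fun i => _ + _) = (fun i => (x i + x' i) * ((y i)^*)%R))//; ext i; rewrite mulrDl.
Qed.

Lemma innerZ a x y : l2 x -> l2 y -> inner (fun i => a * x i) y = a * inner x y.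
Proof.
move=> hx hy; apply: ncvg_unique (inner_cv (l2Z a hx) hy) _.
have := ncvgZ a (inner_cv hx hy).
by rewrite (_ : (fun i => _ * (_ * _)) = (fun i => (a * x i) * ((y i)^*)%R))//; ext i; rewrite mulrA.
Qed.

Lemma ncvg_conj (u : I -> C) l : ncvg u l -> ncvg (fun i => ((u i)^*)%R) ((l^*)%R).
Proof.
move=> h e e0; have [J0 hJ] := h e e0; exists J0 => J sub.
by rewrite /psum -rmorph_sum -rmorphB normc_conj; exact: hJ.
Qed.

Lemma innerC x y : l2 x -> l2 y -> inner y x = ((inner x y)^*)%R.
Proof.
move=> hx hy; apply: ncvg_unique (inner_cv hy hx) _.
have := ncvg_conj (inner_cv hx hy).
rewrite (_ : (fun i => _) = (fun i => y i * ((x i)^*)%R))//; ext i.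
by rewrite rmorphM/= conjCK mulrC.
Qed.

Lemma innerDr x y y' : l2 x -> l2 y -> l2 y' ->
 inner x (fun i => y i + y' i) = inner x y + inner x y'.
Proof.
move=> hx hy hy'; rewrite (innerC (l2D hy hy') hx) (innerD hy hy' hx) rmorphD/=.
by rewrite -(innerC hy hx) -(innerC hy' hx).
Qed.

Lemma innerZr a x y : l2 x -> l2 y -> inner x (fun i => a * y i) = (a^*)%R * inner x y.
Proof.
by move=> hx hy; rewrite (innerC (l2Z a hy) hx) (innerZ a hy hx) rmorphM/= -(innerC hy hx).
Qed.

Lemma inner0 y : l2 y -> inner (fun=> 0) y = 0.
Proof.
move=> hy; rewrite (_ : (fun=> 0) = (fun i : I => 0 * y i)); last by ext i; rewrite mul0r.
by rewrite innerZ// mul0r.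
Qed.

Lemma inner_self x : l2 x -> inner x x = (nrm2 x)%:C.
Proof.
move=> hx; apply: ncvg_unique (inner_cv hx hx) _.
have [s [h1 h2 h3]] := psum_sup (fun i => sqr_ge0 (normc (x i))) (l2le_nrm2 hx).
have -> : nrm2 x = s by apply/eqP; rewrite eq_le h2 andbT; exact: nrm2_le.
move=> e e0; have [J0 hJ] := h3 e e0; exists J0 => J sub.
have -> : psum (fun i => x i * ((x i)^*)%R) J - s%:C =
  (psum (fun i => normc (x i) ^+ 2) J - s)%:C.
 rewrite rmorphB/= real_complex_sum; congr (_ - _).
 by eqs i; rewrite normc_mulconj.
rewrite normc_real ler_norml; have := h1 J; have := hJ J sub => a b.
by lra.
Qed.

Lemma inner_CS x y : l2 x -> l2 y -> normc (inner x y) ^+ 2 <= nrm2 x * nrm2 y.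
Proof.
move=> hx hy; have h0 : 0 <= nrm2 x * nrm2 y by rewrite mulr_ge0 ?nrm2_ge0.
suff : normc (inner x y) <= Num.sqrt (nrm2 x * nrm2 y).
 by move=> h; rewrite -(sqr_sqrtr h0) ler_pXn2r ?nnegrE.
apply/ler_addgt0Pr => e e0; have [J0 hJ] := inner_cv hx hy e0.
apply: le_trans (normc_subl _ (psum (fun i => x i * ((y i)^*)%R) J0)) _.
rewrite addrC; apply: lerD; last by rewrite normc_distC; apply: hJ.
rewrite -[leLHS]ger0_norm ?normc_ge0// -sqrtr_sqr ler_sqrt//.
apply: le_trans (CS (fun i : J0 => x (val i)) (fun i : J0 => ((y (val i))^*)%R)) _.
rewrite n2_conj; apply: ler_pM; rewrite ?n2_ge0//; exact: l2le_nrm2.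
Qed.

Definition cutoff (J : {fset I}) x : I -> C := fun i => (i \in J)%:R * x i.

Lemma cutoff_le J x c : l2le x c -> l2le (cutoff J x) c.
Proof.
move=> h P; apply: le_trans (h P); apply: ler_sum => i _; rewrite normcM exprMn.
by case: (_ \in J); rewrite ?normc1 ?expr1n ?mul1r// normc0 expr0n mul0r sqr_ge0.
Qed.

Lemma cutoff_tail x (e : R) : l2 x -> 0 < e -> exists J0 : {fset I},
 forall J : {fset I}, (J0 `<=` J)%fset -> l2le (fun i => x i - cutoff J x i) e.
Proof.
move=> hx e0; have [s [h1 h2 h3]] := psum_sup (fun i => sqr_ge0 (normc (x i))) (l2le_nrm2 hx).
have [J0 hJ] := h3 e e0; exists J0 => J sub P.
pose y i := normc (x i) ^+ 2.
letr (psum (fun i => normc (x i - cutoff J x i) ^+ 2) (P `|` J)%fset).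
 by apply: psum_le => [i|]; [pos|exact: fsubsetUl].
have -> : psum (fun i => normc (x i - cutoff J x i) ^+ 2) (P `|` J)%fset =
  psum y (P `|` J)%fset - psum y J.
 rewrite (psum_mask y (fsubsetUr P J)) -sumrB; eqs i.
 rewrite /cutoff; case: (_ \in J); first by rewrite !mul1r !subrr normc0 expr0n.
 by rewrite !mul0r !subr0.
have := h1 (P `|` J)%fset; have := hJ J sub; lra.
Qed.

End Hilbert.
Variable I : choiceType.
Local Notation MI n := 'M[I * I -> C]_n.
Local Notation Soo_ := (@Soo R I).
Local Notation S1_ := (@S1 R I).
Local Notation psi_ := (@psi R I).

(** * Adjoints and compact operators *)

Section Operators.
Implicit Types (x y z : I -> C) (A B : I * I -> C) (c M : R).

Lemma matvec_l2 A M x : 0 <= M -> bdd A M -> l2 x ->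
 l2 (matvec A x) /\ nrm2 (matvec A x) <= M * nrm2 x.
Proof.
move=> M0 bA hx; have [_ h] := bdd_matvec M0 bA (l2le_nrm2 hx).
by split; [exact: l2le_l2 h|exact: nrm2_le].
Qed.

Lemma matvec_cv A M x i : 0 <= M -> bdd A M -> l2 x ->
 ncvg (fun j => A (i, j) * x j) (matvec A x i).
Proof. by move=> M0 bA hx; have [h _] := bdd_matvec M0 bA (l2le_nrm2 hx). Qed.

Lemma matvecD A M x y : 0 <= M -> bdd A M -> l2 x -> l2 y ->
 matvec A (fun i => x i + y i) = (fun i => matvec A x i + matvec A y i).
Proof.
move=> M0 bA hx hy; ext i.
apply: ncvg_unique (matvec_cv i M0 bA (l2D hx hy)) _.
have := ncvgD (matvec_cv i M0 bA hx) (matvec_cv i M0 bA hy).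
by rewrite (_ : (fun j => _ + _) = (fun j => A (i, j) * (x j + y j)))//; ext j; rewrite mulrDr.
Qed.

Lemma matvecZ A M a x : 0 <= M -> bdd A M -> l2 x ->
 matvec A (fun i => a * x i) = (fun i => a * matvec A x i).
Proof.
move=> M0 bA hx; ext i.
apply: ncvg_unique (matvec_cv i M0 bA (l2Z a hx)) _.
have := ncvgZ a (matvec_cv i M0 bA hx).
by rewrite (_ : (fun j => _ * (_ * _)) = (fun j => A (i, j) * (a * x j)))//; ext j; rewrite mulrCA.
Qed.

Lemma matvecB A M x y : 0 <= M -> bdd A M -> l2 x -> l2 y ->
 matvec A (fun i => x i - y i) = (fun i => matvec A x i - matvec A y i).
Proof.
move=> M0 bA hx hy.
rewrite (_ : (fun i => x i - y i) = (fun i => x i + (-1) * y i)); last by ext i; rewrite mulN1r.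
rewrite (matvecD M0 bA hx (l2Z (-1) hy)) (matvecZ (-1) M0 bA hy).
by ext i; rewrite mulN1r.
Qed.

Lemma bdd_adjoint A M : 0 <= M -> bdd A M -> bdd (adjoint A) M.
Proof. by move=> M0 bA P Q; exact: opsq_adj (bA Q P). Qed.

Lemma cutoff_l2 J x : l2 x -> l2 (cutoff J x).
Proof. by move=> /l2le_nrm2 /(cutoff_le J); exact: l2le_l2. Qed.

Lemma small_eq0 (z : C) : (forall e : R, 0 < e -> normc z <= e) -> z = 0.
Proof.
move=> h; apply/eqP; rewrite -normc_eq0 eq_le normc_ge0 andbT.
by apply/ler_addgt0Pr => e e0; rewrite add0r; exact: h.
Qed.

Lemma ncvg_cutoff Q (f : I -> C) x :
 ncvg (fun j => f j * cutoff Q x j) (\sum_(j : Q) f (val j) * x (val j)).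
Proof.
have := @ncvg_fin _ (fun j => f j * cutoff Q x j) Q.
rewrite /psum (eq_bigr (fun j : Q => f (val j) * x (val j))); last first.
 by move=> j _; rewrite /cutoff (valP j) mul1r.
by apply=> j /negbTE nj; rewrite /cutoff nj mul0r mulr0.
Qed.

(** For finitely supported x a finite sum is exchanged with a limit; the remainder of x has small
    norm, and both sides are continuous in x. *)
Lemma inner_adjoint A M x y : 0 <= M -> bdd A M -> l2 x -> l2 y ->
 inner (matvec A x) y = inner x (matvec (adjoint A) y).
Proof.
move=> M0 bA hx hy; have bA' := bdd_adjoint M0 bA.
apply/eqP; rewrite -subr_eq0; apply/eqP; apply: small_eq0 => e e0.
have [hAy nAy] := matvec_l2 M0 bA' hy.
pose K := (1 + M) * (nrm2 y + 1).
have K0 : 0 < K by rewrite /K; have := nrm2_ge0 y => ?; apply: mulr_gt0; lra.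
have d0 : 0 < (e / 2) ^+ 2 / K by pos.
have [Q hQ] := cutoff_tail hx d0; have {hQ} tl := hQ Q (fsubset_refl Q).
pose xQ := cutoff Q x; have hxQ := cutoff_l2 Q hx; have hd := l2B hx hxQ.
have nd : nrm2 (fun i => x i - xQ i) <= (e / 2) ^+ 2 / K by exact: nrm2_le.
have E : inner (matvec A xQ) y = inner xQ (matvec (adjoint A) y).
 have E1 : inner (matvec A xQ) y = \sum_(j : Q) x (val j) * ((matvec (adjoint A) y (val j))^*)%R.
  apply: ncvg_unique (inner_cv (matvec_l2 M0 bA hxQ).1 hy) _.
  have h : ncvg (fun i => \sum_(j : Q) x (val j) * (A (i, val j) * ((y i)^*)%R))
    (\sum_(j : Q) x (val j) * ((matvec (adjoint A) y (val j))^*)%R).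
   apply: ncvg_fsum => j _; apply: ncvgZ.
   have := ncvg_conj (matvec_cv (val j) M0 bA' hy).
   rewrite (_ : (fun i => ((_ * _)^*)%R) = (fun i => A (i, val j) * ((y i)^*)%R))//.
   by ext i; rewrite rmorphM/= conjCK.
  rewrite (_ : (fun i => _ * _) = (fun i => \sum_(j : Q) x (val j) * (A (i, val j) * ((y i)^*)%R)))//.
  ext i; rewrite (ncvg_unique (matvec_cv i M0 bA hxQ) (ncvg_cutoff Q (fun j => A (i, j)) x)).
  by sums j; rewrite mulrA [_ * x _]mulrC.
 rewrite E1; apply: ncvg_unique _ (inner_cv hxQ hAy).
 have := ncvg_cutoff Q (fun j => ((matvec (adjoint A) y j)^*)%R) x.
 rewrite (eq_bigr (fun j : Q => x (val j) * ((matvec (adjoint A) y (val j))^*)%R)) => [|j _]; last exact: mulrC.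
 by rewrite (_ : (fun j => _ * _) = (fun i => xQ i * ((matvec (adjoint A) y i)^*)%R))//; ext j; rewrite mulrC.
have xE : x = (fun i => xQ i + (x i - xQ i)) by ext i; rewrite addrC subrK.
rewrite {1}xE (matvecD M0 bA hxQ hd) (innerD (matvec_l2 M0 bA hxQ).1 (matvec_l2 M0 bA hd).1 hy).
have -> : inner x (matvec (adjoint A) y) = inner xQ (matvec (adjoint A) y) +
  inner (fun i => x i - xQ i) (matvec (adjoint A) y) by rewrite -(innerD hxQ hd hAy) -xE.
rewrite E opprD addrACA subrr add0r.
apply: le_trans (normcB _ _) _; rewrite [leRHS](splitr e).
have e20 : 0 <= e / 2 by pos.
have y1 := nrm2_ge0 y.
have bnd (a b : R) : 0 <= a -> 0 <= b -> a * b <= (1 + M) * nrm2 (fun i => x i - xQ i) * (nrm2 y) -> a * b <= (e / 2) ^+ 2.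
 move=> _ _ h; apply: le_trans h _.
 rewrite mulrAC; letr (K * ((e / 2) ^+ 2 / K)); last by rewrite mulrC divfK// gt_eqF.
 apply: ler_pM => //; rewrite ?mulr_ge0 ?addr_ge0 ?nrm2_ge0//.
 by rewrite ler_wpM2l ?addr_ge0// lerDl.
have [l1 n1] := matvec_l2 M0 bA hd.
have nd0 := nrm2_ge0 (fun i => x i - xQ i).
apply: lerD; rewrite -(@ler_pXn2r _ 2) ?nnegrE ?normc_ge0//.
 apply: le_trans (inner_CS l1 hy) _; apply: bnd; rewrite ?nrm2_ge0//.
 by rewrite ler_wpM2r//; apply: le_trans n1 _; rewrite ler_wpM2r// lerDr.
apply: le_trans (inner_CS hd hAy) _; apply: bnd; rewrite ?nrm2_ge0//.
letr (nrm2 (fun i => x i - xQ i) * (M * nrm2 y)).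
 by rewrite ler_wpM2l.
nra.
Qed.

Lemma ereal_cvg0 (f : nat -> \bar R) : (forall k, (0 <= f k)%E) ->
 (f @ \oo --> (0%E : \bar R)) <->
 (forall e : R, 0 < e -> exists N : nat, forall n, (N <= n)%N -> (f n <= e%:E)%E).
Proof.
move=> f0; split=> [h e e0|h].
 have nb : nbhs (0%E : \bar R) [set y | (y < e%:E)%E].
  by apply: open_nbhs_nbhs; split; [exact: open_ereal_lt_ereal|rewrite /=].
 by have [N _ hN] := h _ nb; exists N => n Nn; apply: ltW; exact: hN.
apply/fine_cvgP; split.
 have [N hN] := h 1 ltr01; exists N => // n /= Nn.
 by rewrite ge0_fin_numE//; apply: le_lt_trans (hN n Nn) _; exact: ltry.
apply/cvgrPdist_le => e e0; have [N hN] := h e e0; exists N => // n /= Nn.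
have := hN n Nn; have := f0 n; case: (f n) => [r| |]//; rewrite !lee_fin => r0 re.
by rewrite sub0r normrN ger0_norm.
Qed.

Definition scvg (u : nat -> I -> C) (y : I -> C) : Prop :=
 forall e : R, 0 < e -> exists N : nat, forall n, (N <= n)%N -> l2le (fun i => u n i - y i) e.

Lemma compact_opP A : compact_op A <->
 (exists2 M, 0 <= M & bdd A M) /\
 forall x : nat -> I -> C, (forall k, l2le (x k) 1) ->
  exists (s : nat -> nat) (y : I -> C), [/\ {homo s : k l / (k < l)%N}, l2 y &
   scvg (fun k => matvec A (x (s k))) y].
Proof.
split=> [[b h]|[[M M0 b] h]]; split.
- have [c c0 e] := opnorm_fin b; exists (c ^+ 2); first pos.
 by apply/opnormP => //; rewrite e.
- move=> x hx; have [|s [y [hs hy cv]]] := h x; first by move=> k; apply/l2sqP.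
 exists s, y; split => // e e0; have [N hN] := (ereal_cvg0 (fun k => l2sq_ge0 _)).1 cv e e0.
 by exists N => n Nn; apply/l2sqP; exact: hN.
- apply: (@le_lt_trans _ _ (Num.sqrt M)%:E); last exact: ltry.
 by apply/opnormP; rewrite ?sqrtr_ge0// sqr_sqrtr.
- move=> x hx; have [|s [y [hs hy cv]]] := h x; first by move=> k; apply/l2sqP.
 exists s, y; split => //; apply/ereal_cvg0 => [k|e e0]; first exact: l2sq_ge0.
 by have [N hN] := cv e e0; exists N => n Nn; apply/l2sqP; exact: hN.
Qed.

Lemma psum_inj (J : choiceType) (T : finType) (y : J -> R) (g : T -> J) c : injective g ->
 (forall P : {fset J}, psum y P <= c) -> \sum_t y (g t) <= c.
Proof.
move=> ig h; have := h [fset g t | t in T]%fset.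
rewrite /psum -(big_seq_fsetE _ _ predT y)/= big_imfset//=; last by move=> s t _ _; exact: ig.
by rewrite big_enum.
Qed.

Lemma HS_bdd A c : l2le A c -> bdd A c.
Proof.
move=> h P Q; apply: opsq_le (opsq_HS _).
rewrite pair_big/=.
apply: (psum_inj (y := fun t => normc (A t) ^+ 2) (g := fun p : P * Q => (val p.1, val p.2))) => //.
by move=> [s t] [s' t'] [/val_inj -> /val_inj ->].
Qed.

Lemma ultra_limit (U : set_system nat) (u : nat -> R) : UltraFilter U ->
 (forall k, -1 <= u k <= 1) ->
 exists l : R, forall e : R, 0 < e -> U [set k | `|u k - l| <= e].
Proof.
move=> uU hu; have := @segment_compact R (-1) 1.
move=> /(_ (u @ U) _)[|l [_ hl]].
 by apply: (@filterE _ U) => k; exact: hu.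
exists l => e e0; have [//|nU] := in_ultra_setVsetC [set k | `|u k - l| <= e] uU.
have nb : nbhs l [set z | `|z - l| <= e].
 by apply/nbhs_ballP; exists e => //= z; rewrite /ball/= distrC => /ltW.
have [z [[/=]]] := hl (u @` ~` [set k | `|u k - l| <= e]) _ (filterS (@preimage_image _ _ _ _) nU) nb.
by move=> k hk <- /hk.
Qed.

Lemma extract (P : nat -> nat -> Prop) : (forall n K, exists2 k, (K <= k)%N & P n k) ->
 exists s : nat -> nat, {homo s : k l / (k < l)%N} /\ forall n, P n (s n).
Proof.
move=> h; have /choice[f hf] : forall p : nat * nat, exists k, (p.2 <= k)%N /\ P p.1 k.
 by move=> [n K]; have [k Kk Pk] := h n K; exists k.
pose s := fix s n := if n is m.+1 then f (m.+1, (s m).+1) else f (0%N, 0%N).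
exists s; split; last by case=> [|n]; [exact: (hf (0%N, 0%N)).2|exact: (hf (n.+1, (s n).+1)).2].
apply: homo_ltn => [|n]; first exact: ltn_trans.
exact: (hf (n.+1, (s n).+1)).1.
Qed.

Lemma l2le_cst0 (J : choiceType) (x : J -> C) c : l2le x c -> 0 <= c.
Proof. by move=> /(_ fset0); apply: le_trans; apply: sumr_ge0 => i _; pos. Qed.

(** Coordinatewise limits along an ultrafilter replace a diagonal extraction, for which I would have
    to be countable. Up to a small Hilbert-Schmidt error A has finitely many entries, and on
    finitely many coordinates the convergence is in norm. *)
Lemma HS_compact A c : l2le A c -> compact_op A.
Proof.
move=> hA; have c0 := l2le_cst0 hA; have bA := HS_bdd hA.
apply/compact_opP; split; first by exists c.
move=> x hx.
have [U [uU subU]] := ultraFilterLemma (eventually_filter : ProperFilter (\oo : set_system nat)).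
have b1 k i : normc (x k i) <= 1.
 rewrite -(@ler_pXn2r _ 2) ?nnegrE ?normc_ge0// expr1n.
 by have := entry_nrm2 i (l2le_l2 (hx k)) => h; apply: le_trans h _; exact: nrm2_le.
have /choice[a ha] i := ultra_limit uU (u := fun k => re (x k i)) (fun k =>
 ltac:(rewrite -ler_norml; exact: le_trans (Re_le_normc _) (b1 k i))).
have /choice[b hb] i := ultra_limit uU (u := fun k => im (x k i)) (fun k =>
 ltac:(rewrite -ler_norml; exact: le_trans (Im_le_normc _) (b1 k i))).
pose z i : C := a i +i* b i.
have hz i (e : R) : 0 < e -> U [set k | normc (x k i - z i) <= e].
 move=> e0; have e20 : 0 < e / 2 by pos.
 apply: filterS (filterI (ha i _ e20) (hb i _ e20)) => k [/= h1 h2].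
 apply: le_trans (normc_ReIm _) _; move: h1 h2; case: (x k i) => u v /= h1 h2.
 by lra.
have hzP (P : {fset I}) (e : R) : 0 < e -> U [set k | forall i : P, normc (x k (val i) - z (val i)) <= e].
 by move=> e0; apply: filter_forall => i; exact: hz.
have tailU (K : nat) : U [set k | (K <= k)%N] by apply: subU; exists K.
have zl : l2le z 1.
 move=> P; apply: (@n2_lim _ (fun i : P => z (val i))) => // e e0.
 have [k hk] := filter_ex (hzP P e e0).
 by exists (fun i : P => x k (val i)); split; [exact: hk|exact: (hx k)].
have z2 := l2le_l2 zl; have Az := (matvec_l2 c0 bA z2).1.
have key n K : exists2 k, (K <= k)%N & l2le (fun i => matvec A (x k) i - matvec A z i) (n.+1%:R^-1).
 pose e : R := n.+1%:R^-1; have e0 : 0 < e by rewrite invr_gt0.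
 have d0 : 0 < e / 16 by lra.
 have [Q0 hQ0] := cutoff_tail (l2le_l2 hA) d0; have {hQ0} tl := hQ0 _ (fsubset_refl _).
 pose P := [fset t.2 | t in Q0]%fset; pose m : R := #|{: P}|%:R.
 pose d2 := e / (4 * (c + 1) * (m + 1)).
 have d20 : 0 < d2 by rewrite divr_gt0// ?mulr_gt0// ltr_wpDl.
 have dd : 0 < Num.sqrt d2 by pos.
 have [k [Kk hk]] := filter_ex (filterI (tailU K) (hzP P _ dd)).
 exists k => //.
 have hd := l2B (l2le_l2 (hx k)) z2.
 rewrite -(matvecB c0 bA (l2le_l2 (hx k)) z2).
 set w := fun i => x k i - z i.
 have w4 : nrm2 w <= 4.
  have : l2le w ((1 + 1) ^+ 2).
   rewrite /w (_ : (fun i => _) = (fun i => x k i + (-1) * z i)); last by ext i; rewrite mulN1r.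
   apply: l2le_add => //; rewrite expr1n; first exact: hx.
   have := l2leZ (-1) zl; rewrite (_ : normc (-1 : C) = 1); first by rewrite expr1n mulr1.
   by rewrite -(normc1 R) normcNE.
  by move=> /nrm2_le; rewrite (_ : (1 + 1) ^+ 2 = 4)//; ring.
 have wP : l2le (cutoff P w) (m * d2).
  move=> J; letr (psum (fun i => normc (cutoff P w i) ^+ 2) (J `|` P)%fset).
   by apply: psum_le => [i|]; [pos|exact: fsubsetUl].
  letr (psum (fun i => normc (w i) ^+ 2) P).
   rewrite (psum_mask _ (fsubsetUr J P)); apply: ler_sum => i _; rewrite normcM exprMn.
   by case: (_ \in P); rewrite ?normc1 ?expr1n ?mul1r// normc0 expr0n.
  rewrite mulr_natl -sumr_const; apply: ler_sum => i _.
  rewrite -[leRHS]sqr_sqrtr ?(ltW d20)// ler_pXn2r ?nnegrE ?(ltW dd)//; exact: hk.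
 have E : matvec A w = (fun i => matvec (cutoff Q0 A) (cutoff P w) i + matvec (fun t => A t - cutoff Q0 A t) w i).
  ext i.
  apply: ncvg_unique (matvec_cv i c0 bA hd) _.
  have b1' := HS_bdd (cutoff_le Q0 hA); have b2' := HS_bdd tl.
  have := ncvgD (matvec_cv i c0 b1' (cutoff_l2 P hd)) (matvec_cv i (ltW d0) b2' hd).
  rewrite (_ : (fun j => _ + _) = (fun j => A (i, j) * w j))//; ext j.
  rewrite /cutoff; case: (boolP ((i, j) \in Q0)) => [iQ|_].
   have -> : j \in P by apply/imfsetP; exists (i, j).
   by rewrite !mul1r subrr mul0r addr0.
  by rewrite !mul0r subr0 add0r.
 have h1 : l2le (matvec (cutoff Q0 A) (cutoff P w)) ((Num.sqrt e / 2) ^+ 2).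
  have [_ h] := bdd_matvec c0 (HS_bdd (cutoff_le Q0 hA)) wP.
  move=> J; apply: le_trans (h J) _; rewrite expr_div_n sqr_sqrtr ?(ltW e0)//.
  have -> : c * (m * d2) = e / 4 * ((c / (c + 1)) * (m / (m + 1))).
   by rewrite /d2; field; rewrite !gt_eqF// ltr_wpDl.
  have c1 : c / (c + 1) <= 1 by rewrite ler_pdivrMr ?ltr_wpDl// mul1r lerDl.
  have m1 : m / (m + 1) <= 1 by rewrite ler_pdivrMr ?ltr_wpDl// mul1r lerDl.
  have c00 : 0 <= c / (c + 1) by pos.
  have m00 : 0 <= m / (m + 1) by pos.
  have -> : e / 2 ^+ 2 = e / 4 by congr (_ / _); ring.
  by rewrite ger_pMr ?divr_gt0// -[leRHS]mulr1; exact: ler_pM.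
 have h2 : l2le (matvec (fun t => A t - cutoff Q0 A t) w) ((Num.sqrt e / 2) ^+ 2).
  have [_ h] := bdd_matvec (ltW d0) (HS_bdd tl) (l2le_nrm2 hd).
  move=> J; apply: le_trans (h J) _; rewrite expr_div_n sqr_sqrtr ?(ltW e0)//.
  have -> : e / 2 ^+ 2 = e / 16 * 4 by field.
  by rewrite ler_pM2l.
 rewrite E -[e in l2le _ e]sqr_sqrtr ?(ltW e0)// [Num.sqrt e]splitr.
 by apply: l2le_add => //.
have [s [hs1 hs2]] := extract key.
exists s, (matvec A z); split => // e e0.
have [N _ hN] := near_infty_natSinv_lt (PosNum e0).
exists N => // n Nn J; apply: le_trans (hs2 n J) _; apply: ltW; exact: hN.
Qed.

End Operators.

(** * Eigenvectors of A^* A *)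

Section Spectral.
Implicit Types (x y z : I -> C) (A B : I * I -> C) (c M : R).

Definition nm x : R := Num.sqrt (nrm2 x).

Lemma nm_ge0 x : 0 <= nm x. Proof. exact: sqrtr_ge0. Qed.

Lemma nm_sq x : nm x ^+ 2 = nrm2 x. Proof. by rewrite sqr_sqrtr// nrm2_ge0. Qed.

Lemma nrm2Z a x : l2 x -> nrm2 (fun i => a * x i) = normc a ^+ 2 * nrm2 x.
Proof.
move=> hx; apply: (@complexI R); rewrite -inner_self; last exact: l2Z.
by rewrite (innerZ _ hx (l2Z a hx)) (innerZr _ hx hx) inner_self// [RHS]rmorphM [X in _ = X * _]normc_mulconj mulrA.
Qed.

Lemma nrm2_0 : nrm2 (fun _ : I => 0 : C) = 0.
Proof.
have h : l2le (fun _ : I => 0 : C) 0 by move=> J; rewrite /psum big1// => i _; rewrite normc0 expr0n.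
by apply/eqP; rewrite eq_le nrm2_ge0 nrm2_le.
Qed.

Lemma nmZ a x : l2 x -> nm (fun i => a * x i) = normc a * nm x.
Proof.
move=> hx; rewrite /nm nrm2Z// sqrtrM ?sqr_ge0// sqrtr_sqr ger0_norm//.
Qed.

Lemma nm_tri x y z : l2 x -> l2 y -> l2 z ->
 nm (fun i => x i - z i) <= nm (fun i => x i - y i) + nm (fun i => y i - z i).
Proof.
move=> hx hy hz; have := nrm2D (l2B hx hy) (l2B hy hz).
by rewrite (_ : (fun i => _ + _) = (fun i => x i - z i))//; ext i; rewrite addrA subrK.
Qed.

Lemma nmC x y : l2 x -> l2 y -> nm (fun i => x i - y i) = nm (fun i => y i - x i).
Proof.
move=> hx hy; rewrite -[RHS]mul1r -(normc1 R) -normcNE -nmZ; last exact: l2B.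
by congr nm; ext i; ring.
Qed.

Lemma nm_eq0 x : l2 x -> (forall e : R, 0 < e -> nm x <= e) -> x = (fun=> 0).
Proof.
move=> hx h; apply: nrm2_eq0 => //; rewrite -nm_sq.
have -> : nm x = 0; last by rewrite expr0n.
by apply/eqP; rewrite eq_le nm_ge0 andbT; apply/ler_addgt0Pr => e e0; rewrite add0r; exact: h.
Qed.

Lemma inner_nm x y : l2 x -> l2 y -> normc (inner x y) <= nm x * nm y.
Proof.
rewrite -(@ler_pXn2r _ 2) ?nnegrE ?mulr_ge0 ?nm_ge0//.
by rewrite exprMn !nm_sq; exact: inner_CS.
Qed.

Lemma matvec_nm A M x : 0 <= M -> bdd A M -> l2 x -> nm (matvec A x) <= Num.sqrt M * nm x.
Proof.
move=> M0 bA hx; have [_ h] := matvec_l2 M0 bA hx.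
by rewrite -sqrtrM// ler_sqrt// mulr_ge0 ?nrm2_ge0.
Qed.

Lemma adjointK A : adjoint (adjoint A) = A.
Proof. by apply/funext => -[i j]; rewrite /adjoint/= conjCK. Qed.

Definition gramop A x := matvec (adjoint A) (matvec A x).

Lemma gramop_l2 A M x : 0 <= M -> bdd A M -> l2 x -> l2 (gramop A x).
Proof. by move=> M0 bA hx; have [h _] := matvec_l2 M0 bA hx; have [] := matvec_l2 M0 (bdd_adjoint M0 bA) h. Qed.

Lemma gramop_inner A M x y : 0 <= M -> bdd A M -> l2 x -> l2 y ->
 inner (gramop A x) y = inner (matvec A x) (matvec A y).
Proof.
move=> M0 bA hx hy; rewrite (inner_adjoint M0 (bdd_adjoint M0 bA))//; last first.
 by have [] := matvec_l2 M0 bA hx.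
by rewrite adjointK.
Qed.

Lemma gramop_sym A M x y : 0 <= M -> bdd A M -> l2 x -> l2 y ->
 inner (gramop A x) y = inner x (gramop A y).
Proof.
move=> M0 bA hx hy; rewrite (gramop_inner M0 bA)// (inner_adjoint M0 bA)//.
by have [] := matvec_l2 M0 bA hy.
Qed.

Lemma gramopB A M x y : 0 <= M -> bdd A M -> l2 x -> l2 y ->
 gramop A (fun i => x i - y i) = (fun i => gramop A x i - gramop A y i).
Proof.
move=> M0 bA hx hy; rewrite /gramop (matvecB M0 bA)// (matvecB M0 (bdd_adjoint M0 bA))//.
by have [] := matvec_l2 M0 bA hx. by have [] := matvec_l2 M0 bA hy.
Qed.

Lemma matvec0 A M : 0 <= M -> bdd A M -> matvec A (fun=> 0) = (fun=> 0).
Proof.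
move=> M0 bA; have := matvecZ 0 M0 bA (@l2_0 I).
rewrite mul0r.
by move=> ->; ext i; rewrite mul0r.
Qed.

(** For a unit eigenvector of A^* A the eigenvalue can only be |A x|^2, see [eigvecP]. *)
Definition eigvec A x := gramop A x = (fun i => (nrm2 (matvec A x))%:C * x i).

Lemma eigvecP A M x (l : C) : 0 <= M -> bdd A M -> l2 x -> inner x x = 1 ->
 gramop A x = (fun i => l * x i) -> eigvec A x.
Proof.
move=> M0 bA hx x1 h; rewrite /eigvec.
have [hA _] := matvec_l2 M0 bA hx.
by rewrite -(inner_self hA) -(gramop_inner M0 bA)// h innerZ// x1 mulr1.
Qed.

(* The largest eigenvalue of A^* A on an invariant subspace is attained: a
  maximizing sequence of unit vectors for |A x|^2 is asymptotically an
  eigenvector, and A maps it to a sequence with a convergent subsequence. *)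
Lemma eigvec_in A (H : set (I -> C)) x0 : compact_op A ->
 H `<=` @l2 R I -> H x0 -> x0 <> (fun=> 0) ->
 (forall x, H x -> H (gramop A x)) -> (forall a x, H x -> H (fun i => a * x i)) ->
 (forall (u : nat -> I -> C) x, (forall k, H (u k)) -> l2 x ->
   (forall e : R, 0 < e -> exists k, nm (fun i => u k i - x i) <= e) -> H x) ->
 exists2 x, H x & inner x x = 1 /\ eigvec A x.
Proof.
move=> /compact_opP[[M M0 bA] cA] Hl2 H0 x00 HT HZ Hcl.
have bA' := bdd_adjoint M0 bA.
have unit x : H x -> x <> (fun=> 0) -> exists2 a : C, H (fun i => a * x i) & nrm2 (fun i => a * x i) = 1.
 move=> Hx xn0; exists ((nm x)^-1)%:C; first exact: HZ.
 rewrite nrm2Z; last exact: Hl2.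
 have n0 : nm x != 0.
  by apply/eqP => n0; apply: xn0; apply: nrm2_eq0; [exact: Hl2|rewrite -nm_sq n0 expr0n].
 by rewrite normc_real real_normK ?num_real// -nm_sq exprVn mulVf// expf_neq0.
pose Q := [set r | exists2 x, H x & nrm2 x = 1 /\ r = nrm2 (matvec A x)].
have hQ : has_sup Q.
 have [a Ha na] := unit _ H0 x00; split; first by exists (nrm2 (matvec A (fun i => a * x0 i))), (fun i => a * x0 i).
 exists M => _ [x Hx [nx ->]]; have [_ h] := matvec_l2 M0 bA (Hl2 _ Hx).
 by apply: le_trans h _; rewrite nx mulr1.
pose S := sup Q.
have SA x : H x -> nrm2 (matvec A x) <= S * nrm2 x.
 move=> Hx; have [->|xn0] := pselect (x = (fun=> 0)).
  by rewrite (matvec0 M0 bA) nrm2_0 mulr0.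
 have [a Ha na] := unit _ Hx xn0.
 have : nrm2 (matvec A (fun i => a * x i)) <= S by apply: ub_le_sup; [exact: hQ.2|exists (fun i => a * x i)].
 rewrite (matvecZ _ M0 bA); last exact: Hl2.
 rewrite nrm2Z; last by have [] := matvec_l2 M0 bA (Hl2 _ Hx).
 move: na; rewrite nrm2Z; last exact: Hl2.
 move=> na; have a0 : 0 < normc a ^+ 2.
  by rewrite lt_def sqr_ge0 andbT; apply/eqP => a0; move: na; rewrite a0 mul0r => /esym/eqP; rewrite oner_eq0.
 by move=> h; rewrite -(ler_pM2l a0); rewrite mulrCA na mulr1.
have S0 : 0 <= S.
 have [r Qr] := hQ.1; apply: le_trans (ub_le_sup hQ.2 Qr).
 by case: Qr => ? _ [_ ->]; exact: nrm2_ge0.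
have ST x : H x -> nrm2 (gramop A x) <= S ^+ 2 * nrm2 x.
 move=> Hx; have HTx := HT _ Hx; set t := nrm2 (gramop A x).
 have t0 : 0 <= t by exact: nrm2_ge0.
 have hl := Hl2 _ Hx; have hlT := Hl2 _ HTx.
 have h : t ^+ 2 <= S * nrm2 x * (S * t).
  have -> : t = normc (inner (gramop A x) (gramop A x)).
   by rewrite inner_self// normc_real ger0_norm.
  rewrite {1}(gramop_inner M0 bA)//; apply: le_trans (inner_CS _ _) _.
  - by have [] := matvec_l2 M0 bA hl.
  - by have [] := matvec_l2 M0 bA hlT.
  have -> : normc (inner (gramop A x) (gramop A x)) = t by rewrite inner_self// normc_real ger0_norm.
  by apply: ler_pM; rewrite ?nrm2_ge0//; exact: SA.
 have [t00|tn0] := eqVneq t 0; first by rewrite t00 mulr_ge0 ?sqr_ge0 ?nrm2_ge0.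
 have tp : 0 < t by lra.
 by rewrite -(ler_pM2r tp); apply: le_trans h _; apply: ler_eq; ring.
have [S00|Sn0] := eqVneq S 0.
 have [a Ha na] := unit _ H0 x00; exists (fun i => a * x0 i) => //.
 have hl := Hl2 _ Ha; have i1 : inner (fun i => a * x0 i) (fun i => a * x0 i) = 1 by rewrite inner_self// na.
 split => //; apply: (@eigvecP _ M _ 0) => //.
 have := ST _ Ha; rewrite S00 expr0n/= mul0r => h.
 rewrite (nrm2_eq0 (gramop_l2 M0 bA hl)); first by ext i; rewrite mul0r.
 by apply/eqP; rewrite eq_le h nrm2_ge0.
have Sp : 0 < S by lra.
have /choice[x hx] : forall n : nat, exists x, H x /\ nrm2 x = 1 /\ S - n.+1%:R^-1 <= nrm2 (matvec A x).
 move=> n; have n0 : 0 < (n.+1%:R^-1 : R) by [].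
 have [_ [x Hx [nx ->]] h] := sup_adherent n0 hQ; exists x; split => //; split => //; exact: ltW.
have xl n : l2 (x n) by apply: Hl2; exact: (hx n).1.
have xl1 n : l2le (x n) 1 by rewrite -(hx n).2.1; exact: l2le_nrm2.
have Sx n : nm (fun i => gramop A (x n) i - S%:C * x n i) <= Num.sqrt (2 * S * n.+1%:R^-1).
 have hT := gramop_l2 M0 bA (xl n); have hS := l2Z (- S%:C) (xl n).
 rewrite ler_sqrt; last by pos.
 have -> : (fun i => gramop A (x n) i - S%:C * x n i) = (fun i => gramop A (x n) i + - S%:C * x n i).
  by ext i; rewrite mulNr.
 have E : nrm2 (fun i => gramop A (x n) i + - S%:C * x n i) =
   nrm2 (gramop A (x n)) - 2 * S * nrm2 (matvec A (x n)) + S ^+ 2.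
  apply: (@complexI R); rewrite -inner_self; last exact: l2D.
  have iTx : inner (gramop A (x n)) (x n) = (nrm2 (matvec A (x n)))%:C.
   by rewrite (gramop_inner M0 bA)// inner_self//; have [] := matvec_l2 M0 bA (xl n).
  have ixT : inner (x n) (gramop A (x n)) = (nrm2 (matvec A (x n)))%:C.
   by rewrite -(gramop_sym M0 bA).
  rewrite innerD ?innerDr ?innerZ ?innerZr//; try exact: l2D.
  rewrite !inner_self// (hx n).2.1 iTx ixT rmorphN/= (_ : (S%:C^*)%R = S%:C); last exact: conjc_real.
  ring.
 have := ST _ (hx n).1; rewrite (hx n).2.1; have := (hx n).2.2.
 move: (n.+1%:R^-1) => d; nra.
have [s [z [hs hz cv]]] := cA x xl1.
have hw := (matvec_l2 M0 bA' hz).1; pose w := matvec (adjoint A) z.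
pose u i := (S^-1)%:C * w i; have hu : l2 u by exact: l2Z.
have close (e : R) : 0 < e -> exists n, [/\ nm (fun i => x n i - u i) <= e & nm (fun i => gramop A (x n) i - S%:C * x n i) <= e].
 move=> e0; pose d := e * S / 2; have d0 : 0 < d by rewrite divr_gt0// mulr_gt0.
 have dd : 0 < d / (Num.sqrt M + 1) by pos.
 have d2 : 0 < (d / (Num.sqrt M + 1)) ^+ 2 by pos.
 have [N1 hN1] := cv _ d2.
 pose m := Num.min d e; have m0 : 0 < m by rewrite lt_min d0.
 have m2 : 0 < m ^+ 2 / (2 * S) by pos.
 have [N2 _ hN2] := near_infty_natSinv_lt (PosNum m2).
 pose n := maxn N1 N2; have sn : (n <= s n)%N.
  by elim: n => // k ih; apply: leq_ltn_trans ih _; exact: hs.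
 have a1 : nm (fun i => gramop A (x (s n)) i - w i) <= d.
  have hAx := (matvec_l2 M0 bA (xl (s n))).1.
  rewrite -(matvecB M0 bA' hAx hz).
  apply: le_trans (matvec_nm M0 bA' (l2B hAx hz)) _.
  have : nm (fun i => matvec A (x (s n)) i - z i) <= d / (Num.sqrt M + 1).
   rewrite -[leRHS](ger0_norm (ltW dd)) -sqrtr_sqr ler_sqrt ?sqr_ge0//.
   by apply: nrm2_le; apply: hN1; rewrite leq_maxl.
  move=> h; letr (Num.sqrt M * (d / (Num.sqrt M + 1))).
   by rewrite ler_wpM2l.
  by rewrite mulrA ler_pdivrMr// mulrC ler_pM2l// lerDl.
 have a2 : nm (fun i => gramop A (x (s n)) i - S%:C * x (s n) i) <= m.
  apply: le_trans (Sx _) _; rewrite -[leRHS](ger0_norm (ltW m0)) -sqrtr_sqr ler_sqrt ?sqr_ge0//.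
  have : (s n).+1%:R^-1 < m ^+ 2 / (2 * S).
   by apply: hN2; apply: leq_trans sn; rewrite leq_maxr.
  by rewrite ltr_pdivlMr ?mulr_gt0// => h; apply: ltW; rewrite mulrC.
 exists (s n); split; last by apply: le_trans a2 _; rewrite ge_min lexx orbT.
 have hSx := l2Z S%:C (xl (s n)); have hT := gramop_l2 M0 bA (xl (s n)).
 have E : (fun i => x (s n) i - u i) = (fun i => (S^-1)%:C * (S%:C * x (s n) i - w i)).
  ext i; rewrite mulrBr mulrA -rmorphM/= mulVf// mul1r.
  by [].
 rewrite E nmZ; last exact: l2B.
 rewrite normc_real ger0_norm ?invr_ge0// mulrC ler_pdivrMr//.
 apply: le_trans (nm_tri hSx hT hw) _; rewrite nmC//.
 have : m <= d by rewrite ge_min lexx.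
 by rewrite /d in a1 *; lra.
have Hu : H u.
 apply: (Hcl x) => // [n|e e0]; first exact: (hx n).1.
 by have [n [h _]] := close e e0; exists n.
exists u => //.
have nu : nm u = 1.
 apply/eqP; rewrite eq_le; apply/andP; split; apply/ler_addgt0Pr => e e0;
  have [n [h _]] := close e e0; have nx : nm (x n) = 1 by rewrite /nm (hx n).2.1 sqrtr1.
  have := nm_tri hu (xl n) (@l2_0 I).
  rewrite (_ : (fun i => u i - 0) = u); last by ext i; rewrite subr0.
  rewrite (_ : (fun i => x n i - 0) = x n); last by ext i; rewrite subr0.
  by rewrite nmC//; lra.
 have := nm_tri (xl n) hu (@l2_0 I).
 rewrite (_ : (fun i => u i - 0) = u); last by ext i; rewrite subr0.
 rewrite (_ : (fun i => x n i - 0) = x n); last by ext i; rewrite subr0.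
 lra.
have u1 : inner u u = 1 by rewrite inner_self// -nm_sq nu expr1n.
split => //; apply: (@eigvecP _ M _ S%:C) => //.
have hTu := gramop_l2 M0 bA hu; have hSu := l2Z S%:C hu.
suff : (fun i => gramop A u i - S%:C * u i) = (fun=> 0).
 by move=> h; ext i; have := congr1 (fun f => f i) h => /= /eqP; rewrite subr_eq0 => /eqP.
apply: nm_eq0; first exact: l2B.
move=> e e0; pose K := M + 1 + S; have K0 : 0 < K by rewrite /K; lra.
have eK : 0 < e / K by pos.
have [n [h1 h2]] := close _ eK.
have hTx := gramop_l2 M0 bA (xl n); have hSx := l2Z S%:C (xl n).
apply: le_trans (nm_tri hTu hTx hSu) _.
letr (M * (e / K) + (e / K + S * (e / K))); last first.
 by apply: ler_eq; rewrite /K; field; rewrite gt_eqF.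
apply: lerD.
 rewrite nmC// -(gramopB M0 bA)//.
 have hd := l2B (xl n) hu; have [hAd _] := matvec_l2 M0 bA hd.
 apply: le_trans (matvec_nm M0 bA' hAd) _.
 letr (Num.sqrt M * (Num.sqrt M * nm (fun i => x n i - u i))).
  by rewrite ler_wpM2l ?sqrtr_ge0//; exact: matvec_nm.
 by rewrite mulrA -expr2 sqr_sqrtr// ler_wpM2l.
apply: le_trans (nm_tri hTx hSx hSu) _; apply: lerD => //.
have -> : (fun i => S%:C * x n i - S%:C * u i) = (fun i => S%:C * (x n i - u i)).
 by ext i; rewrite mulrBr.
by rewrite nmZ ?normc_real ?ger0_norm// ?ler_wpM2l//; exact: l2B.
Qed.

End Spectral.

(** * Trace class matrices and compact matrices *)

Section TraceClass.
Implicit Types (x y z : I -> C) (A B : I * I -> C) (c M : R).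

(** Zorn on orthonormal sets of eigenvectors. The orthogonal complement of a maximal one is closed
    and invariant, so a nonzero vector in it would yield a further eigenvector by [eigvec_in]. *)
Lemma spectral_basis A : compact_op A ->
 exists D, orthonormal_basis D /\ forall e, D e -> eigvec A e.
Proof.
move=> cA; have [[M M0 bA] _] := (compact_opP A).1 cA.
pose P := [set D : set (I -> C) | [/\ D `<=` @l2 R I, forall e, D e -> inner e e = 1,
  forall e f, D e -> D f -> e <> f -> inner e f = 0 & forall e, D e -> eigvec A e]].
have [|D [[D1 D2 D3 D4] Dmax]] := @Zorn_bigcup _ P.
 move=> F FP tot; split.
 - by move=> e [X FX Xe]; have [h _ _ _] := FP _ FX; exact: h.
 - by move=> e [X FX Xe]; have [_ h _ _] := FP _ FX; exact: h.
 - move=> e f [X FX Xe] [Y FY Yf]; have [XY|YX] := tot X Y FX FY.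
   by have [_ _ h _] := FP _ FY; apply: h => //; exact: XY.
  by have [_ _ h _] := FP _ FX; apply: h => //; exact: YX.
 - by move=> e [X FX Xe]; have [_ _ _ h] := FP _ FX; exact: h.
exists D; split => //; split => // x hx xD; apply: contrapT => x0.
pose H := [set y : I -> C | l2 y /\ forall e, D e -> inner y e = 0].
have [|||||u Hu [u1 eu]] := @eigvec_in A H x cA _ _ x0.
- by move=> y [].
- by [].
- move=> y [hy yD]; split; first exact: gramop_l2 M0 bA hy.
 move=> e De; rewrite (gramop_sym M0 bA hy (D1 _ De)) (D4 _ De) innerZr ?yD ?mulr0//; exact: D1.
- by move=> a y [hy yD]; split; [exact: l2Z|move=> e De; rewrite innerZ ?yD ?mulr0//; exact: D1].
- move=> w y hw hy cv; split => // e De; apply: small_eq0 => d d0.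
 have [k hk] := cv d d0; have [hwk wD] := hw k.
 have he := D1 _ De.
 have -> : inner y e = inner (fun i => (-1) * (w k i - y i)) e.
  rewrite (_ : (fun i => _) = (fun i => y i + (-1) * w k i)); last by ext i; ring.
  by rewrite innerD ?innerZ ?wD ?mulr0 ?addr0//; exact: l2Z.
 have hB := l2B hwk hy.
 rewrite innerZ// normcM normcNE normc1 mul1r; apply: le_trans (inner_nm hB he) _.
 by rewrite [nm e]/nm -[nrm2 e]/(re (nrm2 e)%:C) -inner_self// D2//= sqrtr1 mulr1.
apply: (Dmax (D `|` [set u])).
 split; first exact: subsetUl.
 move=> /(_ u (or_intror erefl)) Du; have := Hu.2 _ Du; rewrite u1 => /eqP; by rewrite oner_eq0.
split.
- by move=> e [De|->]; [exact: D1|exact: Hu.1].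
- by move=> e [De|->]; [exact: D2|].
- move=> e f [De|->] [Df|->] //; first exact: D3.
  move=> _; rewrite (innerC Hu.1 (D1 _ De)) Hu.2//; exact: conjc_real.
 by move=> _; exact: Hu.2.
- by move=> e [De|->]; [exact: D4|].
Qed.

(** The trace norm, by duality with contractions on finite blocks. *)
Definition tcb A c : Prop := forall (J : {fset I}) (b : J -> J -> C), opsq b 1 ->
 normc (\sum_i \sum_j A (val i, val j) * b i j) <= c.

Lemma tcb_ge0 A c : tcb A c -> 0 <= c.
Proof.
by move=> h; exact: le_trans (normc_ge0 _) (h fset0 (fun _ _ => 0) (@opsq0 _ _ _ ler01)).
Qed.

(** The test matrix is the conjugate of A divided by its Hilbert-Schmidt norm. *)
Lemma tcb_HS A c : tcb A c -> l2le A (c ^+ 2).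
Proof.
move=> h P; have c0 := tcb_ge0 h.
pose J : {fset I} := ([fset t.1 | t in P] `|` [fset t.2 | t in P])%fset.
pose hh := \sum_(i : J) \sum_(j : J) normc (A (val i, val j)) ^+ 2.
have h0 : 0 <= hh by apply: sumr_ge0 => i _; apply: sumr_ge0 => j _; exact: sqr_ge0.
have hP : psum (fun t => normc (A t) ^+ 2) P <= hh.
 have J1 (t : P) : (val t).1 \in J by rewrite inE; apply/orP; left; apply/imfsetP; exists (val t) => //; exact: valP.
 have J2 (t : P) : (val t).2 \in J by rewrite inE; apply/orP; right; apply/imfsetP; exists (val t) => //; exact: valP.
 have ig : injective (fun t : P => ([` J1 t]%fset, [` J2 t]%fset)).
  by move=> s t [e1 e2]; apply: val_inj; exact: injective_projections.
 have := n2_inj (fun p : J * J => A (val p.1, val p.2)) ig.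
 rewrite n2_pair; apply: le_trans; apply: ler_eq.
 by apply: eq_bigr => t _ /=; case: (val t).
apply: le_trans hP _; have [->|hn0] := eqVneq hh 0; first exact: sqr_ge0.
have hp : 0 < hh by rewrite lt_def hn0.
have sp : 0 < Num.sqrt hh by rewrite sqrtr_gt0.
have := h J (fun i j => ((Num.sqrt hh)^-1)%:C * ((A (val i, val j))^*)%R).
have -> : \sum_(i : J) \sum_(j : J) A (val i, val j) * (((Num.sqrt hh)^-1)%:C * ((A (val i, val j))^*)%R)
  = (Num.sqrt hh)%:C.
 transitivity (((Num.sqrt hh)^-1)%:C * hh%:C : C).
  rewrite /hh real_complex_sum; sums i.
  rewrite real_complex_sum; sums j.
  by rewrite normc_mulconj; ring.
 rewrite -rmorphM/=; congr (_%:C).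
 by rewrite -{2}(sqr_sqrtr h0) expr2 mulrA mulVf ?gt_eqF// mul1r.
rewrite normc_real ger0_norm ?sqrtr_ge0// => h1.
have : Num.sqrt hh <= c.
 apply: h1; have hs := opsq_scale ((Num.sqrt hh)^-1)%:C (opsq_conj (opsq_HS (fun i j : J => A (val i, val j)))).
 apply: opsq_le hs; rewrite normc_real real_normK ?num_real// exprVn sqr_sqrtr//.
 by rewrite mulVf// gt_eqF.
by move=> h2; rewrite -[leLHS](sqr_sqrtr h0) ler_pXn2r ?nnegrE// ltW.
Qed.

(** [p] marks the unit vectors of the family; the others are null, as happens to A e / |A e| when A
    e = 0. *)
Lemma orth_comb (F : finType) (u : F -> I -> C) (p : pred F) (c : F -> C) :
 (forall s, l2 (u s)) -> (forall s t, inner (u s) (u t) = (p s && (s == t))%:R) ->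
 l2le (fun i => \sum_s c s * u s i) (n2 c).
Proof.
move=> hu ortho.
have sl2 (r : seq F) : l2 (fun i => \sum_(s <- r) c s * u s i).
 elim: r => [|s r ih].
  by rewrite (_ : (fun i => _) = (fun=> 0)); [exact: l2_0|ext i; rewrite big_nil].
 rewrite (_ : (fun i => _) = (fun i => c s * u s i + \sum_(s <- r) c s * u s i)); last first.
  by ext i; rewrite big_cons.
 by apply: l2D => //; exact: l2Z.
have insum (r : seq F) y : l2 y -> inner (fun i => \sum_(s <- r) c s * u s i) y = \sum_(s <- r) c s * inner (u s) y.
 move=> hy; elim: r => [|s r ih].
  by rewrite big_nil (_ : (fun i => _) = (fun=> 0)); [rewrite inner0|ext i; rewrite big_nil].
 rewrite (_ : (fun i => _) = (fun i => c s * u s i + \sum_(s <- r) c s * u s i)); last first.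
  by ext i; rewrite big_cons.
 by rewrite innerD ?innerZ// ?ih ?big_cons//; exact: l2Z.
have hl := sl2 (index_enum F); have := l2le_nrm2 hl.
have -> : nrm2 (fun i => \sum_s c s * u s i) = \sum_(s | p s) normc (c s) ^+ 2.
 apply: (@complexI R); rewrite -inner_self// insum// real_complex_sum.
 rewrite [RHS]big_mkcond/=; eqs s.
 rewrite (innerC hl (hu s)) insum//.
 rewrite (eq_bigr (fun t => (t == s)%:R * ((p s)%:R * c t))); last first.
  by move=> t _; rewrite ortho; case: eqVneq => [->|_]; rewrite ?andbT ?andbF ?mul0r ?mulr0 ?mul1r// mulrC.
 rewrite sum_deltar rmorphM/= natr_conj; case: (p s); last by rewrite mul0r mulr0.
 by rewrite mul1r normc_mulconj.
move=> h J; apply: le_trans (h J) _; rewrite /n2 [leRHS](bigID p)/= lerDl.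
by apply: sumr_ge0 => s _; exact: sqr_ge0.
Qed.

Lemma orth_opsq (F : finType) (u : F -> I -> C) (p : pred F) (J : {fset I}) :
 (forall s, l2 (u s)) -> (forall s t, inner (u s) (u t) = (p s && (s == t))%:R) ->
 opsq (fun (j : J) (s : F) => u s (val j)) 1.
Proof.
move=> hu ortho c; rewrite mul1r.
apply: le_trans (orth_comb c hu ortho J).
apply: ler_eq; apply: n2_eq => j; eqs s; exact: mulrC.
Qed.

(** With f_s = A e_s / |A e_s|, the partial isometry taking e_s to f_s for every s with A e_s
    nonzero, conjugated, pairs with A to the sum of the |A e_s|. It is cut down to a finite block,
    at a cost below d. *)
Lemma tcb_sum A c (D : set (I -> C)) (F : {fset (I -> C)}) : tcb A c ->
 orthonormal_basis D -> (forall e, D e -> eigvec A e) -> (forall e : F, D (val e)) ->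
 \sum_(e : F) Num.sqrt (nrm2 (matvec A (val e))) <= c.
Proof.
move=> hA [D1 D2 D3 _] eD FD.
have c20 : 0 <= c ^+ 2 by exact: sqr_ge0.
have bA := HS_bdd (tcb_HS hA).
have el (s : F) : l2 (val s) by exact/D1/FD.
have Al (s : F) : l2 (matvec A (val s)) by have [] := matvec_l2 c20 bA (el s).
pose lam (s : F) := nm (matvec A (val s)).
have lam0 s : 0 <= lam s by exact: nm_ge0.
pose f (s : F) i := ((lam s)^-1)%:C * matvec A (val s) i.
have fl s : l2 (f s) by exact: l2Z.
have oe (s t : F) : inner (val s) (val t) = (s == t)%:R.
 have [->|st] := eqVneq s t; first by rewrite D2.
 by rewrite D3// => /val_inj /eqP; rewrite (negbTE st).
have oA (s t : F) : inner (matvec A (val s)) (matvec A (val t)) = (s == t)%:R * (lam s ^+ 2)%:C.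
 rewrite -(gramop_inner c20 bA)// eD// innerZ// oe mulrC; congr (_ * _%:C).
 by rewrite /lam nm_sq.
have of_ s t : inner (f s) (f t) = ((0 < lam s) && (s == t))%:R.
 rewrite innerZ ?innerZr ?oA//.
 rewrite (_ : ((_%:C)^*)%R = ((lam t)^-1)%:C); last exact: conjc_real.
 have [<-|_] := eqVneq s t; last by rewrite andbF mul0r !mulr0.
 rewrite andbT mul1r -!rmorphM/=; have [l0|] := ltP 0 (lam s).
  rewrite (_ : _ * _ = 1) ?rmorph1//; field; by rewrite gt_eqF.
 move=> ln; have -> : lam s = 0 by apply/eqP; rewrite eq_le ln lam0.
 by rewrite expr0n !mulr0.
have iAf s : inner (matvec A (val s)) (f s) = (lam s)%:C.
 rewrite innerZr ?oA// (_ : ((_%:C)^*)%R = ((lam s)^-1)%:C); last exact: conjc_real.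
 rewrite eqxx mul1r -rmorphM/=; congr (_%:C); have [->|l0] := eqVneq (lam s) 0.
  by rewrite expr0n mulr0.
 by field.
apply/ler_addgt0Pr => d d0; pose n : R := #|{: F}|%:R.
have n0 : 0 <= n by rewrite ler0n.
pose K := c * (\sum_(s : F) nm (f s) + 1) + 1.
have nf0 : 0 <= \sum_(s : F) nm (f s) by apply: sumr_ge0 => s _; exact: nm_ge0.
have c0 := tcb_ge0 hA.
have K0 : 0 < K by rewrite ltr_wpDl// mulr_ge0// addr_ge0.
pose L := \sum_(s : F) lam s + 1.
have L0 : 0 < L by rewrite ltr_wpDl// sumr_ge0.
pose dd := d / ((n + 1) * (K + c)).
have Kc : 0 < (n + 1) * (K + c) by apply: mulr_gt0; lra.
have dd0 : 0 < dd by rewrite divr_gt0.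
have dd2 : 0 < dd ^+ 2 by rewrite exprn_gt0.
have /choice[J1 hJ1] s := cutoff_tail (el s) dd2.
have /choice[J2 hJ2] s := cutoff_tail (fl s) dd2.
have [Ja hJa] := fset_cover J1; have [Jb hJb] := fset_cover J2.
pose J := (Ja `|` Jb)%fset.
have t1 (s : F) : nm (fun i => val s i - cutoff J (val s) i) <= dd.
 rewrite -[leRHS](ger0_norm (ltW dd0)) -sqrtr_sqr /nm ler_sqrt ?sqr_ge0//.
 by apply: nrm2_le; apply: hJ1; apply: fsubset_trans (hJa s) _; exact: fsubsetUl.
have t2 (s : F) : nm (fun i => f s i - cutoff J (f s) i) <= dd.
 rewrite -[leRHS](ger0_norm (ltW dd0)) -sqrtr_sqr /nm ler_sqrt ?sqr_ge0//.
 by apply: nrm2_le; apply: hJ2; apply: fsubset_trans (hJb s) _; exact: fsubsetUr.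
pose b (i j : J) : C := \sum_(s : F) ((f s (val i))^*)%R * val s (val j).
have hb : opsq b 1.
 have o1 : opsq (fun (j : J) (s : F) => val s (val j)) 1.
  by apply: (orth_opsq (u := fun s : F => val s) (p := predT)) => // s t; rewrite oe.
 have o2 := opsq_conj (orth_opsq J fl of_).
 exact: (opsq_ext (fun i j => erefl (b i j)) (opsq_comp1 o2 (opsq_tr ler01 o1))).
pose q (s : F) := inner (matvec A (cutoff J (val s))) (cutoff J (f s)).
have cl (s : F) : l2 (cutoff J (val s)) by exact: cutoff_l2.
have cf s : l2 (cutoff J (f s)) by exact: cutoff_l2.
have Acl (s : F) : l2 (matvec A (cutoff J (val s))) by have [] := matvec_l2 c20 bA (cl s).
have E : \sum_i \sum_j A (val i, val j) * b i j = \sum_s q s.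
 have qE (s : F) : q s = \sum_(i : J) \sum_(j : J) A (val i, val j) * (((f s (val i))^*)%R * val s (val j)).
  have h1 := inner_cv (Acl s) (cf s).
  have h2 := ncvg_conj (ncvg_cutoff J (fun i => ((matvec A (cutoff J (val s)) i)^*)%R) (f s)).
  rewrite /q (ncvg_unique h1 (m := ((\sum_(j : J) ((matvec A (cutoff J (val s)) (val j))^*)%R * f s (val j))^*)%R)).
   rewrite rmorph_sum; eqs i; rewrite rmorphM/= conjCK.
   rewrite (ncvg_unique (matvec_cv (val i) c20 bA (cl s)) (ncvg_cutoff J (fun j => A (val i, j)) (val s))).
   by sums j; rewrite -mulrA; congr (_ * _); exact: mulrC.
  move: h2; rewrite (_ : (fun i => _) = (fun i => matvec A (cutoff J (val s)) i * ((cutoff J (f s) i)^*)%R))//.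
  by ext i; rewrite rmorphM/= conjCK.
 under [RHS]eq_bigr do rewrite qE.
 rewrite [RHS]exchange_big; eqs i; rewrite [RHS]exchange_big; eqs j.
 by rewrite /b mulr_sumr.
have := hA J b hb; rewrite E => hq.
have qd (s : F) : normc ((lam s)%:C - q s) <= dd * (K + c).
 rewrite -iAf /q.
 have hd1 := l2B (el s) (cl s); have hd2 := l2B (fl s) (cf s).
 have hAd : l2 (matvec A (fun i => val s i - cutoff J (val s) i)) by have [] := matvec_l2 c20 bA hd1.
 have -> : inner (matvec A (val s)) (f s) - inner (matvec A (cutoff J (val s))) (cutoff J (f s)) =
   inner (matvec A (fun i => val s i - cutoff J (val s) i)) (f s) +
   inner (matvec A (cutoff J (val s))) (fun i => f s i - cutoff J (f s) i).
  rewrite (matvecB c20 bA (el s) (cl s)).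
  rewrite (_ : (fun i => matvec A (val s) i - _) = (fun i => matvec A (val s) i + (-1) * matvec A (cutoff J (val s)) i)); last by ext i; rewrite mulN1r.
  rewrite (_ : (fun i => f s i - _) = (fun i => f s i + (-1) * cutoff J (f s) i)); last by ext i; rewrite mulN1r.
  rewrite innerD ?innerDr ?innerZ ?innerZr//; try exact: l2Z.
  by rewrite rmorphN rmorph1 !mulN1r; ring.
 apply: le_trans (normcD _ _) _; rewrite mulrDr; apply: lerD.
  apply: le_trans (inner_nm hAd (fl s)) _.
  letr (c * dd * nm (f s)).
   rewrite ler_wpM2r ?nm_ge0//; apply: le_trans (matvec_nm c20 bA hd1) _.
   by rewrite sqrtr_sqr ger0_norm// ler_wpM2l.
  rewrite (mulrC c) -mulrA ler_wpM2l ?(ltW dd0)// /K.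
  letr (c * (\sum_(s : F) nm (f s) + 1)); last by rewrite lerDl.
  rewrite ler_wpM2l//; letr (\sum_(s : F) nm (f s)); last by rewrite lerDl.
  by rewrite (bigD1 s)//= lerDl sumr_ge0// => t _; exact: nm_ge0.
 apply: le_trans (inner_nm (Acl s) hd2) _; rewrite mulrC; apply: ler_pM => //; rewrite ?nm_ge0//.
 apply: le_trans (matvec_nm c20 bA (cl s)) _; rewrite sqrtr_sqr ger0_norm// -[leRHS]mulr1 ler_wpM2l//.
 have : nrm2 (cutoff J (val s)) <= 1.
  apply: nrm2_le; apply: cutoff_le; have := l2le_nrm2 (el s).
  by rewrite -[nrm2 _]/(re (nrm2 (val s))%:C) -inner_self// D2.
 by move=> h; rewrite /nm -[leRHS]sqrtr1 ler_sqrt.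
have : re (\sum_s q s) <= c by apply: le_trans (ler_norm _) (le_trans (Re_le_normc _) hq).
rewrite Re_sum => hq'.
letr (\sum_s (re (q s) + dd * (K + c))).
 apply: ler_sum => s _; have := le_trans (Re_le_normc _) (qd s).
 by rewrite ler_norml ReB/= => /andP[_]; rewrite lerBlDl.
rewrite big_split/= sumr_const -mulr_natl -/n; apply: lerD => //.
have -> : n * (dd * (K + c)) = d * (n / (n + 1)).
 by rewrite /dd; field; rewrite !gt_eqF//; lra.
by rewrite ger_pMr// ler_pdivrMr ?ltr_wpDl// mul1r lerDl.
Qed.

(** |A e| <= c, so |A e|^q is at most |A e| c^(q - 1), and the |A e| add up to at most c. *)
Lemma tcb_trace_abs_pow A c (q : R) : tcb A c -> 1 <= q -> (trace_abs_pow q A < +oo)%E.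
Proof.
move=> hA q1; have c0 := tcb_ge0 hA; have c20 : 0 <= c ^+ 2 by exact: sqr_ge0.
have bA := HS_bdd (tcb_HS hA).
have [D [oD eD]] := spectral_basis (HS_compact (tcb_HS hA)).
have [D1 D2 D3 _] := oD.
pose K := c * (c ^+ 2) `^ ((q - 1) / 2).
apply: (@le_lt_trans _ _ K%:E); last exact: ltry.
letr (\esum_(e in D) ((nrm2 (matvec A e)) `^ (q / 2))%:E)%E.
 apply: ereal_inf_lbound; exists D, (fun e => nrm2 (matvec A e)); split => //.
 by move=> e _; exact: nrm2_ge0.
apply: ge_ereal_sup => _ [X [finX XD] <-].
rewrite fsbig_finite//= sumEFin lee_fin big_seq_fsetE/=.
have FD (e : fset_set X) : D (val e).
 by apply: XD; have := valP e; rewrite in_fset_set// inE.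
letr (\sum_(e : fset_set X) Num.sqrt (nrm2 (matvec A (val e))) * (c ^+ 2) `^ ((q - 1) / 2)).
 apply: ler_sum => e _; have n0 := nrm2_ge0 (matvec A (val e)).
 rewrite -powR12_sqrt//.
 have -> : q / 2 = 2^-1 + (q - 1) / 2 by field.
 have q0 : 0 <= (q - 1) / 2 by rewrite divr_ge0// subr_ge0.
 rewrite powRD; last by rewrite gt_eqF// ltr_wpDr// invr_gt0.
 rewrite ler_wpM2l ?powR_ge0// ge0_ler_powR ?nnegrE//.
 have el := D1 _ (FD e); have [_ h] := matvec_l2 c20 bA el.
 apply: le_trans h _; rewrite -[nrm2 (val e)]/(re (nrm2 (val e))%:C) -inner_self// D2 ?mulr1//.
rewrite -mulr_suml ler_wpM2r ?powR_ge0//; exact: tcb_sum hA oD eD FD.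
Qed.

Lemma tcb_schatten A c (q : R) : tcb A c -> 1 <= q -> schatten q A.
Proof.
move=> hA q1; split; first exact: HS_compact (tcb_HS hA).
by apply: poweR_lty; exact: tcb_trace_abs_pow hA q1.
Qed.

Lemma opsq_rowmask (S T : finType) (K : S -> T -> C) (p : pred S) c :
 opsq K c -> opsq (fun s t => (p s)%:R * K s t) c.
Proof.
move=> h v; apply: le_trans (h v); apply: ler_sum => s _.
case: (p s); last by rewrite big1 ?normc0 ?expr0n ?sqr_ge0// => t _; rewrite !mul0r.
by under eq_bigr do rewrite mul1r.
Qed.

(** Otherwise vectors of the unit ball have images of squared mass above e outside [Js n], a growing
    chain that contains all but e/4 of every earlier image. Two late images of a convergent
    subsequence are too close for that. *)
Lemma compact_row_tail A (e : R) : compact_op A -> 0 < e ->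
 exists J : {fset I}, bdd (fun t => (t.1 \notin J)%:R * A t) e.
Proof.
move=> /compact_opP[[M M0 bA] cA] e0; apply: contrapT => nJ.
have bad (J : {fset I}) : exists x : I -> C, l2le x 1 /\
  exists P : {fset I}, e < n2 (fun s : P => (val s \notin J)%:R * matvec A x (val s)).
 apply: contrapT => nx; apply: nJ; exists J => P Q v.
 rewrite leNgt; apply/negP => lt.
 have vp : 0 < n2 v.
  rewrite lt_def n2_ge0 andbT; apply/eqP => v0; move: lt; rewrite v0 mulr0.
  rewrite n2_null ?ltxx// => s; rewrite big1// => t _; rewrite (n2_eq0 v0); exact: mulr0.
 pose r : C := ((Num.sqrt (n2 v))^-1)%:C.
 have rE : normc r ^+ 2 = (n2 v)^-1.
  by rewrite normc_real real_normK ?num_real// exprVn sqr_sqrtr// ltW.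
 apply: nx; exists (zext (fun t => r * v t)); split.
  by move=> J'; apply: le_trans (zext_l2 _ J') _; rewrite n2_scale rE mulVf// gt_eqF.
 exists P; have -> : n2 (fun s : P => (val s \notin J)%:R * matvec A (zext (fun t => r * v t)) (val s)) =
   (n2 v)^-1 * n2 (fun s : P => \sum_t (val s \notin J)%:R * A (val s, val t) * v t).
  rewrite -rE -n2_scale; apply: n2_eq => s; rewrite matvec_zext !mulr_sumr.
  by eqs t; ring.
 by rewrite mulrC ltr_pdivlMr.
have /choice[X hX] := bad.
have [e4 he4] : exists d : R, 0 < d /\ d = e / 4 by exists (e / 4); rewrite divr_gt0.
have Al x : l2le x 1 -> l2 (matvec A x) by move=> h; have [] := matvec_l2 M0 bA (l2le_l2 h).
have /choice[T hT] (J : {fset I}) := cutoff_tail (Al _ (hX J).1) he4.1.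
pose Js := fix Js n := if n is m.+1 then (Js m `|` T (Js m))%fset else (fset0 : {fset I}).
have mono n m : (n <= m)%N -> (Js n `<=` Js m)%fset.
 elim: m => [|m ih]; first by rewrite leqn0 => /eqP ->; exact: fsubset_refl.
 rewrite leq_eqVlt => /orP[/eqP -> |]; first exact: fsubset_refl.
 by rewrite ltnS => /ih h; apply: fsubset_trans h _; exact: fsubsetUl.
have [s [y [hs hy cv]]] := cA (fun n => X (Js n)) (fun n => (hX (Js n)).1).
have [d he16] : exists d : R, 0 < d /\ d = e / 16 by exists (e / 16); rewrite divr_gt0.
have [N hN] := cv d he16.1.
pose k := s N; pose l := s N.+1; have kl : (k < l)%N by exact: hs.
pose xk := X (Js k); pose xl := X (Js l).
have [Px hP] := (hX (Js l)).2.
have dif : l2le (fun i => matvec A xl i - matvec A xk i) (e / 4).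
 have hk := hN N (leqnn N); have hl := hN N.+1 (leqnSn N).
 rewrite (_ : (fun i => _) = (fun i => (matvec A xl i - y i) + (-1) * (matvec A xk i - y i))); last first.
  by ext i; ring.
 have sd : 0 <= Num.sqrt d by exact: sqrtr_ge0.
 rewrite (_ : e / 4 = (Num.sqrt d + Num.sqrt d) ^+ 2); last first.
  rewrite -mulr2n -[_ *+ 2]mulr_natl exprMn sqr_sqrtr ?he16.2 ?divr_ge0 ?(ltW e0)//; by field.
 apply: l2le_add => //; rewrite sqr_sqrtr ?(ltW he16.1)//.
 have := l2leZ (-1) hk; by rewrite normcNE normc1 expr1n mul1r.
have tl : l2le (fun i => (i \notin Js l)%:R * matvec A xk i) (e / 4).
 have h := hT (Js k) (Js l); have sub : (T (Js k) `<=` Js l)%fset.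
  by apply: fsubset_trans (mono k.+1 l kl); exact: fsubsetUr.
 move: (h sub); rewrite he4.2 (_ : (fun i => _ - _) = (fun i => (i \notin Js l)%:R * matvec A xk i))//.
 by ext i; rewrite /cutoff; case: (i \in Js l); rewrite ?mul1r ?mul0r ?subrr ?subr0.
move: hP; rewrite ltNge => /negP; apply.
have -> : e = (Num.sqrt e / 2 + Num.sqrt e / 2) ^+ 2 by rewrite -splitr sqr_sqrtr// ltW.
have e4E : e / 4 = (Num.sqrt e / 2) ^+ 2.
 by rewrite expr_div_n sqr_sqrtr ?(ltW e0)//; congr (_ / _); ring.
have := l2le_add (x := fun i => (i \notin Js l)%:R * (matvec A xl i - matvec A xk i))
 (y := fun i => (i \notin Js l)%:R * matvec A xk i) (c := Num.sqrt e / 2) (d := Num.sqrt e / 2).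
have s2 : 0 <= Num.sqrt e / 2 by rewrite divr_ge0// sqrtr_ge0.
rewrite -e4E => /(_ s2 s2 _ tl) h.
have {}h := h _ Px; rewrite -/xl.
apply: le_trans (h _) => [|J].
 apply: ler_eq; eqs i; congr (normc _ ^+ 2).
 by rewrite mulrBr subrK.
apply: le_trans (dif J); apply: ler_sum => i _.
by case: (_ \notin _); rewrite ?mul1r// mul0r normc0 expr0n sqr_ge0.
Qed.

Definition trunc (J : {fset I}) A : I * I -> C := fun t => ((t.1 \in J) && (t.2 \in J))%:R * A t.

Lemma bdd_add A B (c d : R) : 0 <= c -> 0 <= d -> bdd A (c ^+ 2) -> bdd B (d ^+ 2) ->
 bdd (fun t => A t + B t) ((c + d) ^+ 2).
Proof. by move=> c0 d0 hA hB P Q; exact: opsq_add. Qed.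

Lemma opsq_colmask (S T : finType) (K : S -> T -> C) (p : pred T) c : 0 <= c ->
 opsq K c -> opsq (fun s t => (p t)%:R * K s t) c.
Proof. by move=> c0 h; apply: opsq_tr => //; apply: opsq_rowmask; exact: opsq_tr. Qed.

(** Rows outside J1 are small by [compact_row_tail], also after masking columns; the finitely many
    rows in J1 have small tails, measured in the Hilbert-Schmidt norm. *)
Lemma compact_trunc A (e : R) : compact_op A -> 0 < e ->
 exists J0 : {fset I}, forall J : {fset I}, (J0 `<=` J)%fset -> bdd (fun t => A t - trunc J A t) (e ^+ 2).
Proof.
move=> cA e0; have [[M M0 bA] _] := (compact_opP A).1 cA.
pose d := e / 3; have d0 : 0 < d by rewrite divr_gt0.
have d20 : 0 < d ^+ 2 by rewrite exprn_gt0.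
have [J1 hJ1] := compact_row_tail cA d20.
pose n : R := #|{: J1}|%:R; have n0 : 0 <= n by rewrite ler0n.
pose dd := d ^+ 2 / (n + 1); have dd0 : 0 < dd by rewrite divr_gt0// ltr_wpDl.
have /choice[T hT] (i : J1) := cutoff_tail (l2le_l2 (bdd_row (val i) M0 bA)) dd0.
have [J2 hJ2] := fset_cover T.
exists (J1 `|` J2)%fset => J; rewrite fsubUset => /andP[s1 s2].
have b1 : bdd (fun t => (t.1 \notin J)%:R * A t) (d ^+ 2).
 move=> P Q; have := opsq_rowmask (fun s : P => val s \notin J) (hJ1 P Q).
 apply: opsq_ext => s t /=; case: (boolP (val s \in J)) => [_|nJ]; first by rewrite !mul0r.
 have -> : val s \notin J1 by apply: contra nJ; exact: (fsubsetP s1).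
 by rewrite !mul1r.
have b2 : bdd (fun t => ((t.1 \in J) && (t.2 \notin J))%:R * ((t.1 \notin J1)%:R * A t)) (d ^+ 2).
 move=> P Q; have := opsq_rowmask (fun s : P => val s \in J) (opsq_colmask (fun t : Q => val t \notin J) (ltW d20) (hJ1 P Q)).
 by apply: opsq_ext => s t /=; rewrite -mulnb natrM; ring.
have b3 : bdd (fun t => ((t.1 \in J) && (t.2 \notin J))%:R * ((t.1 \in J1)%:R * A t)) (d ^+ 2).
 move=> P Q; apply: opsq_le (opsq_HS _).
 have nb (b : bool) : normc (b%:R : C) ^+ 2 = b%:R.
  by case: b; rewrite ?normc1 ?normc0 ?expr1n ?expr0n.
 pose y i := (i \in J1)%:R * \sum_(t : Q) normc ((val t \notin J)%:R * A (i, val t)) ^+ 2.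
 have y0 i : 0 <= y i by rewrite mulr_ge0// sumr_ge0// => t _; exact: sqr_ge0.
 letr (psum y P).
  apply: ler_sum => s _; rewrite /y mulr_sumr; apply: ler_sum => t _ /=.
  rewrite -mulnb natrM !normcM !exprMn !nb; have := sqr_ge0 (normc (A (val s, val t))) => a0.
  by case: (_ \in J1); case: (_ \in J); case: (_ \notin J); rewrite ?mul1r ?mul0r ?mulr0 ?mul0r.
 letr (psum y (P `|` J1)%fset); first by apply: psum_le => //; exact: fsubsetUl.
 letr (psum (fun i => \sum_(t : Q) normc ((val t \notin J)%:R * A (i, val t)) ^+ 2) J1).
  by rewrite (psum_mask _ (fsubsetUr P J1)).
 letr (\sum_(i : J1) dd).
  apply: ler_sum => i _; have sub : (T i `<=` J)%fset by apply: fsubset_trans s2; exact: hJ2.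
  have := hT i J sub Q; apply: le_trans; apply: ler_sum => t _.
  by rewrite /cutoff; case: (_ \in J); rewrite /= ?mul1r ?mul0r ?subr0 ?subrr.
 rewrite sumr_const -mulr_natl -/n /dd mulrCA ger_pMr// ler_pdivrMr ?ltr_wpDl// mul1r lerDl//.
have -> : e = d + (d + d) by rewrite /d; field.
have -> : (fun t => A t - trunc J A t) = (fun t => (t.1 \notin J)%:R * A t +
  (((t.1 \in J) && (t.2 \notin J))%:R * ((t.1 \notin J1)%:R * A t) +
  ((t.1 \in J) && (t.2 \notin J))%:R * ((t.1 \in J1)%:R * A t))).
 apply/funext => -[i j]; rewrite /trunc/=.
 by case: (i \in J); case: (j \in J); case: (i \in J1); rewrite /= ?mul1r ?mul0r ?subr0 ?subrr ?addr0 ?add0r.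
by apply: bdd_add; rewrite ?addr_ge0 ?(ltW d0)//; apply: bdd_add; rewrite ?(ltW d0).
Qed.

End TraceClass.

(** * The matrix norms of S_oo and S_1 on finite blocks *)

Section Norms.
Implicit Types (A B : I * I -> C) (c : R) (J : {fset I}).

Definition blk J (n : nat) (x : MI n) : 'I_n * J -> 'I_n * J -> C :=
 fun p q => x p.1 q.1 (val p.2, val q.2).

Arguments blk J {n} x.

(** [G0 c] and [G1 c] are the balls of radius c for the norms of M_A(S_oo^S) and M_A(S_1^S); the
    square comes from [opsq]. *)
Definition G0 c (A S : finType) (x : A * S -> A * S -> C) : Prop := opsq x (c ^+ 2).

Definition G1 c (A S : finType) (x : A * S -> A * S -> C) : Prop :=
 forall (B : finType) (b : B * S -> B * S -> C), opsq b 1 -> opsq (spair x b) (c ^+ 2).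

Lemma Soo_bdd n (x : MI n) c :
 bdd (fun t : ('I_n * I) * ('I_n * I) => x t.1.1 t.2.1 (t.1.2, t.2.2)) (c ^+ 2) <->
 forall J, G0 c (blk J x).
Proof.
split=> [h J|h P Q].
 have ig : injective (fun p : 'I_n * J => (p.1, val p.2)) by move=> [a s] [b t] [-> /val_inj ->].
 exact: (bdd_inj (sqr_ge0 c) ig ig h).
pose J : {fset I} := ([fset t.2 | t in P] `|` [fset t.2 | t in Q])%fset.
have J1 (t : P) : (val t).2 \in J by rewrite inE; apply/orP; left; apply/imfsetP; exists (val t) => //; exact: valP.
have J2 (t : Q) : (val t).2 \in J by rewrite inE; apply/orP; right; apply/imfsetP; exists (val t) => //; exact: valP.
have i1 : injective (fun t : P => ((val t).1, [` J1 t]%fset)).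
 by move=> s t [e1 e2]; apply: val_inj; exact: injective_projections.
have i2 : injective (fun t : Q => ((val t).1, [` J2 t]%fset)).
 by move=> s t [e1 e2]; apply: val_inj; exact: injective_projections.
exact: (opsq_inj (sqr_ge0 c) i1 i2 (h J)).
Qed.

Lemma Soo_fin n (x : MI n) : (Soo x < +oo)%E -> forall i j, compact_op (x i j).
Proof.
by rewrite /Soo /restrict_mnorms; case: asboolP.
Qed.

Lemma SooP n (x : MI n) c : 0 <= c ->
 (Soo x <= c%:E)%E <-> (forall i j, compact_op (x i j)) /\ forall J, G0 c (blk J x).
Proof.
move=> c0; rewrite /Soo /restrict_mnorms; case: asboolP => h.
 by rewrite opnormP// Soo_bdd; split => [?|[]].
by split => [|[]//]; rewrite leye_eq.
Qed.

Definition fsupp J A : Prop := forall t, ~~ ((t.1 \in J) && (t.2 \in J)) -> A t = 0.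

Lemma fsupp_HS J A : fsupp J A -> exists c, l2le A c.
Proof.
move=> h; pose y t := normc (A t) ^+ 2.
exists (psum y (J `*` J)%fset) => P.
letr (psum y (P `|` (J `*` J))%fset).
 by apply: psum_le => [t|]; [exact: sqr_ge0|exact: fsubsetUl].
rewrite (psum_mask y (fsubsetUr P (J `*` J)%fset)); apply: ler_sum => t _.
have [_|ni] := boolP (val t \in (J `*` J)%fset); first by rewrite mul1r.
by rewrite /y h ?normc0 ?expr0n ?mulr0//; move: ni; rewrite in_fsetM.
Qed.

Lemma fsupp_compact J A : fsupp J A -> compact_op A.
Proof. by move=> /fsupp_HS[c]; exact: HS_compact. Qed.

(** The inner sums converge by Cauchy-Schwarz on rows. The outer one converges absolutely: phases
    [u] turn the sum of the moduli into a pairing of A with a contraction. *)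
Lemma tp_cv A B c : tcb A c -> bdd B 1 ->
 (forall i, ncvg (fun j => A (i, j) * B (i, j)) (mxprod A (transp B) (i, i))) /\
 ncvg (fun i => mxprod A (transp B) (i, i)) (trace_pairing A B).
Proof.
move=> hA hB; have c0 := tcb_ge0 hA; have c20 : 0 <= c ^+ 2 by exact: sqr_ge0.
have bA := HS_bdd (tcb_HS hA).
have cv i : ncvg (fun j => A (i, j) * B (i, j)) (mxprod A (transp B) (i, i)).
 suff [l hl] : exists l, ncvg (fun j => A (i, j) * B (i, j)) l by rewrite /mxprod/= (ncvg_sum hl).2.
 have h1 := bdd_row i c20 bA; have h2 := bdd_row i ler01 hB.
 have h3 := bdd_row i ler01 (fun P Q => opsq_conj (hB P Q) : opsq (fun s t => (fun t => ((B t)^*)%R) (val s, val t)) 1).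
 exists (inner (fun j => A (i, j)) (fun j => ((B (i, j))^*)%R)).
 have := inner_cv (l2le_l2 h1) (l2le_l2 h3).
 by rewrite (_ : (fun j => _) = (fun j => A (i, j) * B (i, j)))//; ext j; rewrite conjCK.
split => //.
suff [l hl] : exists l, ncvg (fun i => mxprod A (transp B) (i, i)) l.
 by rewrite /trace_pairing /trace (ncvg_sum hl).2.
apply: (@ncvg_abs _ _ c) => P; apply/ler_addgt0Pr => e e0.
have /choice[u hu] (i : P) : exists u : C, normc u = 1 /\ u * mxprod A (transp B) (val i, val i) =
  (normc (mxprod A (transp B) (val i, val i)))%:C.
 by have [u u1 u2] := normc_phase (mxprod A (transp B) (val i, val i)); exists u.
pose n : R := #|{: P}|%:R; have n0 : 0 <= n by rewrite ler0n.
have d0 : 0 < e / (n + 1) by rewrite divr_gt0// ltr_wpDl.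
have /choice[Q0 hQ] (i : P) := cv (val i) _ d0.
have [Q QQ] := fset_cover Q0.
pose J := (P `|` Q)%fset.
pose uu (i : I) : C := if insub i is Some t then u t else 0.
pose b (i j : J) : C := (val j \in Q)%:R * ((val i \in P)%:R * (uu (val i) * B (val i, val j))).
have hb : opsq b 1.
 apply: opsq_colmask => //; apply: opsq_rowmask.
 have hd : opsq (kcomp (fun s t : J => (s == t)%:R * uu (val s)) (fun s t : J => B (val s, val t))) 1.
  apply: opsq_comp1; last exact: hB.
  apply: opsq_diag => t; rewrite /uu; case: insubP => [s _ _|_]; first by rewrite (hu s).1 expr1n.
  by rewrite normc0 expr0n ler01.
 apply: opsq_ext hd => s t; rewrite /kcomp -[RHS](sum_deltal s (fun s => uu (val s) * B (val s, val t))).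
 by eqs r; have [->|_] := eqVneq s r; rewrite ?mul1r// !mul0r.
have := hA J b hb.
have -> : \sum_i \sum_j A (val i, val j) * b i j =
  \sum_(i : P) u i * \sum_(j : Q) A (val i, val j) * B (val i, val j).
 pose F i j := uu i * (A (i, j) * B (i, j)).
 transitivity (psum (fun i => \sum_(j : Q) F i (val j)) P); last first.
  eqs i; sums j.
  by rewrite /F /uu valK.
 rewrite (psum_mask _ (fsubsetUl P Q)); eqs i.
 rewrite -/(psum (F (val i)) Q) (psum_mask _ (fsubsetUr P Q)) mulr_sumr.
 by eqs j; rewrite /b /F; ring.
move=> hc.
have E : \sum_(i : P) (normc (mxprod A (transp B) (val i, val i)))%:C =
  \sum_(i : P) u i * mxprod A (transp B) (val i, val i).
 by eqs i; rewrite (hu i).2.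
have -> : psum (fun i => normc (mxprod A (transp B) (i, i))) P =
  normc (\sum_(i : P) u i * mxprod A (transp B) (val i, val i)).
 rewrite -E -real_complex_sum normc_real ger0_norm//.
 by apply: sumr_ge0 => i _; exact: normc_ge0.
apply: le_trans (normc_subl _ (\sum_(i : P) u i * \sum_(j : Q) A (val i, val j) * B (val i, val j))) _.
rewrite addrC; apply: lerD => //.
rewrite -sumrB; apply: le_trans (normc_sum _ _ _) _.
letr (\sum_(i : P) (e / (n + 1))).
 apply: ler_sum => i _; rewrite -mulrBr normcM (hu i).1 mul1r normc_distC.
 exact: (hQ i Q (QQ i)).
by rewrite sumr_const -mulr_natl -/n mulrCA ger_pMr// ler_pdivrMr ?ltr_wpDl// mul1r lerDl.
Qed.

Lemma tp_approx (K : finType) (A B : K -> I * I -> C) c (e : R) :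
 (forall k, tcb (A k) c) -> (forall k, bdd (B k) 1) -> 0 < e ->
 exists P Q : {fset I}, forall k,
  normc (\sum_(i : P) \sum_(j : Q) A k (val i, val j) * B k (val i, val j) - trace_pairing (A k) (B k)) <= e.
Proof.
move=> hA hB e0; have e20 : 0 < e / 2 by rewrite divr_gt0.
have /choice[P0 hP0] k := (tp_cv (hA k) (hB k)).2 _ e20.
have [P PP] := fset_cover P0.
pose n : R := #|{: P}|%:R; have n0 : 0 <= n by rewrite ler0n.
have d0 : 0 < e / 2 / (n + 1) by rewrite divr_gt0// ltr_wpDl.
have /choice[Q0 hQ] (ki : K * P) := (tp_cv (hA ki.1) (hB ki.1)).1 (val ki.2) _ d0.
have [Q QQ] := fset_cover Q0.
exists P, Q => k; rewrite [leRHS](splitr e).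
apply: le_trans (normc_subl _ (psum (fun i => mxprod (A k) (transp (B k)) (i, i)) P - trace_pairing (A k) (B k))) _.
apply: lerD; last exact: hP0.
rewrite opprB addrA subrK /psum -sumrB; apply: le_trans (normc_sum _ _ _) _.
letr (\sum_(i : P) (e / 2 / (n + 1))).
 by apply: ler_sum => i _; exact: (hQ (k, i) Q (QQ (k, i))).
rewrite sumr_const -[leLHS]mulr_natl -/n mulrCA; move: (_ / 2) e20 => e' e20.
by rewrite ger_pMr// ler_pdivrMr ?ltr_wpDl// mul1r lerDl.
Qed.

Lemma tp_fsupp A B J : fsupp J B ->
 trace_pairing A B = \sum_(i : J) \sum_(j : J) A (val i, val j) * B (val i, val j).
Proof.
move=> hB.
have h i : mxprod A (transp B) (i, i) = psum (fun j => A (i, j) * B (i, j)) J.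
 have := @ncvg_fin _ (fun j => A (i, j) * B (i, j)) J.
 rewrite /mxprod/= => /(_ _)/ncvg_sum[|_ ->]//.
 by move=> j nj; rewrite /transp/= hB ?mulr0//= negb_and nj orbT.
rewrite /trace_pairing /trace.
have := @ncvg_fin _ (fun i => mxprod A (transp B) (i, i)) J.
move=> /(_ _)/ncvg_sum[|_ ->]; last by eqs i; rewrite h.
move=> i ni; rewrite h /psum big1// => j _; rewrite hB ?mulr0//=.
by rewrite negb_and ni.
Qed.

Lemma G1_tcb c n (x : MI n) i j : 0 <= c -> (forall J, G1 c (blk J x)) -> tcb (x i j) c.
Proof.
move=> c0 h J b hb.
have hb' : opsq (fun (p q : unit * J) => b p.2 q.2) 1.
 have inj : injective (fun p : unit * J => p.2) by move=> [[] s] [[] t] /= ->.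
 exact: (opsq_inj ler01 inj inj hb).
have := opsq_entry (i, tt) (j, tt) (h J _ _ hb').
by rewrite /spair/= ler_pXn2r ?nnegrE ?normc_ge0.
Qed.

Lemma tp_mx_opsq n m (x : MI n) (b : MI m) c :
 opsq (fun i j : 'I_(n * m) => trace_pairing (x (unidx i).1 (unidx j).1)
             (b (unidx i).2 (unidx j).2)) (c ^+ 2) <->
 opsq (fun p q : 'I_n * 'I_m => trace_pairing (x p.1 q.1) (b p.2 q.2)) (c ^+ 2).
Proof.
split=> h.
 have ig : injective (@mxtens_index n m).
  by move=> p q /(congr1 (@mxtens_unindex n m)); rewrite !mxtens_indexK.
 by apply: opsq_ext (opsq_inj (sqr_ge0 c) ig ig h) => p q; rewrite !mxtens_indexK.
have ig : injective (@mxtens_unindex n m).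
 by move=> p q /(congr1 (@mxtens_index n m)); rewrite !mxtens_unindexK.
exact: (opsq_inj (sqr_ge0 c) ig ig h).
Qed.

(** A test on a finite block is extended by zero to compact operators. Conversely a test over I is
    masked to a finite block on which all entries of the pairing are nearly attained. The block
    bounds also yield membership in [schatten 1], through [tcb_schatten]. *)
Lemma S1P n (x : MI n) c : 0 <= c ->
 (S1 x <= c%:E)%E <-> forall J, G1 c (blk J x).
Proof.
move=> c0; split=> [|h].
 rewrite /S1 /restrict_mnorms; case: asboolP => [sch|_]; last by rewrite leye_eq.
 move=> h J B b hb; pose m := #|B|.
 pose b' : MI m := \matrix_(i, j) (fun t =>
   if (insub t.1, insub t.2) is (Some s, Some t) then b (enum_val i, s) (enum_val j, t) else 0).
 have fs i j : fsupp J (b' i j).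
  move=> t; rewrite negb_and mxE => /orP[n1|n2]; first by rewrite insubN.
  by rewrite [insub t.2]insubN//; case: insub.
 have hb' : (Soo b' <= 1%:E)%E.
  apply/SooP => //; split => [i j|J']; first exact: fsupp_compact (fs i j).
  have := @opsq_inj _ _ ('I_m * J)%type ('I_m * J)%type (fun p => (enum_val p.1, p.2)) (fun p => (enum_val p.1, p.2)) b 1 ler01.
  have ig : injective (fun p : 'I_m * J => (enum_val p.1, p.2)) by move=> [i s] [j t] [/enum_val_inj -> ->].
  move=> /(_ ig ig hb) hb1; rewrite /G0 expr1n.
  move=> v; pose v' (p : 'I_m * J) : C := if insub (val p.2) is Some t then v (p.1, t) else 0.
  have nv : n2 v' <= n2 v.
   rewrite (n2_pair v') (n2_pair v); apply: ler_sum => i _.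
   pose w (j : I) : C := if insub j is Some t then v (i, t) else 0.
   have := zext_l2 (fun t => v (i, t)) J; apply: le_trans; exact: lexx.
  rewrite mul1r; apply: le_trans nv; have := hb1 v'; rewrite mul1r; apply: le_trans.
  pose f (p : 'I_m * J) := \sum_t b (enum_val p.1, p.2) (enum_val t.1, t.2) * v' t.
  rewrite (n2_pair (fun s : 'I_m * J' => _)) (n2_pair f); apply: ler_sum => i _.
  have := zext_l2 (fun t => f (i, t)) J'; apply: le_trans.
  apply: ler_eq; eqs s; congr (normc _ ^+ 2).
  rewrite /zext /blk; case: insubP => [u uJ us|nJ]; last first.
   by rewrite big1// => t _; rewrite mxE/= [insub (val s)]insubN// mul0r.
  rewrite /f/= !sum_pair; apply: eq_bigr => j _ /=.
  pose g k : C := (if insub k is Some t then b (enum_val i, u) (enum_val j, t) else 0) *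
   (if insub k is Some t then v (j, t) else 0).
  transitivity (psum g J').
   have bE k : b' i j (val s, k) = if insub k is Some t then b (enum_val i, u) (enum_val j, t) else 0.
    by rewrite mxE/= -us valK; case: insub.
   eqs t; rewrite bE /g valK.
   by case: insub => [t'|]; rewrite ?mul0r.
  transitivity (psum g J); last first.
   by eqs t; rewrite /g valK /v'/=.
  have z1 (k : I) : k \notin J -> g k = 0 by move=> nk; rewrite /g insubN// mul0r.
  have z2 (k : I) : k \notin J' -> g k = 0 by move=> nk; have := zext_out (fun t : J' => v (j, t)) nk; rewrite /zext /g => ->; rewrite mulr0.
  rewrite (ncvg_unique (ncvg_fin z1) (ncvg_fin z2)) //.
 have : (mxnorm (\matrix_(i < n * m, j < n * m)
   trace_pairing (x (unidx i).1 (unidx j).1)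
          (b' (unidx i).2 (unidx j).2)) <= c%:E)%E.
  by apply: le_trans h; apply: ereal_sup_ubound; exists m, b'.
 move=> /(mxnormP _ c0) hM.
 have {}hM : opsq (fun i j : 'I_(n * m) => trace_pairing (x (unidx i).1 (unidx j).1)
             (b' (unidx i).2 (unidx j).2)) (c ^+ 2).
  by apply: opsq_ext hM => i j; rewrite mxE.
 move/tp_mx_opsq: hM => hM.
 have ig : injective (fun p : 'I_n * B => (p.1, enum_rank p.2)) by move=> [i s] [j t] [-> /enum_rank_inj ->].
 apply: opsq_ext (opsq_inj (sqr_ge0 c) ig ig hM) => p q /=.
 rewrite (tp_fsupp _ (fs _ _)) /spair; eqs s t.
 by rewrite mxE/= !valK !enum_rankK.
rewrite /S1 /restrict_mnorms; case: asboolP => [_|[]]; last first.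
 by move=> i j; apply: tcb_schatten (lexx 1); exact: G1_tcb c0 h.
apply: ge_ereal_sup => _ [m [b [hb ->]]].
apply/mxnormP => //.
suff hM : opsq (fun p q : 'I_n * 'I_m => trace_pairing (x p.1 q.1) (b p.2 q.2)) (c ^+ 2).
 by move/tp_mx_opsq: hM; apply: opsq_ext => i j; rewrite mxE.
have [_ hb2] := (SooP b ler01).1 hb.
have hbb i j : bdd (b i j) 1.
 have := (Soo_bdd b 1).2 hb2; rewrite expr1n => hb3 P Q.
 have i1 : injective (fun s : P => (i, val s)) by move=> s t [/val_inj].
 have i2 : injective (fun s : Q => (j, val s)) by move=> s t [/val_inj].
 exact: (bdd_inj ler01 i1 i2 hb3).
apply: opsq_lim; first exact: sqr_ge0.
move=> e e0.
have [P [Q hPQ]] := @tp_approx (('I_n * 'I_m) * ('I_n * 'I_m))%type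
 (fun k => x k.1.1 k.2.1) (fun k => b k.1.2 k.2.2) c e (fun k => G1_tcb _ _ c0 h) (fun k => hbb _ _) e0.
pose J := (P `|` Q)%fset.
pose bm (p q : 'I_m * J) : C := (val q.2 \in Q)%:R * ((val p.2 \in P)%:R * b p.1 q.1 (val p.2, val q.2)).
have hbm : opsq bm 1.
 have := hb2 J; rewrite /G0 expr1n => hJ.
 by apply: (@opsq_colmask _ _ _ (fun q : 'I_m * J => val q.2 \in Q)) => //;
   apply: (@opsq_rowmask _ _ _ (fun q : 'I_m * J => val q.2 \in P)).
exists (spair (blk J x) bm); split; last exact: h.
move=> p q; have := hPQ (p, q) => /=; congr (normc (_ - _) <= e).
pose F i j := x p.1 q.1 (i, j) * b p.2 q.2 (i, j).
rewrite -/(psum (fun i => \sum_(j : Q) F i (val j)) P).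
rewrite (psum_mask _ (fsubsetUl P Q)); eqs i.
rewrite -/(psum (F (val i)) Q) (psum_mask _ (fsubsetUr P Q)) mulr_sumr.
by eqs j; rewrite /bm /F /blk/=; ring.
Qed.

End Norms.

Arguments blk J {n} x.

(** * Common properties of the two families of balls *)

Section Gauges.
Implicit Types S T : finType.

Definition sandS (A : finType) S S' (E : S' -> S -> C) (x : A * S -> A * S -> C) (F : S -> S' -> C) :
  A * S' -> A * S' -> C :=
 fun p q => \sum_s \sum_t E p.2 s * x (p.1, s) (q.1, t) * F t q.2.

Lemma sandS_opsq (A : finType) S S' (E : S' -> S -> C) (x : A * S -> A * S -> C) (F : S -> S' -> C) c :
 0 <= c -> opsq E 1 -> opsq F 1 -> opsq x c -> opsq (sandS E x F) c.
Proof.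
move=> c0 hE hF hx.
have := opsq_comp ler01 (opsq_ampl (X := A) hE) (opsq_comp c0 hx (opsq_ampl (X := A) hF)).
rewrite mul1r mulr1; apply: opsq_ext => p q; rewrite /kcomp /sandS sum_pair.
transitivity (\sum_a (p.1 == a)%:R * \sum_s E p.2 s *
  \sum_t x (a, s) t * ((t.1 == q.1)%:R * F t.2 q.2)).
 by eqs a; sums s; rewrite mulrA.
rewrite sum_deltal; eqs s; rewrite sum_pair exchange_big mulr_sumr; apply: eq_bigr => t _ /=.
rewrite -mulrA; congr (_ * _).
rewrite -(sum_deltar q.1 (fun b => x (p.1, s) (b, t) * F t q.2)).
by eqs b; ring.
Qed.

(** Shared by [G0] and [G1], so that truncation is treated once. [g_sandS] acts on the index S, and
    [g_unit] places a single element at one matrix position. *)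
Record gauge (G : R -> forall A S : finType, (A * S -> A * S -> C) -> Prop) : Prop := Gauge {
 g_0 : forall c (A : finType) S, 0 <= c -> G c A S (fun _ _ : A * S => 0);
 g_le : forall c d A S x, 0 <= c -> c <= d -> G c A S x -> G d A S x;
 g_add : forall c d (A : finType) S (x y : A * S -> A * S -> C), 0 <= c -> 0 <= d ->
  G c A S x -> G d A S y -> G (c + d) A S (fun p q => x p q + y p q);
 g_scale : forall a c (A : finType) S (x : A * S -> A * S -> C), G c A S x ->
  G (normc a * c) A S (fun p q => a * x p q);
 g_sandS : forall c (A : finType) S S' (E : S' -> S -> C) (x : A * S -> A * S -> C) (F : S -> S' -> C),
  opsq E 1 -> opsq F 1 -> G c A S x -> G c A S' (sandS E x F);
 g_entry : forall c (A : finType) S (x : A * S -> A * S -> C) p q, 0 <= c -> G c A S x -> normc (x p q) <= c;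
 g_unit : forall c (A : finType) S (x : unit * S -> unit * S -> C) (i j : A), G c unit S x ->
  G c A S (fun p q => (p.1 == i)%:R * (q.1 == j)%:R * x (tt, p.2) (tt, q.2));
 g_lim : forall c (A : finType) S (x : A * S -> A * S -> C), 0 <= c ->
  (forall e : R, 0 < e -> exists2 y, G c A S y & forall p q, normc (y p q - x p q) <= e) -> G c A S x }.

Lemma opsq_unit (A : finType) S (k : S -> S -> C) (i j : A) c : 0 <= c -> opsq k c ->
 opsq (fun p q : A * S => (p.1 == i)%:R * (q.1 == j)%:R * k p.2 q.2) c.
Proof.
move=> c0 h.
by have := opsq_kron ler01 c0 (opsq_delta i j) h; rewrite mul1r.
Qed.

Lemma gauge_G0 : gauge (@G0).
Proof.
split.
- by move=> c A S c0; apply: opsq0; exact: sqr_ge0.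
- by move=> c d A S x c0 cd; apply: opsq_le; rewrite ler_pXn2r ?nnegrE// (le_trans c0).
- by move=> c d A S x y c0 d0; exact: opsq_add.
- by move=> a c A S x; rewrite /G0 exprMn; exact: opsq_scale.
- by move=> c A S S' E x F hE hF; apply: sandS_opsq => //; exact: sqr_ge0.
- by move=> c A S x p q c0 h; have := opsq_entry p q h; rewrite ler_pXn2r ?nnegrE ?normc_ge0.
- move=> c A S x i j h; apply: (opsq_unit i j (k := fun s t => x (tt, s) (tt, t))); first exact: sqr_ge0.
 have ig : injective (fun s : S => (tt, s)) by move=> s t [].
 exact: (opsq_inj (sqr_ge0 c) ig ig h).
- move=> c A S x c0 h; apply: opsq_lim; first exact: sqr_ge0.
 by move=> e e0; have [y hy1 hy2] := h e e0; exists y.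
Qed.

Lemma gauge_G1 : gauge (@G1).
Proof.
split.
- move=> c A S c0 B b hb; apply: (opsq_ext _ (@opsq0 _ _ _ (sqr_ge0 c))) => p q.
 by rewrite /spair big1// => s _; rewrite big1// => t _; rewrite mul0r.
- move=> c d A S x c0 cd h B b hb; apply: opsq_le (h B b hb).
 by rewrite ler_pXn2r ?nnegrE// (le_trans c0).
- move=> c d A S x y c0 d0 hx hy B b hb.
 apply: opsq_ext (opsq_add c0 d0 (hx B b hb) (hy B b hb)) => p q.
 rewrite /spair -big_split; eqs s; rewrite -big_split; eqs t.
 by rewrite /= mulrDl.
- move=> a c A S x h B b hb; rewrite exprMn.
 apply: opsq_ext (opsq_scale a (h B b hb)) => p q.
 rewrite /spair; sums s t.
 by rewrite mulrA.
- move=> c A S S' E x F hE hF h B b hb.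
 have hb' := sandS_opsq ler01 (opsq_tr ler01 hE) (opsq_tr ler01 hF) hb.
 apply: opsq_ext (h B _ hb') => p q; rewrite /spair /sandS/=.
 transitivity (\sum_s \sum_t \sum_s' \sum_t' E s' s * x (p.1, s) (q.1, t) * F t t' * b (p.2, s') (q.2, t')).
  eqs s t; sums s'.
  sums t'; ring.
 transitivity (\sum_s' \sum_t' \sum_s \sum_t E s' s * x (p.1, s) (q.1, t) * F t t' * b (p.2, s') (q.2, t')).
  under eq_bigr do rewrite exchange_big.
  rewrite exchange_big; eqs s'.
  under eq_bigr do rewrite exchange_big.
  by rewrite exchange_big.
 eqs s' t'; sums s.
 by rewrite mulr_suml.
- move=> c A S x p q c0 h.
 have := h unit (fun u v => (u.2 == p.2)%:R * (v.2 == q.2)%:R) _.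
 have hb : opsq (fun u v : unit * S => (u.2 == p.2)%:R * (v.2 == q.2)%:R : C) 1.
  have ig : injective (fun u : unit * S => (u.2, u.1)) by move=> [[] s] [[] t] [->].
  have h1 : opsq (fun _ _ : unit => 1 : C) 1 by apply: (opsq_ext _ (@opsq_id unit)) => -[] [].
  have := opsq_inj ler01 ig ig (opsq_unit p.2 q.2 ler01 h1).
  by apply: opsq_ext => u v; rewrite mulr1.
 move=> /(_ hb)/(opsq_entry (p.1, tt) (q.1, tt)); rewrite /spair/=.
 have -> : \sum_s \sum_t x (p.1, s) (q.1, t) * ((s == p.2)%:R * (t == q.2)%:R) = x p q.
  transitivity (\sum_s (s == p.2)%:R * \sum_t (t == q.2)%:R * x (p.1, s) (q.1, t)).
   by eqs s; sums t; ring.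
  by rewrite !sum_deltar; case: p {hb} => ? ?; case: q => ? ?.
 by rewrite ler_pXn2r ?nnegrE ?normc_ge0.
- move=> c A S x i j h B b hb.
 have ig : injective (fun s : B => (tt, s)) by move=> s t [].
 have := opsq_unit i j (sqr_ge0 c) (opsq_inj (sqr_ge0 c) ig ig (h B b hb)).
 apply: opsq_ext => p q; rewrite /spair/=; sums s.
 by sums t; rewrite !mulrA.
- move=> c A S x c0 h B b hb; apply: opsq_lim; first exact: sqr_ge0.
 move=> e e0; pose K := \sum_u \sum_v normc (b u v) + 1.
 have K0 : 0 < K by rewrite ltr_wpDl// sumr_ge0// => u _; apply: sumr_ge0 => v _; exact: normc_ge0.
 have eK : 0 < e / K by rewrite divr_gt0.
 have [y hy1 hy2] := h _ eK; exists (spair y b); split; last exact: hy1.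
 move=> p q; rewrite /spair -sumrB.
 letr (\sum_s \sum_t e / K * normc (b (p.2, s) (q.2, t))).
  apply: le_trans (normc_sum _ _ _) _; apply: ler_sum => s _; rewrite -sumrB.
  apply: le_trans (normc_sum _ _ _) _; apply: ler_sum => t _.
  by rewrite -mulrBl normcM ler_wpM2r ?normc_ge0.
 under eq_bigr do rewrite -mulr_sumr.
 rewrite -mulr_sumr mulrAC ler_pdivrMr// ler_pM2l// /K.
 letr (\sum_u \sum_v normc (b u v)); last by rewrite lerDl.
 have sf (f : B * S -> R) a : (forall u, 0 <= f u) -> \sum_s f (a, s) <= \sum_u f u.
  by move=> f0; rewrite sum_pair (bigD1 a)//= lerDl; apply: sumr_ge0 => k _; apply: sumr_ge0.
 letr (\sum_s \sum_v normc (b (p.2, s) v)).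
  by apply: ler_sum => s _; apply: (sf (fun v => normc (b (p.2, s) v))) => v; exact: normc_ge0.
 by apply: (sf (fun u => \sum_v normc (b u v))) => u; apply: sumr_ge0 => v _; exact: normc_ge0.
Qed.

(** * Truncation for a general gauge *)

Section GaugeTheory.
Variables (G : R -> forall A S : finType, (A * S -> A * S -> C) -> Prop) (GG : gauge G).

Lemma g_ext c (A : finType) S (x y : A * S -> A * S -> C) : (forall p q, x p q = y p q) -> G c x -> G c y.
Proof. by move=> h; have -> : x = y by ext p q; exact: h. Qed.

Lemma g_sub c d (A : finType) S (x y : A * S -> A * S -> C) : 0 <= c -> 0 <= d ->
 G c x -> G d y -> G (c + d) (fun p q => x p q - y p q).
Proof.
move=> c0 d0 hx /(g_scale GG (-1)); rewrite normcNE normc1 mul1r => hy.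
by apply: g_ext (g_add GG c0 d0 hx hy) => p q; rewrite mulN1r.
Qed.

Lemma g_sum (K A : finType) S (x : K -> A * S -> A * S -> C) c : 0 <= c ->
 (forall k, G c (x k)) -> G (#|K|%:R * c) (fun p q => \sum_k x k p q).
Proof.
move=> c0 hx; rewrite cardE -[index_enum _]enumT; elim: (enum K) => [|k r ih].
 by rewrite mul0r; apply: g_ext (g_0 GG A S (lexx 0)) => p q; rewrite big_nil.
rewrite /= -add1n natrD mulrDl mul1r.
have r0 : 0 <= (size r)%:R * c by rewrite mulr_ge0.
by apply: g_ext (g_add GG c0 r0 (hx k) ih) => p q; rewrite big_cons.
Qed.

Lemma g_mask c (A : finType) S (x : A * S -> A * S -> C) (a b : pred S) :
 G c x -> G c (fun p q => (a p.2)%:R * (b q.2)%:R * x p q).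
Proof.
have hd (e : pred S) : opsq (fun s t : S => (s == t)%:R * (e s)%:R : C) 1.
 by apply: opsq_diag => t; case: (e t); rewrite ?normc1 ?normc0 ?expr0n.
move=> /(g_sandS GG (hd a) (hd b)); apply: g_ext => p q.
transitivity (\sum_s (p.2 == s)%:R * \sum_t (t == q.2)%:R * ((a p.2)%:R * (b t)%:R * x (p.1, s) (q.1, t))).
 by eqs s; sums t; ring.
by rewrite sum_deltal sum_deltar; case: p q => ? ? [].
Qed.

Implicit Types J : {fset I}.

Lemma g_entries c n J (x : MI n) : 0 <= c ->
 (forall i j, G c (fun p q : unit * J => x i j (val p.2, val q.2))) -> G ((n * n)%:R * c) (blk J x).
Proof.
move=> c0 h.
have := @g_sum ('I_n * 'I_n)%type 'I_n J (fun k p q =>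
 (p.1 == k.1)%:R * (q.1 == k.2)%:R * x k.1 k.2 (val p.2, val q.2)) c c0.
rewrite card_prod card_ord => /(_ _); have hk k : G c (fun p q : 'I_n * J =>
 (p.1 == k.1)%:R * (q.1 == k.2)%:R * x k.1 k.2 (val p.2, val q.2)).
 exact: (g_unit GG k.1 k.2 (h k.1 k.2)).
move=> /(_ hk); apply: g_ext => p q; rewrite sum_pair/=.
transitivity (\sum_i (p.1 == i)%:R * \sum_j (q.1 == j)%:R * x i j (val p.2, val q.2)).
 by eqs i; sums j; rewrite mulrA.
by rewrite !sum_deltal.
Qed.

Definition inc J' J : J' -> J -> C := fun s t => (val s == val t)%:R.

Lemma opsq_inc J' J : opsq (inc (J' := J') (J := J)) 1.
Proof.
move=> v; rewrite mul1r; have := zext_l2 v J'; apply: le_trans.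
apply: ler_eq; apply: n2_eq => s; rewrite /zext.
case: insubP => [u uJ us|nJ].
 by rewrite -(sum_deltal u v); rewrite /inc -us.
rewrite big1// => t _; rewrite /inc; case: eqVneq => [e|_]; last by rewrite mul0r.
by move: nJ; rewrite e (valP t).
Qed.

Definition fsuppM n J (x : MI n) := forall i j, fsupp J (x i j).

Lemma blk_inc n J J' (x : MI n) : fsuppM J x ->
 blk J' x = sandS (inc (J' := J') (J := J)) (blk J x) (inc (J' := J) (J := J')).
Proof.
move=> h; ext p q; rewrite /blk/=.
pose F i j := x p.1 q.1 (i, j).
transitivity (\sum_(s : J) (val s == val p.2)%:R * \sum_(t : J) (val t == val q.2)%:R * F (val s) (val t)); last first.
 eqs s; sums t; rewrite /inc /F.
 by rewrite [val p.2 == _]eq_sym; ring.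
have hF i j : ~~ ((i \in J) && (j \in J)) -> F i j = 0 by move=> ?; exact: h.
have sel (f : I -> C) i : (forall k, k \notin J -> f k = 0) -> \sum_(s : J) (val s == i)%:R * f (val s) = f i.
 move=> f0; have [iJ|niJ] := boolP (i \in J); last first.
  rewrite f0// big1// => s _; case: eqVneq => [e|_]; last by rewrite mul0r.
  by move: niJ; rewrite -e (valP s).
 rewrite (bigD1 [` iJ]%fset)//= eqxx mul1r big1 ?addr0// => s sn.
 case: eqVneq => [e|_]; last by rewrite mul0r.
 by move: sn; rewrite -val_eqE/= e eqxx.
rewrite (sel (fun i => \sum_(t : J) (val t == val q.2)%:R * F i (val t))); last first.
 by move=> k nk; rewrite big1// => t _; rewrite hF ?mulr0// negb_and nk.
by rewrite sel// => k nk; rewrite hF// negb_and nk orbT.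
Qed.

Lemma g_blk_supp c n J (x : MI n) : fsuppM J x -> G c (blk J x) -> forall J', G c (blk J' x).
Proof. by move=> h hx J'; rewrite (blk_inc J' h); apply: (g_sandS GG); [exact: opsq_inc|exact: opsq_inc|]. Qed.

Definition truncmx n J (x : MI n) : MI n := map_mx (trunc J) x.

Lemma truncmx_supp n J (x : MI n) : fsuppM J (truncmx J x).
Proof. by move=> i j t /negbTE h; rewrite mxE /trunc h mul0r. Qed.

Lemma blk_truncmx n J J' (x : MI n) : blk J' (truncmx J x) =
 (fun p q => (val p.2 \in J)%:R * (val q.2 \in J)%:R * blk J' x p q).
Proof. by ext p q; rewrite /blk mxE -natrM mulnb. Qed.

Lemma g_truncmx c n J J' (x : MI n) : G c (blk J' x) -> G c (blk J' (truncmx J x)).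
Proof. by rewrite blk_truncmx; exact: (@g_mask c _ _ (blk J' x) (fun s : J' => val s \in J) (fun s : J' => val s \in J)). Qed.

End GaugeTheory.

(** * Truncation in the trace norm *)

Section TraceClassTruncation.
Implicit Types (J : {fset I}) (A B : I * I -> C).

Lemma tcb_bdd A B c J : tcb A c -> bdd B 1 ->
 normc (\sum_(i : J) \sum_(j : J) A (val i, val j) * B (val i, val j)) <= c.
Proof. by move=> h hB; exact: (h J _ (hB J J)). Qed.

Definition zext2 J (b : J -> J -> C) : I * I -> C := fun t => zext (fun s => zext (b s) t.2) t.1.

Lemma zext2E J (b : J -> J -> C) (s t : J) : zext2 b (val s, val t) = b s t.
Proof. by rewrite /zext2 !zextE. Qed.

Lemma bdd_zext2 J (b : J -> J -> C) : opsq b 1 -> bdd (zext2 b) 1.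
Proof.
move=> hb P Q.
have := opsq_comp1 (@opsq_inc P J) (opsq_comp1 hb (@opsq_inc J Q)).
apply: opsq_ext => s t.
have sel K' (k : K') (f : J -> C) (i : I) : \sum_(u : J) (i == val u)%:R * f u = zext f i.
 rewrite /zext; case: insubP => [u uJ <-|nJ]; first by rewrite -(sum_deltal u f).
 rewrite big1// => u _; case: eqVneq => [e|_]; last by rewrite mul0r.
 by move: nJ; rewrite e (valP u).
transitivity (\sum_u (val s == val u)%:R * zext (b u) (val t)); last exact: sel.
eqs u; congr (_ * _); rewrite -(sel _ t).
by eqs v; rewrite mulrC /inc [val v == _]eq_sym.
Qed.

Lemma tcb_mask A c (p q : pred I) : tcb A c -> tcb (fun t => (p t.1)%:R * ((q t.2)%:R * A t)) c.
Proof.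
move=> h J b hb.
have hb' : opsq (fun s t : J => (p (val s))%:R * ((q (val t))%:R * b s t)) 1.
 exact: (opsq_rowmask (fun s : J => p (val s)) (opsq_colmask (fun s : J => q (val s)) ler01 hb)).
have := h J _ hb'; apply: le_trans; apply: ler_eq.
by congr normc; eqs s; apply: eq_bigr => t _ /=; ring.
Qed.

Lemma tcb_add A B c d : tcb A c -> tcb B d -> tcb (fun t => A t + B t) (c + d).
Proof.
move=> hA hB J b hb; apply: le_trans (lerD (hA J b hb) (hB J b hb)).
apply: le_trans (normcD _ _); apply: ler_eq.
congr normc; rewrite -big_split; eqs s; rewrite -big_split; apply: eq_bigr => t _ /=; ring.
Qed.

Lemma tcb_transp A c : tcb A c -> tcb (transp A) c.
Proof.
move=> h J b hb; have := h J _ (opsq_tr ler01 hb); rewrite exchange_big.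
by [].
Qed.

Lemma pair_supp A B J J' : (J `<=` J')%fset -> fsupp J B ->
 \sum_(i : J') \sum_(j : J') A (val i, val j) * B (val i, val j) =
 \sum_(i : J) \sum_(j : J) A (val i, val j) * B (val i, val j).
Proof.
move=> sub hB; pose F i j := A (i, j) * B (i, j).
have F0 i j : ~~ ((i \in J) && (j \in J)) -> F i j = 0 by move=> h; rewrite /F hB ?mulr0.
rewrite -[RHS]/(psum (fun i => psum (F i) J) J) (psum_mask _ sub).
eqs i; rewrite (psum_mask _ sub); sums j.
case: (boolP (val i \in J)) => iJ; last by rewrite mul0r -/(F _ _) F0// negb_and iJ.
rewrite mul1r; case: (boolP (val j \in J)) => jJ; first by rewrite mul1r.
by rewrite mul0r -/(F _ _) F0// negb_and jJ orbT.
Qed.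

(** A test B0 supported in J0 and nearly attaining the norm M leaves little mass X in the other
    rows: B0 + t B', with B' on rows outside J0, has squared norm at most 1 + t^2, so that t |X| <=
    (sqrt (1 + t^2) - 1) M + t e / 2. *)
Lemma tcb_row_tail A c (e : R) : tcb A c -> 0 < e ->
 exists J, tcb (fun t => (t.1 \notin J)%:R * A t) e.
Proof.
move=> hA e0; have c0 := tcb_ge0 hA.
pose Q := [set r | exists JB : {fset I} * (I * I -> C), bdd JB.2 1 /\
 r = normc (\sum_(i : JB.1) \sum_(j : JB.1) A (val i, val j) * JB.2 (val i, val j))].
have hQ : has_sup Q.
 split; last by exists c => _ [[J B] [/= hB ->]]; exact: tcb_bdd.
 exists 0; exists (fset0, fun=> 0); split; first by move=> P P'; exact: opsq0.
 by rewrite big1 ?normc0// => i _; rewrite big1// => j _; rewrite mulr0.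
pose M := sup Q.
have QM J B : bdd B 1 -> normc (\sum_(i : J) \sum_(j : J) A (val i, val j) * B (val i, val j)) <= M.
 by move=> hB; apply: ub_le_sup; [exact: hQ.2|exists (J, B)].
have M0 : 0 <= M.
 have := QM fset0 (fun=> 0) (fun P P' => @opsq0 _ _ _ ler01); apply: le_trans; exact: normc_ge0.
(* t M <= e keeps the second-order gain t^2 M / 2 below t e / 2. *)
pose t := Num.min 1 (e / (M + 1)).
have t0 : 0 < t by rewrite lt_min ltr01 divr_gt0// ltr_wpDl.
have tM : t * M <= e.
 have : t <= e / (M + 1) by rewrite ge_min lexx orbT.
 rewrite ler_pdivlMr ?ltr_wpDl// => h; apply: le_trans h.
 by rewrite ler_wpM2l ?(ltW t0)// lerDl.
have d0 : 0 < t * e / 2 by rewrite divr_gt0// mulr_gt0.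
have [_ [[J0 B1] [/= hB1 ->]] hlt] := sup_adherent d0 hQ.
have [u u1 uE] := normc_phase (\sum_(i : J0) \sum_(j : J0) A (val i, val j) * B1 (val i, val j)).
pose B0 := trunc J0 (fun t => u * B1 t).
have hB0 : bdd B0 1.
 move=> P P'; have := opsq_scale u (hB1 P P'); rewrite u1 expr1n mul1r => h.
 have := opsq_rowmask (fun s : P => val s \in J0) (opsq_colmask (fun s : P' => val s \in J0) ler01 h).
 by apply: opsq_ext => s s'; rewrite /B0 /trunc/= -mulnb natrM; ring.
have sB0 : fsupp J0 B0 by move=> s /negbTE h; rewrite /B0 /trunc h mul0r.
have pB0 J : (J0 `<=` J)%fset -> M - t * e / 2 <=
  re (\sum_(i : J) \sum_(j : J) A (val i, val j) * B0 (val i, val j)).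
 move=> sub; rewrite (pair_supp A sub sB0); apply: (le_trans (ltW hlt)).
 have -> : \sum_(i : J0) \sum_(j : J0) A (val i, val j) * B0 (val i, val j) =
  u * \sum_(i : J0) \sum_(j : J0) A (val i, val j) * B1 (val i, val j).
  sums i j.
  by rewrite /B0 /trunc/= (valP i) (valP j) mul1r; ring.
 by rewrite uE.
exists J0 => J b hb.
pose X := \sum_(i : J) \sum_(j : J) (fun t => (t.1 \notin J0)%:R * A t) (val i, val j) * b i j.
have [w w1 wE] := normc_phase X.
pose B' := fun s : I * I => (s.1 \notin J0)%:R * (w * zext2 b s).
pose J2 := (J0 `|` J)%fset.
have hz : bdd (fun s => w * zext2 b s) 1.
 by have hz2 := bdd_zext2 hb; move=> P P'; have := opsq_scale w (hz2 P P'); rewrite w1 expr1n mul1r.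
pose r := Num.sqrt (1 + t ^+ 2).
have r1 : 0 < 1 + t ^+ 2 by rewrite ltr_pwDl ?sqr_ge0.
have r0 : 0 < r by rewrite sqrtr_gt0.
have hB : bdd (fun s => (r^-1)%:C * (B0 s + t%:C * B' s)) 1.
 move=> P P'.
 have h1 : opsq (fun (s : P) (s' : P') => B0 (val s, val s') + t%:C * B' (val s, val s')) (1 + t ^+ 2).
  move=> v; have a1 := hB0 P P' v; have a2 := hz P P' v; rewrite !mul1r in a1 a2.
  rewrite mulrDl mul1r; apply: le_trans (lerD a1 (ler_wpM2l (sqr_ge0 t) a2)).
  rewrite {1}/n2 [X in _ <= X + _]/n2 [X in _ <= _ + _ * X]/n2 mulr_sumr -big_split.
  apply: ler_sum => s _ /=.
  have [sJ|sJ] := boolP (val s \in J0).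
   rewrite [X in normc X ^+ 2 <= _](_ : _ = \sum_k B0 (val s, val k) * v k).
    by rewrite lerDl mulr_ge0 ?sqr_ge0.
   by eqs k; rewrite /B'/= sJ mul0r mulr0 addr0.
  rewrite [X in normc X ^+ 2 <= _](_ : _ = t%:C * \sum_k w * zext2 b (val s, val k) * v k).
   by rewrite normcM exprMn normc_real real_normK ?num_real// lerDr sqr_ge0.
  sums k.
  by rewrite sB0 ?negb_and ?sJ// add0r /B'/= sJ mul1r -mulrA.
 have := opsq_scale (r^-1)%:C h1; rewrite normc_real real_normK ?num_real// exprVn sqr_sqrtr ?(ltW r1)//.
 by rewrite mulVf// gt_eqF.
have := QM J2 _ hB.
have -> : \sum_(i : J2) \sum_(j : J2) A (val i, val j) * ((r^-1)%:C * (B0 (val i, val j) + t%:C * B' (val i, val j))) =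
  (r^-1)%:C * (\sum_(i : J2) \sum_(j : J2) A (val i, val j) * B0 (val i, val j) + t%:C * (w * X)).
 have -> : w * X = \sum_(i : J2) \sum_(j : J2) A (val i, val j) * B' (val i, val j).
  have sB' : fsupp J B'.
   move=> s; rewrite negb_and /B' /zext2 => /orP[h|h]; first by rewrite zext_out// !mulr0.
   have -> : zext (fun s0 => zext (b s0) s.2) s.1 = 0; last by rewrite !mulr0.
   by rewrite {1}/zext; case: insub => // k; exact: zext_out.
  rewrite (pair_supp A (fsubsetUr J0 J) sB') /X; sums i.
  by sums j; rewrite /B' zext2E /=; ring.
 rewrite mulr_sumr -big_split; sums i; rewrite mulr_sumr -big_split mulr_sumr.
 by apply: eq_bigr => j _ /=; ring.
rewrite wE; set Z := \sum_(i : J2) \sum_(j : J2) A (val i, val j) * B0 (val i, val j) => hZ.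
have h3 : re ((r^-1)%:C * (Z + t%:C * (normc X)%:C)) <= M.
 by apply: le_trans (ler_norm _) (le_trans (Re_le_normc _) hZ).
have h4 : M - t * e / 2 <= re Z by apply: pB0; exact: fsubsetUl.
have h5 : r^-1 * (re Z + t * normc X) <= M.
 have ReZ (a : R) (z : C) : re (a%:C * z) = a * re z by case: z => u' v'; simpc.
 by move: h3; rewrite ReZ ReD ReZ.
have h6 : re Z + t * normc X <= r * M.
 by move: h5; rewrite mulrC ler_pdivrMr// [M * r]mulrC.
have h7 : r <= 1 + t ^+ 2 / 2.
 rewrite -(@ler_pXn2r _ 2) ?nnegrE ?(ltW r0)//; last by rewrite addr_ge0// divr_ge0// sqr_ge0.
 rewrite sqr_sqrtr ?(ltW r1)//; have := sqr_ge0 (t ^+ 2); nra.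
have h8 : r * M <= (1 + t ^+ 2 / 2) * M by rewrite ler_wpM2r.
rewrite -/X -(ler_pM2l t0).
have h9 : t ^+ 2 * M = t * (t * M) by ring.
have h10 : t * (t * M) <= t * e by rewrite ler_pM2l.
nra.
Qed.

Lemma tcb_trunc A c (e : R) : tcb A c -> 0 < e ->
 exists J0 : {fset I}, forall J, (J0 `<=` J)%fset -> tcb (fun t => A t - trunc J A t) e.
Proof.
move=> hA e0; have e20 : 0 < e / 2 by rewrite divr_gt0.
have [J1 h1] := tcb_row_tail hA e20.
have [J2 h2] := tcb_row_tail (tcb_transp hA) e20.
exists (J1 `|` J2)%fset => J; rewrite fsubUset => /andP[s1 s2].
have := tcb_add (tcb_mask (fun i => i \notin J) predT h1)
 (tcb_mask (fun i => i \in J) (fun i => i \notin J) (tcb_transp h2)).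
rewrite -splitr; congr (tcb _ e); apply/funext => -[i j]; rewrite /transp/trunc/=.
have n1 : i \notin J -> i \notin J1 by apply: contra; exact: (fsubsetP s1).
have n2 : j \notin J -> j \notin J2 by apply: contra; exact: (fsubsetP s2).
case: (boolP (i \in J)) => iJ; last by rewrite /= n1// !mul1r !mul0r addr0 subr0.
case: (boolP (j \in J)) => jJ; last by rewrite /= n2// !mul1r !mul0r add0r subr0.
by rewrite /= !mul0r !mulr0 mul1r subrr addr0.
Qed.

Lemma opsq_test S T (K : S -> T -> C) c : 0 <= c ->
 (forall w v, n2 w <= 1 -> n2 v <= 1 -> normc (\sum_s \sum_t w s * K s t * v t) <= c) -> opsq K (c ^+ 2).
Proof.
move=> c0 h; apply/opsq_bil; first exact: sqr_ge0.
move=> w v; have [w0|w0] := eqVneq (n2 w) 0.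
 rewrite big1 ?normc0 ?expr0n ?w0 ?mul0r ?mulr0// => s _; rewrite big1// => t _.
 by rewrite (n2_eq0 w0) !mul0r.
have [v0|v0] := eqVneq (n2 v) 0.
 rewrite big1 ?normc0 ?expr0n ?v0 ?mulr0// => s _; rewrite big1// => t _.
 by rewrite (n2_eq0 v0) mulr0.
have wp : 0 < n2 w by rewrite lt_def w0 n2_ge0.
have vp : 0 < n2 v by rewrite lt_def v0 n2_ge0.
pose rw := Num.sqrt (n2 w); pose rv := Num.sqrt (n2 v).
have rw0 : 0 < rw by rewrite sqrtr_gt0.
have rv0 : 0 < rv by rewrite sqrtr_gt0.
have := h (fun s => (rw^-1)%:C * w s) (fun t => (rv^-1)%:C * v t).
rewrite !n2_scale !normc_real !real_normK ?num_real// !exprVn !sqr_sqrtr ?n2_ge0// !mulVf// lexx => /(_ isT isT).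
have -> : \sum_s \sum_t (rw^-1)%:C * w s * K s t * ((rv^-1)%:C * v t) =
  (rw^-1 * rv^-1)%:C * \sum_s \sum_t w s * K s t * v t.
 sums s t.
 by rewrite rmorphM/=; ring.
rewrite normcM normc_real ger0_norm; last by rewrite mulr_ge0// invr_ge0 ltW.
rewrite -invfM mulrC ler_pdivrMr ?mulr_gt0// => h2.
rewrite -[n2 w](sqr_sqrtr (ltW wp)) -[n2 v](sqr_sqrtr (ltW vp)) -exprMn -exprMn.
by rewrite ler_pXn2r ?nnegrE ?normc_ge0// !mulr_ge0// ltW.
Qed.

(** A bounded functional is completely bounded with the same bound: the vectors w and v turn the
    matrix-valued test b into a scalar contraction. *)
Lemma tcb_G1 A c J : tcb A c -> G1 c (fun p q : unit * J => A (val p.2, val q.2)).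
Proof.
move=> h B b hb; apply: opsq_test; first exact: tcb_ge0 h.
move=> w v w1 v1.
have -> : \sum_s \sum_t w s * spair (fun p q : unit * J => A (val p.2, val q.2)) b s t * v t =
  \sum_i \sum_j A (val i, val j) * \sum_p \sum_q w (tt, p) * b (p, i) (q, j) * v (tt, q).
 rewrite sum_pair (big_pred1 tt); last by case.
 transitivity (\sum_p \sum_q \sum_i \sum_j A (val i, val j) * (w (tt, p) * b (p, i) (q, j) * v (tt, q))).
  apply: eq_bigr => p _; rewrite sum_pair (big_pred1 tt); last by case.
  apply: eq_bigr => q _; rewrite /spair mulr_sumr mulr_suml; apply: eq_bigr => i _.
  by rewrite mulr_sumr mulr_suml; apply: eq_bigr => j _ /=; ring.
 under eq_bigr do rewrite exchange_big.
 rewrite exchange_big; apply: eq_bigr => i _.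
 under eq_bigr do rewrite exchange_big.
 rewrite exchange_big; apply: eq_bigr => j _; rewrite mulr_sumr; apply: eq_bigr => p _.
 by rewrite mulr_sumr.
apply: h; apply/opsq_bil => // x y; rewrite mul1r.
have -> : \sum_s \sum_t x s * (\sum_p \sum_q w (tt, p) * b (p, s) (q, t) * v (tt, q)) * y t =
 \sum_u \sum_r (w (tt, u.1) * x u.2) * b u r * (v (tt, r.1) * y r.2).
 transitivity (\sum_s \sum_t \sum_p \sum_q x s * (w (tt, p) * b (p, s) (q, t) * v (tt, q)) * y t).
  apply: eq_bigr => s _; apply: eq_bigr => t _; rewrite mulr_sumr mulr_suml; apply: eq_bigr => p _.
  by rewrite mulr_sumr mulr_suml.
 rewrite sum_pair/= [RHS]exchange_big; apply: eq_bigr => s _; rewrite exchange_big; apply: eq_bigr => p _.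
 rewrite sum_pair/= exchange_big; apply: eq_bigr => q _; apply: eq_bigr => t _; ring.
apply: le_trans ((opsq_bil b ler01).1 hb _ _) _; rewrite mul1r.
have nn S T (f : S -> C) (g : T -> C) : n2 (fun u : S * T => f u.1 * g u.2) = n2 f * n2 g.
 rewrite n2_pair /n2 mulr_suml; apply: eq_bigr => s _; rewrite mulr_sumr; apply: eq_bigr => t _.
 by rewrite normcM exprMn.
rewrite (nn _ _ (fun p => w (tt, p)) x) (nn _ _ (fun p => v (tt, p)) y).
have w1' : n2 (fun p => w (tt, p)) <= 1.
 by apply: le_trans w1; rewrite /n2 sum_pair (big_pred1 tt)//; case.
have v1' : n2 (fun p => v (tt, p)) <= 1.
 by apply: le_trans v1; rewrite /n2 sum_pair (big_pred1 tt)//; case.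
have nx := n2_ge0 x; have ny := n2_ge0 y.
apply: ler_pM; rewrite ?mulr_ge0 ?n2_ge0//; by rewrite ler_piMl.
Qed.

End TraceClassTruncation.

(* [N] restricted to finitely supported matrices has unit balls [G], and every
  element is the limit of its truncations. *)
Record norm_gauge (N : @mnorms R (I * I))
  (G : R -> forall A S : finType, (A * S -> A * S -> C) -> Prop) : Prop := NormGauge {
 ng_gauge : gauge G;
 ng_blk : forall n (x : MI n) c (J : {fset I}), 0 <= c -> (N n x <= c%:E)%E -> G c 'I_n J (blk J x);
 ng_fin : forall n (x : MI n) c (J : {fset I}), 0 <= c -> fsuppM J x -> G c 'I_n J (blk J x) -> (N n x <= c%:E)%E;
 ng_approx : forall n (x : MI n) (e : R), (N n x < +oo)%E -> 0 < e ->
  exists J0 : {fset I}, forall J, (J0 `<=` J)%fset -> forall J' : {fset I}, G e 'I_n J' (blk J' (x - truncmx J x));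
 ng_ge0 : forall n (x : MI n), (0 <= N n x)%E }.

Lemma finite_cover T (P : T -> {fset I} -> Prop) :
 (forall t, exists J0, forall J, (J0 `<=` J)%fset -> P t J) ->
 exists J0, forall J, (J0 `<=` J)%fset -> forall t, P t J.
Proof.
move=> /choice[J0 h]; have [Q QQ] := fset_cover J0; exists Q => J sub t.
by apply: h; exact: fsubset_trans (QQ t) sub.
Qed.

Lemma blkB n (x y : MI n) J p q : blk J (x - y) p q = blk J x p q - blk J y p q.
Proof. by rewrite /blk !mxE. Qed.

Lemma norm_gauge_Soo : norm_gauge Soo_ (@G0).
Proof.
have GG := gauge_G0; split => //.
- by move=> n x c J c0 /(SooP x c0)[_]; exact.
- move=> n x c J c0 hs h; apply/SooP => //; split; first by move=> i j; exact: fsupp_compact (hs i j).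
 by move=> J'; exact: (g_blk_supp GG hs h J').
- move=> n x e /Soo_fin cx e0.
 pose d := e / ((n * n)%:R + 1); have d0 : 0 < d by rewrite divr_gt0//.
 have [J0 hJ0] := @finite_cover ('I_n * 'I_n)%type _ (fun k => compact_trunc (cx k.1 k.2) d0).
 exists J0 => J sub J'; apply: (g_le GG (c := (n * n)%:R * d)).
 - by pos.
 - by rewrite mulrCA ger_pMr// ler_pdivrMr ?ltr_wpDl// mul1r lerDl.
 apply: (g_entries GG (ltW d0)) => i j.
 have ig : injective (fun p : unit * J' => val p.2) by move=> [[] s] [[] t] /val_inj /= ->.
 apply: (g_ext _ (bdd_inj (sqr_ge0 d) ig ig (hJ0 J sub (i, j)))) => p q.
 by rewrite !mxE.
- move=> n x; rewrite /Soo /restrict_mnorms; case: ifP => // _; exact: opnorm_ge0.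
Qed.

Lemma norm_gauge_S1 : norm_gauge S1_ (@G1).
Proof.
have GG := gauge_G1.
have ge0 n (x : MI n) : (0 <= S1 x)%E.
 rewrite /S1 /restrict_mnorms; case: ifP => // _.
 apply: ereal_sup_ge; exists (mxnorm (\matrix_(i < n * 0, j < n * 0)
      trace_pairing (x (unidx i).1 (unidx j).1)
             ((0 : MI 0) (unidx i).2 (unidx j).2))); last exact: opnorm_ge0.
 exists 0%N, 0; split => //; apply/SooP => //; split; first by case.
 by move=> J v; rewrite /n2 big1 ?mulr_ge0 ?n2_ge0// => -[[]].
split => //.
- by move=> n x c J c0 /(S1P x c0); exact.
- by move=> n x c J c0 hs h; apply/S1P => // J'; exact: (g_blk_supp GG hs h J').
- move=> n x e xfin e0.
 have [c c0 cE] : exists2 c : R, 0 <= c & (S1 x <= c%:E)%E.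
  by move: xfin (ge0 n x); case: (S1 x) => [c| |]// _; exists c.
 have tx i j := G1_tcb i j c0 ((S1P x c0).1 cE).
 pose d := e / ((n * n)%:R + 1); have d0 : 0 < d by rewrite divr_gt0//.
 have [J0 hJ0] := @finite_cover ('I_n * 'I_n)%type _ (fun k => tcb_trunc (tx k.1 k.2) d0).
 exists J0 => J sub J'; apply: (g_le GG (c := (n * n)%:R * d)).
 - by pos.
 - by rewrite mulrCA ger_pMr// ler_pdivrMr ?ltr_wpDl// mul1r lerDl.
 apply: (g_entries GG (ltW d0)) => i j.
 apply: (g_ext _ (tcb_G1 (J := J') (hJ0 J sub (i, j)))) => p q.
 by rewrite !mxE.
Qed.

(** Far out g is small, and the remaining segment is covered by finitely many balls on which g is
    nearly constant; hence one J0 for all t. *)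
Lemma line_approx N G (NG : norm_gauge N G) n (g : R -> MI n) (e : R) :
 C0_on_line N g -> 0 < e ->
 exists J0 : {fset I}, forall J, (J0 `<=` J)%fset -> forall (J' : {fset I}) t, G e 'I_n J' (blk J' (g t - truncmx J (g t))).
Proof.
move=> [gfin gcont gC0] e0; have GG := ng_gauge NG.
have e2 : 0 < e / 2 by rewrite divr_gt0.
have e4 : 0 < e / 4 by rewrite divr_gt0.
have [c hc] := gC0 _ e2.
have /choice[dl hdl] t : exists d : R, 0 < d /\ forall s, `|s - t| < d -> (N n (g s - g t)%R <= (e / 4)%:E)%E.
 by have [d d0 hd] := gcont t _ e4; exists d.
have /choice[Jt hJt] t := ng_approx NG (gfin t) e4.
have := @segment_compact R (- c) c; rewrite compact_cover.
move=> /(_ R setT (fun t => ball t (dl t))) [||D _ hD].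
- by move=> t _; apply: ball_open; exact: (hdl t).1.
- by move=> t _; exists t => //; apply: ballxx; exact: (hdl t).1.
have [J0 hJ0] := fset_cover (fun t : D => Jt (val t)).
exists J0 => J sub J' s.
have [cs|sc] := ltP c `|s|.
 have h := hc s cs; have h1 := ng_blk NG J' (ltW e2) h.
 rewrite (splitr e); have := g_sub GG (ltW e2) (ltW e2) h1 (g_truncmx GG J h1).
 by apply: g_ext => p q; rewrite blkB.
have [t tD] : (\bigcup_(i in [set` D]) ball i (dl i)) s by apply: hD; rewrite /= in_itv/= -ler_norml.
rewrite /ball/= distrC => st.
have h1 := ng_blk NG J' (ltW e4) ((hdl t).2 s st).
have sub' : (Jt t `<=` J)%fset by apply: fsubset_trans sub; exact: (hJ0 [` tD]%fset).
have h2 := hJt t J sub' J'.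
have := g_sub GG (addr_ge0 (ltW e4) (ltW e4)) (ltW e4) (g_add GG (ltW e4) (ltW e4) h1 h2) (g_truncmx GG J h1).
have le : e / 4 + e / 4 + e / 4 <= e by lra.
have ge : 0 <= e / 4 + e / 4 + e / 4 by lra.
move=> h; apply: (g_le GG ge le); apply: g_ext h => p q.
rewrite /blk !mxE /trunc !fctE; ring.
Qed.

End Gauges.

(** * Complex interpolation and the finite Schatten balls *)

Section Interp.
Implicit Types A S T : finType.
Implicit Types (J : {fset I}).
Local Notation strip := (@strip R).
Local Notation open_strip := (@open_strip R).

Lemma finite_min T (d : T -> R) : (forall t, 0 < d t) ->
 exists2 d0 : R, 0 < d0 & forall t, d0 <= d t.
Proof.
move=> h; suff [d0 d00 hd] : exists2 d0 : R, 0 < d0 & forall t, t \in enum T -> d0 <= d t.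
 by exists d0 => // t; apply: hd; rewrite mem_enum.
elim: (enum T) => [|t r [d0 d00 ih]]; first by exists 1.
exists (Num.min (d t) d0); first by rewrite lt_min h.
move=> s; rewrite inE => /predU1P[->|/ih hs]; first by rewrite ge_min lexx.
by rewrite ge_min hs orbT.
Qed.

Lemma G1_S1b A S (x : A * S -> A * S -> C) (c : R) : 0 < c ->
 G1 c x <-> S1b (fun p q => (c^-1)%:C * x p q).
Proof.
split=> h B b hb.
 have := opsq_scale (c^-1)%:C (h B b hb); rewrite normc_real real_normK ?num_real// exprVn.
 rewrite mulVf ?expf_neq0 ?gt_eqF//; apply: opsq_ext => p q.
 by rewrite /spair; sums s t; rewrite mulrA.
have := opsq_scale c%:C (h B b hb); rewrite normc_real real_normK ?num_real// mulr1.
apply: opsq_ext => p q.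
sums s t.
rewrite !mulrA -rmorphM/= mulfV ?gt_eqF// mul1r//.
Qed.

Lemma G1_1 A S (x : A * S -> A * S -> C) : G1 1 x <-> S1b x.
Proof. by rewrite /G1 expr1n. Qed.

(** Equivalence of norms in finite dimension; the constant comes from the matrix units. *)
Lemma gauge_entries G (GG : @gauge G) A S :
 (forall x : A * S -> A * S -> C, exists2 c : R, 0 <= c & G c A S x) ->
 exists2 K : R, 0 < K & forall (x : A * S -> A * S -> C) (d : R), 0 <= d ->
  (forall p q, normc (x p q) <= d) -> G (K * d) A S x.
Proof.
move=> ex.
have /choice[k hk] (pq : (A * S) * (A * S)) : exists c : R, 0 <= c /\
  G c A S (fun p q => (pq.1 == p)%:R * (pq.2 == q)%:R).
 by have [c c0 h] := ex (fun p q => (pq.1 == p)%:R * (pq.2 == q)%:R); exists c.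
pose k1 := \sum_pq k pq + 1.
have k10 : 0 < k1 by rewrite ltr_wpDl// sumr_ge0// => pq _; exact: (hk pq).1.
have kk pq : k pq <= k1.
 rewrite /k1 (bigD1 pq)//= -addrA lerDl addr_ge0// sumr_ge0// => i _; exact: (hk i).1.
pose n : R := #|{: (A * S) * (A * S)}|%:R.
exists ((n + 1) * k1); first by pos.
move=> x d d0 xd.
have dk0 : 0 <= d * k1 by pos.
have h pq : G (d * k1) A S (fun p q => x pq.1 pq.2 * ((pq.1 == p)%:R * (pq.2 == q)%:R)).
 have := g_scale GG (x pq.1 pq.2) (hk pq).2; apply: (g_le GG).
  by rewrite mulr_ge0 ?normc_ge0//; exact: (hk pq).1.
 by apply: ler_pM; rewrite ?normc_ge0//; exact: (hk pq).1.
have := g_sum GG dk0 h; rewrite -/n => hs.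
have le : n * (d * k1) <= (n + 1) * k1 * d.
 by lra.
apply: (g_le GG _ le); first by pos.
apply: g_ext hs => p q; rewrite sum_pair/=.
transitivity (\sum_u (u == p)%:R * \sum_v (v == q)%:R * x u v).
 by eqs u; sums v; ring.
by rewrite !sum_deltar.
Qed.

Lemma G0_entries A S : exists2 K : R, 0 < K & forall (x : A * S -> A * S -> C) (d : R), 0 <= d ->
  (forall p q, normc (x p q) <= d) -> G0 (K * d) x.
Proof.
apply: (gauge_entries gauge_G0) => x; pose h := \sum_s n2 (x s).
have h0 : 0 <= h by apply: sumr_ge0 => s _.
by exists (Num.sqrt h); rewrite ?sqrtr_ge0// /G0 sqr_sqrtr//; exact: opsq_HS.
Qed.

Lemma G1_entries A S : exists2 K : R, 0 < K & forall (x : A * S -> A * S -> C) (d : R), 0 <= d ->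
  (forall p q, normc (x p q) <= d) -> G1 (K * d) x.
Proof.
apply: (gauge_entries gauge_G1) => x; have [c c0 hc] := S1b_HS x.
exists c^-1; first by pos.
by apply/G1_S1b; rewrite ?invr_gt0// invrK; apply: hc => //.
Qed.

Definition zmx J n (X : 'I_n * J -> 'I_n * J -> C) : MI n :=
 \matrix_(i, j) zext2 (fun s t => X (i, s) (j, t)).

Lemma zmxE J n (X : 'I_n * J -> 'I_n * J -> C) : blk J (zmx X) = X.
Proof. by apply/funext => -[i s]; apply/funext => -[j t]; rewrite /blk mxE zext2E. Qed.

Lemma zext2_out J (b : J -> J -> C) t : ~~ ((t.1 \in J) && (t.2 \in J)) -> zext2 b t = 0.
Proof.
rewrite negb_and /zext2 => /orP[h|h]; first by rewrite zext_out.
by rewrite {1}/zext; case: insub => // k; exact: zext_out.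
Qed.

Lemma zmx_supp J n (X : 'I_n * J -> 'I_n * J -> C) : fsuppM J (zmx X).
Proof. by move=> i j t h; rewrite mxE zext2_out. Qed.

Lemma zmxK J n (x : MI n) : fsuppM J x -> zmx (blk J x) = x.
Proof.
move=> h; apply/matrixP => i j; rewrite mxE; apply/funext => -[s t].
have [/andP[/= sJ tJ]|n_] := boolP ((s \in J) && (t \in J)); last first.
 by rewrite zext2_out// h.
have -> : s = val [` sJ]%fset by []; have -> : t = val [` tJ]%fset by [].
by rewrite zext2E.
Qed.

Lemma sum_norm_entry n (x : MI n) (e : R) i j t :
 (sum_norm Soo_ S1_ x <= e%:E)%E -> normc (x i j t) <= e.
Proof.
move=> h; apply/ler_addgt0Pr => d d0.
have : (sum_norm Soo_ S1_ x < (e + d)%:E)%E.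
 by apply: le_lt_trans h _; rewrite lte_fin ltrDl.
move=> /ereal_inf_lt[r [x0 [x1 [-> ->]]]].
have N0 := norm_gauge_Soo; have N1 := norm_gauge_S1.
have p0 := ng_ge0 N0 x0; have p1 := ng_ge0 N1 x1.
case E0 : (Soo x0) p0 => [a| |]// p0; case E1 : (S1 x1) p1 => [b| |]// p1.
rewrite lte_fin => ab; apply: ltW; apply: le_lt_trans ab.
pose J : {fset I} := [fset t.1; t.2]%fset.
have J1 : t.1 \in J by rewrite !inE eqxx.
have J2 : t.2 \in J by rewrite !inE eqxx orbT.
have g0 := ng_blk N0 J p0 (_ : (Soo x0 <= a%:E)%E); have g1 := ng_blk N1 J p1 (_ : (S1 x1 <= b%:E)%E).
have e0 := g_entry gauge_G0 (i, [` J1]%fset) (j, [` J2]%fset) p0 (g0 (ltac:(by rewrite E0))).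
have e1 := g_entry gauge_G1 (i, [` J1]%fset) (j, [` J2]%fset) p1 (g1 (ltac:(by rewrite E1))).
rewrite mxE; apply: le_trans (normcD _ _) _.
move: e0 e1; rewrite /blk/= -surjective_pairing => e0 e1; exact: lerD.
Qed.

Lemma sum_norm_le0 n (x : MI n) (e : R) : (Soo x <= e%:E)%E ->
 (sum_norm Soo_ S1_ x <= e%:E)%E.
Proof.
move=> h; apply: le_trans h; apply: ereal_inf_lbound; exists x, 0; split; first by rewrite addr0.
have z : S1 (0 : MI n) = 0%E.
 apply/eqP; rewrite eq_le (ng_ge0 norm_gauge_S1) andbT.
 apply: (ng_fin norm_gauge_S1 (J := fset0)) => //.
  by move=> i j t _; rewrite mxE.
 by apply: (g_ext _ (g_0 gauge_G1 _ _ (lexx 0))) => p q; rewrite /blk mxE.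
by rewrite z adde0.
Qed.

(** What is used of the norms of S_p and its conjugate from here on. The two directions [sb_ball]
    and [sb_fin] differ in strictness because the norm is an infimum over families. *)
Record spball_norm (th : R) (N : @mnorms R (I * I)) : Prop := SpballNorm {
 sb_ball : forall n (x : MI n) (c : R) (J : {fset I}), 0 < c -> (N n x < c%:E)%E ->
  Spball th (fun p q => (c^-1)%:C * blk J x p q);
 sb_approx : forall n (x : MI n) (e : R), (N n x < +oo)%E -> 0 < e ->
  exists J0 : {fset I}, forall J : {fset I}, (J0 `<=` J)%fset -> forall J' : {fset I},
   Spball th (fun p q => (e^-1)%:C * blk J' (x - truncmx J x) p q);
 sb_fin : forall n (x : MI n) (c : R) (J : {fset I}), 0 < c -> fsuppM J x ->
  Spball th (fun p q => (c^-1)%:C * blk J x p q) -> (N n x <= c%:E)%E;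
 sb_ge0 : forall n (x : MI n), (0 <= N n x)%E }.

Lemma exp_small (K : R) : 0 <= K -> exists2 lam : R, 0 <= lam & expR (- lam) * K <= 1.
Proof.
exists K => //; rewrite expRN ler_pdivrMl ?expR_gt0// mulr1.
by apply: le_trans (expR_ge1Dx K); rewrite lerDr.
Qed.

Lemma opsq_phase S T (K : S -> T -> C) c z : normc z <= 1 -> 0 <= c -> opsq K c ->
 opsq (fun s t => z * K s t) c.
Proof.
move=> z1 c0 h; apply: opsq_le (opsq_scale z h); rewrite ler_piMl//.
by rewrite expr_le1//.
Qed.

Lemma S1b_scale A S (x : A * S -> A * S -> C) z : normc z <= 1 -> S1b x -> S1b (fun p q => z * x p q).
Proof.
move=> z1 h B b hb; apply: opsq_ext (opsq_phase z1 ler01 (h B b hb)) => p q.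
by rewrite /spair; sums s t; rewrite mulrA.
Qed.

Lemma Re_affine (a d : R) (z : C) : re (a%:C * z + d%:C) = a * re z + d.
Proof. by case: z => u v; simpc. Qed.

(** The family exp (lam (z - 1)) x; a large lam makes it a contraction on Re z = 0. *)
Lemma Spball1 A S (x : A * S -> A * S -> C) : S1b x <-> Spball 1 x.
Proof.
split=> [h|[f [_ <- _ h]]]; last exact: (h 0).
pose K := \sum_s n2 (x s); have K0 : 0 <= K by apply: sumr_ge0 => s _.
have [lam lam0 hl] := exp_small K0.
exists (fun z p q => cexp (lam%:C * z + (- lam)%:C) * x p q); split.
- by move=> p q; apply: goodM; [exact: good_cexp|exact: good_cst].
- ext p q; rewrite -rmorphM/= -rmorphD/= mulr1 subrr.
 by rewrite cexp0 mul1r.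
- move=> y; apply: opsq_le (opsq_scale _ (opsq_HS x)); rewrite normc_cexp.
 rewrite Re_affine mulr0 add0r.
 apply: le_trans hl; rewrite ler_wpM2r// ler_piMl ?expR_ge0//.
 by rewrite -expR0 ler_expR oppr_le0.
- move=> y; apply: S1b_scale => //; rewrite normc_cexp.
 by rewrite Re_affine mulr1 subrr.
Qed.

(** The family exp (- lam z) x; a large lam brings it into the S_1 ball on Re z = 1. *)
Lemma Spball0 A S (x : A * S -> A * S -> C) : opsq x 1 <-> Spball 0 x.
Proof.
split=> [h|[f [_ <- h _]]]; last exact: (h 0).
have [k k0 hk] := S1b_HS x.
have k1 : 0 <= k^-1 by pos.
have [lam lam0 hl] := exp_small k1.
exists (fun z p q => cexp ((- lam)%:C * z + 0%:C) * x p q); split.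
- by move=> p q; apply: goodM; [exact: good_cexp|exact: good_cst].
- by ext p q; rewrite mulr0 addr0 cexp0 mul1r.
- move=> y; apply: opsq_phase => //; rewrite normc_cexp.
 by rewrite Re_affine mulr0.
- move=> y; set z := cexp _.
 have nz : normc z = expR (- lam).
  by rewrite normc_cexp Re_affine mulr1 addr0.
 have nz0 : 0 < normc z by rewrite nz expR_gt0.
 have nk : normc z <= k by move: hl; rewrite nz ler_pdivrMr// mul1r.
 have -> : (fun p q => z * x p q) = (fun p q => z * ((normc z)^-1)%:C * ((normc z)%:C * x p q)).
  ext p q; rewrite !mulrA -[z * _ * _]mulrA -rmorphM/=.
  by rewrite mulVf ?gt_eqF// mulr1.
 apply: S1b_scale; last exact: hk (ltW nz0) nk.
 by rewrite normcM normc_real ger0_norm ?invr_ge0 ?normc_ge0// mulfV// gt_eqF.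
Qed.

Lemma scaleVK (A : Type) (x : A -> A -> C) (c : R) p q : 0 < c -> c%:C * ((c^-1)%:C * x p q) = x p q.
Proof. by move=> c0; rewrite mulrA -rmorphM/= mulfV ?gt_eqF// mul1r. Qed.

Lemma G0_opsq A S (x : A * S -> A * S -> C) (c : R) : 0 < c ->
 G0 c x <-> opsq (fun p q => (c^-1)%:C * x p q) 1.
Proof.
split=> h.
 have := opsq_scale (c^-1)%:C h; rewrite normc_real real_normK ?num_real// exprVn.
 by rewrite mulVf ?expf_neq0 ?gt_eqF.
have := opsq_scale c%:C h; rewrite normc_real real_normK ?num_real// mulr1.
by apply: opsq_ext => p q; exact: scaleVK.
Qed.

Lemma spball_gauge (th : R) N G : norm_gauge N G ->
 (forall A S (x : A * S -> A * S -> C) c, 0 < c -> G c A S x <-> Spball th (fun p q => (c^-1)%:C * x p q)) ->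
 spball_norm th N.
Proof.
move=> NG GP; split.
- by move=> n x c J c0 /ltW h; apply/GP => //; exact: (ng_blk NG J (ltW c0) h).
- move=> n x e h e0; have [J0 hJ] := ng_approx NG h e0; exists J0 => J sub J'.
 by apply/GP => //; exact: hJ.
- move=> n x c J c0 hs /(GP _ _ _ _ c0) h; exact: (ng_fin NG (ltW c0) hs h).
- exact: ng_ge0 NG.
Qed.

Lemma spball_S1 : spball_norm 1 S1_.
Proof. by apply: (spball_gauge norm_gauge_S1) => A S x c c0; split=> [/G1_S1b|] h; [apply/Spball1/h|apply/G1_S1b/Spball1]. Qed.

Lemma spball_Soo : spball_norm 0 Soo_.
Proof. by apply: (spball_gauge norm_gauge_Soo) => A S x c c0; split=> [/G0_opsq|] h; [apply/Spball0/h|apply/G0_opsq/Spball0]. Qed.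

Lemma interp_good n (f : C -> MI n) i j t :
 interp_fun Soo_ S1_ f -> good (fun z => f z i j t).
Proof.
move=> [[[K hK] hcont] han _ _]; split.
- move=> z sz e e0; have [d d0 hd] := hcont z sz e e0; exists d => // w sw wz.
 by have := sum_norm_entry i j t (hd w sw wz); rewrite !mxE.
- by exists K => z sz; exact: (sum_norm_entry i j t (hK z sz)).
- move=> z oz; have [D _ hD] := han z oz; exists (D i j t) => e e0.
 have [d d0 hd] := hD e e0; exists d => // k kd.
 by have := sum_norm_entry i j t (hd k kd); rewrite !mxE.
Qed.

Lemma interp_norm_le n (f : C -> MI n) c :
 (interp_fun_norm Soo_ S1_ f <= c)%E <->
 (forall y : R, (Soo (f (0 +i* y)%R) <= c)%E) /\ (forall y : R, (S1 (f (1 +i* y)%R) <= c)%E).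
Proof.
rewrite ge_max; split.
 move=> /andP[h0 h1]; split=> y.
  by apply: le_trans h0; apply: ereal_sup_ubound.
 by apply: le_trans h1; apply: ereal_sup_ubound.
by move=> [h0 h1]; apply/andP; split; apply: ge_ereal_sup => _ [y _ <-].
Qed.

Lemma interp_ball (th : R) n (x : MI n) (c : R) J : 0 < c ->
 (interpolation Soo_ S1_ th x < c%:E)%E -> Spball th (fun p q => (c^-1)%:C * blk J x p q).
Proof.
move=> c0 /ereal_inf_lt[_ [f [hf <-] <-]] /ltW/interp_norm_le[h0 h1].
exists (fun z p q => (c^-1)%:C * blk J (f z) p q); split => //.
- by move=> p q; apply: goodM; [exact: good_cst|exact: interp_good].
- by move=> y; apply/G0_opsq => //; exact: (ng_blk norm_gauge_Soo J (ltW c0) (h0 y)).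
- by move=> y; apply/G1_S1b => //; exact: (ng_blk norm_gauge_S1 J (ltW c0) (h1 y)).
Qed.

(** A family for x minus its truncation is a family for the difference; [line_approx] controls it on
    both boundary lines with a single J. *)
Lemma interp_approx (th : R) n (x : MI n) (e : R) :
 (interpolation Soo_ S1_ th x < +oo)%E -> 0 < e ->
 exists J0 : {fset I}, forall J : {fset I}, (J0 `<=` J)%fset -> forall J' : {fset I},
   Spball th (fun p q => (e^-1)%:C * blk J' (x - truncmx J x) p q).
Proof.
move=> /ereal_inf_lt[_ [f [hf <-] <-]] _ e0.
have [_ _ l0 l1] := hf.
have [Ja hJa] := line_approx norm_gauge_Soo l0 e0.
have [Jb hJb] := line_approx norm_gauge_S1 l1 e0.
exists (Ja `|` Jb)%fset => J; rewrite fsubUset => /andP[sa sb] J'.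
exists (fun z p q => (e^-1)%:C * blk J' (f z - truncmx J (f z)) p q); split => //.
- move=> p q; apply: goodM; first exact: good_cst.
 have g := interp_good p.1 q.1 (val p.2, val q.2) hf.
 have := goodD g (goodM (good_cst (- ((val p.2 \in J) && (val q.2 \in J))%:R)) g).
 by congr good; ext z; rewrite /blk !mxE mulNr.
- by move=> y; apply/G0_opsq => //; exact: (hJa J sa J' y).
- by move=> y; apply/G1_S1b => //; exact: (hJb J sb J' y).
Qed.

Lemma fsupp_tcb J (A : I * I -> C) : fsupp J A -> exists c, tcb A c.
Proof.
move=> hA; pose x : MI 1 := const_mx A.
have hx : fsuppM J x by move=> i j t h; rewrite mxE hA.
have [c c0 hc] := S1b_HS (blk J x).
have c1 : 0 < c^-1 by pos.
have h : G1 (c^-1) (blk J x) by apply/G1_S1b => //; rewrite invrK; apply: hc => //.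
exists c^-1; have := G1_tcb ord0 ord0 (ltW c1) (g_blk_supp gauge_G1 hx h).
by rewrite mxE.
Qed.

(** The families of [Spball] need not vanish at infinity on the boundary lines. The factor exp (e
    (z^2 - th^2)) is 1 at th, forces the decay, and costs at most exp e in norm. *)
Lemma interp_fin (th : R) n (x : MI n) (c : R) J : 0 <= th <= 1 -> 0 < c -> fsuppM J x ->
 Spball th (fun p q => (c^-1)%:C * blk J x p q) ->
 (interpolation Soo_ S1_ th x <= c%:E)%E.
Proof.
move=> /andP[th0 th1] c0 hs [F [gF Fth F0 F1]].
have N0 := norm_gauge_Soo; have N1 := norm_gauge_S1.
have [K0 K00 hK0] := @G0_entries 'I_n J; have [K1 K10 hK1] := @G1_entries 'I_n J.
have small N G K (NG : norm_gauge N G) : 0 < K ->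
  (forall X d, 0 <= d -> (forall p q, normc (X p q) <= d) -> G (K * d) 'I_n J X) ->
  forall (X : 'I_n * J -> 'I_n * J -> C) d, 0 <= d -> (forall p q, normc (X p q) <= d) -> (N n (zmx X) <= (K * d)%:E)%E.
 move=> k0 hK X d d0 hX; apply: (ng_fin NG _ (zmx_supp X)); first by rewrite mulr_ge0// ltW.
 by rewrite zmxE; exact: hK.
have Soo_small := small _ _ _ N0 K00 hK0; have S1_small := small _ _ _ N1 K10 hK1.
have zB (X Y : 'I_n * J -> 'I_n * J -> C) : zmx X - zmx Y = zmx (fun p q => X p q - Y p q).
 apply/matrixP => i j; rewrite !mxE; apply/funext => -[s t]; rewrite !fctE.
 have [/andP[/= sJ tJ]|n_] := boolP ((s \in J) && (t \in J)).
  have -> : s = val [` sJ]%fset by []; have -> : t = val [` tJ]%fset by [].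
  by rewrite !zext2E.
 by rewrite !zext2_out// subr0.
have key (e : R) : 0 < e -> (interpolation Soo_ S1_ th x <= (c * expR e)%:E)%E.
 move=> e0.
 pose g z := cexp (e%:C * (z * z) + (- (e * th ^+ 2))%:C).
 have gE z : normc (g z) = expR (e * (re z ^+ 2 - im z ^+ 2) - e * th ^+ 2).
  by rewrite normc_cexp Re_affine; congr expR; case: z => a b /=; simpc; ring.
 have gle z : strip z -> normc (g z) <= expR (e * (1 - im z ^+ 2)).
  move=> /andP[z0 z1]; rewrite gE ler_expR.
  have : re z ^+ 2 <= 1 by rewrite expr_le1.
  have := mulr_ge0 (ltW e0) (sqr_ge0 th); have := sqr_ge0 (im z); nra.
 have gg : good g.
  apply: (@good_entire g (expR e)).
   move=> z; apply: (@cdiff_comp cexp (fun z => e%:C * (z * z) + (- (e * th ^+ 2))%:C)).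
    apply: cdiffD; last exact: cdiff_cst.
    by apply: cdiffM; [exact: cdiff_cst|apply: cdiffM; exact: cdiff_id].
   exact: cdiff_cexp.
  move=> z sz; apply: le_trans (gle z sz) _; rewrite ler_expR.
  have := sqr_ge0 (im z); nra.
 have gth : g th%:C = 1.
  rewrite /g -rmorphM/= -rmorphM/= -rmorphD/= (_ : _ + _ = 0); last by ring.
  by rewrite cexp0.
 pose X z p q := c%:C * F z p q * g z.
 have gX p q : good (fun z => X z p q) by apply: goodM => //; apply: goodM => //; exact: good_cst.
 pose f z := zmx (X z).
 have fth : f th%:C = x.
  rewrite -[RHS](zmxK hs); congr zmx; ext p q.
  by rewrite /X gth mulr1 Fth scaleVK.
 have bX : exists2 B : R, 0 <= B & forall z, strip z -> forall p q, normc (F z p q) <= B.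
  have /choice[b hb] (pq : ('I_n * J) * ('I_n * J)) : exists B : R, forall z, strip z -> normc (F z pq.1 pq.2) <= B.
   by have [_ h _] := gF pq.1 pq.2.
  have sz0 : strip (0 : C) by rewrite /strip/= lexx ler01.
  have b0 pq : 0 <= b pq by apply: le_trans (hb pq 0 sz0); exact: normc_ge0.
  exists (\sum_pq b pq); first by apply: sumr_ge0.
  move=> z sz p q; apply: le_trans (hb (p, q) z sz) _.
  by rewrite (bigD1 (p, q))//= lerDl sumr_ge0.
 have [B B0 hB] := bX.
 have Xle z : strip z -> forall p q, normc (X z p q) <= c * B * expR (e * (1 - im z ^+ 2)).
  move=> sz p q; rewrite /X (normcM (c%:C * F z p q)) (normcM c%:C) normc_real (ger0_norm (ltW c0)).
  apply: ler_pM; rewrite ?mulr_ge0 ?normc_ge0 ?(ltW c0)//; last exact: gle.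
  by apply: ler_wpM2l; [exact: ltW|exact: hB].
 have cB : 0 <= c * B by rewrite mulr_ge0// ltW.
 have sline0 y : strip (0 +i* y : C) by rewrite /strip/= lexx ler01.
 have sline1 y : strip (1 +i* y : C) by rewrite /strip/= lexx ler01.
 have cont z : strip z -> forall d : R, 0 < d -> exists2 r : R, 0 < r & forall w, strip w -> normc (w - z) < r ->
   forall p q, normc (X w p q - X z p q) <= d.
  move=> sz d d0.
  have /choice[r hr] (pq : ('I_n * J) * ('I_n * J)) : exists r : R, 0 < r /\ forall w, strip w -> normc (w - z) < r ->
    normc (X w pq.1 pq.2 - X z pq.1 pq.2) <= d.
   by have [h _ _] := gX pq.1 pq.2; have [r r0 hr] := h z sz d d0; exists r.
  have [r0 r00 hr0] := finite_min (fun pq => (hr pq).1).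
  exists r0 => // w sw wz p q; apply: ((hr (p, q)).2 w sw); exact: lt_le_trans wz (hr0 (p, q)).
 have decay (k : R) (e' : R) : 0 < k -> 0 < e' -> exists cc : R, forall t, cc < `|t| -> k * (c * B * expR (e * (1 - t ^+ 2))) <= e'.
  move=> k0 e'0; have kc : 0 <= k * (c * B) by rewrite mulr_ge0// ltW.
  have [lam lam0 hl] := exp_small (mulr_ge0 kc (ltW (ltac:(by rewrite invr_gt0; exact: e'0) : 0 < e'^-1))).
  exists (lam / e + 1) => t ht.
  have t1 : 1 <= `|t| by apply: ltW; apply: le_lt_trans ht; rewrite lerDr divr_ge0// ltW.
  have t2 : lam / e + 1 <= t ^+ 2.
   rewrite -real_normK ?num_real//; apply: le_trans (ltW ht) _; rewrite expr2 ler_peMl//.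
  rewrite mulrA; letr (k * (c * B) * expR (- lam)).
   rewrite ler_wpM2l// ler_expR.
   have : lam / e <= t ^+ 2 - 1 by lra.
   by rewrite ler_pdivrMr//; lra.
  by rewrite mulrC -[leRHS]mul1r -ler_pdivrMr// -[X in X <= _]mulrA.
 have lineC0 (N : @mnorms R (I * I)) k (u : R) : 0 < k -> (u = 0 \/ u = 1) ->
   (forall (X' : 'I_n * J -> 'I_n * J -> C) d, 0 <= d -> (forall p q, normc (X' p q) <= d) -> (N n (zmx X') <= (k * d)%:E)%E) ->
   C0_on_line N (fun t => f (u +i* t)).
  move=> k0 hu small'.
  have su t : strip (u +i* t : C) by case: hu => ->.
  split.
  - move=> t; apply: le_lt_trans (small' _ _ _ (Xle _ (su t))) (ltry _).
   by rewrite mulr_ge0// expR_ge0.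
  - move=> t e' e'0; have e'k : 0 < e' / k by rewrite divr_gt0.
   have [r r0 hr] := cont _ (su t) _ e'k; exists r => // s st.
   rewrite /f zB; apply: le_trans (small' _ _ (ltW e'k) (hr _ (su s) _)) _.
    have -> : ((u +i* s)%C - (u +i* t)%C)%R = (0 +i* (s - t))%C by apply/eqP; rewrite eq_complex/= subrr !eqxx.
    by rewrite /normc/= expr0n/= add0r sqrtr_sqr.
   by rewrite lee_fin mulrC divfK// gt_eqF.
  - move=> e' e'0; have [cc hcc] := decay k e' k0 e'0; exists cc => t ct.
   apply: le_trans (small' _ _ _ (Xle _ (su t))) _; first by rewrite mulr_ge0// expR_ge0.
   by rewrite lee_fin; exact: hcc.
 have hf : interp_fun Soo_ S1_ f.
  split.
  - split.
    exists (K0 * (c * B * expR e)) => z sz; apply: sum_norm_le0; apply: Soo_small.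
     by rewrite mulr_ge0// expR_ge0.
    move=> p q; apply: le_trans (Xle z sz p q) _; rewrite ler_wpM2l// ler_expR.
    have := sqr_ge0 (im z); nra.
   move=> z sz e' e'0; have e'k : 0 < e' / K0 by rewrite divr_gt0.
   have [r r0 hr] := cont z sz _ e'k; exists r => // w sw wz; apply: sum_norm_le0.
   rewrite /f zB; apply: le_trans (Soo_small _ _ (ltW e'k) (hr w sw wz)) _.
   by rewrite lee_fin mulrC divfK// gt_eqF.
  - move=> z oz.
   have /choice[D hD] (pq : ('I_n * J) * ('I_n * J)) : exists D : C, forall e : R, 0 < e -> exists2 d : R, 0 < d &
     forall k : C, normc k < d -> normc (X (z + k) pq.1 pq.2 - X z pq.1 pq.2 - k * D) <= e * normc k.
    by have [_ _ h] := gX pq.1 pq.2; exact: h z oz.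
   pose DD p q := D (p, q); exists (zmx DD).
    pose m := \sum_pq normc (D pq); have m0 : 0 <= m by apply: sumr_ge0 => pq _; exact: normc_ge0.
    apply: le_lt_trans (sum_norm_le0 (Soo_small DD m m0 _)) (ltry _) => p q.
    by rewrite /m (bigD1 (p, q))//= lerDl sumr_ge0// => pq _; exact: normc_ge0.
   move=> e' e'0; have e'k : 0 < e' / K0 by rewrite divr_gt0.
   have /choice[r hr] (pq : ('I_n * J) * ('I_n * J)) : exists r : R, 0 < r /\ forall k : C, normc k < r ->
     normc (X (z + k) pq.1 pq.2 - X z pq.1 pq.2 - k * D pq) <= e' / K0 * normc k.
    by have [r r0 hr] := hD pq _ e'k; exists r.
   have [r0 r00 hr0] := finite_min (fun pq => (hr pq).1).
   exists r0 => // h hh.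
   have -> : scalemxf h (zmx DD) = zmx (fun p q => h * DD p q).
    apply/matrixP => i j; rewrite !mxE; apply/funext => -[s t]; rewrite /scalef.
    have [/andP[/= sJ tJ]|n_] := boolP ((s \in J) && (t \in J)).
     have -> : s = val [` sJ]%fset by []; have -> : t = val [` tJ]%fset by [].
     by rewrite !zext2E.
    by rewrite !zext2_out// mulr0.
   rewrite /f !zB; apply: sum_norm_le0.
   have d0 : 0 <= e' / K0 * normc h by rewrite mulr_ge0 ?normc_ge0// ltW.
   apply: le_trans (Soo_small _ _ d0 _) _.
    by move=> p q; apply: (hr (p, q)).2; exact: lt_le_trans hh (hr0 _).
   by rewrite lee_fin mulrA [K0 * _]mulrC divfK// gt_eqF.
  - by apply: (lineC0 _ K0) => //; left.
  - by apply: (lineC0 _ K1) => //; right.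
 letr (interp_fun_norm Soo_ S1_ f).
  by apply: ereal_inf_lbound; exists f.
 apply/interp_norm_le.
 have ce : 0 <= c * expR e by rewrite mulr_ge0 ?expR_ge0// ltW.
 have gl u y : (u = 0 \/ u = 1) -> normc (g (u +i* y)) <= expR e.
  move=> hu; have su : strip (u +i* y : C) by case: hu => ->.
  by apply: le_trans (gle _ su) _; rewrite ler_expR/=; have := sqr_ge0 y; nra.
 have bound N G u y (NG : norm_gauge N G) : (u = 0 \/ u = 1) -> G 1 _ _ (F (u +i* y)) ->
   (N n (f (u +i* y)) <= (c * expR e)%:E)%E.
  move=> hu /(g_scale (ng_gauge NG) c%:C); rewrite normc_real (ger0_norm (ltW c0)) mulr1.
  move=> /(g_scale (ng_gauge NG) (g (u +i* y)))/(g_le (ng_gauge NG) (mulr_ge0 (normc_ge0 _) (ltW c0)))h.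
  apply: (ng_fin NG ce (zmx_supp _)); rewrite zmxE; apply: g_ext (h (c * expR e) _) => [p q|]; first by rewrite /X mulrC.
  by rewrite mulrC ler_pM2l//; exact: gl.
 split => y; [apply: (bound _ _ _ _ N0); [by left|]|apply: (bound _ _ _ _ N1); [by right|exact/G1_1]].
 by rewrite /G0 expr1n; exact: F0.
apply/lee_addgt0Pr => d d0.
have [e e0 he] : exists2 e : R, 0 < e & c * expR e <= c + d.
 exists (ln (1 + d / c)); first by rewrite ln_gt0// ltrDl divr_gt0.
 rewrite lnK ?posrE ?addr_gt0 ?divr_gt0//.
 by rewrite mulrDr mulr1 mulrCA mulfV ?gt_eqF// mulr1.
by apply: le_trans (key e e0) _; rewrite -EFinD lee_fin.
Qed.

Lemma spball_interp (r : R) : 1 < r ->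
 spball_norm r^-1 (restrict_mnorms (@schatten R I r) (interpolation Soo_ S1_ r^-1)).
Proof.
move=> r1; have r0 : 0 < r by exact: lt_trans ltr01 r1.
have th01 : 0 <= r^-1 <= 1 by rewrite invr_ge0 (ltW r0)/= invf_le1// ltW.
have dn (N : @mnorms R (I * I)) E n (x : MI n) c : (restrict_mnorms E N x < c)%E -> (N n x < c)%E.
 by rewrite /restrict_mnorms; case: ifP => // _; rewrite lt_neqAle leye_eq; case/andP => /eqP h /eqP h'; rewrite h' in h.
split.
- by move=> n x c J c0 /dn; exact: interp_ball.
- by move=> n x e /dn; exact: interp_approx.
- move=> n x c J c0 hs hb; rewrite /restrict_mnorms; case: asboolP => [_|[]]; first exact: interp_fin hs hb.
 by move=> i j; have [cc hcc] := fsupp_tcb (hs i j); exact: tcb_schatten hcc (ltW r1).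
- move=> n x; rewrite /restrict_mnorms; case: ifP => // _.
 apply: le_ereal_inf_tmp => _ [f _ <-]; rewrite /interp_fun_norm le_max.
 apply/orP; left; apply: ereal_sup_ge; exists (Soo (f (0 +i* 0))); first by exists 0.
 exact: (ng_ge0 norm_gauge_Soo).
Qed.

(** th = 1/p, and the conjugate exponent has inverse 1 - th. At p = 1 the two spaces are S_1 and
    S_oo themselves, not given by interpolation. *)
Lemma spball_Sp (p : R) : 1 <= p -> exists th : R, [/\ 0 <= th <= 1,
 spball_norm th (@Sp R I p%:E) & spball_norm (1 - th) (@Sp R I (hoelder_conjugate p%:E))].
Proof.
move=> p1; have [->|p1'] := eqVneq p 1.
 exists 1; split; first by rewrite ler01 lexx.
  by rewrite /Sp eqxx; exact: spball_S1.
 by rewrite hoelder_conjugate1 subrr; exact: spball_Soo.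
have pgt : 1 < p by rewrite lt_def p1'.
have p0 : 0 < p by exact: lt_trans ltr01 pgt.
exists p^-1; split.
- by rewrite invr_ge0 (ltW p0)/= invf_le1// ltW.
- by rewrite /Sp (negbTE p1'); exact: spball_interp.
have -> : hoelder_conjugate p%:E = (p / (p - 1))%:E.
 have pn : p%:E != 0%E by rewrite gt_eqF// lte_fin.
 apply/esym; apply: (hoelder_conjugateP _ (ltNyr p) pn).1.
 have p10 : 0 < p - 1 by rewrite subr_gt0.
 rewrite !inver gt_eqF// gt_eqF ?divr_gt0// -EFinD; congr (_%:E).
 by field; rewrite !gt_eqF.
have q1 : 1 < p / (p - 1) by rewrite ltr_pdivlMr ?subr_gt0// mul1r ltrBlDr ltrDl.
rewrite /Sp (gt_eqF q1) (_ : 1 - p^-1 = (p / (p - 1))^-1); last by field; rewrite !gt_eqF// subr_gt0.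
exact: spball_interp.
Qed.

End Interp.

(** * Schur products and reindexing in the finite Schatten balls *)

Section Tensor.
Implicit Types A K S T X Y : finType.

Section SchurTensor.

Lemma opsq_schur_tensor X Y S (x : X * S -> X * S -> C) (b : Y * S -> Y * S -> C) :
 opsq x 1 -> opsq b 1 ->
 opsq (fun p q : (X * Y) * S => x (p.1.1, p.2) (q.1.1, q.2) * b (p.1.2, p.2) (q.1.2, q.2)) 1.
Proof.
move=> hx hb; pose g (p : (X * Y) * S) := ((p.1.1, p.2), (p.1.2, p.2)).
have ig : injective g by move=> [[a a'] s] [[d d'] t] [-> _ -> ->].
have := opsq_inj _ ig ig (opsq_kron ler01 ler01 hx hb); rewrite mulr1 => h.
by apply: opsq_ext (h ler01) => p q.
Qed.

Lemma S1b_schur_l X Y S (x : X * S -> X * S -> C) (y : Y * S -> Y * S -> C) :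
 S1b x -> opsq y 1 ->
 S1b (fun p q : (X * Y) * S => x (p.1.1, p.2) (q.1.1, q.2) * y (p.1.2, p.2) (q.1.2, q.2)).
Proof.
move=> hx hy B b hb; have := hx _ _ (opsq_schur_tensor hy hb).
pose g (p : (X * Y) * B) := (p.1.1, (p.1.2, p.2)).
have ig : injective g by move=> [[a a'] s] [[d d'] t] [-> -> ->].
move=> /(opsq_inj ler01 ig ig); apply: opsq_ext => p q.
by eqs s t; rewrite mulrA.
Qed.

Lemma S1b_schur_r X Y S (x : X * S -> X * S -> C) (y : Y * S -> Y * S -> C) :
 opsq x 1 -> S1b y ->
 S1b (fun p q : (X * Y) * S => x (p.1.1, p.2) (q.1.1, q.2) * y (p.1.2, p.2) (q.1.2, q.2)).
Proof.
move=> hx hy B b hb; have := hy _ _ (opsq_schur_tensor hx hb).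
pose g (p : (X * Y) * B) := (p.1.2, (p.1.1, p.2)).
have ig : injective g by move=> [[a a'] s] [[d d'] t] [-> -> ->].
move=> /(opsq_inj ler01 ig ig); apply: opsq_ext => p q.
by eqs s t; rewrite mulrCA !mulrA.
Qed.

(** The Schur product of f(z) and g(1 - z) has, on either boundary line, one factor in the S_1 ball
    and one contraction. This is the complete contractivity of [psi] on blocks. *)
Lemma Spball_schur X Y S (th : R) (x : X * S -> X * S -> C) (y : Y * S -> Y * S -> C) :
 0 <= th <= 1 -> Spball th x -> Spball (1 - th) y ->
 S1b (fun p q : (X * Y) * S => x (p.1.1, p.2) (q.1.1, q.2) * y (p.1.2, p.2) (q.1.2, q.2)).
Proof.
move=> th01 [f [gf <- f0 f1]] [g [gg <- g0 g1]] B b hb.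
rewrite -[X in opsq _ X](expr1n R 2); apply: opsq_test => // w v w1 v1.
pose z u (p q : (X * Y) * S) := f u (p.1.1, p.2) (q.1.1, q.2) * g (1 - u) (p.1.2, p.2) (q.1.2, q.2).
pose h u := \sum_s \sum_t w s * spair (z u) b s t * v t.
have hE u : S1b (z u) -> normc (h u) <= 1.
 move=> /(_ _ _ hb)/(opsq_bil _ ler01)/(_ w v); rewrite mul1r => hz.
 rewrite -(@ler_pXn2r _ 2)// ?nnegrE ?normc_ge0// expr1n.
 by apply: le_trans hz _; rewrite -[leRHS]mulr1 ler_pM//.
have -> : \sum_s \sum_t w s * spair (fun p q => f th%:C (p.1.1, p.2) (q.1.1, q.2) *
  g (1 - th)%:C (p.1.2, p.2) (q.1.2, q.2)) b s t * v t = h th%:C.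
 by rewrite rmorphB.
apply: three_lines => // [|r|r].
- apply: good_sum => p _; apply: good_sum => q _.
 apply: goodM; last exact: good_cst.
 apply: goodM; first exact: good_cst.
 apply: good_sum => s _; apply: good_sum => t _; apply: goodM; last exact: good_cst.
 by apply: goodM; [exact: gf|apply: (good_onem (gg _ _))].
- apply: hE.
 rewrite /z (_ : 1 - (0 +i* r) = 1 +i* (- r)); last by apply/eqP; rewrite eq_complex/= subr0 sub0r !eqxx.
 exact: S1b_schur_r (f0 r) (g1 (- r)).
- apply: hE.
 rewrite /z (_ : 1 - (1 +i* r) = 0 +i* (- r)); last by apply/eqP; rewrite eq_complex/= subrr sub0r !eqxx.
 exact: S1b_schur_l (f1 r) (g0 (- r)).
Qed.

(* A partial injection [h : S' -> option S] moves kernels on S to kernels on S'. *)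
Definition pinc S S' (h : S' -> option S) : S' -> S -> C := fun s' s => (h s' == Some s)%:R.

Definition pull A S S' (h : S' -> option S) (x : A * S -> A * S -> C) : A * S' -> A * S' -> C :=
 sandS (pinc h) x (fun s s' => pinc h s' s).

Lemma pullE A S S' (h : S' -> option S) (x : A * S -> A * S -> C) p q :
 pull h x p q = if h p.2 is Some s then if h q.2 is Some t then x (p.1, s) (q.1, t) else 0 else 0.
Proof.
rewrite /pull /sandS /pinc; case: (h p.2) => [s|]; last first.
 by rewrite big1// => s _; rewrite big1// => t _; rewrite !mul0r.
rewrite (bigD1 s)//= [X in _ + X]big1 ?addr0; last first.
 move=> i /negbTE ni; rewrite big1// => t _.
 by rewrite (_ : (Some s == Some i) = false) ?mul0r// eq_sym.
rewrite eqxx; case: (h q.2) => [t|]; last by rewrite big1// => t _; rewrite mulr0.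
rewrite (bigD1 t)//= [X in _ + X]big1 ?addr0; last first.
 move=> i /negbTE ni.
 by rewrite (_ : (Some t == Some i) = false) ?mulr0// eq_sym.
by rewrite eqxx mul1r mulr1.
Qed.

Definition pinj (S S' : Type) (h : S' -> option S) := forall s s' t, h s = Some t -> h s' = Some t -> s = s'.

Lemma pinc_opsq S S' (h : S' -> option S) : pinj h -> opsq (pinc h) 1.
Proof.
move=> ih v; rewrite mul1r /n2.
have -> : \sum_s' normc (\sum_s pinc h s' s * v s) ^+ 2 =
  \sum_s' \sum_s (h s' == Some s)%:R * normc (v s) ^+ 2.
 eqs s'; rewrite /pinc; case: (h s') => [s|]; last first.
  by rewrite !big1 ?normc0 ?expr0n// => s _; rewrite mul0r.
 have e t : (Some s == Some t) = (s == t) by [].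
 by under eq_bigr do rewrite e; rewrite !sum_deltal.
rewrite exchange_big; apply: ler_sum => s _ /=; rewrite -mulr_suml ler_piMl ?sqr_ge0//.
have [/existsP[s' /eqP hs']|/existsPn no] := boolP [exists s', h s' == Some s].
 rewrite (bigD1 s')//= hs' eqxx big1 ?addr0// => t nt.
 by case: eqP => // ht; rewrite (ih _ _ _ ht hs') eqxx in nt.
by rewrite big1// => s' _; rewrite (negbTE (no s')).
Qed.

Lemma Spball_pull A S S' (th : R) (h : S' -> option S) (x : A * S -> A * S -> C) :
 pinj h -> Spball th x -> Spball th (pull h x).
Proof.
move=> ih [f [gf <- f0 f1]]; exists (fun z => pull h (f z)).
have hE := pinc_opsq ih; have hF : opsq (fun s s' => pinc h s' s) 1 by apply: opsq_tr.
split => // [p q|y|y].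
- apply: good_sum => s _; apply: good_sum => t _; apply: goodM; last exact: good_cst.
 by apply: goodM; [exact: good_cst|exact: gf].
- exact: sandS_opsq.
- by apply/G1_1; apply: (g_sandS gauge_G1) => //; apply/G1_1.
Qed.

Lemma Spball_reindex A A' S (th : R) (h : A' -> A) (x : A * S -> A * S -> C) :
 injective h -> Spball th x -> Spball th (fun p q : A' * S => x (h p.1, p.2) (h q.1, q.2)).
Proof.
move=> ih [f [gf <- f0 f1]]; exists (fun z p q => f z (h p.1, p.2) (h q.1, q.2)); split => // y.
 pose g (p : A' * S) := (h p.1, p.2); have ig : injective g by move=> [a s] [a' s'] [/ih -> ->].
 exact: (opsq_inj ler01 ig ig (f0 y)).
move=> B b hb; pose g (p : A' * B) := (h p.1, p.2).
have ig : injective g by move=> [a s] [a' s'] [/ih -> ->].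
exact: (opsq_inj ler01 ig ig (f1 y B b hb)).
Qed.

Lemma Spball_unit S (th : R) (s t : S) :
 Spball th (fun p q : unit * S => (p.2 == s)%:R * (q.2 == t)%:R : C).
Proof.
exists (fun _ p q => (p.2 == s)%:R * (q.2 == t)%:R); split => // [p q|_|_ B b hb].
- exact: good_cst.
- by apply: opsq_ext (opsq_delta (tt, s) (tt, t)) => -[[] p] [[] q].
- pose g (u : S) (p : unit * B) := (p.2, u).
 have ig u : injective (g u) by move=> [[] a] [[] a'] [->].
 apply: opsq_ext (opsq_inj ler01 (ig s) (ig t) hb) => p q.
 rewrite /spair (bigD1 s)//= [X in _ + X]big1 ?addr0; last first.
  by move=> s' /negbTE ns; rewrite big1// => t' _; rewrite ns !mul0r.
 rewrite (bigD1 t)//= [X in _ + X]big1 ?addr0; last by move=> t' /negbTE nt; rewrite nt mulr0 mul0r.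
 by rewrite !eqxx !mul1r.
Qed.

End SchurTensor.

End Tensor.

(** * Atoms of the projective tensor norm *)

Section Atomic.
Implicit Types S T X Y : finType.
Implicit Types J : {fset I}.
Variable th : R.
Hypothesis th01 : 0 <= th <= 1.

Section TensorAtoms.
Implicit Types A K : finType.

(** The entries of a (x (x) y) b: (s, t) is the position in x and (s', t') the one in y. *)
Definition tatom A X Y S (a : A -> X * Y -> C) (x : X * S -> X * S -> C)
  (y : Y * S -> Y * S -> C) (b : X * Y -> A -> C) : A -> A -> S -> S -> S -> S -> C :=
 fun i j s t s' t' => \sum_q \sum_q' a i q * x (q.1, s) (q'.1, t) * y (q.2, s') (q'.2, t') * b q' j.

(* TK c: the open-ball-type atoms a (x (x) y) b of the projective tensor norm,
  normalized by |a|^2, |b|^2 <= c and x, y in the unit balls. *)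
Definition TK (c : R) A S (u : A -> A -> S -> S -> S -> S -> C) : Prop :=
 exists X Y x y a b, [/\ @Spball th X S x, @Spball (1 - th) Y S y, opsq a c, opsq b c &
  u = @tatom A X Y S a x y b].

(** The image of the atoms under [psi]: both positions coincide. *)
Definition BK (c : R) A S (w : A * S -> A * S -> C) : Prop :=
 exists2 u, TK c u & forall p q, w p q = u p.1 q.1 p.2 q.2 p.2 q.2.

Lemma TK_le c d A S (u : A -> A -> S -> S -> S -> S -> C) : c <= d -> TK c u -> TK d u.
Proof.
move=> cd [X [Y [x [y [a [b [hx hy ha hb ->]]]]]]]; exists X, Y, x, y, a, b; split => //.
 exact: opsq_le cd ha.
exact: opsq_le cd hb.
Qed.

Lemma TK_bimod p c A A' S (al : A' -> A -> C) (be : A -> A' -> C)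
  (u : A -> A -> S -> S -> S -> S -> C) : 0 <= p -> 0 <= c -> opsq al p -> opsq be p -> TK c u ->
 TK (p * c) (fun i j s t s' t' => \sum_k \sum_l al i k * u k l s t s' t' * be l j).
Proof.
move=> p0 c0 hal hbe [X [Y [x [y [a [b [hx hy ha hb ->]]]]]]].
exists X, Y, x, y, (kcomp al a), (kcomp b be); split => //.
- exact: opsq_comp.
- by rewrite mulrC; exact: opsq_comp.
ext i j; ext s t; ext s' t'.
transitivity (\sum_k \sum_l \sum_q \sum_q' al i k * a k q * x (q.1, s) (q'.1, t) * y (q.2, s') (q'.2, t') * b q' l * be l j).
 eqs k l; sums q.
 by sums q'; ring.
transitivity (\sum_q \sum_q' \sum_k \sum_l al i k * a k q * x (q.1, s) (q'.1, t) * y (q.2, s') (q'.2, t') * b q' l * be l j).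
 under eq_bigr do rewrite exchange_big; rewrite exchange_big; eqs q.
 by under eq_bigr do rewrite exchange_big; rewrite exchange_big.
eqs q q'; rewrite -!mulrA; sums k.
by rewrite !mulr_sumr; eqs l; ring.
Qed.

Lemma TK_pull c A S S' (h : S' -> option S) (u : A -> A -> S -> S -> S -> S -> C) : pinj h -> TK c u ->
 TK c (fun i j s t s' t' =>
  if h s is Some s0 then if h t is Some t0 then if h s' is Some s1 then if h t' is Some t1
  then u i j s0 t0 s1 t1 else 0 else 0 else 0 else 0).
Proof.
move=> ih [X [Y [x [y [a [b [hx hy ha hb ->]]]]]]].
exists X, Y, (pull h x), (pull h y), a, b; split => //; [exact: Spball_pull|exact: Spball_pull|].
ext i j; ext s t; ext s' t'.
under [RHS]eq_bigr do under eq_bigr do rewrite !pullE/=.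
case: (h s) => [s0|]; last by rewrite big1// => q _; rewrite big1// => q' _; rewrite mulr0 !mul0r.
case: (h t) => [t0|]; last by rewrite big1// => q _; rewrite big1// => q' _; rewrite mulr0 !mul0r.
case: (h s') => [s1|]; last by rewrite big1// => q _; rewrite big1// => q' _; rewrite mulr0 !mul0r.
by case: (h t') => [t1|]//; rewrite big1// => q _; rewrite big1// => q' _; rewrite mulr0 !mul0r.
Qed.

Lemma TK_dsum c A1 A2 S (u1 : A1 -> A1 -> S -> S -> S -> S -> C) (u2 : A2 -> A2 -> S -> S -> S -> S -> C) :
 0 <= c -> TK c u1 -> TK c u2 -> TK c (fun i j s t s' t' =>
  dsum (fun k l => u1 k l s t s' t') (fun k l => u2 k l s t s' t') i j).
Proof.
move=> c0 [X1 [Y1 [x1 [y1 [a1 [b1 [hx1 hy1 ha1 hb1 ->]]]]]]].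
move=> [X2 [Y2 [x2 [y2 [a2 [b2 [hx2 hy2 ha2 hb2 ->]]]]]]].
pose a (i : A1 + A2) (q : (X1 + X2) * (Y1 + Y2)) : C :=
 match i, q with inl i, (inl q, inl q') => a1 i (q, q') | inr i, (inr q, inr q') => a2 i (q, q') | _, _ => 0 end.
pose b (q : (X1 + X2) * (Y1 + Y2)) (i : A1 + A2) : C :=
 match i, q with inl i, (inl q, inl q') => b1 (q, q') i | inr i, (inr q, inr q') => b2 (q, q') i | _, _ => 0 end.
have sumq (F : (X1 + X2) * (Y1 + Y2) -> C) : (forall k l, F (inl k, inr l) = 0) -> (forall k l, F (inr k, inl l) = 0) ->
  \sum_q F q = \sum_q F (inl q.1, inl q.2) + \sum_q F (inr q.1, inr q.2).
 move=> F1 F2; rewrite !sum_pair big_sumType/=; congr (_ + _); eqs k; rewrite big_sumType/=.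
  by rewrite [X in _ + X]big1 ?addr0// => l _.
 by rewrite [X in X + _]big1 ?add0r// => l _.
have opa (a1' : A1 -> X1 * Y1 -> C) (a2' : A2 -> X2 * Y2 -> C) : opsq a1' c -> opsq a2' c ->
  opsq (fun (i : A1 + A2) (q : (X1 + X2) * (Y1 + Y2)) =>
   match i, q with inl i, (inl q, inl q') => a1' i (q, q') | inr i, (inr q, inr q') => a2' i (q, q') | _, _ => 0 end) c.
 move=> h1 h2 v; rewrite n2_sum.
 letr (c * n2 (fun q : X1 * Y1 => v (inl q.1, inl q.2)) + c * n2 (fun q : X2 * Y2 => v (inr q.1, inr q.2))).
  apply: lerD; [apply: le_trans (h1 _)|apply: le_trans (h2 _)]; apply: ler_eq;
   apply: n2_eq => i; rewrite sumq/= => [||k l]; try by move=> *; rewrite mul0r.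
   rewrite [X in _ + X]big1 ?addr0; last by move=> q _; rewrite mul0r.
   by apply: eq_bigr => -[].
  rewrite [X in X + _]big1 ?add0r; last by move=> q _; rewrite mul0r.
  by apply: eq_bigr => -[].
 rewrite -mulrDr ler_wpM2l// /n2 !sum_pair big_sumType/=; apply: lerD; apply: ler_sum => k _; rewrite big_sumType/=.
  by rewrite lerDl => *; pos.
 by rewrite lerDr => *; pos.
exists (X1 + X2)%type, (Y1 + Y2)%type, (mxsum x1 x2), (mxsum y1 y2), a, b; split.
- exact: Spball_mxsum.
- exact: Spball_mxsum.
- exact: opa.
- have := opsq_tr c0 (opa _ _ (opsq_tr c0 hb1) (opsq_tr c0 hb2)); apply: opsq_ext => -[[q|q] [q'|q']] [i|i] //=.
ext i j; ext s t; ext s' t'.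
have z0 (F : (X1 + X2) * (Y1 + Y2) -> (X1 + X2) * (Y1 + Y2) -> C) :
  (forall q q', F q q' = 0) -> \sum_q \sum_q' F q q' = 0 by move=> h; rewrite big1// => q _; rewrite big1.
case: i j => i [j|j]; rewrite /tatom.
- rewrite [RHS]sumq/=; [|by move=> *; rewrite big1// => *; rewrite !mul0r..].
 rewrite [X in _ = _ + X]big1 ?addr0; last by move=> q _; rewrite big1// => *; rewrite !mul0r.
 apply: eq_bigr => -[q1 q2] _ /=; rewrite [RHS]sumq/=; [|by move=> *; rewrite mulr0..].
 by rewrite [X in _ = _ + X]big1 ?addr0; [apply: eq_bigr => -[]|move=> *; rewrite mulr0].
- rewrite z0// => -[[q1|q1] [q2|q2]] [[q3|q3] [q4|q4]] /=; by rewrite ?(mulr0, mul0r).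
- rewrite z0// => -[[q1|q1] [q2|q2]] [[q3|q3] [q4|q4]] /=; by rewrite ?(mulr0, mul0r).
rewrite [RHS]sumq/=; [|by move=> *; rewrite big1// => *; rewrite !mul0r..].
rewrite [X in _ = X + _]big1 ?add0r; last by move=> q _; rewrite big1// => *; rewrite !mul0r.
apply: eq_bigr => -[q1 q2] _ /=; rewrite [RHS]sumq/=; [|by move=> *; rewrite mulr0..].
by rewrite [X in _ = X + _]big1 ?add0r; [apply: eq_bigr => -[]|move=> *; rewrite mulr0].
Qed.

(** Each outer factor takes sqrt |z|, and the left one also the phase. *)
Lemma TK_scale z c A S (u : A -> A -> S -> S -> S -> S -> C) : 0 <= c -> TK c u ->
 TK (normc z * c) (fun i j s t s' t' => z * u i j s t s' t').
Proof.
move=> c0 hu; have [w w1 wz] := normc_phase z.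
have wn : w != 0 by rewrite -normc_eq0 w1.
have wV : normc w^-1 = 1 by rewrite normcV w1 invr1.
have zE : z = w^-1 * (normc z)%:C by rewrite -wz mulrA mulVf// mul1r.
pose r : C := (Num.sqrt (normc z))%:C.
have rr : r * r = (normc z)%:C by rewrite -rmorphM/= -expr2 sqr_sqrtr.
have dg (k : C) : normc k = 1 -> opsq (fun i j : A => (i == j)%:R * (k * r)) (normc z).
 move=> k1; apply: opsq_diag => i.
 by rewrite normcM k1 mul1r normc_real ger0_norm ?sqrtr_ge0// sqr_sqrtr.
have := TK_bimod (normc_ge0 z) c0 (dg _ wV) (dg 1 (normc1 _)) hu.
congr TK; ext i j; ext s t; ext s' t'.
transitivity (\sum_k (i == k)%:R * \sum_l (l == j)%:R * (w^-1 * r * u k l s t s' t' * (1 * r))).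
 by eqs k; sums l; ring.
rewrite sum_deltal sum_deltar zE -rr; ring.
Qed.

Lemma TK_eq0 A S (u : A -> A -> S -> S -> S -> S -> C) : TK 0 u ->
 forall i j s t s' t', u i j s t s' t' = 0.
Proof.
move=> [X [Y [x [y [a [b [_ _ ha _ ->]]]]]]] i j s t s' t'; rewrite /tatom big1// => q _; rewrite big1// => q' _.
have : normc (a i q) ^+ 2 <= 0 by apply: opsq_entry ha.
rewrite -[0](expr0n R 2) ler_pXn2r ?nnegrE ?normc_ge0// => h.
have /eqP : normc (a i q) == 0 by rewrite eq_le h normc_ge0.
by move/eqP; rewrite normc_eq0 => /eqP->; rewrite !mul0r.
Qed.

Lemma TK_zero c A S : 0 <= c -> TK c (fun (_ _ : A) (_ _ _ _ : S) => 0).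
Proof.
have sb t : Spball t (fun _ _ : void * S => 0 : C).
 exists (fun _ _ _ => 0); split => // [p q|_|_ B b _]; first exact: good_cst.
  exact: opsq0.
 by apply: (opsq_ext _ (@opsq0 _ _ 1 ler01)) => p q; rewrite /spair big1// => s _; rewrite big1// => t' _; rewrite mul0r.
exists void, void, (fun _ _ => 0), (fun _ _ => 0), (fun _ _ => 0), (fun _ _ => 0); split => //; try exact: opsq0.
by rewrite /tatom big1// => -[[]].
Qed.

(** u / c and v / d form a direct sum, compressed by the row (sqrt c, sqrt d) and its transpose, of
    squared norm c + d. The divisions set the cases c = 0 and d = 0 apart. *)
Lemma TK_add c d A S (u v : A -> A -> S -> S -> S -> S -> C) : 0 <= c -> 0 <= d ->
 TK c u -> TK d v -> TK (c + d) (fun i j s t s' t' => u i j s t s' t' + v i j s t s' t').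
Proof.
move=> c0 d0 hu hv.
move: c0; rewrite le_eqVlt => /predU1P[c0|c0].
 rewrite -c0 add0r; move: hv; congr TK.
 ext i j; ext s t; ext s' t'.
 by rewrite -c0 in hu; rewrite (TK_eq0 hu) add0r.
move: d0; rewrite le_eqVlt => /predU1P[d0|d0].
 rewrite -d0 addr0; move: hu; congr TK.
 ext i j; ext s t; ext s' t'.
 by rewrite -d0 in hv; rewrite (TK_eq0 hv) addr0.
have nz (k : R) (w : A -> A -> S -> S -> S -> S -> C) : 0 < k -> TK k w ->
  TK 1 (fun i j s t s' t' => (k^-1)%:C * w i j s t s' t').
 move=> k0 /(TK_scale (k^-1)%:C (ltW k0)).
 by rewrite normc_real ger0_norm ?invr_ge0 ?(ltW k0)// mulVf ?gt_eqF.
pose al (i : A) (k : A + A) : C := match k with inl j => (i == j)%:R * (Num.sqrt c)%:C | inr j => (i == j)%:R * (Num.sqrt d)%:C end.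
have hal : opsq al (c + d).
 move=> f; rewrite n2_sum mulrDr !mulr_sumr -big_split; apply: ler_sum => i _ /=.
 rewrite big_sumType/=.
 have E (k : R) (g : A -> C) : \sum_t (i == t)%:R * k%:C * g t = k%:C * g i.
  by under eq_bigr do rewrite -mulrA; rewrite sum_deltal.
 rewrite !E.
 have h : normc ((Num.sqrt c)%:C * f (inl i) + (Num.sqrt d)%:C * f (inr i)) <=
   Num.sqrt c * normc (f (inl i)) + Num.sqrt d * normc (f (inr i)).
  by apply: le_trans (normcD _ _) _; rewrite !normcM !normc_real !ger0_norm.
 letr ((Num.sqrt c * normc (f (inl i)) + Num.sqrt d * normc (f (inr i))) ^+ 2).
  rewrite ler_pXn2r// nnegrE ?normc_ge0// addr_ge0// mulr_ge0 ?sqrtr_ge0//.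
 have := sqr_sqrtr (ltW c0); have := sqr_sqrtr (ltW d0).
 move: (Num.sqrt c) (Num.sqrt d) (normc (f (inl i))) (normc (f (inr i))) => p q x y <- <-.
 by have := sqr_ge0 (p * y - q * x); nra.
have hbe : opsq (fun k i => al i k) (c + d) by apply: opsq_tr => //; rewrite addr_ge0//.
have := TK_bimod (addr_ge0 (ltW c0) (ltW d0)) ler01 hal hbe (TK_dsum ler01 (nz _ _ c0 hu) (nz _ _ d0 hv)).
rewrite mulr1; congr TK.
ext i j; ext s t; ext s' t'.
rewrite big_sumType/=.
have E (k : R) (w : A -> A -> C) : 0 < k ->
  \sum_i0 \sum_i1 (i == i0)%:R * (Num.sqrt k)%:C * ((k^-1)%:C * w i0 i1) * ((j == i1)%:R * (Num.sqrt k)%:C) = w i j.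
 transitivity (\sum_i0 (i == i0)%:R * \sum_i1 (j == i1)%:R * ((Num.sqrt k * k^-1 * Num.sqrt k)%:C * w i0 i1)).
  by eqs i0; sums i1; ring.
 rewrite !sum_deltal mulrAC -expr2 sqr_sqrtr ?(ltW k0)// mulfV ?gt_eqF// mul1r//.
congr (_ + _).
 rewrite -[RHS](E c (fun i j => u i j s t s' t') c0); eqs i0.
 by rewrite big_sumType/= [X in _ + X]big1 ?addr0// => i1 _; rewrite mulr0 mul0r.
rewrite -[RHS](E d (fun i j => v i j s t s' t') d0); eqs i0.
by rewrite big_sumType/= [X in X + _]big1 ?add0r// => i1 _; rewrite mulr0 mul0r.
Qed.

Lemma TK_unit A S (p q : A * S) : TK 1 (fun i j s t s' t' =>
 (i == p.1)%:R * (j == q.1)%:R * ((s == p.2)%:R * (t == q.2)%:R) * ((s' == p.2)%:R * (t' == q.2)%:R)).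
Proof.
pose a (k : A) (i : A) (_ : unit * unit) : C := (i == k)%:R.
have ha k : opsq (a k) 1.
 by apply: opsq_ext (opsq_delta k (tt, tt)) => i [[] []]; rewrite /a mulr1.
exists unit, unit, (fun p' q' => (p'.2 == p.2)%:R * (q'.2 == q.2)%:R), (fun p' q' => (p'.2 == p.2)%:R * (q'.2 == q.2)%:R),
 (a p.1), (fun k i => a q.1 i k); split.
- exact: Spball_unit.
- exact: Spball_unit.
- exact: ha.
- exact: opsq_tr.
ext i j; ext s t; ext s' t'.
have e (F : unit * unit -> C) : \sum_q F q = F (tt, tt) by rewrite sum_pair ?(big_pred1 tt)// => -[].
by rewrite /tatom !e/=; ring.
Qed.

Lemma BK_ext c A S (w w' : A * S -> A * S -> C) : (forall p q, w p q = w' p q) -> BK c w -> BK c w'.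
Proof. by move=> e [u hu h]; exists u => // p q; rewrite -e. Qed.

Lemma BK_le c d A S (w : A * S -> A * S -> C) : c <= d -> BK c w -> BK d w.
Proof. by move=> cd [u hu h]; exists u => //; exact: TK_le hu. Qed.

Lemma BK_zero c A S : 0 <= c -> BK c (fun _ _ : A * S => 0).
Proof. exists (fun _ _ _ _ _ _ => 0) => //; exact: TK_zero. Qed.

Lemma BK_add c d A S (w w' : A * S -> A * S -> C) : 0 <= c -> 0 <= d ->
 BK c w -> BK d w' -> BK (c + d) (fun p q => w p q + w' p q).
Proof.
move=> c0 d0 [u hu h] [v hv h']; exists (fun i j s t s' t' => u i j s t s' t' + v i j s t s' t').
 exact: TK_add.
by move=> p q; rewrite h h'.
Qed.

Lemma BK_scale z c A S (w : A * S -> A * S -> C) : 0 <= c ->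
 BK c w -> BK (normc z * c) (fun p q => z * w p q).
Proof.
move=> c0 [u hu h]; exists (fun i j s t s' t' => z * u i j s t s' t'); first exact: TK_scale.
by move=> p q; rewrite h.
Qed.

Lemma BK_sub c d A S (w w' : A * S -> A * S -> C) : 0 <= c -> 0 <= d ->
 BK c w -> BK d w' -> BK (c + d) (fun p q => w p q - w' p q).
Proof.
move=> c0 d0 hw /(BK_scale (-1) d0); rewrite normcNE normc1 mul1r => hw'.
by apply: BK_ext (BK_add c0 d0 hw hw') => p q; rewrite mulN1r.
Qed.

Lemma BK_sum K A S (c : K -> R) (w : K -> A * S -> A * S -> C) : (forall k, 0 <= c k) ->
 (forall k, BK (c k) (w k)) -> BK (\sum_k c k) (fun p q => \sum_k w k p q).
Proof.
move=> c0 hw; elim: (index_enum K) => [|k r ih].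
 rewrite big_nil; apply: BK_ext (BK_zero _ _ (lexx _)) => p q; by rewrite big_nil.
rewrite big_cons; apply: BK_ext (BK_add _ _ (hw k) ih) => [p q|//|]; first by rewrite big_cons.
by pos.
Qed.

(** A crude bound by matrix units; it makes small entrywise errors on a finite block harmless. *)
Lemma BK_entries A S (w : A * S -> A * S -> C) (c : R) :
 \sum_p \sum_q normc (w p q) <= c -> BK c w.
Proof.
move=> h; apply: (BK_le h).
have := @BK_sum ((A * S) * (A * S))%type A S (fun r => normc (w r.1 r.2))
 (fun r p q => (p == r.1)%:R * (q == r.2)%:R * w r.1 r.2) (fun _ => normc_ge0 _).
rewrite sum_pair/= => h'; apply: BK_ext (h' _) => [p q|[[i s] [j t]] /=].
 rewrite sum_pair/=; under eq_bigr do under eq_bigr do rewrite -mulrA.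
 under eq_bigr do rewrite -mulr_sumr; rewrite sum_deltal.
 by rewrite sum_deltal.
have /(BK_scale (w (i, s) (j, t)) ler01) : BK 1 (fun p q : A * S => (p == (i, s))%:R * (q == (j, t))%:R).
 eexists; first exact: (TK_unit (i, s) (j, t)).
 move=> [i' s'] [j' t']; rewrite !xpair_eqE.
 by case: (i' == i); case: (s' == s); case: (j' == j); case: (t' == t); rewrite ?(mulr0, mul0r, mulr1).
by rewrite mulr1; apply: BK_ext => p q; rewrite mulrC.
Qed.

Lemma BK_bimod p c A A' S (al : A' -> A -> C) (be : A -> A' -> C) (w : A * S -> A * S -> C) :
 0 <= p -> 0 <= c -> opsq al p -> opsq be p -> BK c w ->
 BK (p * c) (fun i j => \sum_k \sum_l al i.1 k * w (k, i.2) (l, j.2) * be l j.1).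
Proof.
move=> p0 c0 hal hbe [u hu h]; eexists; first exact: (TK_bimod p0 c0 hal hbe hu).
by move=> i j; eqs k l; rewrite h.
Qed.

Lemma BK_pull c A S S' (h : S' -> option S) (w : A * S -> A * S -> C) :
 pinj h -> BK c w -> BK c (pull h w).
Proof.
move=> ih [u hu hE]; eexists; first exact: (TK_pull ih hu).
move=> p q; rewrite pullE; case: (h p.2) => // s; case: (h q.2) => // t.
Qed.

Lemma BK_dsum c A1 A2 S (w1 : A1 * S -> A1 * S -> C) (w2 : A2 * S -> A2 * S -> C) :
 0 <= c -> BK c w1 -> BK c w2 -> BK c (mxsum w1 w2).
Proof.
move=> c0 [u1 hu1 h1] [u2 hu2 h2]; eexists; first exact: (TK_dsum c0 hu1 hu2).
by move=> [[p|p] s] [[q|q] t] //=; rewrite /mxsum/=.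
Qed.

Lemma BK_G1 c A S (w : A * S -> A * S -> C) : 0 <= c -> BK c w -> G1 c w.
Proof.
move=> c0 [u [X [Y [x [y [a [b [hx hy ha hb uE]]]]]]] hE] B d hd.
have := Spball_schur th01 hx hy hd; set z := spair _ d => hz.
have ea (a' : A -> X * Y -> C) : opsq a' c -> opsq (fun (p : A * B) (q : (X * Y) * B) => (p.2 == q.2)%:R * a' p.1 q.1) c.
 exact: kext_opsq.
have hb' : opsq (fun (q : (X * Y) * B) (p : A * B) => (q.2 == p.2)%:R * b q.1 p.1) c by exact: kext_opsq.
have haz := opsq_comp c0 (ea a ha) hz; rewrite mulr1 in haz.
have := opsq_comp c0 haz hb'; apply: opsq_ext => -[i be] [j be'].
rewrite /kcomp sum_pair.
under eq_bigr do under eq_bigr do rewrite mulrCA.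
under eq_bigr do rewrite sum_deltar sum_pair.
transitivity (\sum_q' \sum_q \sum_s \sum_t a i q * x (q.1, s) (q'.1, t) * y (q.2, s) (q'.2, t) * b q' j * d (be, s) (be', t)).
 eqs q'; sums q.
 under eq_bigr do rewrite -mulrA; rewrite sum_deltal; sums s.
 by rewrite mulr_sumr mulr_suml; apply: eq_bigr => t _ /=; ring.
rewrite exchange_big/=; under eq_bigr do rewrite exchange_big/=.
rewrite exchange_big/=; eqs s.
under eq_bigr do rewrite exchange_big/=.
rewrite exchange_big/=; eqs t.
rewrite hE uE; sums q.
by rewrite mulr_suml.
Qed.

Lemma bimod_tensm (T1 T2 : Type) n k l (a : 'M[C]_(n, k * l)) (x : 'M[T1 -> C]_k) (y : 'M[T2 -> C]_l)
  (b : 'M[C]_(k * l, n)) i j t :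
 bimod a (tensm x y) b i j t =
 \sum_q \sum_q' a i (mxtens_index q) * x q.1 q'.1 t.1 * y q.2 q'.2 t.2 * b (mxtens_index q') j.
Proof.
have bij : {on [pred _ | true], bijective (@mxtens_index k l)}.
 exists (@mxtens_unindex k l) => q _; [exact: mxtens_indexK|exact: mxtens_unindexK].
rewrite mxE mxE (reindex _ bij)/= exchange_big/=.
under [RHS]eq_bigr do rewrite -mulr_suml.
eqs q'; congr (_ * _); rewrite mxE (reindex _ bij)/=; eqs q.
by rewrite !mxE !mxtens_indexK mulrA.
Qed.

(** Room to enlarge all factors of a strict bound at once, so that they become positive and strict
    bounds themselves. *)
Lemma perturb_prod (A B X Y c : R) : 0 <= A -> 0 <= B -> 0 <= X -> 0 <= Y -> A * (X * Y) * B < c ->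
 exists2 d : R, 0 < d & (A + d) * ((X + d) * (Y + d)) * (B + d) <= c.
Proof.
move=> A0 B0 X0 Y0 h.
have step (P Q P' Q' d : R) : 0 <= P -> 0 <= Q -> 0 <= P' -> 0 <= Q' -> 0 <= d -> d <= 1 ->
  (P + d * P') * (Q + d * Q') <= P * Q + d * (P * Q' + P' * Q + P' * Q').
 move=> P0 Q0 P0' Q0' d0 d1.
 have : d * d * (P' * Q') <= d * 1 * (P' * Q') by rewrite ler_wpM2r ?mulr_ge0// ler_wpM2l.
 lra.
pose K1 := X * 1 + 1 * Y + 1 * 1; pose K2 := A * 1 + 1 * B + 1 * 1.
have K10 : 0 <= K1 by rewrite /K1; lra.
have K20 : 0 <= K2 by rewrite /K2; lra.
pose K := X * Y * K2 + K1 * (A * B) + K1 * K2.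
have K0 : 0 <= K by rewrite !addr_ge0 ?mulr_ge0.
have K10' : 0 < K + 1 by lra.
pose d := Num.min 1 ((c - A * (X * Y) * B) / (K + 1)).
have d0 : 0 < d by rewrite lt_min ltr01 divr_gt0// subr_gt0.
have d1 : d <= 1 by rewrite ge_min lexx.
exists d => //; have d0' := ltW d0.
have hXY := step _ _ _ _ _ X0 Y0 ler01 ler01 d0' d1.
have hAB := step _ _ _ _ _ A0 B0 ler01 ler01 d0' d1.
rewrite !mulr1 in hXY hAB.
have e : (A + d) * ((X + d) * (Y + d)) * (B + d) = ((X + d) * (Y + d)) * ((A + d) * (B + d)) by ring.
rewrite e; letr ((X * Y + d * K1) * (A * B + d * K2)).
 by rewrite ler_pM ?mulr_ge0 ?addr_ge0// ?(le_trans hXY)// ?(le_trans hAB)// /K1 /K2 !mulr1.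
apply: le_trans (step _ _ _ _ _ (mulr_ge0 X0 Y0) (mulr_ge0 A0 B0) K10 K20 d0' d1) _.
have : d * K <= c - A * (X * Y) * B.
 letr (d * (K + 1)); first by rewrite ler_wpM2l// lerDl.
 by rewrite -ler_pdivlMr// ge_min lexx orbT.
rewrite /K; lra.
Qed.

(** The projective norm unfolded, with pairs as inner indices, strict bounds on x and y, and a and b
    balanced to a common bound d. *)
Lemma proj_atom (T1 T2 : Type) (N1 : @mnorms R T1) (N2 : @mnorms R T2) n (u : 'M[T1 * T2 -> C]_n) (c : R) :
 (forall k x, 0 <= N1 k x)%E -> (forall k x, 0 <= N2 k x)%E -> (proj_tensor N1 N2 u < c%:E)%E ->
 exists k l (x : 'M[T1 -> C]_k) (y : 'M[T2 -> C]_l) (a : 'I_n -> 'I_k * 'I_l -> C) (b : 'I_k * 'I_l -> 'I_n -> C)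
  (xi eta d : R),
 [/\ 0 < xi, 0 < eta, (N1 k x < xi%:E)%E, (N2 l y < eta%:E)%E & [/\ 0 <= d, opsq a d, opsq b d, xi * eta * d <= c &
  forall i j t, u i j t = \sum_q \sum_q' a i q * x q.1 q'.1 t.1 * y q.2 q'.2 t.2 * b q' j]].
Proof.
move=> N10 N20 /ereal_inf_lt[_ [k [l [a [x [y [b [hx hy uE ->]]]]]]]].
have fin (e : \bar R) : (0 <= e)%E -> (e < +oo)%E -> exists2 r : R, 0 <= r & e = r%:E.
 by case: e => [r| |]// h _; exists r.
have [X X0 xE] := fin _ (N10 _ x) hx; have [Y Y0 yE] := fin _ (N20 _ y) hy.
have [A A0 aE] := mxnorm_fin a; have [B B0 bE] := mxnorm_fin b.
rewrite xE yE aE bE -!EFinM lte_fin => /perturb_prod[]// d d0 hd.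
have A'0 : 0 < A + d by rewrite ltr_wpDl. have B'0 : 0 < B + d by rewrite ltr_wpDl.
have ig : injective (@mxtens_index k l).
 by move=> p q /(congr1 (@mxtens_unindex k l)); rewrite !mxtens_indexK.
have ha : opsq (fun i q => a i (mxtens_index q)) ((A + d) ^+ 2).
 apply: (opsq_inj (g := id) (h := @mxtens_index k l) (sqr_ge0 _) (@inj_id _) ig).
 by apply/(mxnormP _ (ltW A'0)); rewrite aE lee_fin lerDl ltW.
have hb : opsq (fun q j => b (mxtens_index q) j) ((B + d) ^+ 2).
 apply: (opsq_inj (g := @mxtens_index k l) (h := id) (sqr_ge0 _) ig (@inj_id _)).
 by apply/(mxnormP _ (ltW B'0)); rewrite bE lee_fin lerDl ltW.
have [t [w [tw hta htb]]] := opsq_balance A'0 B'0 ha hb.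
exists k, l, x, y, (fun i q => t * a i (mxtens_index q)), (fun q j => w * b (mxtens_index q) j),
 (X + d), (Y + d), ((A + d) * (B + d)).
split; rewrite ?xE ?yE ?lte_fin ?ltrDl ?ltr_wpDl//; split => //; first by pos.
 by apply: le_trans hd; apply: ler_eq; ring.
move=> i j r; rewrite uE bimod_tensm; eqs q q'.
by rewrite -[LHS]mul1r -tw; ring.
Qed.

End TensorAtoms.

(** * Block bounds and convergence of truncations *)

Section RGauge.

(** d > c because atoms describe a norm that is an infimum. *)
Definition RB n (c : R) (x : MI n) := forall J (d : R), c < d -> BK d (blk J x).

(** The companion of [RB]: lifts to the completed tensor product are built from differences of
    truncations. *)
Definition RA n (x : MI n) := forall e : R, 0 < e ->
 exists J0 : {fset I}, forall J : {fset I}, (J0 `<=` J)%fset -> forall J' : {fset I}, BK e (blk J' (x - truncmx J x)).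

Lemma mxfD n (x y : MI n) i j t : (x + y) i j t = x i j t + y i j t.
Proof. by rewrite mxE. Qed.

Lemma mxfB n (x y : MI n) i j t : (x - y) i j t = x i j t - y i j t.
Proof. by rewrite !mxE. Qed.

Lemma truncmxE n J (x : MI n) i j t : truncmx J x i j t = ((t.1 \in J) && (t.2 \in J))%:R * x i j t.
Proof. by rewrite mxE. Qed.

Lemma BK_mask c n J J' (x : MI n) : BK c (blk J' x) -> BK c (blk J' (truncmx J x)).
Proof.
pose h (s : J') := if val s \in J then Some s else None.
have ih : pinj h by move=> s s' t; rewrite /h; case: ifP => // _ [->]; case: ifP => // _ [->].
move=> /(BK_pull ih); apply: BK_ext => p q; rewrite pullE blk_truncmx /h.
case: (val p.2 \in J); case: (val q.2 \in J); rewrite ?(mul0r, mul1r)//; case: p q => [? ?] [].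
Qed.

Lemma BK_sub_blk c n J J' (x : MI n) : (J' `<=` J)%fset -> BK c (blk J x) -> BK c (blk J' x).
Proof.
move=> sub; pose h (s : J') : option J := insub (val s).
have hE s : h s = Some [` fsubsetP sub _ (valP s)]%fset.
 by rewrite /h insubT ?(fsubsetP sub _ (valP s))// => ?; congr Some; apply: val_inj.
have ih : pinj h by move=> s s' t; rewrite !hE => -[<-] -[e]; exact/val_inj/esym.
by move=> /(BK_pull ih); apply: BK_ext => p q; rewrite pullE !hE.
Qed.

(** By [BK_entries] entrywise errors on a finite block cost little, and d - c pays for them. *)
Lemma BK_lim c (A S : finType) (w : A * S -> A * S -> C) (d : R) : 0 <= c -> c < d ->
 (forall e : R, 0 < e -> exists2 v, BK c v & forall p q, normc (v p q - w p q) <= e) -> BK d w.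
Proof.
move=> c0 cd h; pose n : R := #|{: A * S}|%:R; pose K := n * n + 1.
have n0 : 0 <= n by rewrite ler0n.
have K0 : 0 < K by rewrite ltr_wpDl// mulr_ge0.
have dc : 0 < (d - c) / K by rewrite divr_gt0// subr_gt0.
have [v hv vw] := h _ dc.
have hz : BK (d - c) (fun p q => v p q - w p q).
 apply: BK_entries; letr (\sum_(p : A * S) \sum_(q : A * S) ((d - c) / K)).
  by apply: ler_sum => p _; apply: ler_sum => q _.
 under eq_bigr do rewrite sumr_const -mulr_natl -/n.
 rewrite sumr_const -[leLHS]mulr_natl -/n (_ : n * (n * ((d - c) / K)) = (d - c) * (n * n / K)); last by ring.
 by rewrite -[leRHS]mulr1 ler_pM2l ?subr_gt0// ler_pdivrMr// mul1r /K lerDl.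
have dc0 : 0 <= d - c by rewrite subr_ge0 ltW.
have := BK_sub c0 dc0 hv hz; rewrite subrKC; apply: BK_ext => p q; by rewrite subKr.
Qed.

Lemma RB_le n c d (x : MI n) : c <= d -> RB c x -> RB d x.
Proof. by move=> cd h J e de; apply: h; exact: le_lt_trans de. Qed.

Lemma RB_BK n c (x : MI n) : (forall J, BK c (blk J x)) -> RB c x.
Proof. by move=> h J d /ltW cd; apply: BK_le cd (h J). Qed.

Lemma RB_ext n c (x y : MI n) : (forall i j t, x i j t = y i j t) -> RB c x -> RB c y.
Proof. by move=> e h J d cd; apply: BK_ext (h J d cd) => p q; rewrite /blk e. Qed.

Lemma RB_add n c d (x y : MI n) : 0 <= c -> 0 <= d -> RB c x -> RB d y -> RB (c + d) (x + y).
Proof.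
move=> c0 d0 hx hy J e cde; pose h := (e - (c + d)) / 2.
have h0 : 0 < h by rewrite divr_gt0// subr_gt0.
have ch : c < c + h by rewrite ltrDl. have dh : d < d + h by rewrite ltrDl.
have := BK_add (le_trans c0 (ltW ch)) (le_trans d0 (ltW dh)) (hx J _ ch) (hy J _ dh).
have -> : c + h + (d + h) = e by rewrite /h; field.
by apply: BK_ext => p q; rewrite /blk mxE.
Qed.

Lemma RB_scale n c z (x : MI n) : 0 <= c -> RB c x -> RB (normc z * c) (scalemxf z x).
Proof.
move=> c0 hx J d; have [->|z0] := eqVneq z 0.
 rewrite normc0 mul0r => d0; apply: BK_ext (BK_zero _ _ (ltW d0)) => p q.
 by rewrite /blk mxE /scalef mul0r.
have nz : 0 < normc z by rewrite lt_def normc_ge0 normc_eq0 z0.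
move=> h; have cd : c < (normc z)^-1 * d by rewrite mulrC ltr_pdivlMr// mulrC.
have := BK_scale z (le_trans c0 (ltW cd)) (hx J _ cd); rewrite mulrA mulfV ?gt_eqF// mul1r.
by apply: BK_ext => p q; rewrite /blk mxE.
Qed.

Lemma RB_sub n c d (x y : MI n) : 0 <= c -> 0 <= d -> RB c x -> RB d y -> RB (c + d) (x - y).
Proof.
move=> c0 d0 hx /(@RB_scale _ _ (-1) _ d0); rewrite normcNE normc1 mul1r => hy.
by apply: RB_ext (RB_add c0 d0 hx hy) => i j t; rewrite mxfD mxfB mxE /scalef mulN1r.
Qed.

Lemma RB_mask n c J (x : MI n) : RB c x -> RB c (truncmx J x).
Proof. by move=> h J' d cd; apply: BK_mask; exact: h. Qed.

Lemma RB_bimod m n c d (al : 'I_m -> 'I_n -> C) (be : 'I_n -> 'I_m -> C) (x : MI n) (y : MI m) :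
 0 < d -> 0 <= c -> opsq al d -> opsq be d ->
 (forall i j t, y i j t = \sum_k \sum_l al i k * x k l t * be l j) -> RB c x -> RB (d * c) y.
Proof.
move=> d0 c0 hal hbe yE hx J e h.
have ce : c < d^-1 * e by rewrite mulrC ltr_pdivlMr// mulrC.
have := BK_bimod (ltW d0) (le_trans c0 (ltW ce)) hal hbe (hx J _ ce).
rewrite mulrA mulfV ?gt_eqF// mul1r.
by apply: BK_ext => p q; rewrite /blk yE.
Qed.

Lemma RB_lim n c (x : MI n) : 0 <= c ->
 (forall e : R, 0 < e -> forall J, exists2 y : MI n, BK (c + e) (blk J y) &
   forall p q, normc (blk J y p q - blk J x p q) <= e) -> RB c x.
Proof.
move=> c0 h J d cd; pose g := (d - c) / 2.
have g0 : 0 < g by rewrite divr_gt0// subr_gt0.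
apply: (@BK_lim (c + g)); rewrite ?addr_ge0 ?(ltW g0)//; first by rewrite /g; lra.
move=> e e0; pose f := Num.min e g.
have f0 : 0 < f by rewrite lt_min e0 g0.
have [y hy yx] := h _ f0 J; exists (blk J y); first by apply: BK_le hy; rewrite lerD2l ge_min lexx orbT.
by move=> p q; apply: le_trans (yx p q) _; rewrite ge_min lexx.
Qed.

Lemma RB_entry n c (x : MI n) i j t : 0 <= c -> RB c x -> normc (x i j t) <= c.
Proof.
move=> c0 h; apply/ler_addgt0Pr => e e0.
have ce : c < c + e by rewrite ltrDl.
have := h [fset t.1; t.2]%fset _ ce => /(BK_G1 (le_trans c0 (ltW ce))) hG.
have h1 : t.1 \in [fset t.1; t.2]%fset by rewrite !inE eqxx.
have h2 : t.2 \in [fset t.1; t.2]%fset by rewrite !inE eqxx orbT.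
have := g_entry gauge_G1 (i, [` h1]%fset) (j, [` h2]%fset) (le_trans c0 (ltW ce)) hG.
by rewrite /blk/=; case: (t).
Qed.

Lemma RB_S1 n c (x : MI n) : 0 <= c -> RB c x -> (S1 x <= c%:E)%E.
Proof.
move=> c0 h; apply/lee_addgt0Pr => e e0; rewrite -EFinD.
have ce : c < c + e by rewrite ltrDl.
by apply/S1P; [exact: le_trans (ltW ce)|move=> J; apply: BK_G1; [exact: le_trans (ltW ce)|exact: h]].
Qed.

(** Masking does not increase norms, so the truncation error of x is at most that of y plus twice
    the size of x - y. *)
Lemma RA_closed n (x : MI n) :
 (forall e : R, 0 < e -> exists2 y : MI n, RA y & RB e (x - y)) -> RA x.
Proof.
move=> h e e0; have e4 : 0 < e / 4 by rewrite divr_gt0.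
have [y hy hxy] := h _ e4; have [J0 hJ0] := hy _ e4; exists J0 => J sub J'.
have hB := hxy J'; have e2 : e / 4 < e / 4 + e / 16 by rewrite ltrDl divr_gt0.
have h1 := hB _ e2; have h2 := BK_mask J h1; have h3 := hJ0 _ sub J'.
have e20 : 0 <= e / 4 + e / 16 by exact: ltW (lt_trans e4 e2).
have := BK_add (addr_ge0 e20 e20) (ltW e4) (BK_sub e20 e20 h1 h2) h3.
have le : e / 4 + e / 16 + (e / 4 + e / 16) + e / 4 <= e by lra.
move=> /(BK_le le); apply: BK_ext => p q; rewrite /blk !(mxfB, truncmxE); ring.
Qed.

End RGauge.

(** * The quotient norm described by atoms *)

Section Quotient.
Variables (Np Nq : @mnorms R (I * I)).
Hypotheses (Hp : spball_norm th Np) (Hq : spball_norm (1 - th) Nq).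
Local Notation PN := (proj_tensor Np Nq).
Local Notation RN := (quotient_image (fun n => @proj_tensor R _ _ Np Nq n) S1_ psi_).

Lemma ereal_cvg_lt (f : nat -> \bar R) r c : f @ \oo --> r -> (r < c)%E ->
 exists K : nat, forall k, (K <= k)%N -> (f k < c)%E.
Proof.
move=> fr rc; have nb : nbhs r [set y | (y < c)%E].
 by apply: open_nbhs_nbhs; split; [exact: open_ereal_lt_ereal|].
by have [K _ hK] := fr _ nb; exists K => k; exact: hK.
Qed.

Lemma atom_BK (A X Y S : finType) (d : R) x y a b (k m : R) (w : A * S -> A * S -> C) : 0 < k -> 0 < m -> 0 <= d ->
 Spball th (fun p q : X * S => (k^-1)%:C * x p q) -> Spball (1 - th) (fun p q : Y * S => (m^-1)%:C * y p q) ->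
 opsq a d -> opsq b d ->
 (forall p q, w p q = \sum_r \sum_r' a p.1 r * x (r.1, p.2) (r'.1, q.2) * y (r.2, p.2) (r'.2, q.2) * b r' q.1) ->
 BK (k * m * d) w.
Proof.
move=> k0 m0 d0 hx hy ha hb wE.
have h : BK d (fun p q => tatom a (fun p q => (k^-1)%:C * x p q) (fun p q => (m^-1)%:C * y p q) b
  p.1 q.1 p.2 q.2 p.2 q.2)
 by eexists => //; exists X, Y, (fun p q => (k^-1)%:C * x p q), (fun p q => (m^-1)%:C * y p q), a, b.
have := BK_scale (k * m)%:C d0 h; rewrite normc_real ger0_norm ?mulr_ge0 ?(ltW k0) ?(ltW m0)//.
apply: BK_ext => p q; rewrite wE /tatom; sums r r'.
have e : (k * m)%:C * ((k^-1)%:C * (m^-1)%:C) = 1 :> C by rewrite -!rmorphM/= -invfM mulfV// gt_eqF// mulr_gt0.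
by rewrite -[RHS]mul1r -e; ring.
Qed.

Lemma proj_BK n (u : 'M[(I * I) * (I * I) -> C]_n) c J : (PN u < c%:E)%E -> BK c (blk J (map_mx psi_ u)).
Proof.
move=> /proj_atom[]; [exact: (sb_ge0 Hp)|exact: (sb_ge0 Hq)|].
move=> k [l [x [y [a [b [xi [eta [d [xi0 eta0 hx hy [d0 ha hb hc uE]]]]]]]]]].
apply: (BK_le hc); apply: (atom_BK xi0 eta0 d0 (sb_ball Hp J xi0 hx) (sb_ball Hq J eta0 hy) ha hb) => p q.
by rewrite /blk mxE /psi uE.
Qed.

(** Truncating x alone already truncates the Schur product, so [sb_approx] is applied to one factor;
    eta and d bound the others. *)
Lemma proj_RA n (u : 'M[(I * I) * (I * I) -> C]_n) : (PN u < +oo)%E -> RA (map_mx psi_ u).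
Proof.
move=> fu; have [c hc] : exists c : R, (PN u < c%:E)%E.
 move: fu; case: (PN u) => [r| |]// _; last by exists 0; rewrite ltNyr.
 by exists (r + 1); rewrite lte_fin ltrDl.
move: hc => /proj_atom[]; [exact: (sb_ge0 Hp)|exact: (sb_ge0 Hq)|].
move=> k [l [x [y [a [b [xi [eta [d [xi0 eta0 hx hy [d0 ha hb hc uE]]]]]]]]]] e e0.
have K0 : 0 < eta * d + 1 by rewrite ltr_wpDl// mulr_ge0// ltW.
have f0 : 0 < e / (eta * d + 1) by rewrite divr_gt0.
have [J0 hJ0] := sb_approx Hp (lt_trans hx (ltry _)) f0; exists J0 => J sub J'.
have le : e / (eta * d + 1) * eta * d <= e.
 by rewrite -mulrA mulrAC ler_pdivrMr// ler_pM2l// lerDl.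
apply: (BK_le le); apply: (atom_BK f0 eta0 d0 (hJ0 J sub J') (sb_ball Hq J' eta0 hy) ha hb) => p q.
rewrite /blk mxfB truncmxE !mxE /psi/= uE.
case E : (_ && _); last first.
 by rewrite mul0r subr0; eqs r r'; rewrite mxfB truncmxE E mul0r subr0.
rewrite mul1r subrr big1// => r _; rewrite big1// => r' _.
by rewrite mxfB truncmxE E mul1r subrr mulr0 !mul0r.
Qed.

Lemma S1_entry n (x : MI n) (e : R) i j t : 0 <= e -> (S1 x <= e%:E)%E -> normc (x i j t) <= e.
Proof.
move=> e0 /(S1P x e0)/(_ [fset t.1; t.2]%fset) hG.
have h1 : t.1 \in [fset t.1; t.2]%fset by rewrite !inE eqxx.
have h2 : t.2 \in [fset t.1; t.2]%fset by rewrite !inE eqxx orbT.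
have := g_entry gauge_G1 (i, [` h1]%fset) (j, [` h2]%fset) e0 hG.
by rewrite /blk/=; case: (t).
Qed.

Lemma proj_ge0 n (u : 'M[(I * I) * (I * I) -> C]_n) : (0 <= PN u)%E.
Proof.
apply: le_ereal_inf_tmp => _ [k [l [a [x [y [b [_ _ _ ->]]]]]]].
by rewrite !mule_ge0 ?opnorm_ge0 ?(sb_ge0 Hp) ?(sb_ge0 Hq).
Qed.

Lemma rpcb_ge0 n (A : MI n) : (0 <= RN A)%E.
Proof.
apply: le_ereal_inf_tmp => r [u [_ _ ru]].
by apply: cvge_ge ru; apply: nearW => k; exact: proj_ge0.
Qed.

(** Convergence in S_1 is entrywise, so the block bounds of the representing tensors pass to A; the
    room that [BK_lim] asks for is made by c', strictly between their limit norm and c.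
    Approximability passes to A by [RA_closed]. *)
Lemma rpcb_RC n (A : MI n) c : (RN A < c%:E)%E -> (forall J, BK c (blk J A)) /\ RA A.
Proof.
move=> /ereal_inf_lt[r [u [[fu cu] uA ru]] rc].
have [c' c'0 [rc' c'c]] : exists2 c' : R, 0 <= c' & (r < c'%:E)%E /\ c' < c.
 have r0 : (0 <= r)%E by apply: cvge_ge ru; apply: nearW => k; exact: proj_ge0.
 move: r0 rc; case: (r) => [s| |]//; rewrite lee_fin lte_fin => s0 sc.
 by exists ((s + c) / 2); rewrite ?lte_fin; lra.
have S10 k : (0 <= S1 (map_mx psi_ (u k) - A)%R)%E by exact: (ng_ge0 norm_gauge_S1).
have cvA := (ereal_cvg0 S10).1 uA.
have small (e : R) K : 0 < e -> exists2 k, (K <= k)%N & forall i j t, normc ((map_mx psi_ (u k)) i j t - A i j t) <= e.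
 move=> e0; have [N hN] := cvA e e0; exists (maxn K N); first exact: leq_maxl.
 by move=> i j t; have := S1_entry i j t (ltW e0) (hN _ (leq_maxr K N)); rewrite !mxE.
split.
 move=> J; have [K hK] := ereal_cvg_lt ru rc'.
 apply: (@BK_lim c') => // e e0; have [k Kk hk] := small e K e0.
 by exists (blk J (map_mx psi_ (u k))); [exact: proj_BK (hK k Kk)|move=> p q; exact: hk].
apply: RA_closed => e e0; have [K hK] := cu e e0.
exists (map_mx psi_ (u K)); first by apply: proj_RA; exact: fu.
apply: (RB_lim (ltW e0)) => d d0 J; have [k Kk hk] := small d K d0.
exists (map_mx psi_ (u k) - map_mx psi_ (u K)).
 apply: (@BK_le e); first by rewrite lerDl ltW.
 have := proj_BK J (hK k K Kk (leqnn _)).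
 by apply: BK_ext => p q; rewrite /blk mxfB !mxE.
by move=> p q; rewrite !blkB opprB addrA subrK; exact: hk.
Qed.

Definition TJ n J (c : R) (u : 'M[(I * I) * (I * I) -> C]_n) :=
 (forall i j r, ~~ [&& r.1.1 \in J, r.1.2 \in J, r.2.1 \in J & r.2.2 \in J] -> u i j r = 0) /\
 TK c (fun i j (s t s' t' : J) => u i j ((val s, val t), (val s', val t'))).

Lemma TJ_widen n J J' c (u : 'M[(I * I) * (I * I) -> C]_n) : (J `<=` J')%fset -> TJ J c u -> TJ J' c u.
Proof.
move=> /fsubsetP sub [u0 hu]; split.
 move=> i j r nr; apply: u0; apply: contra nr => /and4P[h1 h2 h3 h4].
 by rewrite !sub.
pose h (s : J') : option J := insub (val s).
have ih : pinj h.
 move=> s s' t; rewrite /h; case: insubP => // v _ us [<-]; case: insubP => // u' _ us' [uu].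
 by apply: val_inj; rewrite -us -us' uu.
have := TK_pull ih hu; congr (TK c _).
ext i j; ext s t; ext s' t'.
rewrite /h.
case: insubP => [v _ <-|n1]; last by rewrite u0//= (negbTE n1).
case: insubP => [v' _ <-|n1]; last by rewrite u0//= (negbTE n1) ?andbF.
case: insubP => [v1 _ <-|n1]; last by rewrite u0//= (negbTE n1) ?andbF.
by case: insubP => [v2 _ <-|n1]; last by rewrite u0//= (negbTE n1) ?andbF.
Qed.

Lemma TJ_le n J c d (u : 'M[(I * I) * (I * I) -> C]_n) : c <= d -> TJ J c u -> TJ J d u.
Proof. by move=> cd [u0 hu]; split => //; exact: TK_le hu. Qed.

Lemma TJ_zero n J (c : R) : 0 <= c -> TJ J c (0 : 'M[(I * I) * (I * I) -> C]_n).
Proof.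
move=> c0; split; first by move=> i j r _; rewrite mxE.
have := TK_zero 'I_n J c0; congr (TK c _).
by do 6![apply/funext => ?]; rewrite mxE.
Qed.

Lemma TJ_add n J c d (u v : 'M[(I * I) * (I * I) -> C]_n) : 0 <= c -> 0 <= d ->
 TJ J c u -> TJ J d v -> TJ J (c + d) (u + v).
Proof.
move=> c0 d0 [u0 hu] [v0 hv]; split.
 by move=> i j r nr; have := u0 i j r nr; have := v0 i j r nr; rewrite mxE => h h'; rewrite -[RHS](addr0 0) -{1}h' -h.
have := TK_add c0 d0 hu hv; congr (TK _ _).
by do 6![apply/funext => ?]; rewrite mxE.
Qed.

Lemma TJ_scale n J c z (u : 'M[(I * I) * (I * I) -> C]_n) : 0 <= c ->
 TJ J c u -> TJ J (normc z * c) (scalemxf z u).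
Proof.
move=> c0 [u0 hu]; split; first by move=> i j r nr; rewrite mxE /scalef u0// mulr0.
have := TK_scale z c0 hu; congr (TK _ _).
by do 6![apply/funext => ?]; rewrite mxE.
Qed.

(** x and y are extended by zero to matrices over I, where [sb_fin] bounds their norms by 1. *)
Lemma TJ_proj n J c (u : 'M[(I * I) * (I * I) -> C]_n) : 0 <= c -> TJ J c u -> (PN u <= c%:E)%E.
Proof.
move=> c0 [u0 [X [Y [x [y [a [b [hx hy ha hb uE]]]]]]]].
pose xm : 'M[I * I -> C]_#|X| := zmx (fun p q => x (enum_val p.1, p.2) (enum_val q.1, q.2)).
pose ym : 'M[I * I -> C]_#|Y| := zmx (fun p q => y (enum_val p.1, p.2) (enum_val q.1, q.2)).
pose am : 'M[C]_(n, #|X| * #|Y|) := \matrix_(i, q) a i (enum_val (unidx q).1, enum_val (unidx q).2).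
pose bm : 'M[C]_(#|X| * #|Y|, n) := \matrix_(q, j) b (enum_val (unidx q).1, enum_val (unidx q).2) j.
have Nx : (Np xm <= 1%:E)%E.
 apply: (sb_fin Hp ltr01 (zmx_supp _)); rewrite zmxE.
 have := Spball_reindex (@enum_val_inj X X) hx.
 by congr Spball; ext p q; rewrite invr1 mul1r.
have Ny : (Nq ym <= 1%:E)%E.
 apply: (sb_fin Hq ltr01 (zmx_supp _)); rewrite zmxE.
 have := Spball_reindex (@enum_val_inj Y Y) hy.
 by congr Spball; ext p q; rewrite invr1 mul1r.
pose g (q : 'I_(#|X| * #|Y|)) := (enum_val (unidx q).1, enum_val (unidx q).2) : X * Y.
have ig : injective g.
 move=> q q' [/enum_val_inj e1 /enum_val_inj e2]; rewrite -(mxtens_unindexK q) -(mxtens_unindexK q').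
 have e1' : (unidx q).1 = (unidx q').1 := e1.
 have e2' : (unidx q).2 = (unidx q').2 := e2.
 by rewrite [unidx q]surjective_pairing e1' e2' -surjective_pairing.
have Na : (mxnorm am <= (Num.sqrt c)%:E)%E.
 apply/mxnormP; first exact: sqrtr_ge0.
 rewrite sqr_sqrtr//; apply: opsq_ext (opsq_inj (h := g) c0 (@inj_id _) ig ha) => i q; by rewrite mxE.
have Nb : (mxnorm bm <= (Num.sqrt c)%:E)%E.
 apply/mxnormP; first exact: sqrtr_ge0.
 rewrite sqr_sqrtr//; apply: opsq_ext (opsq_inj (g := g) c0 ig (@inj_id _) hb) => i q; by rewrite mxE.
letr (mxnorm am * (Np xm * Nq ym) * mxnorm bm)%E.
 apply: ereal_inf_lbound; exists #|X|, #|Y|, am, xm, ym, bm; split => //.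
 - exact: le_lt_trans Nx (ltry _).
 - exact: le_lt_trans Ny (ltry _).
 apply/matrixP => i j; apply/funext => -[[r1 r2] [r3 r4]]; rewrite bimod_tensm.
 have [/and4P[h1 h2 h3 h4]|nr] := boolP [&& r1 \in J, r2 \in J, r3 \in J & r4 \in J]; last first.
  rewrite u0// big1// => q _; rewrite big1// => q' _.
  have [hr|hr] := boolP ((r1 \in J) && (r2 \in J)).
   rewrite [ym _ _ _](zmx_supp _) ?mulr0 ?mul0r//; apply: contra nr => hr'.
   by case/andP: hr => -> ->.
  by rewrite [xm _ _ _](zmx_supp _) ?mulr0 ?mul0r.
 have -> := congr1 (fun f => f i j [` h1]%fset [` h2]%fset [` h3]%fset [` h4]%fset) uE.
 have bij : {on [pred _ | true], bijective (fun q : 'I_#|X| * 'I_#|Y| => (enum_val q.1, enum_val q.2) : X * Y)}.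
  exists (fun q : X * Y => (enum_rank q.1, enum_rank q.2)) => -[q1 q2] _ /=; by rewrite ?enum_valK ?enum_rankK.
 rewrite /tatom (reindex _ bij)/=; eqs q.
 rewrite (reindex _ bij)/=; eqs q'.
 rewrite !mxE !mxtens_indexK; congr (_ * _ * _ * _).
  exact: (esym (zext2E _ [` h1]%fset [` h2]%fset)).
 exact: (esym (zext2E _ [` h3]%fset [` h4]%fset)).
letr ((Num.sqrt c)%:E * (1%:E * 1%:E) * (Num.sqrt c)%:E)%E.
 by rewrite !lee_pmul ?mule_ge0 ?opnorm_ge0 ?(sb_ge0 Hp) ?(sb_ge0 Hq).
by rewrite -!EFinM !mulr1 -expr2 sqr_sqrtr.
Qed.

Lemma BK_lift n J c (x : MI n) : fsuppM J x -> BK c (blk J x) ->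
 exists2 u, TJ J c u & map_mx psi_ u = x.
Proof.
move=> sx [u hu hE].
pose U : 'M[(I * I) * (I * I) -> C]_n := \matrix_(i, j) (fun r =>
 if insub r.1.1 is Some s then if insub r.1.2 is Some t then
 if insub r.2.1 is Some s' then if insub r.2.2 is Some t' then u i j s t s' t' else 0 else 0 else 0 else 0).
exists U; first split.
- move=> i j r nr; rewrite mxE; case: insubP => // s hs _; case: insubP => // t ht _.
 case: insubP => // s' hs' _; case: insubP => // t' ht' _.
 by move: nr; rewrite hs ht hs' ht'.
- move: hu; congr (TK c _).
 by do 6![apply/funext => ?]; rewrite mxE !valK.
apply/matrixP => i j; rewrite !mxE; apply/funext => -[s t]; rewrite /psi/=.
case: insubP => [s0 _ <-|n1]; last by rewrite sx//= (negbTE n1).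
case: insubP => [t0 _ <-|n1]; last by rewrite sx//= (negbTE n1) ?andbF.
by rewrite -(hE (i, s0) (j, t0)).
Qed.

(** The representing sequence consists of the partial sums of a series: the first truncation of A
    and the differences of successive truncations are lifted one by one, the differences with norms
    of order e / 2^k. *)
Lemma RC_rpcb n (A : MI n) c : 0 <= c -> RB c A -> RA A -> (RN A <= c%:E)%E.
Proof.
move=> c0 hB hA; apply/lee_addgt0Pr => e1 e10; rewrite -EFinD.
(* The first lift costs c + e and the series of differences 2 e, together c + e1. *)
pose e := e1 / 3; have e0 : 0 < e by rewrite divr_gt0.
pose ek k : R := e / 2 ^+ k; have ek0 k : 0 < ek k by rewrite divr_gt0// exprn_gt0.
have ek2 k : ek k = 2 * ek k.+1 by rewrite /ek exprS; field; rewrite gt_eqF// exprn_gt0.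
have /choice[P hP] (k : nat) := hA _ (ek0 k).
pose Js := fix Js k : {fset I} := if k is k'.+1 then (Js k' `|` P k)%fset else P 0%N.
have PJ k : (P k `<=` Js k)%fset by case: k => [|k] /=; [exact: fsubset_refl|exact: fsubsetUr].
have JS k : (Js k `<=` Js k.+1)%fset by exact: fsubsetUl.
pose d k : MI n := if k is k'.+1 then truncmx (Js k) A - truncmx (Js k') A else truncmx (Js 0%N) A.
pose ck k := if k is k'.+1 then ek k' else c + e.
have ck0 k : 0 <= ck k by case: k => [|k] /=; [rewrite addr_ge0// ltW|exact: ltW].
have /choice[t ht] (k : nat) : exists t, TJ (Js k) (ck k) t /\ map_mx psi_ t = d k.
 suff [t h1 h2] : exists2 t, TJ (Js k) (ck k) t & map_mx psi_ t = d k by exists t.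
 case: k => [|k].
  apply: BK_lift; first exact: truncmx_supp.
  by apply: BK_mask; apply: hB; rewrite ltrDl.
 apply: BK_lift.
  move=> i j r nr; rewrite /d mxfB (truncmx_supp _ _ _ nr) truncmx_supp ?subr0//.
  by apply: contra nr => /andP[h1 h2]; rewrite !(fsubsetP (JS k)).
 have := BK_mask (Js k.+1) (hP k _ (PJ k) (Js k.+1)); apply: BK_ext => p q.
 rewrite /blk /d !(mxfB, truncmxE)/= mulrBr mulrA; congr (_ - _ * _).
 rewrite -natrM mulnb; congr (_%:R); congr nat_of_bool.
 apply/andP/idP => [[]//|h]; split => //; case/andP: h => h1 h2.
 by rewrite !(fsubsetP (JS k)).
pose u k := \sum_(i < k.+1) t i.
have udiff k m : TJ (Js (k + m)%N) (2 * ek k - 2 * ek (k + m)%N) (u (k + m)%N - u k).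
 elim: m => [|m ih]; first by rewrite addn0 !subrr; exact: TJ_zero.
 have -> : u (k + m.+1)%N - u k = (u (k + m)%N - u k) + t (k + m).+1.
  by rewrite addnS {1}/u big_ord_recr/= -/(u _) addrAC.
 have -> : 2 * ek k - 2 * ek (k + m.+1)%N = (2 * ek k - 2 * ek (k + m)%N) + ek (k + m)%N.
  by rewrite addnS [ek (k + m)%N]ek2; ring.
 have le k' m' : 2 * ek (k' + m')%N <= 2 * ek k'.
  elim: m' => [|m' im]; first by rewrite addn0.
  by apply: le_trans im; rewrite addnS [X in _ <= _ * X]ek2; have := ek0 (k' + m').+1; lra.
 rewrite addnS; apply: TJ_add; [by rewrite subr_ge0|exact: ltW|by apply: TJ_widen ih|].
 exact: (ht (k + m).+1).1.
have ud k m : (PN (u (k + m)%N - u k)%R <= (2 * ek k)%:E)%E.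
 apply: (@TJ_proj _ (Js (k + m)%N)); first by rewrite mulr_ge0// ltW.
 by apply: TJ_le (udiff k m); rewrite gerBl mulr_ge0// ltW.
have ud' k m : (PN (u k - u (k + m)%N)%R <= (2 * ek k)%:E)%E.
 apply: (@TJ_proj _ (Js (k + m)%N)); first by rewrite mulr_ge0// ltW.
 have -> : u k - u (k + m)%N = scalemxf (-1) (u (k + m)%N - u k).
  by apply/matrixP => i j; rewrite !mxE; ext r; rewrite /scalef mulN1r; apply/esym; exact: opprB.
 have h0 : 0 <= 2 * ek k by rewrite mulr_ge0// ltW.
 have := TJ_scale (-1) h0 (TJ_le _ (udiff k m)); rewrite normcNE normc1 mul1r; apply.
 by rewrite gerBl mulr_ge0// ltW.
have uM k : (PN (u k) <= (c + e1)%:E)%E.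
 apply: (@TJ_proj _ (Js k)); first by rewrite addr_ge0// ltW.
 have -> : u k = (u k - u 0%N) + t 0%N by rewrite {3}/u big_ord1 subrK.
 have h1 := udiff 0%N k; rewrite add0n in h1.
 have h2 : TJ (Js k) (c + e) (t 0%N).
  have sub : (Js 0%N `<=` Js k)%fset by elim: (k) => [|k' ih]; [exact: fsubset_refl|exact: fsubset_trans ih (JS k')].
  exact: TJ_widen sub (ht 0%N).1.
 have h3 : 2 * ek 0%N - 2 * ek k <= 2 * e.
  by rewrite /ek expr0 divr1 gerBl mulr_ge0// ltW//; exact: ek0.
 have := TJ_add _ _ (TJ_le h3 h1) h2.
 have -> : 2 * e + (c + e) = c + e1 by rewrite /e; field.
 by apply; [rewrite mulr_ge0// ltW|rewrite addr_ge0// ltW].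
have psiu k : map_mx psi_ (u k) = truncmx (Js k) A.
 elim: k => [|k ih]; first by rewrite /u big_ord1; exact: (ht 0%N).2.
 have -> : u k.+1 = u k + t k.+1 by rewrite {1}/u big_ord_recr.
 have -> : map_mx psi_ (u k + t k.+1) = map_mx psi_ (u k) + map_mx psi_ (t k.+1).
  by apply/matrixP => i j; rewrite !mxE.
 by rewrite ih (ht k.+1).2 /d addrC subrK.
have ekle K k : (K <= k)%N -> ek k <= ek K.
 move=> Kk; rewrite /ek ler_pM2l// lef_pV2 ?posrE ?exprn_gt0//.
 by rewrite ler_weXn2l// ler1n.
have eks (f : R) : 0 < f -> exists K, 2 * ek K < f.
 move=> f0; have [K hK] := bernoulli_unbounded (2 * e / f) (ltr1n R 2); exists K.
 by rewrite /ek mulrA ltr_pdivrMr ?exprn_gt0// [X in _ < X]mulrC -ltr_pdivrMr.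
pose g k := fine (PN (u k)).
have gE k : PN (u k) = (g k)%:E.
 rewrite fineK// ge0_fin_numE ?proj_ge0//; exact: le_lt_trans (uM k) (ltry _).
have gM k : 0 <= g k <= c + e1.
 by have := proj_ge0 (u k); have := uM k; rewrite gE !lee_fin => -> ->.
(* The norms must converge along a representing sequence. Compactness of [0, c + e1] gives a cluster
   value, realized below by the subsequence [s]. *)
have [l [lM hl]] : exists l, 0 <= l <= c + e1 /\ forall f K, 0 < f -> exists2 k, (K <= k)%N & `|g k - l| <= f.
 have := @segment_compact R 0 (c + e1).
 move=> /(_ (g @ \oo) _)[|l [/=]]; first by exists 0%N => // k _; rewrite /= in_itv/=; exact: gM.
 rewrite in_itv/= => lM hl; exists l; split => // f K f0.
 have nb : nbhs l [set z | `|z - l| <= f].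
  by apply/nbhs_ballP; exists f => //= z; rewrite /ball/= distrC => /ltW.
 have gK : (g @ \oo) [set z | exists2 k, (K <= k)%N & z = g k] by exists K => // k Kk; exists k.
 by have [z [[k Kk ->] /= h]] := hl _ _ gK nb; exists k.
have hx (m K : nat) : exists2 k, (K <= k)%N & `|g k - l| <= m.+1%:R^-1.
 by apply: hl; rewrite invr_gt0.
have [s [smono sP]] := extract hx.
have sge k : (k <= s k)%N by elim: k => // k ih; apply: leq_ltn_trans ih (smono _ _ (ltnSn k)).
letr l%:E; last by rewrite lee_fin; case/andP: lM.
apply: ereal_inf_lbound; exists (u \o s); split.
- split; first by move=> k; apply: le_lt_trans (uM _) (ltry _).
 move=> f f0; have [K hK] := eks f f0; exists K => k m Kk Km /=.
 have key a b : (K <= a)%N -> (a <= b)%N -> (PN (u a - u b)%R < f%:E)%E /\ (PN (u b - u a)%R < f%:E)%E.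
  move=> Ka ab; have ha : 2 * ek a < f by apply: le_lt_trans hK; rewrite ler_pM2l// ekle.
  by rewrite -(subnKC ab); split; [apply: le_lt_trans (ud' _ _) _|apply: le_lt_trans (ud _ _) _]; rewrite lte_fin.
 have [/ltnW mk|km] := ltnP m k.
  have sm : (s m <= s k)%N by move: mk; rewrite leq_eqVlt => /predU1P[->//|/smono/ltnW].
  exact: (key _ _ (leq_trans Km (sge m)) sm).2.
 have sm : (s k <= s m)%N by move: km; rewrite leq_eqVlt => /predU1P[->//|/smono/ltnW].
 exact: (key _ _ (leq_trans Kk (sge k)) sm).1.
- apply/ereal_cvg0; first by move=> k; exact: (ng_ge0 norm_gauge_S1).
 move=> f f0; have [K hK] := eks f f0; exists K => k Kk /=.
 have sub : (P K `<=` Js (s k))%fset.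
  apply: fsubset_trans (PJ K) _.
  rewrite -(subnKC (leq_trans Kk (sge k))); elim: (_ - _)%N => [|m ih]; first by rewrite addn0 fsubset_refl.
  by rewrite addnS; exact: fsubset_trans ih (JS _).
 have h1 : RB (ek K) (A - truncmx (Js (s k)) A) by apply: RB_BK => J; exact: (hP K _ sub).
 have h2 := @RB_scale _ _ (-1) _ (ltW (ek0 K)) h1.
 letr (ek K)%:E; last by rewrite lee_fin; have := ek0 K; lra.
 apply: (RB_S1 (ltW (ek0 K))); move: h2; rewrite normcNE normc1 mul1r; apply: RB_ext => i j t0.
 by rewrite psiu mxE /scalef mxfB mxfB mulN1r opprB.
have -> : (fun k => PN ((u \o s) k)) = EFin \o (g \o s) by ext k; exact: gE.
apply: cvg_EFin; first by apply: nearW.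
apply/cvgrPdist_le => f f0.
have [N hN] := inv_small f0; exists N => // k Nk /=; rewrite distrC; apply: le_trans (sP k) _.
exact: hN Nk.
Qed.

End Quotient.

(** * Operator space structure and matrix product *)

Section RCAlgebra.

Lemma scalemxfE n z (x : MI n) i j t : scalemxf z x i j t = z * x i j t.
Proof. by rewrite mxE. Qed.

Lemma truncmx_id n J (x : MI n) : fsuppM J x -> truncmx J x = x.
Proof.
move=> sx; apply/matrixP => i j; ext t; rewrite truncmxE.
by have [h|h] := boolP (_ && _); rewrite ?mul1r// sx ?mulr0.
Qed.

Lemma RB_zero n (c : R) : 0 <= c -> RB c (0 : MI n).
Proof.
move=> c0 J d cd; apply: BK_ext (BK_zero _ _ (le_trans c0 (ltW cd))) => p q.
by rewrite /blk mxE.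
Qed.

Lemma fsuppM_widen n J J' (x : MI n) : (J `<=` J')%fset -> fsuppM J x -> fsuppM J' x.
Proof.
by move=> /fsubsetP sub sx i j t nt; apply: sx; apply: contra nt => /andP[h1 h2]; rewrite !sub.
Qed.

Lemma RA_fsupp n J (x : MI n) : fsuppM J x -> RA x.
Proof.
move=> sx e e0; exists J => J1 sub J'; rewrite truncmx_id; last exact: fsuppM_widen sx.
by apply: BK_ext (BK_zero _ _ (ltW e0)) => p q; rewrite blkB subrr.
Qed.

Lemma RA_elim n (x : MI n) : RA x -> forall e : R, 0 < e -> exists J, RB e (x - truncmx J x).
Proof. by move=> h e e0; have [J hJ] := h e e0; exists J; apply: RB_BK; exact: hJ. Qed.

Lemma RA_intro n (x : MI n) :
 (forall e : R, 0 < e -> exists y : MI n, (exists J, fsuppM J y) /\ RB e (x - y)) -> RA x.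
Proof.
by move=> h; apply: RA_closed => e /h[y [[J sy] hy]]; exists y => //; exact: RA_fsupp sy.
Qed.

Lemma RA_add n (x y : MI n) : RA x -> RA y -> RA (x + y).
Proof.
move=> hx hy; apply: RA_intro => e e0; have e2 : 0 < e / 2 by pos.
have [J hJ] := RA_elim hx e2; have [J' hJ'] := RA_elim hy e2.
exists (truncmx J x + truncmx J' y); split.
 exists (J `|` J')%fset => i j t nt; rewrite mxfD.
 by rewrite (fsuppM_widen (fsubsetUl J J') (@truncmx_supp _ _ _) _ _ nt) (fsuppM_widen (fsubsetUr J J') (@truncmx_supp _ _ _) _ _ nt) addr0.
have := RB_add (ltW e2) (ltW e2) hJ hJ'; rewrite -splitr; apply: RB_ext => i j t.
rewrite !(mxfB, mxfD); ring.
Qed.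

Lemma RA_bimod m n (d : R) (al : 'I_m -> 'I_n -> C) (be : 'I_n -> 'I_m -> C) (x : MI n) (y : MI m) :
 0 < d -> opsq al d -> opsq be d ->
 (forall i j t, y i j t = \sum_k \sum_l al i k * x k l t * be l j) -> RA x -> RA y.
Proof.
move=> d0 hal hbe yE hx; apply: RA_intro => e e0.
have ed : 0 < e / d by pos.
have [J hJ] := RA_elim hx ed; exists (truncmx J y); split; first by exists J; exact: truncmx_supp.
have := RB_bimod (y := y - truncmx J y) d0 (ltW ed) hal hbe _ hJ.
rewrite mulrC divfK ?gt_eqF//; apply => i j t; rewrite mxfB truncmxE !yE mulr_sumr -sumrB; eqs k.
by rewrite mulr_sumr -sumrB; eqs l; rewrite mxfB truncmxE; ring.
Qed.

Lemma RA_scale n z (x : MI n) : RA x -> RA (scalemxf z x).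
Proof.
move=> hx; apply: RA_intro => e e0.
have nz : 0 < normc z + 1 by pos.
have ed : 0 < e / (normc z + 1) by pos.
have [J hJ] := RA_elim hx ed; exists (truncmx J (scalemxf z x)); split; first by exists J; exact: truncmx_supp.
have := @RB_scale n _ z _ (ltW ed) hJ => h; apply: RB_le (RB_ext _ h).
 by rewrite mulrCA ger_pMr// ler_pdivrMr// mul1r lerDl.
by move=> i j t; rewrite !(mxfB, truncmxE, scalemxfE); ring.
Qed.

Lemma RA_sub n (x y : MI n) : RA x -> RA y -> RA (x - y).
Proof.
move=> hx /(RA_scale (-1)) hy; have := RA_add hx hy; congr RA.
by apply/matrixP => i j; rewrite !mxE; congr (_ + _); exact: mulN1r.
Qed.

Lemma RB_block m n (c : R) (x : MI m) (y : MI n) : 0 <= c -> RB c x -> RB c y ->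
 RB c (block_mx x 0 0 y).
Proof.
move=> c0 hx hy J d cd; have d0 := le_trans c0 (ltW cd).
have hal : opsq (fun (i : 'I_(m + n)) (k : 'I_m + 'I_n) => (fintype.split i == k)%:R : C) 1.
 have isp : injective (@fintype.split m n) by move=> i j /(congr1 unsplit); rewrite !splitK.
 exact: (opsq_inj (g := @fintype.split m n) ler01 isp (@inj_id _) (@opsq_id _)).
have hbe : opsq (fun (k : 'I_m + 'I_n) (i : 'I_(m + n)) => (fintype.split i == k)%:R : C) 1 by exact: opsq_tr.
have := BK_bimod ler01 d0 hal hbe (BK_dsum d0 (hx J d cd) (hy J d cd)); rewrite mul1r.
apply: BK_ext => p q; under eq_bigr do under eq_bigr do rewrite -mulrA.
under eq_bigr do rewrite -mulr_sumr; rewrite sum_deltal.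
under eq_bigr do rewrite mulrC; rewrite sum_deltal /blk.
case: p q => p s [q t] /=; rewrite mxE.
case: (fintype.split p) => p'; rewrite mxE; case: (fintype.split q) => q' //=; by rewrite mxE.
Qed.

Lemma RA_block m n (x : MI m) (y : MI n) : RA x -> RA y -> RA (block_mx x 0 0 y).
Proof.
move=> hx hy; apply: RA_intro => e e0.
have [J hJ] := RA_elim hx e0; have [J' hJ'] := RA_elim hy e0.
exists (block_mx (truncmx J x) 0 0 (truncmx J' y)); split.
 exists (J `|` J')%fset => i j t nt; rewrite mxE; case: (fintype.split i) => i'; rewrite mxE; case: (fintype.split j) => j'.
 - exact: (fsuppM_widen (fsubsetUl J J') (@truncmx_supp _ _ _) _ _ nt).
 - by rewrite mxE.
 - by rewrite mxE.
 - exact: (fsuppM_widen (fsubsetUr J J') (@truncmx_supp _ _ _) _ _ nt).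
have := RB_block (ltW e0) hJ hJ'.
by rewrite opp_block_mx add_block_mx !oppr0 !addr0.
Qed.

(** The norms whose balls are given by [RB] and [RA]; the algebra structure is derived from this
    description alone. *)
Record rc_norm (N : @mnorms R (I * I)) : Prop := RcNorm {
 rn_ge0 : forall n (x : MI n), (0 <= N n x)%E;
 rn_RC : forall n (x : MI n) c, (N n x < c%:E)%E -> (forall J, BK c (blk J x)) /\ RA x;
 rn_fin : forall n (x : MI n) c, 0 <= c -> RB c x -> RA x -> (N n x <= c%:E)%E }.

Variable N : @mnorms R (I * I).
Hypothesis HN : rc_norm N.
Implicit Types n m : nat.

Lemma rn_le n (x : MI n) c : (N x <= c%:E)%E -> RB c x /\ RA x.
Proof.
move=> h; have h' d : c < d -> (N x < d%:E)%E by move=> cd; apply: le_lt_trans h _.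
split; first by move=> J d /h'/(rn_RC HN)[].
by have [|_] := rn_RC HN (h' (c + 1) _); rewrite ?ltrDl.
Qed.

Lemma rn_finite n (x : MI n) : (N x < +oo)%E -> exists2 c : R, 0 <= c & N x = c%:E.
Proof. by have := rn_ge0 HN x; case: (N x) => [c| |]//; exists c. Qed.

Lemma rn_finP n (x : MI n) : (N x < +oo)%E -> exists c : R, [/\ 0 <= c, N x = c%:E, RB c x & RA x].
Proof.
by move=> /rn_finite[c c0 e]; exists c; have [|h1 h2] := @rn_le n x c; rewrite ?e.
Qed.

Lemma rn_triangle n (x y : MI n) : (N (x + y)%R <= N x + N y)%E.
Proof.
have [fx|] := ltP (N x) +oo%E; last by rewrite leye_eq => /eqP->; rewrite addye ?leey// gt_eqF// (lt_le_trans _ (rn_ge0 HN y)).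
have [fy|] := ltP (N y) +oo%E; last by rewrite leye_eq => /eqP->; rewrite addey ?leey// gt_eqF// (lt_le_trans _ (rn_ge0 HN x)).
have [c [c0 -> hB hA]] := rn_finP fx; have [d [d0 -> hB' hA']] := rn_finP fy.
apply: (rn_fin HN); [pos|exact: RB_add|exact: RA_add].
Qed.

Lemma rn_scale_le n z (x : MI n) : (N x < +oo)%E -> (N (scalemxf z x) <= (normc z)%:E * N x)%E.
Proof.
move=> /rn_finP[c [c0 -> hB hA]]; apply: (rn_fin HN); first by pos.
 exact: RB_scale.
exact: RA_scale.
Qed.

Lemma rn_zero n : N (0 : MI n) = 0%E.
Proof.
apply/eqP; rewrite eq_le (rn_ge0 HN) andbT; apply: (rn_fin HN) => //; first exact: RB_zero.
by apply: (@RA_fsupp n fset0) => i j t _; rewrite mxE.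
Qed.

Lemma rn_entry n (x : MI n) c i j t : 0 <= c -> (N x <= c%:E)%E -> normc (x i j t) <= c.
Proof. by move=> c0 /rn_le[h _]; exact: RB_entry. Qed.

Lemma rn_eq0 n (x : MI n) : N x = 0%E <-> x = 0.
Proof.
split=> [h|->]; last exact: rn_zero.
apply/matrixP => i j; ext t; rewrite mxE; apply/eqP; rewrite -normc_eq0 eq_le normc_ge0 andbT.
by apply: rn_entry => //; rewrite h.
Qed.

Lemma rn_scale n z (x : MI n) : (N x < +oo)%E -> N (scalemxf z x) = ((normc z)%:E * N x)%E.
Proof.
move=> fx; apply/eqP; rewrite eq_le rn_scale_le//=.
have [->|z0] := eqVneq z 0; first by rewrite normc0 mul0e (rn_ge0 HN).
have nz : 0 < normc z by rewrite lt_def normc_ge0 normc_eq0 z0.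
have fz : (N (scalemxf z x) < +oo)%E.
 apply: le_lt_trans (rn_scale_le z fx) _.
 by have [c c0 ->] := rn_finite fx; rewrite ltry.
have := rn_scale_le z^-1 fz.
have -> : scalemxf z^-1 (scalemxf z x) = x.
 by apply/matrixP => i j; ext t; rewrite !scalemxfE mulrA mulVf// mul1r.
have [c c0 ->] := rn_finite fx; have [d d0 ->] := rn_finite fz.
by rewrite normcV !lee_fin -ler_pdivrMl ?invr_gt0// invrK.
Qed.

Lemma rn_bimod m n (a : 'M[C]_(m, n)) (x : MI n) (b : 'M[C]_(n, m)) :
 (N x < +oo)%E -> (N (bimod a x b) <= mxnorm a * N x * mxnorm b)%E.
Proof.
move=> /rn_finP[c [c0 -> hB hA]].
have [A A0 aE] := mxnorm_fin a; have [B B0 bE] := mxnorm_fin b.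
rewrite aE bE; apply/lee_addgt0Pr => e e0.
have [|d d0 hd] := @perturb_prod A B c 1 (A * c * B + e) A0 B0 c0 ler01; first by rewrite mulr1 ltrDl.
have A'0 : 0 < A + d by lra. have B'0 : 0 < B + d by lra.
have ha : opsq (fun i j => a i j) ((A + d) ^+ 2).
 by apply/(mxnormP _ (ltW A'0)); rewrite aE lee_fin lerDl.
have hb : opsq (fun i j => b i j) ((B + d) ^+ 2).
 by apply/(mxnormP _ (ltW B'0)); rewrite bE lee_fin lerDl.
have [t [w [tw ha' hb']]] := opsq_balance A'0 B'0 ha hb.
have AB : 0 < (A + d) * (B + d) by pos.
have yE i j s : bimod a x b i j s = \sum_k \sum_l (t * a i k) * x k l s * (w * b l j).
 rewrite !mxE exchange_big; eqs l; rewrite mxE; sums k.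
 by rewrite mxE -[LHS]mul1r -tw; ring.
letr ((A + d) * (B + d) * c)%:E.
 apply: (rn_fin HN); first by pos.
  exact: RB_bimod AB c0 ha' hb' yE hB.
 exact: RA_bimod AB ha' hb' yE hA.
apply: le_trans hd.
rewrite [leRHS](_ : _ = (A + d) * (B + d) * ((c + d) * (1 + d))); last by ring.
rewrite ler_wpM2l; nra.
Qed.

Lemma rn_sum_fin (T : finType) n (x : T -> MI n) : (forall k, (N (x k) < +oo)%E) ->
 (N (\sum_k x k)%R < +oo)%E.
Proof.
move=> h; elim/big_ind: _ => [|y z hy hz|k _]; [by rewrite rn_zero| |exact: h].
apply: le_lt_trans (rn_triangle _ _) _; have [c _ ->] := rn_finite hy; have [d _ ->] := rn_finite hz.
by rewrite ltry.
Qed.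

Lemma rn_bimod_fin m n (a : 'M[C]_(m, n)) (x : MI n) (b : 'M[C]_(n, m)) :
 (N x < +oo)%E -> (N (bimod a x b) < +oo)%E.
Proof.
move=> fx; apply: le_lt_trans (rn_bimod a b fx) _.
have [A A0 ->] := mxnorm_fin a; have [B B0 ->] := mxnorm_fin b; have [c c0 ->] := rn_finite fx.
by rewrite ltry.
Qed.

(** Entries are compressions by matrix units, and a matrix is the finite sum of its entries put in
    place. *)
Lemma rn_carrier n (x : MI n) : (N x < +oo)%E <-> (forall i j, carrier N (x i j)).
Proof.
split=> [fx i j|h].
 rewrite /carrier /norm1/= (_ : const_mx _ = bimod (delta_mx 0 i) x (delta_mx j 0)); first exact: rn_bimod_fin.
 apply/matrixP => i0 j0; ext t; rewrite !mxE.
 rewrite (bigD1 j)//= [X in _ + X]big1 ?addr0; last by move=> k /negbTE nk; rewrite [delta_mx _ _ _ _]mxE nk mulr0.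
 rewrite [delta_mx _ _ _ _]mxE [j0]ord1 eqxx mulr1 mxE (bigD1 i)//= [X in _ + X]big1 ?addr0; last first.
  by move=> k /negbTE nk; rewrite mxE nk andbF mul0r.
 by rewrite !mxE [i0]ord1 !eqxx mul1r.
have -> : x = \sum_(p : 'I_n * 'I_n) bimod (delta_mx p.1 0) (const_mx (x p.1 p.2) : MI 1) (delta_mx 0 p.2).
 apply/matrixP => i j; ext t; rewrite summxE fct_sumE.
 transitivity (\sum_(p : 'I_n * 'I_n) (i == p.1)%:R * ((j == p.2)%:R * x p.1 p.2 t)).
  by rewrite sum_pair/=; under eq_bigr do rewrite -mulr_sumr; rewrite sum_deltal sum_deltal.
 eqs p; rewrite !mxE big_ord1 !mxE big_ord1 !mxE andbT; ring.
by apply: rn_sum_fin => p; apply: rn_bimod_fin; exact: h.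
Qed.

Lemma rn_compress m n (a : 'M[C]_(m, n)) (x : MI n) (b : 'M[C]_(n, m)) :
 opsq (fun i j => a i j) 1 -> opsq (fun i j => b i j) 1 -> (N (bimod a x b) <= N x)%E.
Proof.
move=> ha hb; have [fx|] := ltP (N x) +oo%E; last by rewrite leye_eq => /eqP->; rewrite leey.
apply: le_trans (rn_bimod a b fx) _.
have [a1 b1] : (mxnorm a <= 1%:E)%E /\ (mxnorm b <= 1%:E)%E by split; apply/mxnormP; rewrite ?expr1n.
letr (1 * N x * 1)%E; last by rewrite mul1e mule1.
by rewrite !lee_pmul ?mule_ge0 ?opnorm_ge0 ?(rn_ge0 HN).
Qed.

Lemma rn_direct_sum m n (x : MI m) (y : MI n) :
 N (block_mx x 0 0 y) = maxe (N x) (N y).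
Proof.
have idr k l (f : 'I_k -> 'I_l) (a : 'M[C]_(k, l)) : injective f -> (forall i j, a i j = (f i == j)%:R) ->
  opsq (fun i j => a i j) 1 /\ opsq (fun i j => a^T i j) 1.
 move=> fi aE; have h : opsq (fun i j => a i j) 1.
  by apply: opsq_ext (opsq_inj (g := f) ler01 fi (@inj_id _) (@opsq_id _)) => i j.
 by split => //; apply: opsq_ext (opsq_tr ler01 h) => i j; rewrite mxE.
have ev t : evmx (block_mx x 0 0 y) t = block_mx (evmx x t) 0 0 (evmx y t).
 by rewrite /evmx map_block_mx; congr block_mx; apply/matrixP => i j; rewrite !mxE.
apply/eqP; rewrite eq_le; apply/andP; split.
 have [fx|] := ltP (N x) +oo%E; last by rewrite leye_eq => /eqP->; rewrite maxye leey.
 have [fy|] := ltP (N y) +oo%E; last by rewrite leye_eq => /eqP->; rewrite maxey leey.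
 have [c [c0 -> hB hA]] := rn_finP fx; have [d [d0 -> hB' hA']] := rn_finP fy.
 rewrite -EFin_max; apply: (rn_fin HN); first by rewrite le_max c0.
  apply: RB_block; first by rewrite le_max c0.
   by apply: RB_le hB; rewrite le_max lexx.
  by apply: RB_le hB'; rewrite le_max lexx orbT.
 exact: RA_block.
rewrite ge_max; apply/andP; split.
 pose a : 'M[C]_(m, m + n) := row_mx 1%:M 0.
 have [|h1 h2] := idr _ _ (@lshift m n) a (@lshift_inj _ _).
  by move=> i j; rewrite -[j]splitK; case: (fintype.split j) => k /=; rewrite ?row_mxEl ?row_mxEr !mxE ?(inj_eq (@lshift_inj _ _))// eq_lrshift.
 have := rn_compress (block_mx x 0 0 y) h1 h2; congr (N _ <= _)%E.
 apply/matrixP => i j; ext t; rewrite mxE ev tr_row_mx mul_row_block mul_row_col.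
 by rewrite trmx1 !(mul1mx, mulmx0, mul0mx, addr0) mulmx1 mxE.
pose a : 'M[C]_(n, m + n) := row_mx 0 1%:M.
have [|h1 h2] := idr _ _ (@rshift m n) a (@rshift_inj _ _).
 by move=> i j; rewrite -[j]splitK; case: (fintype.split j) => k /=; rewrite ?row_mxEl ?row_mxEr !mxE ?(inj_eq (@rshift_inj _ _))// eq_rlshift.
have := rn_compress (block_mx x 0 0 y) h1 h2; congr (N _ <= _)%E.
apply/matrixP => i j; ext t; rewrite mxE ev tr_row_mx mul_row_block mul_row_col.
by rewrite trmx1 !(mul1mx, mulmx0, mul0mx, add0r) mulmx1 mxE.
Qed.

Lemma rn_operator_space : operator_space N.
Proof.
split.
- exact: (rn_ge0 HN).
- exact: rn_carrier.
- exact: rn_eq0.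
- exact: rn_scale.
- exact: rn_triangle.
- exact: rn_direct_sum.
- exact: rn_bimod.
Qed.

Lemma rn_sub_fin n (x y : MI n) : (N x < +oo)%E -> (N y < +oo)%E -> (N (x - y)%R < +oo)%E.
Proof.
move=> /rn_finP[c [c0 _ hB hA]] /rn_finP[d [d0 _ hB' hA']].
apply: le_lt_trans (ltry (c + d)); apply: (rn_fin HN); [pos|exact: RB_sub|exact: RA_sub].
Qed.

Lemma complex_cauchy (u : nat -> C) :
 (forall e : R, 0 < e -> exists K : nat, forall m n, (K <= m)%N -> (K <= n)%N -> normc (u m - u n) <= e) ->
 exists l : C, forall e : R, 0 < e -> exists K : nat, forall n, (K <= n)%N -> normc (u n - l) <= e.
Proof.
move=> cu; have [a ha] : exists a : R, forall e : R, 0 < e -> exists K : nat, forall n, (K <= n)%N -> `|re (u n) - a| <= e.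
 apply: real_cauchy => e /cu[K hK]; exists K => m n Km Kn.
 by apply: le_trans (hK m n Km Kn); rewrite -ReB; exact: Re_le_normc.
have [b hb] : exists b : R, forall e : R, 0 < e -> exists K : nat, forall n, (K <= n)%N -> `|im (u n) - b| <= e.
 apply: real_cauchy => e /cu[K hK]; exists K => m n Km Kn.
 by apply: le_trans (hK m n Km Kn); rewrite -ImB; exact: Im_le_normc.
exists (a +i* b) => e e0; have e2 : 0 < e / 2 by pos.
have [K1 h1] := ha _ e2; have [K2 h2] := hb _ e2; exists (maxn K1 K2) => n; rewrite geq_max => /andP[/h1 n1 /h2 n2].
by apply: le_trans (normc_ReIm _) _; rewrite ReB ImB/= [leRHS]splitr lerD.
Qed.

Lemma finite_eventually (T : finType) (P : T -> nat -> Prop) :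
 (forall t, exists K : nat, forall k, (K <= k)%N -> P t k) -> exists K : nat, forall k, (K <= k)%N -> forall t, P t k.
Proof.
move=> /choice[K hK]; exists (\max_t K t) => k kK t; apply: hK; apply: leq_trans kK.
exact: leq_bigmax.
Qed.

(** Entries converge. [RB_lim] carries the Cauchy estimate over to the entrywise limit, and
    [RA_closed] gives convergence of its truncations. *)
Lemma rn_complete n (u : nat -> MI n) : cauchy_seq N u ->
 exists2 A : MI n, (N A < +oo)%E & cvg_seq N u A.
Proof.
move=> [fu cu].
have ent e k l i j t : (N (u k - u l)%R < e%:E)%E -> normc (u k i j t - u l i j t) <= e.
 move=> h; have e0 : 0 <= e by rewrite -lee_fin; apply: le_trans (rn_ge0 HN _) (ltW h).
 by have := rn_entry i j t e0 (ltW h); rewrite mxfB.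
have /choice[L hL] (p : ('I_n * 'I_n) * (I * I)) : exists l : C, forall e : R, 0 < e ->
  exists K : nat, forall k, (K <= k)%N -> normc (u k p.1.1 p.1.2 p.2 - l) <= e.
 apply: complex_cauchy => e /cu[K hK]; exists K => k l Kk Kl; apply: ent; exact: hK.
pose A : MI n := \matrix_(i, j) (fun t => L ((i, j), t)).
have near_ (e : R) K : 0 < e -> (forall k l : nat, (K <= k)%N -> (K <= l)%N -> (N (u k - u l)%R < e%:E)%E) ->
  forall k, (K <= k)%N -> RB e (u k - A).
 move=> e0 hK k Kk; apply: RB_lim (ltW e0) _ => d d0 J.
 have [K' hK'] : exists K' : nat, forall l, (K' <= l)%N -> forall p : ('I_n * J) * ('I_n * J),
   normc (u l p.1.1 p.2.1 (val p.1.2, val p.2.2) - A p.1.1 p.2.1 (val p.1.2, val p.2.2)) <= d.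
  apply: finite_eventually => p; rewrite mxE; have := hL ((p.1.1, p.2.1), (val p.1.2, val p.2.2)) d d0.
  by move=> [K' h]; exists K' => l /h.
 pose l := maxn K K'; exists (u k - u l).
  apply: (@BK_le e); first by rewrite lerDl.
  exact: (rn_RC HN (hK k l Kk (leq_maxl _ _))).1.
 move=> p q; rewrite !blkB opprB addrC addrA subrK normc_distC.
 by have := hK' l (leq_maxr _ _) (p, q).
have RAA : RA A.
 apply: RA_closed => e e0; have [K hK] := cu e e0; exists (u K).
  by have [c [_ _ _ ]] := rn_finP (fu K).
 have := @RB_scale _ _ (-1) _ (ltW e0) (near_ e K e0 hK K (leqnn _)).
 rewrite normcNE normc1 mul1r; apply: RB_ext => i j t; rewrite scalemxfE mxfB mxfB; ring.
have fuA (e : R) K : 0 < e -> (forall k l : nat, (K <= k)%N -> (K <= l)%N -> (N (u k - u l)%R < e%:E)%E) ->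
  forall k, (K <= k)%N -> (N (u k - A)%R <= e%:E)%E.
 move=> e0 hK k Kk; apply: (rn_fin HN); [pos|exact: near_ Kk|].
 by apply: RA_sub => //; have [c []] := rn_finP (fu k).
exists A.
 have [K hK] := cu 1 ltr01; have h := fuA 1 K ltr01 hK K (leqnn _).
 have -> : A = u K - (u K - A) by rewrite subKr.
 by apply: rn_sub_fin (fu K) (le_lt_trans h (ltry _)).
apply/ereal_cvg0; first by move=> k; exact: (rn_ge0 HN).
by move=> e e0; have [K hK] := cu e e0; exists K => k; exact: fuA.
Qed.

Lemma rn_complete_space : complete_space N.
Proof.
move=> u /rn_complete[A fA uA]; have AE : const_mx (A 0 0) = A by apply/matrixP => i j; rewrite mxE !ord1.
by exists (A 0 0); [rewrite /carrier /norm1/= AE|rewrite AE].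
Qed.

Lemma rn_limit_le n (u : nat -> MI n) A (c : R) : (N A < +oo)%E -> cvg_seq N u A ->
 (exists K : nat, forall k, (K <= k)%N -> (N (u k) <= c%:E)%E) -> (N A <= c%:E)%E.
Proof.
move=> fA uA [K hK]; apply/lee_addgt0Pr => e e0.
have [K' hK'] := (ereal_cvg0 (fun k => rn_ge0 HN _)).1 uA e e0.
pose k := maxn K K'; have hk := hK k (leq_maxl _ _); have hk' := hK' k (leq_maxr _ _).
have -> : A = u k + scalemxf (-1) (u k - A).
 apply/matrixP => i j; ext t; rewrite mxfD scalemxfE mxfB; ring.
apply: le_trans (rn_triangle _ _) _; apply: leeD => //.
apply: le_trans (rn_scale_le _ (le_lt_trans hk' (ltry _))) _.
by rewrite normcNE normc1 mul1e.
Qed.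

Lemma BK_reindex c (A A' : finType) S (h : A' -> A) (w : A * S -> A * S -> C) : injective h -> 0 <= c ->
 BK c w -> BK c (fun p q : A' * S => w (h p.1, p.2) (h q.1, q.2)).
Proof.
move=> ih c0 hw.
have hal : opsq (fun (i : A') (k : A) => (h i == k)%:R : C) 1.
 exact: (opsq_inj (g := h) ler01 ih (@inj_id _) (@opsq_id _)).
have hbe : opsq (fun (k : A) (i : A') => (h i == k)%:R : C) 1 by exact: opsq_tr.
have := BK_bimod ler01 c0 hal hbe hw; rewrite mul1r; apply: BK_ext => p q.
under eq_bigr do under eq_bigr do rewrite -mulrA.
under eq_bigr do rewrite -mulr_sumr; rewrite sum_deltal.
by under eq_bigr do rewrite mulrC; rewrite sum_deltal.
Qed.

Lemma opsq_tens (A1 A2 : finType) X1 X2 (Y1 Y2 : finType) (a1 : A1 -> X1 * Y1 -> C) (a2 : A2 -> X2 * Y2 -> C) c d :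
 0 <= c -> 0 <= d -> opsq a1 c -> opsq a2 d ->
 opsq (fun (p : A1 * A2) (q : (X1 * X2) * (Y1 * Y2)) => a1 p.1 (q.1.1, q.2.1) * a2 p.2 (q.1.2, q.2.2)) (c * d).
Proof.
move=> c0 d0 h1 h2; have ig : injective (fun q : (X1 * X2) * (Y1 * Y2) => ((q.1.1, q.2.1), (q.1.2, q.2.2))).
 by move=> [[? ?] [? ?]] [[? ?] [? ?]] [-> -> -> ->].
exact: (opsq_inj (mulr_ge0 c0 d0) (@inj_id _) ig (opsq_kron c0 d0 h1 h2)).
Qed.

(** The outer coefficients of the two atoms are tensored, and the sum over k between them becomes
    the single atom of [schur_product_decomposition], at the price 1 + e. *)
Lemma BK_prod c d e (A1 A2 : finType) S (w1 : A1 * S -> A1 * S -> C) (w2 : A2 * S -> A2 * S -> C) :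
 0 <= c -> 0 <= d -> 0 < e -> BK c w1 -> BK d w2 ->
 BK (c * d * (1 + e)) (fun p q : (A1 * A2) * S => \sum_k w1 (p.1.1, p.2) (q.1.1, k) * w2 (p.1.2, k) (q.1.2, q.2)).
Proof.
move=> c0 d0 e0 [u1 [X1 [Y1 [x1 [y1 [a1 [b1 [hx1 hy1 ha1 hb1 ->]]]]]]] h1].
move=> [u2 [X2 [Y2 [x2 [y2 [a2 [b2 [hx2 hy2 ha2 hb2 ->]]]]]]] h2].
have [X [Y [x [y [a [b [hx hy E ha hb]]]]]]] := schur_product_decomposition th01 e0 hx1 hx2 hy1 hy2.
pose w0 (p q : ((X1 * X2) * (Y1 * Y2)) * S) := \sum_k tcol x1 x2 k (p.1.1, p.2) (q.1.1, q.2) * tcol y1 y2 k (p.1.2, p.2) (q.1.2, q.2).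
have hw0 : BK (1 + e) w0.
 exists (tatom a x y b); first by exists X, Y, x, y, a, b.
 by move=> p q; rewrite /w0.
have hb' : opsq (fun (q : (X1 * X2) * (Y1 * Y2)) (p : A1 * A2) => b1 (q.1.1, q.2.1) p.1 * b2 (q.1.2, q.2.2) p.2) (c * d).
 have cd0 := mulr_ge0 c0 d0.
 exact: opsq_tr cd0 (opsq_tens c0 d0 (opsq_tr c0 hb1) (opsq_tr d0 hb2)).
have e1 : 0 <= 1 + e by pos.
have := BK_bimod (mulr_ge0 c0 d0) e1 (opsq_tens c0 d0 ha1 ha2) hb' hw0.
apply: BK_ext => -[[i1 i2] s] [[j1 j2] t]; rewrite /w0 /tcol/=.
pose T := ((X1 * X2) * (Y1 * Y2))%type.
have sw (F : X1 * Y1 -> X2 * Y2 -> C) : \sum_q1 \sum_q2 F q1 q2 = \sum_(q : T) F (q.1.1, q.2.1) (q.1.2, q.2.2).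
 rewrite sum_pair sum_pair/=.
 under [LHS]eq_bigr do under eq_bigr do rewrite sum_pair.
 under [LHS]eq_bigr do rewrite exchange_big/=.
 rewrite [RHS]sum_pair/=; apply: eq_bigr => i _; apply: eq_bigr => j _.
 by rewrite [RHS]sum_pair.
have swM (G1 : X1 * Y1 -> C) (G2 : X2 * Y2 -> C) :
  (\sum_q1 G1 q1) * (\sum_q2 G2 q2) = \sum_(q : T) G1 (q.1.1, q.2.1) * G2 (q.1.2, q.2.2).
 rewrite -(sw (fun q1 q2 => G1 q1 * G2 q2)) mulr_suml; apply: eq_bigr => q1 _.
 by rewrite mulr_sumr.
under [RHS]eq_bigr do rewrite h1 h2 swM.
rewrite [RHS]exchange_big/=; apply: eq_bigr => q _.
under [RHS]eq_bigr do rewrite swM.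
rewrite [RHS]exchange_big/=; apply: eq_bigr => q' _; rewrite mulr_sumr mulr_suml; apply: eq_bigr => k _; ring.
Qed.

(** Bounded blocks make elements trace class, hence Hilbert-Schmidt; rows and columns in l_2 are
    what the entries of products need. *)
Definition HSop (A : I * I -> C) := exists c, l2le A c.

Lemma RB_HS n c (x : MI n) i j : 0 <= c -> RB c x -> HSop (x i j).
Proof.
move=> c0 hx; exists (c ^+ 2); apply: tcb_HS; apply: (@G1_tcb c n) => //.
exact/(S1P x c0)/(RB_S1 c0 hx).
Qed.

Lemma HSop_col A j : HSop A -> l2 (fun k => A (k, j)).
Proof.
move=> [c h]; have c0 : 0 <= c by have := h fset0; rewrite /psum big1// => -[].
have hb : bdd (transp A) c by have hb0 := HS_bdd h; move=> P Q; apply: opsq_tr => //.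
by apply: l2le_l2; exact: bdd_row c0 hb.
Qed.

Lemma HSop_row A i : HSop A -> l2 (fun k => A (i, k)).
Proof.
move=> [c h]; have c0 : 0 <= c by have := h fset0; rewrite /psum big1// => -[].
have hb := HS_bdd h; by apply: l2le_l2; exact: bdd_row c0 hb.
Qed.

Lemma mxprod_cv A B i j : HSop A -> HSop B -> ncvg (fun k => A (i, k) * B (k, j)) (mxprod A B (i, j)).
Proof.
move=> [c h] hB; have c0 : 0 <= c by have := h fset0; rewrite /psum big1// => -[].
exact: matvec_cv c0 (HS_bdd h) (HSop_col j hB).
Qed.

Lemma mxprod_linl z A A' B : HSop A -> HSop A' -> HSop B ->
 HSop (scalef z A + A') -> mxprod (scalef z A + A') B = scalef z (mxprod A B) + mxprod A' B.
Proof.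
move=> hA hA' hB h; apply/funext => -[i j]; apply: ncvg_unique (mxprod_cv i j h hB) _.
have := ncvgD (ncvgZ z (mxprod_cv i j hA hB)) (mxprod_cv i j hA' hB).
by congr ncvg; ext k; rewrite mulrDl mulrA.
Qed.

Lemma mxprod_linr z A A' B : HSop A -> HSop A' -> HSop B ->
 HSop (scalef z A + A') -> mxprod B (scalef z A + A') = scalef z (mxprod B A) + mxprod B A'.
Proof.
move=> hA hA' hB h; apply/funext => -[i j]; apply: ncvg_unique (mxprod_cv i j hB h) _.
have := ncvgD (ncvgZ z (mxprod_cv i j hB hA)) (mxprod_cv i j hB hA').
congr ncvg; ext k; rewrite -[RHS]/(B (i, k) * (z * A (k, j) + A' (k, j))); ring.
Qed.

(** Both sides are <B v, w>, with v a column of D and w a conjugated row of A; moving B to its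
    adjoint changes the bracketing. *)
Lemma mxprod_assoc A B D : HSop A -> HSop B -> HSop D ->
 mxprod A (mxprod B D) = mxprod (mxprod A B) D.
Proof.
move=> hA hB hD; have [c h] := hB.
have c0 : 0 <= c by have := h fset0; rewrite /psum big1// => -[].
have hb := HS_bdd h.
apply/funext => -[i j]; pose v k := D (k, j); pose w k := ((A (i, k))^*)%R.
have lv : l2 v by exact: HSop_col.
have lw : l2 w.
 have [K hK] := (l2P _).1 (HSop_row i hA); apply: (@l2le_l2 _ _ K) => J.
 by have := hK J; congr (_ <= _); eqs k; rewrite normc_conj.
have E : inner (matvec B v) w = mxprod A (mxprod B D) (i, j).
 by rewrite /inner; congr net_sum; ext k; rewrite conjCK mulrC.
rewrite -E (inner_adjoint c0 hb lv lw); congr net_sum; ext l.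
rewrite mulrC.
have -> : matvec (adjoint B) w l = ((mxprod A B (i, l))^*)%R; last by rewrite conjCK.
have := ncvg_conj (mxprod_cv i l hA hB); have [_ e] := ncvg_sum (ncvg_conj (mxprod_cv i l hA hB)).
move=> _; rewrite -e; congr net_sum; ext k.
by rewrite rmorphM mulrC.
Qed.

Definition prodmx k l (x : MI k) (y : MI l) : MI (k * l) :=
 \matrix_(i, j) mxprod (x (unidx i).1 (unidx j).1) (y (unidx i).2 (unidx j).2).

(** The product is the entrywise limit of its sums over finite K. For K containing J such a sum is a
    product of blocks over K, bounded by [BK_prod], and [perturb_prod] pays for the losses. *)
Lemma RB_prodmx k l (x : MI k) (y : MI l) c d : 0 <= c -> 0 <= d ->
 RB c x -> RB d y -> RB (c * d) (prodmx x y).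
Proof.
move=> c0 d0 hx hy; apply: RB_lim (mulr_ge0 c0 d0) _ => e e0 J.
have [|f f0 hf] := @perturb_prod c 1 d 1 (c * d + e) c0 ler01 d0 ler01; first by rewrite !mulr1 ltrDl.
have [K0 hK0] : exists J0 : {fset I}, forall K : {fset I}, (J0 `<=` K)%fset -> forall t : ('I_(k * l) * J) * ('I_(k * l) * J),
  normc (psum (fun k0 => x (unidx t.1.1).1 (unidx t.2.1).1 (val t.1.2, k0) *
   y (unidx t.1.1).2 (unidx t.2.1).2 (k0, val t.2.2)) K - blk J (prodmx x y) t.1 t.2) <= e.
 apply: finite_cover => t; rewrite /blk mxE.
 have [K0 h] := mxprod_cv (val t.1.2) (val t.2.2) (RB_HS (unidx t.1.1).1 (unidx t.2.1).1 c0 hx)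
   (RB_HS (unidx t.1.1).2 (unidx t.2.1).2 d0 hy) e0.
 by exists K0 => K; exact: h.
pose K := (K0 `|` J)%fset.
pose P : MI (k * l) := \matrix_(i, j) (fun t => \sum_(k0 : K)
  x (unidx i).1 (unidx j).1 (t.1, val k0) * y (unidx i).2 (unidx j).2 (val k0, t.2)).
exists P; last first.
 by move=> p q; rewrite {1}/blk mxE; exact: (hK0 K (fsubsetUl _ _) (p, q)).
apply: (@BK_sub_blk _ _ K); first exact: fsubsetUr.
have cf : c < c + f by lra. have df : d < d + f by lra.
have cf0 := le_trans c0 (ltW cf). have df0 := le_trans d0 (ltW df).
have h := BK_prod cf0 df0 f0 (hx K _ cf) (hy K _ df).
have ui : injective (@mxtens_unindex k l).
 by move=> p q /(congr1 (@mxtens_index k l)); rewrite !mxtens_unindexK.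
have f1 : 0 <= 1 + f by pos.
have := BK_reindex ui (mulr_ge0 (mulr_ge0 cf0 df0) f1) h.
have le : (c + f) * (d + f) * (1 + f) <= c * d + e.
 apply: le_trans hf; rewrite mulrA ler_peMr ?lerDl ?(ltW f0)//.
 by pos.
move=> /(BK_le le); apply: BK_ext => p q.
by rewrite /blk mxE.
Qed.

Lemma prodmxB k l (x x' : MI k) (y y' : MI l) c c' d d' :
 0 <= c -> 0 <= c' -> 0 <= d -> 0 <= d' -> RB c x -> RB c' x' -> RB d y -> RB d' y' ->
 prodmx x y - prodmx x' y' = prodmx (x - x') y + prodmx x' (y - y').
Proof.
move=> c0 c'0 d0 d'0 hx hx' hy hy'.
have hxx := RB_sub c0 c'0 hx hx'; have hyy := RB_sub d0 d'0 hy hy'.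
have cc := addr_ge0 c0 c'0; have dd := addr_ge0 d0 d'0.
apply/matrixP => i j; apply/funext => -[s t]; rewrite mxfB mxfD ![prodmx _ _ _ _]mxE.
set i1 := (unidx i).1; set j1 := (unidx j).1.
set i2 := (unidx i).2; set j2 := (unidx j).2.
have cv1 := mxprod_cv s t (RB_HS i1 j1 c0 hx) (RB_HS i2 j2 d0 hy).
have cv2 := mxprod_cv s t (RB_HS i1 j1 c'0 hx') (RB_HS i2 j2 d'0 hy').
have cv3 := mxprod_cv s t (RB_HS i1 j1 cc hxx) (RB_HS i2 j2 d0 hy).
have cv4 := mxprod_cv s t (RB_HS i1 j1 c'0 hx') (RB_HS i2 j2 dd hyy).
apply/esym/(ncvg_unique (ncvgD cv3 cv4)).
have := ncvgD cv1 (ncvgZ (-1) cv2); rewrite mulN1r; congr ncvg; ext r.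
by rewrite !mxfB; ring.
Qed.

Lemma RA_prodmx k l (x : MI k) (y : MI l) c d : 0 <= c -> 0 <= d ->
 RB c x -> RB d y -> RA x -> RA y -> RA (prodmx x y).
Proof.
move=> c0 d0 hx hy ax ay; apply: RA_intro => e e0.
have cd : 0 < c + d + 1 by pos.
pose f := e / (c + d + 1); have f0 : 0 < f by rewrite divr_gt0.
have [J1 h1] := RA_elim ax f0; have [J2 h2] := RA_elim ay f0.
have hx1 := RB_mask J1 hx; have hy2 := RB_mask J2 hy.
exists (prodmx (truncmx J1 x) (truncmx J2 y)); split.
 exists (J1 `|` J2)%fset => i j [s t] nt; rewrite mxE /mxprod/=.
 have z k0 : truncmx J1 x (unidx i).1 (unidx j).1 (s, k0) *
   truncmx J2 y (unidx i).2 (unidx j).2 (k0, t) = 0.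
  rewrite !truncmxE/=; move: nt; rewrite !in_fsetU negb_and !negb_or => /orP[/andP[/negbTE-> _]|/andP[_ /negbTE->]].
   by rewrite !mul0r.
  by rewrite andbF mul0r mulr0.
 rewrite (_ : (fun _ => _) = fun=> 0); last by apply/funext.
 exact: (ncvg_sum (@ncvg0 I)).2.
rewrite (prodmxB c0 c0 d0 d0 hx hx1 hy hy2).
have := RB_add (mulr_ge0 (ltW f0) d0) (mulr_ge0 c0 (ltW f0)) (RB_prodmx (ltW f0) d0 h1 hy) (RB_prodmx c0 (ltW f0) hx1 h2).
apply: RB_le; rewrite mulrC -mulrDl mulrA ler_pdivrMr// mulrC ler_pM2l// addrC lerDl//.
Qed.

Local Notation PN := (proj_tensor (fun n => @N n) (fun n => @N n)).

(* The continuous extension of A (x) B |-> AB to the projective tensor product. *)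
Definition contract (u : (I * I) * (I * I) -> C) : I * I -> C :=
 fun t => net_sum (fun k => u ((t.1, k), (k, t.2))).

(** On an atom the contraction is the compression of [prodmx x y] by a and b, and the sums converge
    because the entries of x and y are Hilbert-Schmidt. *)
Lemma contract_le n (u : 'M[(I * I) * (I * I) -> C]_n) c : (PN u < c%:E)%E ->
 (forall i j t, ncvg (fun k => u i j ((t.1, k), (k, t.2))) (contract (u i j) t)) /\
 (N (map_mx contract u) <= c%:E)%E.
Proof.
move=> /proj_atom[]; [exact: (rn_ge0 HN)|exact: (rn_ge0 HN)|].
move=> k [l [x [y [a [b [xi [eta [d [xi0 eta0 hx hy [d0 ha hb hc uE]]]]]]]]]].
have [bx ax] := rn_le (ltW hx); have [by_ ay] := rn_le (ltW hy).
pose S i j t := \sum_q \sum_q' a i q * mxprod (x q.1 q'.1) (y q.2 q'.2) t * b q' j.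
have cv i j t : ncvg (fun r => u i j ((t.1, r), (r, t.2))) (S i j t).
 have -> : (fun r => u i j ((t.1, r), (r, t.2))) =
   (fun r => \sum_q \sum_q' a i q * x q.1 q'.1 (t.1, r) * y q.2 q'.2 (r, t.2) * b q' j).
  by ext r.
 apply: ncvg_fsum => q _; apply: ncvg_fsum => q' _.
 have := ncvgZ (a i q * b q' j) (mxprod_cv t.1 t.2 (RB_HS q.1 q'.1 (ltW xi0) bx) (RB_HS q.2 q'.2 (ltW eta0) by_)).
 rewrite mulrAC; congr ncvg; ext r; ring.
have cE i j t : contract (u i j) t = S i j t by exact: (ncvg_sum (cv i j t)).2.
split; first by move=> i j t; rewrite cE.
have ui : injective (@mxtens_unindex k l).
 by move=> p q /(congr1 (@mxtens_index k l)); rewrite !mxtens_unindexK.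
pose al (i : 'I_n) (q : 'I_(k * l)) : C := a i (unidx q).
pose be (q : 'I_(k * l)) (i : 'I_n) : C := b (unidx q) i.
have hal : opsq al d by exact: (opsq_inj d0 (@inj_id _) ui ha).
have hbe : opsq be d by exact: (opsq_inj d0 ui (@inj_id _) hb).
have yE i j t : map_mx contract u i j t = \sum_q \sum_q' al i q * prodmx x y q q' t * be q' j.
 have bij : {on [pred _ | true], bijective (@mxtens_unindex k l)}.
  exists (@mxtens_index k l) => q _; [exact: mxtens_unindexK|exact: mxtens_indexK].
 rewrite mxE cE /S (reindex _ bij)/=; eqs q; rewrite (reindex _ bij)/=; eqs q'.
 by rewrite mxE.
apply/lee_addgt0Pr => e e0.
have xe : 0 < xi * eta by pos.
(* d may be 0, but the compression lemmas ask for a positive bound; the change costs e. *)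
pose d' := d + e / (xi * eta); have d'd : d <= d' by rewrite lerDl divr_ge0//.
have d'0 : 0 < d' by rewrite ltr_wpDl// divr_gt0.
have le : d' * (xi * eta) <= c + e by rewrite mulrDl divfK ?gt_eqF// lerD2r mulrC.
letr (d' * (xi * eta))%:E; last by rewrite lee_fin.
apply: (rn_fin HN); first by pos.
 apply: (RB_bimod d'0 (ltW xe) (opsq_le d'd hal) (opsq_le d'd hbe) yE).
 exact: (RB_prodmx (ltW xi0) (ltW eta0) bx by_).
apply: (RA_bimod d'0 (opsq_le d'd hal) (opsq_le d'd hbe) yE).
exact: (RA_prodmx (ltW xi0) (ltW eta0) bx by_ ax ay).
Qed.

Lemma proj_tensor_ge0 n (u : 'M[(I * I) * (I * I) -> C]_n) : (0 <= PN u)%E.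
Proof.
apply: le_ereal_inf_tmp => _ [k [l [a [x [y [b [_ _ _ ->]]]]]]].
by rewrite !mule_ge0 ?opnorm_ge0 ?(rn_ge0 HN).
Qed.

Lemma contract_cv n (u : 'M[(I * I) * (I * I) -> C]_n) i j t : (PN u < +oo)%E ->
 ncvg (fun k => u i j ((t.1, k), (k, t.2))) (contract (u i j) t).
Proof.
have := proj_tensor_ge0 u; case E : (PN u) => [r| |]// _ _.
by have [] := @contract_le _ u (r + 1) _ ; rewrite ?E ?lte_fin ?ltrDl.
Qed.

Lemma contract_linear z x y : carrier (fun n => @proj_tensor R _ _ N N n) x ->
 carrier (fun n => @proj_tensor R _ _ N N n) y ->
 contract (scalef z x + y) = scalef z (contract x) + contract y.
Proof.
move=> /= hx hy; ext t.
have := contract_cv 0 0 t hx; have := contract_cv 0 0 t hy; rewrite !mxE => cy cx.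
exact: (ncvg_sum (ncvgD (ncvgZ z cx) cy)).2.
Qed.

Lemma contract_complete_contraction :
 complete_contraction (fun n => @proj_tensor R _ _ N N n) N contract.
Proof.
split; first by move=> z x y; exact: contract_linear.
move=> n u [fu cu].
have cB k l : map_mx contract (u k - u l) = map_mx contract (u k) - map_mx contract (u l).
 apply/matrixP => i j; ext t; rewrite mxfB !mxE.
 have := ncvgD (contract_cv i j t (fu k)) (ncvgZ (-1) (contract_cv i j t (fu l))).
 rewrite mulN1r => /ncvg_sum[_ <-]; congr net_sum; ext r.
 by rewrite mulN1r.
have fin k : (N (map_mx contract (u k)) < +oo)%E.
 have := fu k; have := proj_tensor_ge0 (u k); case E : (PN (u k)) => [r| |]// _ _.
 have [|_ h] := @contract_le _ (u k) (r + 1); first by rewrite E lte_fin ltrDl.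
 exact: le_lt_trans h (ltry _).
have cau : cauchy_seq N (fun k => map_mx contract (u k)).
 split=> // e e0; have e2 : 0 < e / 2 by pos.
 have [K hK] := cu _ e2; exists K => k l Kk Kl; rewrite -cB.
 have [_ h] := contract_le (hK k l Kk Kl); apply: le_lt_trans h _.
 by rewrite lte_fin [X in _ < X]splitr ltrDl.
have [A fA uA] := rn_complete cau.
exists A; split => // r ur.
have r0 : (0 <= r)%E by apply: cvge_ge ur; apply: nearW => k; exact: proj_tensor_ge0.
case: r r0 ur => [r| |]// r0 ur; last by rewrite leey.
apply/lee_addgt0Pr => e e0.
apply: (rn_limit_le fA uA).
have [|K hK] := ereal_cvg_lt ur (c := (r + e)%:E); first by rewrite lte_fin ltrDl.
by exists K => k /hK /contract_le[].
Qed.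

Lemma carrier_HS A : carrier N A -> HSop A.
Proof.
move=> /rn_finP[c [c0 _ hB _]].
by have := RB_HS 0 0 c0 hB; rewrite mxE.
Qed.

Lemma carrier_mxprod A B : carrier N A -> carrier N B ->
 (norm1 N (mxprod A B) <= norm1 N A * norm1 N B)%E.
Proof.
move=> /rn_finP[c [c0 cE hB hA]] /rn_finP[d [d0 dE hB' hA']].
rewrite /norm1 cE dE.
have -> : const_mx (mxprod A B) = prodmx (const_mx A : MI 1) (const_mx B : MI 1).
 by apply/matrixP => i j; rewrite !mxE.
apply: (rn_fin HN (n := 1)); first pos.
 exact: (RB_prodmx c0 d0 hB hB').
exact: (RA_prodmx c0 d0 hB hB' hA hA').
Qed.

Lemma carrier_closed A B : carrier N A -> carrier N B -> carrier N (mxprod A B).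
Proof.
move=> hA hB; apply: le_lt_trans (carrier_mxprod hA hB) _.
move: hA hB => /rn_finP[c [_ cE _ _]] /rn_finP[d [_ dE _ _]].
by rewrite /norm1 cE dE ltry.
Qed.

Lemma carrier_lin z A B : carrier N A -> carrier N B -> carrier N (scalef z A + B).
Proof.
move=> hA hB; rewrite /carrier /norm1/=.
have -> : const_mx (scalef z A + B) = scalemxf z (const_mx A) + const_mx B :> MI 1.
 by apply/matrixP => i j; rewrite !mxE.
apply: le_lt_trans (rn_triangle _ _) _.
have := rn_scale_le z hA; move: hA hB => /rn_finP[c [_ cE _ _]] /rn_finP[d [_ dE _ _]].
rewrite cE dE => h; apply: (@le_lt_trans _ _ ((normc z * c)%:E + d%:E)%E); last by rewrite ltry.
exact: leeD.
Qed.

Lemma mxprod_jcc : jointly_completely_contractive N N N (@mxprod R I I I).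
Proof. by exists contract; split; [|exact: contract_complete_contraction]. Qed.

Lemma banach_algebra : completely_contractive_banach_algebra N (@mxprod R I I I).
Proof.
split.
- exact: (rn_operator_space).
- exact: (rn_complete_space).
- exact: carrier_closed.
- move=> z x y w hx hy hw; have hl := carrier_lin z hx hy.
 by apply: mxprod_linl; exact: carrier_HS.
- move=> z x y w hx hy hw; have hl := carrier_lin z hx hy.
 by apply: mxprod_linr; exact: carrier_HS.
- by move=> x y z hx hy hz; apply: mxprod_assoc; exact: carrier_HS.
- exact: carrier_mxprod.
- exact: mxprod_jcc.
Qed.

End RCAlgebra.

End Atomic.

End Main.

Theorem theorem3p7 (R : realType) (I : choiceType) (p : R) (hp : 1 <= p) :
  [/\ forall A B : I * I -> R[i],
        carrier (Rpcb I p) A -> carrier (Rpcb I p) B -> forall i j : I,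
        cvg ((partial_sum (fun k : I => A (i, k) * B (k, j)) :
               {fset I} -> R[i]^o) @ totally),
      forall A B : I * I -> R[i],
        carrier (Rpcb I p) A -> carrier (Rpcb I p) B ->
        carrier (Rpcb I p) (mxprod A B),
      jointly_completely_contractive (Rpcb I p) (Rpcb I p) (Rpcb I p)
        (@mxprod R I I I) &
      completely_contractive_banach_algebra (Rpcb I p) (@mxprod R I I I)].
Proof.
have [th [th01 Hp Hq]] := spball_Sp I hp.
(* With th = 1/p the quotient norm is the one described by [RB] and [RA]; every claim follows from
   this description. *)
have HN : rc_norm th (Rpcb I p).
 split.
 - exact: (rpcb_ge0 Hp Hq).
 - exact: (rpcb_RC Hp Hq).
 - exact: (RC_rpcb th01 Hp Hq).
split.
- move=> A B hA hB i j; apply/cvg_ex; exists (mxprod A B (i, j)); apply/ncvgP.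
 exact: (mxprod_cv i j (carrier_HS th01 HN hA) (carrier_HS th01 HN hB)).
- exact: (carrier_closed th01 HN).
- exact: (mxprod_jcc th01 HN).
- exact: (banach_algebra th01 HN).
Qed.
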